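(* Let $\mathbb{K}$ be a field, let $d\ge 2$ be an integer, and let $V$ be a non-trivial, possibly infinite-dimensional, vector space over $\mathbb{K}$. Let $(X,\Xi)$ be a Veronesean cap of degree $d$ and finite index $n\ge 2$ in $\mathbb{P}(V)$. Put $M:=\binom{n+d}{d}$ and suppose that $\dim V\ge M$ and $|\mathbb{K}|\ge d^{3/2}$. Then $\dim V=M$, and $X$ is projectively equivalent to the Veronese variety $\mathcal{V}_n^{d^n}$ over $\mathbb{K}$.
   Context: The Veronese embedding $\phi_{n,d}:\mathbb{P}^n(\mathbb{K})\to\mathbb{P}^{\binom{n+d}{d}-1}(\mathbb{K})$ maps $(x_0,\dots,x_n)$ to $(x_0^d,x_0^{d-1}x_1,\dots,x_n^d)$ (all monomials of degree $d$). The Veronese variety $\mathcal{V}_n^{d^n}$ is the image of this map. A rational normal curve $C$ in a $d$-dimensional projective space $\Sigma$ over $\mathbb{K}$ is a set of points of $\Sigma$ projectively equivalent to $\mathcal{V}_1^{d}=\{(s^d,s^{d-1}t,\dots,t^d)\}$. For $x\in C$, $T_x(C)$ denotes the tangent line of $C$ at $x$: for $\mathcal{V}_1^d$ it is the line spanned by $v(s,t)=(s^d,s^{d-1}t,\dots,t^d)$ and its formal partial derivatives $\partial_s v,\partial_t v$, and in general it is transported by the projective equivalence. It is determined by the point set $C$ if $d=2$ or $|\mathbb{K}|\ge d+2$; this is the case whenever $|\mathbb{K}|\ge d^{3/2}$. Veronesean cap: let $X$ be a spanning point set of $\mathbb{P}(V)$ and $\Xi$ a collection of $d$-dimensional (projective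 dimension) subspaces of $\mathbb{P}(V)$, called rational spaces, such that for every $\xi\in\Xi$ the set $X(\xi):=\xi\cap X$ is a rational normal curve in the $d$-dimensional space $\xi$. For $x\in X(\xi)$ write $T_x(\xi):=T_x(X(\xi))$. The pair $(X,\Xi)$ (or briefly $X$) is a Veronesean cap of degree $d$ if: (V1) any two points $x,y$ of $X$ lie in a unique element of $\Xi$, denoted $[x,y]$; (V2) if $\xi_1,\xi_2\in\Xi$ with $\xi_1\ne\xi_2$, then $\xi_1\cap\xi_2\subset X$; (V3) for every $x\in X$ and every $\xi\in\Xi$ with $x\notin\xi$, the union $\bigcup_{y\in X(\xi)}T_x([x,y])$ is a plane, denoted $T(x,\xi)$. Index: for a Veronesean cap, the set $\bigcup_{\xi\in\Xi,\,x\in\xi}T_x(\xi)$ is, for every $x\in X$, a subspace whose (projective) dimension does not depend on $x$; this dimension is the index of the cap. *)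

(* Defs.v *)
From mathcomp Require Import all_boot all_algebra.
From mathcomp Require Import boolp classical_sets.

Set Implicit Arguments.
Unset Strict Implicit.
Unset Printing Implicit Defensive.

Import GRing.Theory.
Local Open Scope classical_set_scope.
Local Open Scope ring_scope.

(* A projective subspace of P(V) is represented by the corresponding linear
   subspace of V, as a [set V]; its projective dimension is thus one less than
   its linear dimension. A point is a subspace of linear dimension 1, it lies
   on [U] when [p `<=` U], and a set of points is a [set (set V)]. *)

Section Projective.
Variables (K : fieldType) (V : lmodType K).
Implicit Types (U p x y : set V) (C X Xi : set (set V)).

Definition is_subspace U : Prop :=
  U 0 /\ forall (a : K) (u v : V), U u -> U v -> U (a *: u + v).

Definition lspan (S : set V) : set V :=
  \bigcap_(U in [set U | is_subspace U /\ S `<=` U]) U.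

Definition lin_indep (m : nat) (b : 'I_m -> V) : Prop :=
  forall c : 'I_m -> K, \sum_(i < m) c i *: b i = 0 -> forall i, c i = 0.

Definition has_dim U (m : nat) : Prop :=
  exists b : 'I_m -> V, lin_indep b /\ lspan (range b) = U.

(* dim V >= m, also meaningful when V is infinite-dimensional. *)
Definition dim_ge (m : nat) : Prop :=
  exists b : 'I_m -> V, lin_indep b.

Definition is_pdim U (m : nat) : Prop := has_dim U m.+1.
Definition is_point p : Prop := is_pdim p 0.
Definition is_plane U : Prop := is_pdim U 2.

Definition spanning X : Prop := lspan (\bigcup_(p in X) p) = setT.

Definition points_on X U : set (set V) := [set p | X p /\ p `<=` U].

End Projective.

Arguments dim_ge {K} V m.

(* [f] is a projective isomorphism from P(W) onto the subspace [U] of P(V)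
   that maps the point set [D] onto [C]. *)
Definition proj_equiv_by (K : fieldType) (W V : lmodType K)
    (f : {linear W -> V}) (D : set (set W)) (U : set V) (C : set (set V))
    : Prop :=
  [/\ injective f, range f = U & C = [set f @` p | p in D]].

Definition proj_equiv (K : fieldType) (W V : lmodType K)
    (D : set (set W)) (U : set V) (C : set (set V)) : Prop :=
  exists f : {linear W -> V}, proj_equiv_by f D U C.

Section Veronese.
Variables n d : nat.

(* Exponents of the monomials of degree [d] in [n.+1] variables. *)
Definition exponents : {set n.+1.-tuple 'I_d.+1} :=
  [set e : n.+1.-tuple 'I_d.+1 | (\sum_(i <- e) i == d)%N]%SET.

Lemma card_exponents : #|exponents| = 'C(n + d, d).
Proof. by rewrite card_ord_partitions -bin_sub ?leq_addr // addKn. Qed.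

(* An enumeration of these exponents; its order is immaterial, since another
   one gives a projectively equivalent variety. *)
Definition exponent (j : 'I_'C(n + d, d)) : n.+1.-tuple 'I_d.+1 :=
  enum_val (cast_ord (esym card_exponents) j).

Variable K : fieldType.

Definition veronese_vec (x : 'rV[K]_n.+1) : 'rV[K]_'C(n + d, d) :=
  \row_j \prod_(i < n.+1) x 0 i ^+ tnth (exponent j) i.

Definition veronese_variety : set (set 'rV[K]_'C(n + d, d)) :=
  [set lspan [set veronese_vec x] | x in [set x : 'rV[K]_n.+1 | x != 0]].

End Veronese.

Arguments veronese_variety n d K : clear implicits.

Section RationalNormalCurve.
Variable d : nat.

(* v(s,t) = (s^d, s^(d-1) t, ..., t^d); the coefficient ring is general so that
   [s] or [t] can be taken to be a formal variable. *)
Definition rnc_vec (R : comNzRingType) (s t : R) : 'rV[R]_d.+1 :=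
  \row_(i < d.+1) (s ^+ (d - i) * t ^+ i).

Variable K : fieldType.

Definition rnc_ds (s t : K) : 'rV[K]_d.+1 :=
  map_mx (fun q : {poly K} => q^`().[s]) (rnc_vec 'X t%:P).

Definition rnc_dt (s t : K) : 'rV[K]_d.+1 :=
  map_mx (fun q : {poly K} => q^`().[t]) (rnc_vec s%:P 'X).

Definition rnc_point (s t : K) : set 'rV[K]_d.+1 := lspan [set rnc_vec s t].

Definition rnc_tangent (s t : K) : set 'rV[K]_d.+1 :=
  lspan [set rnc_vec s t; rnc_ds s t; rnc_dt s t].

Definition std_rnc : set (set 'rV[K]_d.+1) :=
  [set rnc_point st.1 st.2 | st in [set st : K * K | st != (0, 0)]].

Variable V : lmodType K.
Implicit Types (U x L : set V) (C : set (set V)).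

Definition rational_normal_curve U C : Prop := proj_equiv std_rnc U C.

Definition is_tangent U C x L : Prop :=
  exists f : {linear 'rV[K]_d.+1 -> V}, proj_equiv_by f std_rnc U C /\
  exists s t : K, [/\ (s, t) != (0, 0),
    x = f @` rnc_point s t & L = f @` rnc_tangent s t].

(* T_x(C), for [C] a rational normal curve in [U]: the line does not depend on
   the projective equivalence if d = 2 or |K| >= d + 2. *)
Definition tangent U C x : set V := get (is_tangent U C x).

End RationalNormalCurve.

Section VeroneseanCap.
Variables (d : nat) (K : fieldType) (V : lmodType K).
Variables X Xi : set (set V).
Implicit Types x y xi : set V.

(* T_x(xi) *)
Definition cap_tangent x xi : set V := tangent d xi (points_on X xi) x.

(* [x,y] *)
Definition rational_space x y : set V :=
  get [set xi | [/\ Xi xi, x `<=` xi & y `<=` xi]].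

Record veronesean_cap : Prop := VeroneseanCap {
  cap_points : forall x, X x -> is_point x;
  cap_spanning : spanning X;
  cap_dim : forall xi, Xi xi -> is_pdim xi d;
  cap_rnc : forall xi, Xi xi ->
    rational_normal_curve d xi (points_on X xi);
  cap_V1 : forall x y, X x -> X y -> x <> y ->
    exists! xi, [/\ Xi xi, x `<=` xi & y `<=` xi];
  cap_V2 : forall xi1 xi2, Xi xi1 -> Xi xi2 -> xi1 <> xi2 ->
    forall p, is_point p -> p `<=` xi1 -> p `<=` xi2 -> X p;
  cap_V3 : forall x xi, X x -> Xi xi -> ~ x `<=` xi ->
    is_plane (\bigcup_(y in points_on X xi)
                cap_tangent x (rational_space x y))
}.

Definition cap_index (n : nat) : Prop :=
  forall x, X x ->
    is_pdim (\bigcup_(xi in [set xi | Xi xi /\ x `<=` xi]) cap_tangent x xi) n.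

End VeroneseanCap.

(* |K| >= d^(3/2), with both sides squared; it holds whenever K is infinite. *)
Definition card_ge_pow_3_2 (K : eqType) (d : nat) : Prop :=
  exists s : seq K, uniq s /\ (d ^ 3 <= size s ^ 2)%N.

(* Main.v *)
Require Import Defs.
From HB Require Import structures.
From mathcomp Require Import all_boot all_algebra.
From mathcomp Require Import boolp classical_sets.
From mathcomp Require Import ring zify.

Set Implicit Arguments.
Unset Strict Implicit.
Unset Printing Implicit Defensive.

Import GRing.Theory.
Local Open Scope classical_set_scope.
Local Open Scope ring_scope.

(** The points of a cap, with the rational spaces as lines, are a projective space
    over [K], mapped to [P(V)] by all forms of degree [d] in its coordinates.

    _Projective space_. By the last axiom the lines that join a point [p] to the
    points of a line form a linear pencil in the tangent space at [p]. This gives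
    planes in which any two lines meet [plane_meet], and hyperplanes.

    _Dimension_. A binary form of degree [d] with [d + 1] zeros vanishes, so a line
    of a plane that meets [d + 1] given lines lies in their span, as long as no
    three of these concur on it; at a double point the tangents of the two lines
    span the tangent plane. The bound on [K] leaves room to choose lines with few
    triple points [greedy_exists], and hyperplanes through a point in general
    position [no_three]. Therefore [dim V] is at most the binomial number of the
    statement [finite_dim]; as it is at least that number, every plane spans as
    much as it can [plane_full], and the conditions imposed by lines and points
    of a plane are independent.

    _Coordinates_. Linear forms that vanish on [d - 1] lines of a plane and at
    given points thus exist. Comparing their restrictions to other lines, which
    are binary forms with known zeros, shows that the projection of a line from a
    point is linear in the parameter of the line [perspectivity]. The directions
    seen from two points of a hyperplane then provide affine coordinates off it
    [chart], and adding points at infinity gives homogeneous coordinates in which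
    every line is parametrized projectively [frame_exists].

    _Forms_. In coordinates a linear form that vanishes on [d] lines of a dual conic
    restricts to explicit products on the sides of a triangle. This fixes the
    proportions between the vectors of the vertices [carnot], so that vectors can
    be assigned to coordinates in such a way that they are forms of degree [d] on
    every line [lift_exists]. Such a function is a polynomial [pencilwise_poly],
    hence a linear image of the vector of all monomials. The linear map is onto
    since the points span [V], and bijective by dimension. *)

(** * Subspaces and linear forms *)

Section Subspaces.
Variables (K : fieldType) (V : lmodType K).
Implicit Types (U W : set V) (S : set V) (v w : V).

Lemma sub0 U : is_subspace U -> U 0.
Proof. by case. Qed.

Lemma subZD U a u v : is_subspace U -> U u -> U v -> U (a *: u + v).
Proof. by case=> _; apply. Qed.

Lemma subD U u v : is_subspace U -> U u -> U v -> U (u + v).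
Proof. by move=> sU Uu Uv; rewrite -(scale1r u); apply: subZD. Qed.

Lemma subZ U a u : is_subspace U -> U u -> U (a *: u).
Proof. by move=> sU Uu; rewrite -[_ *: _]addr0; apply: subZD => //; apply: sub0. Qed.

Lemma subB U u v : is_subspace U -> U u -> U v -> U (u - v).
Proof. by move=> sU Uu Uv; rewrite -scaleN1r addrC; apply: subZD. Qed.

Lemma subZK U a u : is_subspace U -> a != 0 -> U (a *: u) -> U u.
Proof. by move=> sU a0 /(subZ a^-1 sU); rewrite scalerA mulVf // scale1r. Qed.

Lemma sub_sum U (I : Type) (r : seq I) (P : pred I) (F : I -> V) :
  is_subspace U -> (forall i, P i -> U (F i)) -> U (\sum_(i <- r | P i) F i).
Proof.
move=> sU UF; elim/big_rec: _ => [|i x Pi Ux]; first exact: sub0.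
by apply: subD => //; apply: UF.
Qed.

Lemma lspan_subspace S : is_subspace (lspan S).
Proof.
split=> [U [[U0 _] _] //|a u v Su Sv U [sU SU]].
by apply: subZD => //; [apply: Su | apply: Sv].
Qed.

Lemma sub_lspan S : S `<=` lspan S.
Proof. by move=> v Sv U [_]; apply. Qed.

Lemma in_lspan S v : S v -> lspan S v.
Proof. exact: (@sub_lspan S v). Qed.

Lemma lspan_elim S U v : is_subspace U -> (forall w, S w -> U w) -> lspan S v -> U v.
Proof. by move=> sU SU; apply. Qed.

Lemma lspan_trans S S' v :
  (forall w, S w -> lspan S' w) -> lspan S v -> lspan S' v.
Proof. exact: lspan_elim (@lspan_subspace S'). Qed.

Lemma lspan_mono S U : S `<=` U -> lspan S `<=` lspan U.
Proof.
by move=> SU v; apply: lspan_trans => w /SU; apply: in_lspan.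
Qed.

Lemma lspanZ S a v : lspan S v -> lspan S (a *: v).
Proof. exact: (@subZ (lspan S) a v (@lspan_subspace S)). Qed.

Lemma lspanD S v w : lspan S v -> lspan S w -> lspan S (v + w).
Proof. exact: (@subD (lspan S) v w (@lspan_subspace S)). Qed.

Lemma lspanB S v w : lspan S v -> lspan S w -> lspan S (v - w).
Proof. exact: (@subB (lspan S) v w (@lspan_subspace S)). Qed.

Lemma lspanZK S a v : a != 0 -> lspan S (a *: v) -> lspan S v.
Proof. exact: (@subZK (lspan S) a v (@lspan_subspace S)). Qed.

Lemma lspan_sum S (I : Type) (r : seq I) (P : pred I) (F : I -> V) :
  (forall i, P i -> lspan S (F i)) -> lspan S (\sum_(i <- r | P i) F i).
Proof. exact: (@sub_sum (lspan S) I r P F (@lspan_subspace S)). Qed.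

Lemma lspan1 v w : lspan [set v] w <-> exists a, w = a *: v.
Proof.
split=> [|[a ->]]; last by apply: lspanZ; apply: in_lspan.
apply: (@lspan_elim _ [set w | exists a, w = a *: v]).
  split=> [|a _ _ [b ->] [c ->]]; first by exists 0; rewrite scale0r.
  by exists (a * b + c); rewrite scalerDl scalerA.
by move=> _ ->; exists 1; rewrite scale1r.
Qed.

Lemma lspan_range m (b : 'I_m -> V) w :
  lspan (range b) w <-> exists c : 'rV[K]_m, w = \sum_i c 0 i *: b i.
Proof.
split=> [|[c ->]]; last first.
  by apply: lspan_sum => i _; apply: lspanZ; apply: in_lspan; exists i.
apply: (@lspan_elim _ [set w | exists c : 'rV[K]_m, w = \sum_i c 0 i *: b i]).
  split=> [|a _ _ [c ->] [e ->]].
    by exists 0; rewrite big1 // => i _; rewrite mxE scale0r.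
  exists (a *: c + e); rewrite scaler_sumr -big_split.
  by apply: eq_bigr => i _; rewrite !mxE scalerDl scalerA.
move=> _ [i _ <-]; exists (delta_mx 0 i); rewrite (bigD1 i) //= mxE !eqxx scale1r.
by rewrite big1 ?addr0 // => j /negbTE ne; rewrite mxE eqxx ne scale0r.
Qed.

(** The span of [U] together with one further vector. *)
Lemma lspanU1 U v w : is_subspace U ->
  lspan (U `|` [set v]) w <-> exists a, U (w - a *: v).
Proof.
move=> sU; split=> [|[a Uw]]; last first.
  rewrite -(subrK (a *: v) w); apply: lspanD; first by apply: in_lspan; left.
  by apply: lspanZ; apply: in_lspan; right.
apply: (@lspan_elim _ [set w | exists a, U (w - a *: v)]).
  split=> [|a x y [b Ux] [c Uy]]; first by exists 0; rewrite scale0r subr0; apply: sub0.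
  exists (a * b + c); rewrite scalerDl -scalerA opprD addrACA -scalerBr.
  exact: subZD.
move=> x [Ux|->]; first by exists 0; rewrite scale0r subr0.
by exists 1; rewrite scale1r subrr; apply: sub0.
Qed.

(** [W] lies in the span of [U] and at most [k] further vectors; this bounds
    dimensions without assuming that [V] is finite-dimensional. *)
Definition dimle U W (k : nat) : Prop :=
  exists bs : seq V, (size bs <= k)%N /\ W `<=` lspan (U `|` [set` bs]).

Lemma dimle_sub U W : W `<=` lspan U -> dimle U W 0.
Proof.
by move=> WU; exists [::]; split=> // v /WU; apply: lspan_mono => w Uw; left.
Qed.

Lemma dimle_le U W k k' : (k <= k')%N -> dimle U W k -> dimle U W k'.
Proof. by move=> lek [bs [szb bsP]]; exists bs; split=> //; apply: leq_trans lek. Qed.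

Lemma dimle_trans U W W' k l : dimle U W k -> dimle W W' l -> dimle U W' (k + l).
Proof.
move=> [bs [szb bsP]] [cs [szc csP]]; exists (bs ++ cs).
rewrite size_cat leq_add //; split=> // v /csP.
apply: lspan_trans => w [/bsP|wcs].
  apply: lspan_mono => x [Ux|xbs]; [by left | right].
  by rewrite /= mem_cat xbs.
by apply: in_lspan; right; rewrite /= mem_cat wcs orbT.
Qed.

Lemma dimle_mono U U' W W' k :
  U `<=` lspan U' -> W' `<=` lspan W -> dimle U W k -> dimle U' W' k.
Proof.
move=> UU WW dk; have := dimle_trans (dimle_trans (dimle_sub UU) dk) (dimle_sub WW).
by rewrite add0n addn0.
Qed.

Lemma dimleU U W W' k : dimle U W k -> W' `<=` lspan U -> dimle U (W `|` W') k.
Proof.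
move=> [bs [szb bsP]] WU; exists bs; split=> // v [/bsP//|/WU].
by apply: lspan_mono => w Uw; left.
Qed.

Lemma dimle_indep k m (b : 'I_m -> V) :
  dimle set0 [set: V] k -> lin_indep b -> (m <= k)%N.
Proof.
move=> [bs [szb bsP]] ib; apply: leq_trans szb.
have E i : exists c : 'rV[K]_(size bs), b i = \sum_j c 0 j *: bs`_j.
  have := bsP (b i) I => /lspan_mono h.
  have {}h : lspan (range (fun j : 'I_(size bs) => bs`_j)) (b i).
    apply: h => v [//|/= vb]; have lt : (index v bs < size bs)%N by rewrite index_mem.
    by exists (Ordinal lt) => //=; rewrite nth_index.
  by move/lspan_range: h.
case: (choice E) => c cP.
pose A : 'M[K]_(m, size bs) := \matrix_(i, j) c i 0 j.
rewrite leqNgt; apply/negP => lt.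
have : kermx A != 0.
  by rewrite -mxrank_eq0 mxrank_ker subn_eq0 -ltnNge (leq_ltn_trans (rank_leq_col A)).
case/rowV0Pn => x /sub_kermxP xA x0.
case/negP: x0; apply/eqP/rowP => i; rewrite [RHS]mxE; move: i.
apply: ib.
under eq_bigr => i _ do rewrite cP scaler_sumr.
rewrite exchange_big /= big1 // => j _.
have : (x *m A) 0 j = 0 by rewrite xA mxE.
rewrite mxE => xAj.
transitivity ((\sum_i x 0 i * A i j) *: bs`_j); last by rewrite xAj scale0r.
by rewrite scaler_suml; apply: eq_bigr => i _; rewrite scalerA mxE.
Qed.

Lemma indep_span m (b : 'I_m -> V) : dimle set0 [set: V] m -> lin_indep b ->
  lspan (range b) = [set: V].
Proof.
move=> dm ib; apply/seteqP; split=> // v _; apply: contrapT => nv.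
suff : (m.+1 <= m)%N by rewrite ltnn.
apply: (dimle_indep dm (b := fun i : 'I_m.+1 => if unlift ord0 i is Some j then b j else v)).
move=> c; rewrite big_ord_recl unlift_none /=.
under eq_bigr => i _ do rewrite liftK.
move=> s0; have c00 : c ord0 = 0.
  apply/eqP/negP => /negP c0; apply: nv; apply: (lspanZK c0).
  move/eqP: s0; rewrite addr_eq0 => /eqP ->; rewrite -scaleN1r.
  by apply: lspanZ; apply: lspan_sum => i _; apply: lspanZ; apply: in_lspan; exists i.
move: s0; rewrite c00 scale0r add0r => /ib h i.
by case: (unliftP ord0 i) => [j ->|->].
Qed.

(** Linear forms are kept as bare functions, since most of them are obtained by
    choice or by composition. *)
Definition functional (f : V -> K) : Prop :=
  forall a u v, f (a *: u + v) = a * f u + f v.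

Lemma funD f u v : functional f -> f (u + v) = f u + f v.
Proof. by move=> lf; rewrite -{1}[u]scale1r lf mul1r. Qed.

Lemma fun0 f : functional f -> f 0 = 0.
Proof. by move=> lf; apply: (@addrI _ (f 0)); rewrite -funD // !addr0. Qed.

Lemma funZ f a u : functional f -> f (a *: u) = a * f u.
Proof. by move=> lf; have := lf a u 0; rewrite fun0 // !addr0. Qed.

Lemma fun_sum f (I : Type) (r : seq I) (P : pred I) (F : I -> V) :
  functional f -> f (\sum_(i <- r | P i) F i) = \sum_(i <- r | P i) f (F i).
Proof.
by move=> lf; apply: (big_morph f (fun u v => funD u v lf)); apply: fun0.
Qed.

Lemma functional_ker f : functional f -> is_subspace [set v | f v = 0].
Proof.
move=> lf; split=> [|a u v /= fu fv]; first exact: fun0.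
by rewrite lf fu fv mulr0 addr0.
Qed.

(** Functionals separate a subspace from a vector outside it, by extending the
    subspace greedily along a finite spanning list. *)
Lemma functional_sep k U v : dimle set0 [set: V] k -> is_subspace U -> ~ U v ->
  exists f, [/\ functional f, forall u, U u -> f u = 0 & f v = 1].
Proof.
move=> [bs [_ bsP]] sU nUv.
have [U1 [sU1 UU1 nU1 allU1]] : exists U1, [/\ is_subspace U1, U `<=` U1, ~ U1 v
    & forall w, lspan (U1 `|` [set v]) w].
  have : forall w, lspan (U `|` [set v] `|` [set` bs]) w.
    by move=> w; apply: lspan_mono (bsP w I) => x [//|xb]; right.
  elim: bs {bsP} U sU nUv => [|b bs IH] U sU nUv allU.
    by exists U; split=> // w; apply: lspan_mono (allU w) => x [].
  case: (pselect (lspan (U `|` [set b]) v)) => [vb|nvb].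
    apply: IH => // w; have := allU w; apply: lspan_trans.
    move=> x [Ux|]; first by apply: in_lspan; left.
    rewrite /= inE => /orP[/eqP ->|xb]; last by apply: in_lspan; right.
    case/lspanU1: vb => // a Uva.
    have a0 : a != 0 by apply/eqP => a0; apply: nUv; rewrite a0 scale0r subr0 in Uva.
    apply: (lspanZK a0).
    have -> : a *: b = v - (v - a *: b) by rewrite opprB addrC subrK.
    by apply: lspanB; apply: in_lspan; left; [right | left].
  have [||w|U1 [sU1 UU1 nU1 allU1]] := IH (lspan (U `|` [set b])).
  - exact: lspan_subspace.
  - exact: nvb.
  - have := allU w; apply: lspan_trans => x [[Ux|->]|].
    + by apply: in_lspan; left; left; apply: in_lspan; left.
    + by apply: in_lspan; left; right.
    + rewrite /= inE => /orP[/eqP ->|xb]; apply: in_lspan; last by right.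
      by left; left; apply: in_lspan; right.
  - by exists U1; split=> // x Ux; apply: UU1; apply: in_lspan; left.
have E w : exists a, U1 (w - a *: v) by apply/lspanU1 => //; apply: allU1.
case: (choice E) => f fP.
have fU w a : U1 (w - a *: v) -> f w = a.
  move=> Uw; apply/eqP; rewrite -subr_eq0; apply/negP => /negP ne; apply: nU1.
  apply: (subZK sU1 ne); have := subB sU1 Uw (fP w).
  by rewrite opprB [X in U1 X]addrC addrA subrK -scalerBl.
exists f; split=> [a x y|u Uu|].
- apply: fU; rewrite scalerDl -scalerA opprD addrACA -scalerBr.
  exact: subZD.
- by apply: fU; rewrite scale0r subr0; apply: UU1.
- by apply: fU; rewrite scale1r subrr; apply: sub0.
Qed.

(** Exchange: a nonzero vector of a subspace is part of a basis of it. *)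
Lemma basis_exchange m U v : has_dim U m.+1 -> U v -> v != 0 ->
  exists b : 'I_m -> V, [/\ forall i, U (b i),
    forall a (c : 'rV[K]_m), a *: v + \sum_i c 0 i *: b i = 0 -> a = 0 /\ c = 0
    & forall w, U w -> exists a (c : 'rV[K]_m), w = a *: v + \sum_i c 0 i *: b i].
Proof.
move=> [b [ib sb]] Uv v0; move: (Uv); rewrite -sb => /lspan_range[c cE].
have [i0 ci0] : exists i, c 0 i != 0.
  apply: contrapT => nc; case/eqP: v0; rewrite cE big1 // => i _.
  case: (eqVneq (c 0 i) 0) => [->|ci]; first by rewrite scale0r.
  by case: nc; exists i.
have spl (F : 'I_m.+1 -> V) : \sum_i F i = F i0 + \sum_j F (lift i0 j).
  by rewrite (bigD1_ord i0).
have Ub i : U (b i) by rewrite -sb; apply: in_lspan; exists i.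
have vE : v = c 0 i0 *: b i0 + \sum_j c 0 (lift i0 j) *: b (lift i0 j).
  by rewrite {1}cE spl.
exists (fun j => b (lift i0 j)); split=> [j|a e s0|w].
- by rewrite sb; apply: Ub.
- pose g i := a * c 0 i + (if unlift i0 i is Some j then e 0 j else 0).
  have g0 : forall i, g i = 0.
    apply: ib; rewrite spl /g unlift_none addr0.
    under eq_bigr => j _ do rewrite liftK scalerDl -scalerA.
    by rewrite big_split /= -scaler_sumr addrA -scalerA -scalerDr -vE.
  have a0 : a = 0.
    have := g0 i0; rewrite /g unlift_none addr0 => /eqP.
    by rewrite mulf_eq0 (negbTE ci0) orbF => /eqP.
  split=> //; apply/rowP => j; rewrite [RHS]mxE.
  by have := g0 (lift i0 j); rewrite /g liftK a0 mul0r add0r.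
- move=> /lspan_range[e ->].
  exists (e 0 i0 / c 0 i0), (\row_j (e 0 (lift i0 j) - e 0 i0 / c 0 i0 * c 0 (lift i0 j))).
  rewrite spl vE scalerDr scalerA divfK // -addrA; congr (_ + _).
  rewrite scaler_sumr -big_split /=; apply: eq_bigr => j _.
  by rewrite mxE scalerBl scalerA addrC subrK.
Qed.

End Subspaces.

(** * Binary forms *)

Section Forms.
Variable K : fieldType.
Implicit Types (p q : {poly K}) (z : K * K).

(** A binary form of degree [k] is stored as the polynomial obtained by setting
    [s := 1], which has [size <= k.+1]; [hev k p s t] is its value at [(s, t)]. *)
Definition hev (R : comNzRingType) k (p : {poly R}) (s t : R) : R :=
  \sum_(i < k.+1) p`_i * (s ^+ (k - i) * t ^+ i).

(** The linear form with zero [z], as a polynomial and as a function. *)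
Definition lamp (z : K * K) : {poly K} := z.1 *: 'X - z.2%:P.
Definition lam (z : K * K) (s t : K) : K := z.1 * t - z.2 * s.

Lemma hevD (R : comNzRingType) k (p q : {poly R}) s t :
  hev k (p + q) s t = hev k p s t + hev k q s t.
Proof. by rewrite /hev -big_split; apply: eq_bigr => i _; rewrite coefD mulrDl. Qed.

Lemma hevZ (R : comNzRingType) k a (p : {poly R}) s t : hev k (a *: p) s t = a * hev k p s t.
Proof. by rewrite /hev mulr_sumr; apply: eq_bigr => i _; rewrite coefZ mulrA. Qed.

Lemma hevS (R : comNzRingType) k (p : {poly R}) s t : (size p <= k.+1)%N ->
  hev k.+1 p s t = s * hev k p s t.
Proof.
move=> szp; rewrite /hev big_ord_recr /= nth_default // mul0r addr0 mulr_sumr.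
apply: eq_bigr => i _; rewrite subSn; last by rewrite -ltnS.
by rewrite exprS; ring.
Qed.

Lemma hevX (R : comNzRingType) k (p : {poly R}) s t : hev k.+1 ('X * p) s t = t * hev k p s t.
Proof.
rewrite /hev big_ord_recl /= coefXM mul0r add0r mulr_sumr.
apply: eq_bigr => i _; rewrite coefXM /= /bump /= add1n subSS /= exprS; ring.
Qed.

Lemma hev_lamp (R : comNzRingType) k (p : {poly R}) (u v s t : R) :
  (size p <= k.+1)%N ->
  hev k.+1 ((u *: 'X - v%:P) * p) s t = (u * t - v * s) * hev k p s t.
Proof.
move=> szp; rewrite mulrBl hevD -scalerAl hevZ hevX -mulN1r mulrA -polyCN -polyCM.
by rewrite mulN1r mul_polyC hevZ hevS //; ring.
Qed.

Lemma hev_lam k z p s t : (size p <= k.+1)%N ->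
  hev k.+1 (lamp z * p) s t = lam z s t * hev k p s t.
Proof. exact: hev_lamp. Qed.

Lemma size_lamp z : (size (lamp z) <= 2)%N.
Proof.
rewrite /lamp (leq_trans (size_polyD _ _)) // geq_max size_polyN.
by rewrite (leq_trans (size_scale_leq _ _)) ?size_polyX // (leq_trans (size_polyC_leq1 _)).
Qed.

Lemma size_lampM z p k : (size p <= k)%N -> (size (lamp z * p)%R <= k.+1)%N.
Proof.
move=> szp; apply: leq_trans (size_polyMleq _ _) _.
by have := size_lamp z; lia.
Qed.

Lemma hev_horner k p s t : (size p <= k.+1)%N -> s != 0 ->
  hev k p s t = s ^+ k * p.[t / s].
Proof.
move=> szp s0; rewrite (horner_coef_wide _ szp) mulr_sumr.
apply: eq_bigr => i _; rewrite expr_div_n.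
have -> : s ^+ k = s ^+ (k - i) * s ^+ i by rewrite -exprD subnK // -ltnS.
have si : s ^+ i != 0 by rewrite expf_neq0.
by field.
Qed.

Lemma hev_infty k p t : hev k p 0 t = p`_k * t ^+ k.
Proof.
rewrite /hev big_ord_recr /= subnn expr0 mul1r big1 ?add0r // => i _.
by rewrite expr0n subn_eq0 leqNgt ltn_ord mul0r mulr0.
Qed.

Lemma pair_neq0 z : z != (0, 0) -> z.1 = 0 -> z.2 != 0.
Proof. by case: z => a b z0 /= a0; apply: contra z0 => /eqP ->; rewrite a0. Qed.

(** A zero of a binary form splits off a linear factor, also at infinity. *)
Lemma hev_factor k p z : (size p <= k.+2)%N -> z != (0, 0) -> hev k.+1 p z.1 z.2 = 0 ->
  exists2 q : {poly K}, (size q <= k.+1)%N & p = lamp z * q.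
Proof.
case: z => s0 t0 szp z0 /=; case: (eqVneq s0 0) => [s00|s0n0].
  have t0n0 : t0 != 0 by apply: (pair_neq0 z0).
  rewrite s00 hev_infty => /eqP; rewrite mulf_eq0 (negbTE (expf_neq0 _ t0n0)) orbF => /eqP pk.
  exists (- t0^-1 *: p).
    apply: leq_trans (size_scale_leq _ _) _; apply/leq_sizeP => j.
    by rewrite leq_eqVlt => /orP[/eqP <- //|lt]; apply: nth_default; apply: leq_trans lt.
  by rewrite /lamp /= scale0r sub0r mulNr mul_polyC scalerA mulrN divff // scaleN1r opprK.
rewrite hev_horner // => /eqP; rewrite mulf_eq0 (negbTE (expf_neq0 _ s0n0)) /=.
case/factor_theorem => q qE; exists (s0^-1 *: q).
  apply: leq_trans (size_scale_leq _ _) _; case: (eqVneq q 0) => [->|q0]; first by rewrite size_poly0.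
  by move: szp; rewrite qE size_Mmonic ?monicXsubC // size_XsubC addn2.
rewrite qE /lamp /= -scalerAr mulrC scalerAl; congr (_ * _).
by rewrite scalerBr scalerA mulVf // scale1r -mul_polyC -polyCM mulrC.
Qed.

(** Derivative of the form [p] at [(s, t)] in the direction [(a, b)]. *)
Definition dhev k p s t a b : K :=
  a * ((hev k (map_poly polyC p) 'X t%:P)^`()).[s]
  + b * ((hev k (map_poly polyC p) s%:P 'X)^`()).[t].

Lemma hev_map k p (u v : {poly K}) x : (hev k (map_poly polyC p) u v).[x] = hev k p u.[x] v.[x].
Proof.
rewrite /hev horner_sum; apply: eq_bigr => i _.
by rewrite coef_map /= !hornerE.
Qed.

Lemma dhev_lam k z p s t a b : (size p <= k.+1)%N ->
  dhev k.+1 (lamp z * p) s t a b =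
  lam z a b * hev k p s t + lam z s t * dhev k p s t a b.
Proof.
move=> szp; rewrite /dhev rmorphM /=.
have -> : map_poly polyC (lamp z) = z.1%:P *: 'X - (z.2%:P)%:P.
  by rewrite /lamp rmorphB /= map_polyZ map_polyX map_polyC.
rewrite !hev_lamp ?size_map_polyC //.
rewrite !derivE !hornerE !hev_map !hornerE /lam.
ring.
Qed.

Lemma lam_self z : lam z z.1 z.2 = 0. Proof. by rewrite /lam mulrC subrr. Qed.

Lemma lam_dir z : z != (0, 0) -> exists ab : K * K, lam z ab.1 ab.2 != 0.
Proof.
case: z => s t z0; rewrite /lam /=; case: (eqVneq s 0) => [s0|s0].
  by exists (1, 0); rewrite /= mulr0 mulr1 sub0r oppr_eq0; apply: (pair_neq0 z0).
by exists (0, 1); rewrite /= mulr1 mulr0 subr0.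
Qed.

(** Vanishing of [p] at a list of points, to second order at the points that
    occur twice. *)
Definition zero_at (T : eqType) k p (z : T -> K * K) (ys : seq T) : Prop :=
  forall y, y \in ys -> hev k p (z y).1 (z y).2 = 0 /\
    ((1 < count_mem y ys)%N -> forall a b, dhev k p (z y).1 (z y).2 a b = 0).

Definition zpts (T : eqType) (z : T -> K * K) (ys : seq T) : Prop :=
  [/\ forall y, y \in ys -> z y != (0, 0),
      forall y y', y \in ys -> y' \in ys -> y != y' -> lam (z y) (z y').1 (z y').2 != 0
    & forall y, (count_mem y ys <= 2)%N].

Lemma zpts_cons (T : eqType) (z : T -> K * K) y ys : zpts z (y :: ys) -> zpts z ys.
Proof.
move=> [z0 zl zc]; split=> [x xs|x x' xs xs'|x].
- by apply: z0; rewrite inE xs orbT.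
- by apply: zl; rewrite inE ?xs ?xs' orbT.
- by apply: leq_trans (zc x); rewrite /= leq_addl.
Qed.

(** Removing one occurrence of a zero: at a double zero the product rule shows
    that the cofactor still vanishes. *)
Lemma zero_at_cons (T : eqType) k (z : T -> K * K) y ys q : zpts z (y :: ys) ->
  (size q <= k.+1)%N ->
  zero_at k.+1 (lamp (z y) * q) z (y :: ys) -> zero_at k q z ys.
Proof.
move=> [z0 zl zc] szq zp x xs; have xys : x \in y :: ys by rewrite inE xs orbT.
have [h d] := zp x xys; case: (eqVneq x y) => [xy|ne].
  subst x; have cy : (1 < count_mem y (y :: ys))%N.
    by rewrite /= eqxx ltnS -has_count has_pred1.
  split; last by move: (zc y); rewrite /= eqxx => le2 le1; exfalso; lia.
  have [ab abn0] := lam_dir (z0 y (mem_head _ _)).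
  have := d cy ab.1 ab.2; rewrite dhev_lam // lam_self mul0r addr0 => /eqP.
  by rewrite mulf_eq0 (negbTE abn0) => /eqP.
have ln0 : lam (z y) (z x).1 (z x).2 != 0 by apply: zl; rewrite ?mem_head // eq_sym.
have hx : hev k q (z x).1 (z x).2 = 0.
  by move/eqP: h; rewrite hev_lam // mulf_eq0 (negbTE ln0) => /eqP.
split=> // cx a b; have := d _ a b; rewrite dhev_lam // hx mulr0 add0r.
have -> : (1 < count_mem x (y :: ys))%N by rewrite /= (leq_trans cx) ?leq_addl.
by move/(_ isT)/eqP; rewrite mulf_eq0 (negbTE ln0) => /eqP.
Qed.

(** Zeros of a form, counted with multiplicity, split off linear factors. *)
Lemma form_factor (T : eqType) (z : T -> K * K) ys k p : zpts z ys ->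
  (size ys <= k)%N -> (size p <= k.+1)%N -> zero_at k p z ys ->
  exists2 q : {poly K}, (size q <= (k - size ys).+1)%N & p = (\prod_(y <- ys) lamp (z y)) * q.
Proof.
elim: ys k p => [|y ys IH] k p zz szy szp zp.
  by exists p; rewrite ?subn0 // big_nil mul1r.
case: k szy szp zp => // k szy szp zp.
have z0 : z y != (0, 0) by case: zz => + _ _; apply; rewrite mem_head.
have [h _] := zp y (mem_head _ _).
have [q szq pE] := hev_factor szp z0 h; subst p.
have [r szr qE] := IH k q (zpts_cons zz) szy szq (zero_at_cons zz szq zp).
by exists r; rewrite ?subSS // qE big_cons mulrA.
Qed.

Lemma form_zero (T : eqType) (z : T -> K * K) ys k p : zpts z ys ->
  (k < size ys)%N -> (size p <= k.+1)%N -> zero_at k p z ys -> p = 0.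
Proof.
elim: k ys p => [|k IH] [|y ys] p zz // szy szp zp.
  have := zp y (mem_head _ _); rewrite /hev big_ord1 !expr0 !mulr1 => -[p0 _].
  by rewrite (size1_polyC szp) p0.
have z0 : z y != (0, 0) by case: zz => + _ _; apply; rewrite mem_head.
have [h _] := zp y (mem_head _ _).
have [q szq pE] := hev_factor szp z0 h; subst p.
by rewrite (IH ys q (zpts_cons zz)) ?mulr0 //; apply: zero_at_cons zp.
Qed.

Lemma size_prod_lamp (T : eqType) (z : T -> K * K) ys :
  (size (\prod_(y <- ys) lamp (z y))%R <= (size ys).+1)%N.
Proof.
elim: ys => [|y ys IH]; first by rewrite big_nil size_poly1.
by rewrite big_cons; apply: size_lampM.
Qed.

Lemma hev_prod (T : eqType) (z : T -> K * K) ys k q s t : (size q <= k.+1)%N ->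
  hev (size ys + k) ((\prod_(y <- ys) lamp (z y)) * q) s t =
  (\prod_(y <- ys) lam (z y) s t) * hev k q s t.
Proof.
move=> szq; elim: ys => [|y ys IH]; first by rewrite !big_nil !mul1r.
rewrite !big_cons -!mulrA /= addSn hev_lam ?IH //.
apply: leq_trans (size_polyMleq _ _) _; move: (size_prod_lamp z ys) szq.
by case: (size _) => [|a]; case: (size q) => [|b]; rewrite ?addSn ?addnS /=; lia.
Qed.

Lemma hev0 (q : K) s t : hev 0 q%:P s t = q.
Proof. by rewrite /hev big_ord1 coefC eqxx !expr0 !mulr1. Qed.

Lemma hev1 (q : {poly K}) s t : hev 1 q s t = q`_0 * s + q`_1 * t.
Proof. by rewrite /hev big_ord_recl big_ord1 /= !expr1 !expr0 mulr1 mul1r. Qed.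

End Forms.

(** * The rational normal curve and its tangents *)

Section NormalCurve.
Variables (K : fieldType) (d : nat).
Notation rv := 'rV[K]_d.+1.
Implicit Types (p q : {poly K}) (z : K * K) (v : rv) (g : rv -> K).

(** The tangent vector in the direction [(a, b)] of the parameter plane. *)
Definition drnc (s t a b : K) : rv := a *: rnc_ds d s t + b *: rnc_dt d s t.

(** Functionals on the ambient space of the curve are binary forms. *)
Definition gpoly p v : K := \sum_(i < d.+1) p`_i * v 0 i.
Definition polyf g : {poly K} := \poly_(i < d.+1) g (delta_mx 0 (inord i)).

Lemma gpoly_functional p : functional (gpoly p).
Proof.
move=> a u v; rewrite /gpoly mulr_sumr -big_split /=; apply: eq_bigr => i _.
by rewrite !mxE; ring.
Qed.

Lemma gpolyK g v : functional g -> gpoly (polyf g) v = g v.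
Proof.
move=> lg; rewrite [in RHS](row_sum_delta v) fun_sum //; apply: eq_bigr => i _.
by rewrite coef_poly ltn_ord inord_val funZ // mulrC.
Qed.

Lemma gpolyD a p q v : gpoly (a *: p + q) v = a * gpoly p v + gpoly q v.
Proof.
rewrite /gpoly mulr_sumr -big_split /=; apply: eq_bigr => i _.
by rewrite coefD coefZ; ring.
Qed.

Lemma gpoly0 v : gpoly 0 v = 0.
Proof. by rewrite /gpoly big1 // => i _; rewrite coef0 mul0r. Qed.

Lemma size_polyf g : (size (polyf g) <= d.+1)%N.
Proof. exact: size_poly. Qed.

Lemma gpoly_rnc p s t : gpoly p (rnc_vec d s t) = hev d p s t.
Proof. by apply: eq_bigr => i _; rewrite mxE. Qed.

Lemma gpoly_drnc p s t a b : gpoly p (drnc s t a b) = dhev d p s t a b.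
Proof.
rewrite /drnc (gpoly_functional p) (funZ b _ (gpoly_functional p)) /dhev /hev !raddf_sum /=.
rewrite !horner_sum; congr (_ * _ + _ * _); apply: eq_bigr => i _;
  by rewrite !mxE coef_map /= mul_polyC derivZ hornerZ.
Qed.

Lemma polyf_rnc g s t : functional g -> hev d (polyf g) s t = g (rnc_vec d s t).
Proof. by move=> lg; rewrite -gpoly_rnc gpolyK. Qed.

Lemma polyf_drnc g s t a b : functional g -> dhev d (polyf g) s t a b = g (drnc s t a b).
Proof. by move=> lg; rewrite -gpoly_drnc gpolyK. Qed.

Lemma drncD s t a b a' b' c :
  drnc s t (c * a + a') (c * b + b') = c *: drnc s t a b + drnc s t a' b'.
Proof. by rewrite /drnc !scalerDl scalerDr !scalerA addrACA. Qed.

(** Euler's relation; it keeps the tangent a line although it is spanned by three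
    vectors. *)
Lemma drnc_euler s t : drnc s t s t = d%:R *: rnc_vec d s t.
Proof.
apply/rowP => i; rewrite !mxE.
have -> : (('X ^+ (d - i) * t%:P ^+ i : {poly K})^`()).[s] = (d - i)%:R * s ^+ (d - i).-1 * t ^+ i.
  by rewrite -polyC_exp mulrC mul_polyC derivZ derivXn hornerZ hornerMn hornerXn mulrC mulr_natl.
have -> : ((s%:P ^+ (d - i) * 'X ^+ i : {poly K})^`()).[t] = s ^+ (d - i) * (i%:R * t ^+ i.-1).
  by rewrite -polyC_exp mul_polyC derivZ derivXn hornerZ hornerMn hornerXn mulr_natl.
have h (x : K) k : x * (k%:R * x ^+ k.-1) = k%:R * x ^+ k.
  by case: k => [|k]; [rewrite !mul0r mulr0 | rewrite exprS /=; ring].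
rewrite mulrA h; have -> : t * (s ^+ (d - i) * (i%:R * t ^+ i.-1)) = s ^+ (d - i) * (t * (i%:R * t ^+ i.-1)).
  by ring.
rewrite h -mulrA.
have -> : (d%:R : K) = (d - i)%:R + i%:R by rewrite -natrD subnK // -ltnS.
ring.
Qed.

Lemma lam_prop z z' : z != (0, 0) -> z' != (0, 0) -> lam z z'.1 z'.2 = 0 ->
  exists2 a : K, a != 0 & z' = (a * z.1, a * z.2).
Proof.
case: z => s t; case: z' => s' t' z0 z0'; rewrite /lam /= => /eqP; rewrite subr_eq0 => /eqP e.
case: (eqVneq s 0) => [s0|s0].
  have t0 := pair_neq0 z0 s0; move: e; rewrite s0 mul0r => /esym/eqP.
  rewrite mulf_eq0 (negbTE t0) /= => /eqP s'0; have t'0 := pair_neq0 z0' s'0.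
  by exists (t' / t); rewrite ?mulf_neq0 ?invr_neq0 // s'0 mulr0 divfK.
exists (s' / s); last by rewrite divfK // mulrAC [s' * t]mulrC -e mulrAC divff // mul1r.
apply/negP; rewrite mulf_eq0 invr_eq0 (negbTE s0) orbF => /eqP s'0.
have /negP := pair_neq0 z0' s'0; apply.
by move/eqP: e; rewrite s'0 mulr0 mulf_eq0 (negbTE s0).
Qed.

Lemma hev_lamp1 z s t : hev 1 (lamp z) s t = lam z s t.
Proof.
by have := @hev_lam K 0 z 1 s t; rewrite size_poly1 mulr1 (hev0 1) mulr1 => ->.
Qed.

Lemma lamp_neq0 z : z != (0, 0) -> lamp z != 0.
Proof.
move=> z0; have [[e f] /= h] := lam_dir z0; apply: contra h => /eqP l0.
by rewrite -hev_lamp1 l0 /hev big1 // => i _; rewrite coef0 mul0r.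
Qed.

Lemma lamC z z' : lam z z'.1 z'.2 = - lam z' z.1 z.2.
Proof. by rewrite /lam; ring. Qed.

(** In the plane of pairs, any pair is a combination of two independent ones. *)
Lemma lam_comb z1 z2 z : lam z1 z2.1 z2.2 != 0 ->
  exists a b, z = (a * z1.1 + b * z2.1, a * z1.2 + b * z2.2) /\
    lam z1 z2.1 z2.2 * a = - lam z2 z.1 z.2 /\ lam z1 z2.1 z2.2 * b = lam z1 z.1 z.2.
Proof.
case: z1 => s1 t1; case: z2 => s2 t2; case: z => s t; rewrite /lam /= => D.
exists (- (s2 * t - t2 * s) / (s1 * t2 - t1 * s2)), ((s1 * t - t1 * s) / (s1 * t2 - t1 * s2)).
by split; [congr (_, _); field | split; field].
Qed.

Lemma form_nz k z : z != (0, 0) -> exists2 p : {poly K}, (size p <= k.+1)%N & hev k p z.1 z.2 != 0.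
Proof.
case: z => s t z0 /=; case: (eqVneq s 0) => [s0|s0].
  exists 'X^k; first by rewrite size_polyXn.
  by rewrite s0 hev_infty coefXn eqxx mul1r expf_neq0 // (pair_neq0 z0).
exists 1; first by rewrite size_poly1.
by rewrite hev_horner ?size_poly1 // hornerE mulr1 expf_neq0.
Qed.

Lemma rnc_neq0 z : z != (0, 0) -> rnc_vec d z.1 z.2 != 0.
Proof.
move=> z0; have [p _] := form_nz d z0; apply: contra => /eqP e.
by rewrite -gpoly_rnc e fun0 //; apply: gpoly_functional.
Qed.

Lemma rnc_tangentP s t v :
  @rnc_tangent d K s t v <-> exists c a b, v = c *: rnc_vec d s t + drnc s t a b.
Proof.
split=> [|[c [a [b ->]]]]; last first.
  by apply: lspanD; [|apply: lspanD]; apply: lspanZ; apply: in_lspan; do ?[by right|by left|left].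
apply: (@lspan_elim _ _ _ [set v | exists c a b, v = c *: rnc_vec d s t + drnc s t a b]).
  split=> [|e _ _ [c [a [b ->]]] [c' [a' [b' ->]]]].
    by exists 0, 0, 0; rewrite /drnc !scale0r !addr0.
  exists (e * c + c'), (e * a + a'), (e * b + b').
  by rewrite drncD scalerDl scalerDr -scalerA addrACA.
move=> w [[->|->]|->].
- by exists 1, 0, 0; rewrite /drnc !scale0r scale1r !addr0.
- by exists 0, 1, 0; rewrite /drnc !scale0r scale1r addr0 add0r.
- by exists 0, 0, 1; rewrite /drnc !scale0r scale1r !add0r.
Qed.

Lemma rv_dimle : dimle set0 [set: rv] d.+1.
Proof.
exists [seq delta_mx 0 i | i <- enum 'I_d.+1]; split; first by rewrite size_map size_enum_ord.
move=> v _; rewrite (row_sum_delta v); apply: lspan_sum => i _; apply: lspanZ; apply: in_lspan.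
by right; apply/mapP; exists i; rewrite ?mem_enum.
Qed.

(** [d.+1] points of the curve, counted with multiplicity, span its space. *)
Lemma rnc_full (T : eqType) (z : T -> K * K) ys (U : set rv) : is_subspace U ->
  zpts z ys -> (d < size ys)%N ->
  (forall y, y \in ys -> U (rnc_vec d (z y).1 (z y).2) /\
    ((1 < count_mem y ys)%N -> forall a b, U (drnc (z y).1 (z y).2 a b))) ->
  forall v, U v.
Proof.
move=> sU zz szy Uys v; apply: contrapT => nUv.
have [g [lg gU gv]] := functional_sep rv_dimle sU nUv.
have p0 : polyf g = 0.
  apply: (form_zero zz szy (size_polyf g)) => y /Uys[Uy dU].
  split=> [|c a b]; first by rewrite polyf_rnc // gU.
  by rewrite polyf_drnc // gU //; apply: dU.
have := gpolyK v lg; rewrite p0 gv /gpoly big1 => [/esym/eqP|i _].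
  by rewrite oner_eq0.
by rewrite coef0 mul0r.
Qed.

Hypothesis hd : (2 <= d)%N.

Lemma tangent_indep z (a b c e : K) : z != (0, 0) -> lam z a b != 0 ->
  c *: rnc_vec d z.1 z.2 + e *: drnc z.1 z.2 a b = 0 -> c = 0 /\ e = 0.
Proof.
move=> z0 l0 s0; have dE : d = d.-1.+1 by lia.
have [q szq hq] := form_nz d.-1 z0.
have e0 : e = 0.
  have := congr1 (gpoly (lamp z * q)) s0.
  rewrite (gpoly_functional _) (funZ e _ (gpoly_functional _)) (fun0 (gpoly_functional _)).
  rewrite gpoly_rnc gpoly_drnc dE hev_lam // dhev_lam // lam_self !mul0r mulr0 add0r addr0.
  by move/eqP; rewrite !mulf_eq0 (negbTE l0) (negbTE hq) !orbF => /eqP.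
split=> //; move/eqP: s0; rewrite e0 scale0r addr0 scaler_eq0 (negbTE (rnc_neq0 z0)) orbF.
by move/eqP.
Qed.

(** The tangent meets the curve only at the point of contact. *)
Lemma tangent_meet z z' (a b c e : K) : z != (0, 0) -> z' != (0, 0) -> c != 0 ->
  c *: rnc_vec d z'.1 z'.2 = e *: rnc_vec d z.1 z.2 + drnc z.1 z.2 a b ->
  lam z z'.1 z'.2 = 0.
Proof.
move=> z0 z0' c0 E; have dE : d = d.-2.+2 by lia.
have [q szq hq] := form_nz d.-2 z0'.
have szq1 := @size_lampM K z q _ szq.
have := congr1 (gpoly (lamp z * (lamp z * q))) E.
rewrite (gpoly_functional _) (funZ c _ (gpoly_functional _)) !gpoly_rnc gpoly_drnc.
rewrite dE !hev_lam // dhev_lam // !hev_lam // lam_self !(mul0r, mulr0, addr0).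
by move/eqP; rewrite !mulf_eq0 (negbTE c0) (negbTE hq) orbF orbb => /eqP.
Qed.

Lemma tangent_span z (a b : K) : z != (0, 0) -> lam z a b != 0 ->
  forall v, @rnc_tangent d K z.1 z.2 v ->
  exists c e, v = c *: rnc_vec d z.1 z.2 + e *: drnc z.1 z.2 a b.
Proof.
move=> z0 l0 v /rnc_tangentP[c [a' [b' ->]]].
have [x [y [[-> ->] _]]] := @lam_comb z (a, b) (a', b') l0.
exists (c + x * d%:R), y; rewrite drncD drnc_euler scalerA addrA -scalerDl.
by rewrite -[y * a]addr0 -[y * b]addr0 drncD /drnc !scale0r !addr0.
Qed.

Lemma rnc_scale (a s t : K) : rnc_vec d (a * s) (a * t) = a ^+ d *: rnc_vec d s t.
Proof.
apply/rowP => i; rewrite !mxE !exprMn.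
have -> : a ^+ d = a ^+ (d - i) * a ^+ i by rewrite -exprD subnK // -ltnS.
ring.
Qed.

(** The curve is parametrized injectively: some form of degree [d] vanishes at [z]
    but not at [z']. *)
Lemma rnc_prop z z' (c : K) : z != (0, 0) -> z' != (0, 0) ->
  rnc_vec d z'.1 z'.2 = c *: rnc_vec d z.1 z.2 -> lam z z'.1 z'.2 = 0.
Proof.
move=> z0 z0' E; have dE : d = d.-1.+1 by lia.
have [q szq hq] := form_nz d.-1 z0'.
have := congr1 (gpoly (lamp z * q)) E.
rewrite (funZ c _ (gpoly_functional _)) !gpoly_rnc dE !hev_lam // lam_self mul0r mulr0.
by move/eqP; rewrite mulf_eq0 (negbTE hq) orbF => /eqP.
Qed.

End NormalCurve.

Section Transport.
Variables (K : fieldType) (d : nat).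
Hypothesis hd : (2 <= d)%N.
Notation rv := 'rV[K]_d.+1.
Variables (G : rv -> rv) (sg : K * K -> K * K) (k : K * K -> K).
Hypothesis Glin : forall a u v, G (a *: u + v) = a *: G u + G v.
Hypothesis Ginj : injective G.
Hypothesis sg0 : forall z : K * K, z != (0, 0) -> sg z != (0, 0).
Hypothesis k0 : forall z : K * K, z != (0, 0) -> k z != 0.
Hypothesis Gsg : forall z : K * K, z != (0, 0) ->
  G (rnc_vec d z.1 z.2) = k z *: rnc_vec d (sg z).1 (sg z).2.
Implicit Types (p q : {poly K}) (z : K * K).

Let pull p : {poly K} := polyf (gpoly p \o G).

Let pull_fun p : functional (gpoly p \o G).
Proof. by move=> a u v; rewrite /= Glin; apply: gpoly_functional. Qed.

Let pull_hev p z : z != (0, 0) ->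
  hev d (pull p) z.1 z.2 = k z * hev d p (sg z).1 (sg z).2.
Proof.
by move=> z0; rewrite polyf_rnc //= Gsg // (funZ _ _ (gpoly_functional _)) gpoly_rnc.
Qed.

Let pullD a p q : pull (a *: p + q) = a *: pull p + pull q.
Proof.
apply/polyP => i; rewrite coefD coefZ !coef_poly; case: ltnP => _; last by rewrite mulr0 addr0.
rewrite /= /gpoly mulr_sumr -big_split /=; apply: eq_bigr => j _.
by rewrite coefD coefZ; ring.
Qed.

Let pull_size p : (size (pull p) <= d.+1)%N. Proof. exact: size_polyf. Qed.

Let sg_inj z z' : z != (0, 0) -> z' != (0, 0) ->
  lam (sg z) (sg z').1 (sg z').2 = 0 -> lam z z'.1 z'.2 = 0.
Proof.
move=> z0 z0' /(lam_prop (sg0 z0) (sg0 z0'))[a a0 E].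
have h : rnc_vec d z'.1 z'.2 = (k z' * a ^+ d / k z) *: rnc_vec d z.1 z.2.
  apply: Ginj; have := Glin (k z' * a ^+ d / k z) (rnc_vec d z.1 z.2) 0.
  have -> : G 0 = 0.
    by have := Glin (-1) 0 0; rewrite scaler0 addr0 => {1}->; rewrite scaleN1r addNr.
  rewrite !addr0 => ->; rewrite !Gsg // E /= rnc_scale !scalerA; congr (_ *: _).
  by have kz := k0 z0; field.
exact: rnc_prop z0 z0' h.
Qed.

(** Pulling back a form with a double zero at [sg z] and simple zeros at the images
    of [J]. The forms that vanish at [sg x] and on the image of [J] are a pencil,
    and the pull-back of a member is known up to a scalar from its zeros. Three
    members, compared at [x = z] and at [x = r], determine the ratios of these
    scalars; they are the same at both points, so that the member of the first
    pencil with a double zero at [sg z] pulls back to a form with a double zero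
    at [z]. *)
Lemma transport_split (J : seq (K * K)) z r y1 y2 y3 a b :
  (size J).+2 = d -> uniq (z :: r :: y1 :: y2 :: y3 :: J) ->
  (forall y, y \in z :: r :: y1 :: y2 :: y3 :: J -> y != (0, 0)) ->
  (forall y y', y \in z :: r :: y1 :: y2 :: y3 :: J ->
     y' \in z :: r :: y1 :: y2 :: y3 :: J -> y != y' -> lam y y'.1 y'.2 != 0) ->
  gpoly (lamp (sg z) * (lamp (sg z) * \prod_(j <- J) lamp (sg j)))
     (G (drnc d z.1 z.2 a b)) = 0.
Proof.
move=> szJ un nz ind.
set P := z :: _ in un nz ind *.
have lampD (e f : K) (u v : K * K) :
    lamp (e * u.1 + f * v.1, e * u.2 + f * v.2) = e *: lamp u + f *: lamp v.
  by rewrite /lamp /= polyCD !polyCM !scalerBr scalerDl !scalerA -!mul_polyC -!polyCM; ring.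
pose B (x : K * K) := lamp x * \prod_(j <- J) lamp j.
pose Pol (x w : K * K) := lamp w * (lamp (sg x) * \prod_(j <- J) lamp (sg j)).
have JP y : y \in J -> y \in P by move=> yJ; rewrite /P !inE yJ !orbT.
have szB x : (size (B x) <= d)%N.
  by rewrite -szJ; apply: size_lampM; apply: (size_prod_lamp id).
have szPol0 x : (size (lamp (sg x) * \prod_(j <- J) lamp (sg j))%R <= d)%N.
  by rewrite -szJ; apply: size_lampM; apply: (size_prod_lamp sg).
have ev1 (u : K * K) (v : {poly K}) : (size v <= d)%N -> forall y : K * K, hev d (lamp u * v) y.1 y.2
    = lam u y.1 y.2 * hev d.-1 v y.1 y.2.
  move=> szv y; have E : d = d.-1.+1 by lia.
  by rewrite [in LHS]E hev_lam // -E.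
have evB (x y : K * K) : hev d.-1 (B x) y.1 y.2 = lam x y.1 y.2 * \prod_(j <- J) lam j y.1 y.2.
  rewrite -szJ /= /B hev_lam ?(size_prod_lamp id) //; congr (_ * _).
  have := @hev_prod K _ id J 0 1 y.1 y.2; rewrite size_poly1 addn0 mulr1 => -> //.
  by rewrite (hev0 1) mulr1.
have evPol (x y : K * K) : hev d.-1 (lamp (sg x) * \prod_(j <- J) lamp (sg j)) y.1 y.2
    = lam (sg x) y.1 y.2 * \prod_(j <- J) lam (sg j) y.1 y.2.
  rewrite -szJ /= hev_lam ?(size_prod_lamp sg) //; congr (_ * _).
  have := @hev_prod K _ sg J 0 1 y.1 y.2; rewrite size_poly1 addn0 mulr1 => -> //.
  by rewrite (hev0 1) mulr1.
have [[yz yr] [yy1 yy2] yy3] : [/\ z \in P /\ r \in P, y1 \in P /\ y2 \in P & y3 \in P].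
  by rewrite /P !inE !eqxx !orbT.
have sgne y y' : y \in P -> y' \in P -> y != y' -> lam (sg y) (sg y').1 (sg y').2 != 0.
  move=> yP y'P ne; apply: contra (ind y y' yP y'P ne) => /eqP /sg_inj ->//; exact: nz.
(* pulling back the pencil of forms vanishing at the images of [x] and [J] *)
have pen x y0 y' : x \in P -> y0 \in P -> y' \in P -> uniq (x :: y0 :: y' :: J) ->
    exists2 c : K, c != 0 & pull (Pol x (sg y0)) = (c *: lamp y0) * B x.
  move=> xP y0P y'P; rewrite /= !inE !negb_or => /and4P[/and3P[xy0 xy' xJ] /andP[y0y' y0J] y'J uJ].
  have vP y : y \in P -> hev d (pull (Pol x (sg y0))) y.1 y.2 =
      k y * (lam (sg y0) (sg y).1 (sg y).2 * (lam (sg x) (sg y).1 (sg y).2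
         * \prod_(j <- J) lam (sg j) (sg y).1 (sg y).2)).
    by move=> yP; rewrite pull_hev ?nz // ev1 // evPol.
  have zz : zpts id (y0 :: x :: J).
    split=> [y|y t|y].
    - by rewrite !inE => /or3P[/eqP ->|/eqP ->|/JP]; apply: nz.
    - move=> yy tt; apply: ind.
        by move: yy; rewrite !inE => /or3P[/eqP ->|/eqP ->|/JP].
      by move: tt; rewrite !inE => /or3P[/eqP ->|/eqP ->|/JP].
    - rewrite count_uniq_mem; first by case: (_ \in _).
      by rewrite /= !inE negb_or eq_sym xy0 y0J xJ.
  have ze : zero_at d (pull (Pol x (sg y0))) id (y0 :: x :: J).
    move=> y yy; split; last first.
      rewrite count_uniq_mem; first by case: (_ \in _).
      by rewrite /= !inE negb_or eq_sym xy0 y0J xJ.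
    have yP : y \in P by move: yy; rewrite !inE => /or3P[/eqP ->|/eqP ->|/JP].
    rewrite vP //; move: yy; rewrite !inE => /or3P[/eqP ->|/eqP ->|yJ].
    + by rewrite lam_self mul0r mulr0.
    + by rewrite lam_self mul0r !mulr0.
    + by rewrite (big_rem y) //= lam_self mul0r !mulr0.
  have [|q szq qE] := form_factor zz _ (pull_size _) ze; first by rewrite -szJ.
  have qC : q = (q`_0)%:P by apply: size1_polyC; move: szq; rewrite /= szJ subnn.
  exists q`_0; last first.
    rewrite qE !big_cons [in LHS]qC -mul_polyC /B; ring.
  apply/negP => /eqP q0; have := vP y' y'P; rewrite qE qC q0 mulr0 /hev big1; last first.
    by move=> i _; rewrite coef0 mul0r.
  move/esym/eqP; rewrite !mulf_eq0 (negbTE (k0 _)) ?nz //=.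
  rewrite (negbTE (sgne _ _ y0P y'P y0y')) (negbTE (sgne _ _ xP y'P xy')) /=.
  apply/negP; rewrite prodf_seq_neq0; apply/allP => j jJ; apply/implyP => _; apply: sgne => //; first exact: JP.
  by apply: contra y'J => /eqP <-.
have B0 x : x \in P -> B x != 0.
  move=> xP; rewrite mulf_neq0 ?lamp_neq0 ?nz //.
  by rewrite prodf_seq_neq0; apply/allP => j jJ; apply/implyP => _; rewrite lamp_neq0 // nz // JP.
have PolD x (e f : K) (u v : K * K) : Pol x (e * u.1 + f * v.1, e * u.2 + f * v.2)
    = e *: Pol x u + f *: Pol x v.
  by rewrite /Pol lampD mulrDl !scalerAl.
have pullL x (e f : K) (u v : K * K) : pull (Pol x (e * u.1 + f * v.1, e * u.2 + f * v.2))
    = e *: pull (Pol x u) + f *: pull (Pol x v).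
  rewrite PolD pullD; congr (_ + _); have := pullD f (Pol x v) 0; rewrite addr0 => ->.
  suff -> : pull 0 = 0 by rewrite addr0.
  by have := pullD (-1) 0 0; rewrite scaler0 addr0 => {1}->; rewrite scaleN1r addNr.
move: (un); rewrite /P /= !inE !negb_or => /and5P[Hz Hr H1 /andP[y23 y2J] /andP[y3J uJ]].
move: Hz Hr H1 => /and5P[zr zy1 zy2 zy3 zJ] /and4P[ry1 ry2 ry3 rJ] /and3P[y12 y13 y1J].
have [al [be [szE [_ _]]]] := @lam_comb K (sg y1) (sg y2) (sg z) (sgne _ _ yy1 yy2 y12).
have [ga [de [sy3E [gaE deE]]]] := @lam_comb K (sg y1) (sg y2) (sg y3) (sgne _ _ yy1 yy2 y12).
have ga0 : ga != 0.
  apply/eqP => g0; have := sgne _ _ yy2 yy3 y23.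
  by rewrite -oppr_eq0 -gaE g0 mulr0 eqxx.
have de0 : de != 0.
  by apply/eqP => g0; have := sgne _ _ yy1 yy3 y13; rewrite -deE g0 mulr0 eqxx.
have key x c1 c2 c3 : x \in P ->
    pull (Pol x (sg y1)) = (c1 *: lamp y1) * B x ->
    pull (Pol x (sg y2)) = (c2 *: lamp y2) * B x ->
    pull (Pol x (sg y3)) = (c3 *: lamp y3) * B x ->
    c3 * lam y3 y1.1 y1.2 = de * c2 * lam y2 y1.1 y1.2 /\
    c3 * lam y3 y2.1 y2.2 = ga * c1 * lam y1 y2.1 y2.2.
  move=> xP E1 E2; rewrite sy3E pullL E1 E2 !scalerAl -mulrDl => /(mulIf (B0 x xP)) E.
  by split; rewrite -!hev_lamp1 -hevZ -E hevD !hevZ !hev_lamp1 lam_self; ring.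
have un3 x y0 y' : uniq (x :: y0 :: y' :: J) = [&& x != y0, x != y', y0 != y', x \notin J,
    y0 \notin J & y' \notin J].
  rewrite /= uJ !inE !negb_or andbT.
  by case: (x == y0); case: (x == y'); case: (y0 == y'); case: (x \in J); case: (y0 \in J);
    case: (y' \in J).
have pz y0 y' : y0 \in P -> y' \in P -> [&& z != y0, z != y', y0 != y', z \notin J,
    y0 \notin J & y' \notin J] -> exists2 c : K, c != 0 & pull (Pol z (sg y0)) = (c *: lamp y0) * B z.
  by rewrite -un3 => P1 P2 U; apply: pen P2 U.
have pr y0 y' : y0 \in P -> y' \in P -> [&& r != y0, r != y', y0 != y', r \notin J,
    y0 \notin J & y' \notin J] -> exists2 c : K, c != 0 & pull (Pol r (sg y0)) = (c *: lamp y0) * B r.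
  by rewrite -un3 => P1 P2 U; apply: pen P2 U.
have [c1 c10 E1] := pz y1 y2 yy1 yy2 ltac:(by apply/and5P; split=> //; apply/andP).
have [c2 c20 E2] := pz y2 y3 yy2 yy3 ltac:(by apply/and5P; split=> //; apply/andP).
have [c3 c30 E3] := pz y3 y2 yy3 yy2 ltac:(by rewrite [y3 == _]eq_sym; apply/and5P; split=> //; apply/andP).
have [e1 e10 F1] := pr y1 y2 yy1 yy2 ltac:(by apply/and5P; split=> //; apply/andP).
have [e2 e20 F2] := pr y2 y3 yy2 yy3 ltac:(by apply/and5P; split=> //; apply/andP).
have [e3 e30 F3] := pr y3 y2 yy3 yy2 ltac:(by rewrite [y3 == _]eq_sym; apply/and5P; split=> //; apply/andP).
have [f f0 Fz] := pr z y2 yz yy2 ltac:(by rewrite [r == _]eq_sym; apply/and5P; split=> //; apply/andP).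
have [K1 K2] := key z _ _ _ yz E1 E2 E3; have [L1 L2] := key r _ _ _ yr F1 F2 F3.
have l12 := ind _ _ yy1 yy2 y12; have l21 : lam y2 y1.1 y1.2 != 0 by rewrite lamC oppr_eq0.
have M1 : e3 * c1 = c3 * e1.
  have : ga * lam y1 y2.1 y2.2 * (e3 * c1) = ga * lam y1 y2.1 y2.2 * (c3 * e1).
    by transitivity (e3 * (ga * c1 * lam y1 y2.1 y2.2)); [ring | rewrite -K2;
      transitivity (c3 * (e3 * lam y3 y2.1 y2.2)); [ring | rewrite L2; ring]].
  by apply: mulfI; rewrite mulf_neq0.
have M2 : e3 * c2 = c3 * e2.
  have : de * lam y2 y1.1 y1.2 * (e3 * c2) = de * lam y2 y1.1 y1.2 * (c3 * e2).
    by transitivity (e3 * (de * c2 * lam y2 y1.1 y1.2)); [ring | rewrite -K1;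
      transitivity (c3 * (e3 * lam y3 y1.1 y1.2)); [ring | rewrite L1; ring]].
  by apply: mulfI; rewrite mulf_neq0.
have Z : al * e1 * lam y1 z.1 z.2 + be * e2 * lam y2 z.1 z.2 = 0.
  move: Fz; rewrite szE pullL F1 F2 !scalerAl -mulrDl => /(mulIf (B0 r yr)) E.
  by rewrite -!hev_lamp1 -!hevZ -hevD -!scalerA E hevZ hev_lamp1 lam_self mulr0.
pose li : {poly K} := al *: (c1 *: lamp y1) + be *: (c2 *: lamp y2).
have li0 : hev 1 li z.1 z.2 = 0.
  apply: (mulfI e30); rewrite mulr0 /li hevD !hevZ !hev_lamp1.
  transitivity (c3 * (al * e1 * lam y1 z.1 z.2 + be * e2 * lam y2 z.1 z.2)); last by rewrite Z mulr0.
  transitivity (al * (e3 * c1) * lam y1 z.1 z.2 + be * (e3 * c2) * lam y2 z.1 z.2); first ring.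
  by rewrite M1 M2; ring.
have szli : (size li <= 2)%N.
  apply: leq_trans (size_polyD _ _) _; rewrite geq_max.
  by apply/andP; split; do 2! apply: leq_trans (size_scale_leq _ _) _; apply: size_lamp.
have [q szq liE] := hev_factor szli (nz z yz) li0.
change (gpoly (Pol z (sg z)) (G (drnc d z.1 z.2 a b)) = 0).
have -> : gpoly (Pol z (sg z)) (G (drnc d z.1 z.2 a b)) = dhev d (pull (Pol z (sg z))) z.1 z.2 a b.
  by rewrite (polyf_drnc _ _ _ _ (pull_fun _)).
have -> : pull (Pol z (sg z)) = lamp z * (lamp z * (q * \prod_(j <- J) lamp j)).
  by rewrite szE pullL E1 E2 !scalerAl -mulrDl -/li liE /B; ring.
have dd : d = d.-2.+2 by rewrite -szJ.
have szqJ : (size (q * \prod_(j <- J) lamp j)%R <= d.-2.+1)%N.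
  by rewrite (size1_polyC szq) mul_polyC (leq_trans (size_scale_leq _ _)) // -szJ (size_prod_lamp id).
have szqJ' := @size_lampM K z _ _ szqJ.
by rewrite dd dhev_lam // hev_lam // !lam_self !mul0r mulr0 addr0.
Qed.

(** For [d = 2] the form is a square: a second zero of the pull-back would be
    another point with image [sg z]. *)
Lemma transport_conic z a b q : d = 2 -> z != (0, 0) -> (size q <= 1)%N ->
  gpoly (lamp (sg z) * (lamp (sg z) * q)) (G (drnc d z.1 z.2 a b)) = 0.
Proof.
move=> d2 z0 szq; set p := lamp _ * _.
have ev y : hev d p y.1 y.2 = lam (sg z) y.1 y.2 ^+ 2 * q`_0.
  rewrite /p d2 hev_lam ?size_lampM // hev_lam // mulrA -expr2; congr (_ * _).
  by rewrite /hev big_ord1 !expr0 !mulr1.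
have pz : hev d (pull p) z.1 z.2 = 0.
  by rewrite pull_hev // ev lam_self expr0n mul0r mulr0.
have -> : gpoly p (G (drnc d z.1 z.2 a b)) = dhev d (pull p) z.1 z.2 a b.
  by rewrite (polyf_drnc _ _ _ _ (pull_fun _)).
case: (eqVneq q`_0 0) => [q0|q0].
  suff -> : pull p = 0 by rewrite -gpoly_drnc gpoly0.
  have -> : p = 0 by rewrite /p (size1_polyC szq) q0 polyC0 !mulr0.
  by have := pullD (-1) 0 0; rewrite scaler0 addr0 => {1}->; rewrite scaleN1r addNr.
have [r szr prE] : exists2 r : {poly K}, (size r <= 2)%N & pull p = lamp z * r.
  have szp : (size (pull p) <= 3)%N by rewrite (leq_trans (pull_size p)) // d2.
  have hp : hev 2 (pull p) z.1 z.2 = 0 by move: pz; rewrite [in hev _]d2.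
  by have [r szr E] := hev_factor szp z0 hp; exists r.
have r0 : hev 1 r z.1 z.2 = 0.
  case: (eqVneq (r`_1, - r`_0) (0, 0)) => [[r1 /eqP]|w0].
    by rewrite oppr_eq0 hev1 r1 => /eqP ->; rewrite !mul0r addr0.
  have : hev d (pull p) r`_1 (- r`_0) = 0.
    by rewrite prE d2 hev_lam // hev1; ring.
  rewrite (pull_hev _ w0) ev => /eqP; rewrite !mulf_eq0 (negbTE (k0 w0)) (negbTE q0) orbF /= orbb.
  move=> /eqP /(sg_inj z0 w0) /(lam_prop z0 w0) [e e0 [E1 /eqP E0]].
  apply: (mulfI e0); rewrite mulr0 hev1.
  by move/eqP: E0; rewrite E1 => /eqP; rewrite eqr_oppLR => /eqP ->; ring.
have [r' szr' rE] := hev_factor szr z0 r0.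
rewrite prE rE d2 dhev_lam ?size_lampM // hev_lam // !lam_self; ring.
Qed.

(** The scalars in [S] as points, with the point at infinity in place of [z]. *)
Lemma base_points (S : seq K) z : uniq S -> z != (0, 0) ->
  exists ps : seq (K * K), [/\ size ps = size S, uniq ps,
    forall y, y \in ps -> y != (0, 0) /\ lam z y.1 y.2 != 0
    & forall y y', y \in ps -> y' \in ps -> y != y' -> lam y y'.1 y'.2 != 0].
Proof.
move=> uS z0; case: z z0 => s t z0.
have E (x : K) : (1, x) != (0, 0) :> K * K by apply/eqP => -[/eqP]; rewrite oner_eq0.
case: (eqVneq s 0) => [s0|s0].
  exists [seq (1, x) | x <- S]; split; rewrite ?size_map //.
  - by rewrite map_inj_uniq // => x y [].
  - move=> _ /mapP[x xS ->]; split; first exact: E.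
    by rewrite /lam /= s0 mul0r sub0r mulr1 oppr_eq0 (pair_neq0 z0).
  - move=> _ _ /mapP[x xS ->] /mapP[y yS ->] ne; rewrite /lam /= mul1r mulr1 subr_eq0.
    by apply: contra ne => /eqP ->.
pose S' := [seq x <- S | x != t / s].
have szS : (size S <= (size S').+1)%N.
  rewrite size_filter -(count_predC (pred1 (t / s)) S) -[X in (_ <= X)%N]add1n leq_add2r.
  by rewrite count_uniq_mem //; case: (_ \in _).
exists (take (size S) ((0, 1) :: [seq (1, x) | x <- S'])).
have sub y : y \in take (size S) ((0, 1) :: [seq (1, x) | x <- S']) ->
    y = (0, 1) \/ exists2 x, x \in S' & y = (1, x).
  by move/mem_take; rewrite inE => /orP[/eqP|/mapP]; [left|right].
split.
- by rewrite size_takel // /= size_map.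
- rewrite take_uniq //= map_inj_uniq ?filter_uniq // => [|x y [] //].
  by rewrite andbT; apply/mapP => -[x _ [/eqP]]; rewrite eq_sym oner_eq0.
- move=> y /sub[->|[x]].
    rewrite /lam /= mulr1 mulr0 subr0 s0; split=> //.
    by apply/eqP => -[/eqP]; rewrite oner_eq0.
  rewrite mem_filter => /andP[xs _] ->; split=> //; rewrite /lam /= mulr1 subr_eq0.
  by apply: contra xs => /eqP <-; rewrite mulrC mulKf.
- move=> y y' /sub[->|[x xS ->]] /sub[->|[x' xS' ->]]; rewrite /lam /= ?eqxx // => ne.
  + by rewrite mul0r mulr1 sub0r oppr_eq0 oner_eq0.
  + by rewrite mulr0 mulr1 subr0 oner_eq0.
  + by rewrite mul1r mulr1 subr_eq0; apply: contra ne => /eqP ->.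
Qed.

(** A linear map that carries the curve to itself carries tangents to tangents.
    The tangent at [sg z] is cut out by the forms with a double zero there, so it
    is enough that they pull back to forms with a double zero at [z]. For [d > 2]
    such a form is a combination of completely split ones, by interpolation. *)
Lemma tangent_transport (S : seq K) z a b : uniq S -> (d ^ 3 <= size S ^ 2)%N ->
  z != (0, 0) -> @rnc_tangent d K (sg z).1 (sg z).2 (G (drnc d z.1 z.2 a b)).
Proof.
move=> uS hS z0; set w := G _; apply: contrapT => nw.
have [g [lg gT gw]] := functional_sep (rv_dimle K d) (@lspan_subspace _ _ _) nw.
have [||q szq pE] := @form_factor K unit (fun=> sg z) [:: tt; tt] d (polyf g) _ hd (size_polyf g).
- by split=> [y _|[] []|[]] //; apply: sg0.
- move=> y _; rewrite polyf_rnc // gT; last first.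
    by apply/rnc_tangentP; exists 1, 0, 0; rewrite /drnc !scale0r scale1r !addr0.
  split=> // _ e f; rewrite polyf_drnc // gT //.
  by apply/rnc_tangentP; exists 0, e, f; rewrite scale0r add0r.
move: pE; rewrite !big_cons big_nil mulr1 -mulrA => pE.
have : gpoly (polyf g) w = 1 by rewrite gpolyK.
rewrite pE /= in szq *; case: (ltnP d 3) => d3.
  rewrite transport_conic // => [/eqP||].
  + by rewrite eq_sym oner_eq0.
  + by lia.
  + by move: szq; have -> : d = 2 by lia.
have szS : (d.+2 <= size S)%N.
  rewrite leqNgt; apply/negP => lt; have : (size S ^ 2 <= d.+1 ^ 2)%N by rewrite leq_exp2r.
  by move: hS; rewrite !expnS !expn0; nia.
have [ps [szps ups ps0 psl]] := base_points uS z0.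
case: ps => [|y1 [|y2 [|y3 ps]]] // in szps ups ps0 psl *; try by (move: szps => /= szps; lia).
pose J0 := take d.-1 ps; have uJ0 : uniq J0.
  by move: ups => /= /and4P[_ _ _ ?]; rewrite take_uniq.
have szJ0 : size J0 = d.-1 by rewrite size_takel //; move: szps => /= szps; lia.
have J0P y : y \in J0 -> y \in [:: y1, y2, y3 & ps].
  by move/mem_take => yp; rewrite !inE yp !orbT.
have zJ : zpts sg J0.
  split=> [y /J0P /ps0[y0 _]|y y' /J0P yp /J0P yp' ne|y]; first exact: sg0.
    apply: contra (psl _ _ yp yp' ne) => /eqP /sg_inj ->//; [by case: (ps0 y yp)|by case: (ps0 y' yp')].
  by rewrite count_uniq_mem //; case: (_ \in _).
pose L (j : K * K) := \prod_(i <- rem j J0) lamp (sg i).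
have szL j : j \in J0 -> (size (L j) <= d.-2.+1)%N.
  move=> jJ; apply: leq_trans (size_prod_lamp _ _) _; rewrite size_rem // szJ0; lia.
have evL j (y : K * K) : j \in J0 -> hev d.-2 (L j) y.1 y.2 = \prod_(i <- rem j J0) lam (sg i) y.1 y.2.
  move=> jJ; have := @hev_prod K _ sg (rem j J0) 0 1 y.1 y.2.
  rewrite size_poly1 addn0 mulr1 size_rem // szJ0 => -> //.
  by rewrite (hev0 1) mulr1.
pose c (j : K * K) := hev d.-2 q (sg j).1 (sg j).2 / \prod_(i <- rem j J0) lam (sg i) (sg j).1 (sg j).2.
have hevs (r : seq (K * K)) (F : K * K -> {poly K}) s t :
    hev d.-2 (\sum_(j <- r) F j) s t = \sum_(j <- r) hev d.-2 (F j) s t.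
  elim: r => [|x r IH]; last by rewrite !big_cons hevD IH.
  by rewrite !big_nil /hev big1 // => i _; rewrite coef0 mul0r.
(* Lagrange interpolation at the images of [J0] *)
have qE : q = \sum_(j <- J0) c j *: L j.
  apply/eqP; rewrite -subr_eq0; apply/eqP; apply: (form_zero (k := d.-2) zJ).
  - by rewrite szJ0; lia.
  - apply: leq_trans (size_polyD _ _) _; rewrite geq_max size_polyN; apply/andP; split.
      by apply: leq_trans szq _; lia.
    rewrite big_seq; elim/big_ind: _ => [|x y hx hy|j jJ]; first by rewrite size_poly0.
      by apply: leq_trans (size_polyD _ _) _; rewrite geq_max hx.
    by apply: leq_trans (size_scale_leq _ _) (szL j jJ).
  - move=> y yJ; split; last by rewrite count_uniq_mem //; case: (_ \in _).
    rewrite -scaleN1r addrC hevD hevZ hevs (big_rem y) //= big_seq big1 ?addr0; last first.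
      move=> j jr; have jJ := mem_rem jr; rewrite hevZ evL // (big_rem y) /=.
        by rewrite lam_self mul0r mulr0.
      by rewrite mem_rem_uniq // inE yJ andbT; move: jr; rewrite mem_rem_uniq // inE eq_sym => /andP[].
    rewrite hevZ evL // /c divfK ?mulN1r ?addNr // prodf_seq_neq0; apply/allP => i ir.
    apply/implyP => _; case: zJ => _ + _; apply=> //; first exact: mem_rem ir.
    by move: ir; rewrite mem_rem_uniq // inE => /andP[].
have -> : lamp (sg z) * (lamp (sg z) * q) = \sum_(j <- J0) c j *: (lamp (sg z) * (lamp (sg z) * L j)).
  by rewrite qE !mulr_sumr; apply: eq_bigr => j _; rewrite -!scalerAr.
suff -> : gpoly (\sum_(j <- J0) c j *: (lamp (sg z) * (lamp (sg z) * L j))) w = 0.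
  by move/eqP; rewrite eq_sym oner_eq0.
rewrite big_seq; elim/big_ind: _ => [|x y hx hy|j jJ]; first exact: gpoly0.
  by rewrite -[x]scale1r gpolyD hx hy mulr0 addr0.
rewrite -[_ *: _]addr0 gpolyD gpoly0 addr0.
have zP y : y \in z :: j :: y1 :: y2 :: y3 :: rem j J0 -> y = z \/ y \in [:: y1, y2, y3 & ps].
  rewrite in_cons => /orP[/eqP|yy]; [by left | right].
  move: yy; rewrite 4!in_cons => /or4P[/eqP ->|/eqP ->|/eqP ->|/orP[/eqP ->|/mem_rem /J0P //]].
  - exact: J0P.
  - by rewrite !inE eqxx.
  - by rewrite !inE eqxx orbT.
  - by rewrite !inE eqxx !orbT.
rewrite (@transport_split _ z j y1 y2 y3) ?mulr0 //.
- by rewrite size_rem // szJ0; lia.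
- have zn y : y \in [:: y1, y2, y3 & ps] -> z != y.
    by move=> yp; apply/eqP => zy; have [_] := ps0 y yp; rewrite zy lam_self eqxx.
  have J0n y : y \in J0 -> y \in ps by apply: mem_take.
  rewrite cons_uniq; apply/andP; split.
    apply/negP => zin; have : z \in [:: y1, y2, y3 & ps].
      move: zin; rewrite 4!in_cons => /or4P[/eqP ->|/eqP ->|/eqP ->|/orP[/eqP ->|/mem_rem /J0P //]];
      [exact: J0P | by rewrite !inE eqxx | by rewrite !inE eqxx orbT | by rewrite !inE eqxx !orbT].
    by move/zn; rewrite eqxx.
  move: ups; rewrite /= !inE !negb_or => /and4P[/and3P[h12 h13 h1p] /andP[h23 h2p] h3p _].
  have nr y : y \notin ps -> y \notin rem j J0 by apply: contra => /mem_rem /J0n.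
  have jy y : y \notin ps -> j != y by apply: contra => /eqP <-; apply: J0n.
  have jj : j \notin rem j J0 by rewrite mem_rem_uniq // inE eqxx.
  by rewrite h12 h13 h23 (nr _ h1p) (nr _ h2p) (nr _ h3p) rem_uniq // (jy _ h1p) (jy _ h2p) (jy _ h3p) jj.
- by move=> y /zP[->|/ps0[]].
- move=> y y' /zP[->|yp] /zP[->|yp'] ne; rewrite ?eqxx // in ne *.
  + by case: (ps0 _ yp').
  + by rewrite lamC oppr_eq0; case: (ps0 _ yp).
  + exact: psl.
Qed.

End Transport.

(** * Veronesean caps in coordinates *)

(** A Veronesean cap in coordinates: points carry a vector, lines (the rational
    spaces) a linear parametrization by the ambient space of the standard curve,
    and the tangent space at [p] is spanned by [vr p] and the image of [tv p]. *)
Record cap (K : fieldType) (V : lmodType K) (d n : nat) := Cap {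
  pt : eqType;
  ln : eqType;
  vr : pt -> V;
  par : ln -> 'rV[K]_d.+1 -> V;
  crd : ln -> pt -> K * K;
  tv : pt -> 'rV[K]_n -> V;
  join : pt -> pt -> ln;
  onl := fun (l : ln) (p : pt) => `[< exists v, par l v = vr p >];
  tgl := fun (l : ln) (p : pt) (v : V) =>
    exists2 w, @rnc_tangent d K (crd l p).1 (crd l p).2 w & v = par l w;
  vr_neq0 : forall p, vr p != 0;
  vr_inj : forall a p q, vr p = a *: vr q -> p = q;
  vr_span : forall U : set V, is_subspace U -> (forall p, U (vr p)) -> forall v, U v;
  par_lin : forall l a u v, par l (a *: u + v) = a *: par l u + par l v;
  par_inj : forall l, injective (par l);
  par_pt : forall l (z : K * K), z != (0, 0) ->
    exists p (c : K), c != 0 /\ par l (rnc_vec d z.1 z.2) = c *: vr p;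
  crdP : forall l p, onl l p -> crd l p != (0, 0) /\
    exists2 c : K, c != 0 & par l (rnc_vec d (crd l p).1 (crd l p).2) = c *: vr p;
  joinP : forall p q, p != q -> onl (join p q) p /\ onl (join p q) q;
  join_uniq : forall p q l, p != q -> onl l p -> onl l q -> l = join p q;
  lines_meet : forall l l' v v', l != l' -> par l v = par l' v' -> v != 0 ->
    exists p (c : K), c != 0 /\ par l v = c *: vr p;
  tv_lin : forall p a u v, tv p (a *: u + v) = a *: tv p u + tv p v;
  tv_indep : forall p c u, c *: vr p + tv p u = 0 -> u = 0;
  tgl_tv : forall l p v, onl l p -> tgl l p v -> exists c u, v = c *: vr p + tv p u;
  tv_tgl : forall p u, exists2 l, onl l p & tgl l p (tv p u);
  plane_axiom : forall p l, ~~ onl l p -> exists2 B : 'M[K]_(2, n), row_free B &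
    forall u, (u <= B)%MS <-> exists2 q, onl l q & tgl (join p q) p (tv p u) }.

Section Geometry.
Variables (K : fieldType) (V : lmodType K) (d n : nat) (C : cap V d n).
Hypothesis hd : (2 <= d)%N.
Notation pt := (@pt _ _ _ _ C).
Notation ln := (@ln _ _ _ _ C).
Notation on := (@onl _ _ _ _ C).
Notation vr := (@vr _ _ _ _ C).
Notation par := (@par _ _ _ _ C).
Notation crd := (@crd _ _ _ _ C).
Notation tg := (@tgl _ _ _ _ C).
Notation tv := (@tv _ _ _ _ C).
Notation join := (@join _ _ _ _ C).
Implicit Types (p q : pt) (l m : ln) (U : set V).

Lemma par0 l : par l 0 = 0.
Proof. by have := par_lin l (-1) 0 0; rewrite scaler0 addr0 => {1}->; rewrite scaleN1r addNr. Qed.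
Lemma parZ l a v : par l (a *: v) = a *: par l v.
Proof. by have := par_lin l a v 0; rewrite par0 !addr0. Qed.
Lemma parD l u v : par l (u + v) = par l u + par l v.
Proof. by have := par_lin l 1 u v; rewrite !scale1r. Qed.
Lemma tv0 p : tv p 0 = 0.
Proof. by have := tv_lin p (-1) 0 0; rewrite scaler0 addr0 => {1}->; rewrite scaleN1r addNr. Qed.
Lemma tvZ p a v : tv p (a *: v) = a *: tv p v.
Proof. by have := tv_lin p a v 0; rewrite tv0 !addr0. Qed.

Lemma onP l p : reflect (exists v, par l v = vr p) (on l p).
Proof. exact: asboolP. Qed.

Lemma crd0 l p : on l p -> crd l p != (0, 0).
Proof. by case/crdP. Qed.

Lemma rnc_on l z c p : c != 0 -> par l (rnc_vec d z.1 z.2) = c *: vr p -> on l p.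
Proof.
move=> c0 E; apply/onP; exists (c^-1 *: rnc_vec d z.1 z.2).
by rewrite parZ E scalerA mulVf // scale1r.
Qed.

Lemma crd_uniq l p z c : z != (0, 0) -> c != 0 -> par l (rnc_vec d z.1 z.2) = c *: vr p ->
  lam (crd l p) z.1 z.2 = 0.
Proof.
move=> z0 c0 E; have [cp0 [e e0 E']] := crdP (rnc_on c0 E).
apply: (@rnc_prop _ _ hd _ _ (c / e)) => //; apply: (@par_inj _ _ _ _ _ l).
by rewrite parZ E E' scalerA divfK.
Qed.

Lemma crd_neq l p q : on l p -> on l q -> p != q -> lam (crd l p) (crd l q).1 (crd l q).2 != 0.
Proof.
move=> lp lq; apply: contra => /eqP h.
have [p0 [c c0 Ep]] := crdP lp; have [q0 [e e0 Eq]] := crdP lq.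
have [a a0 E] := lam_prop p0 q0 h; apply/eqP/esym.
apply: (@vr_inj _ _ _ _ _ (e^-1 * (a ^+ d * c))).
have : e *: vr q = (a ^+ d * c) *: vr p by rewrite -Eq E /= rnc_scale parZ Ep scalerA.
by move/(congr1 (fun v => e^-1 *: v)); rewrite !scalerA mulVf // scale1r.
Qed.

Lemma two_points l p q m : p != q -> on l p -> on l q -> on m p -> on m q -> l = m.
Proof. by move=> pq lp lq mp mq; rewrite (join_uniq pq lp lq) (join_uniq pq mp mq). Qed.

Lemma one_point l m p q : l != m -> on l p -> on l q -> on m p -> on m q -> p = q.
Proof.
move=> lm lp lq mp mq; apply/eqP; apply: contraNT lm => pq; apply/eqP.
exact: (two_points pq).
Qed.

Lemma joinC p q : p != q -> join p q = join q p.
Proof. by move=> pq; have [] := joinP pq => jp jq; rewrite (join_uniq _ jq jp) // eq_sym. Qed.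

Lemma join_on l p q : p != q -> on l p -> on l q -> join p q = l.
Proof. by move=> pq lp lq; rewrite (join_uniq pq lp lq). Qed.

(** The point of [l] with parameter [z]. *)
Lemma pt_exists l z : z != (0, 0) -> exists2 p, on l p &
  exists2 c : K, c != 0 & par l (rnc_vec d z.1 z.2) = c *: vr p.
Proof. by case/(par_pt l) => p [c [c0 E]]; exists p; [exact: rnc_on E | exists c]. Qed.

Lemma points_of_line l (S : seq K) : uniq S ->
  exists ps : seq pt, [/\ size ps = (size S).+1, uniq ps & forall p, p \in ps -> on l p].
Proof.
move=> uS; have E (x : K) : (1, x) != (0, 0) :> K * K by apply/eqP => -[/eqP]; rewrite oner_eq0.
have E' : (0, 1) != (0, 0) :> K * K by apply/eqP => -[/eqP]; rewrite oner_eq0.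
have [po lpo [c c0 Ec]] := pt_exists l E'.
have /choice[f fP] : forall x : K, exists p, on l p /\
    exists2 c : K, c != 0 & par l (rnc_vec d 1 x) = c *: vr p.
  by move=> x; have [p lp h] := pt_exists l (E x); exists p.
have fi (x y : K) : f x = f y -> x = y.
  move=> fxy; have [_ [a a0 Ea]] := fP x; have [_ [b b0 Eb]] := fP y.
  have := @rnc_prop K d hd (1, x) (1, y) (b / a) (E x) (E y).
  rewrite /= /lam /= mul1r mulr1 => h; apply/esym/eqP; rewrite -subr_eq0; apply/eqP/h.
  by apply: (@par_inj _ _ _ _ _ l); rewrite parZ Ea Eb fxy scalerA divfK.
have fo (x : K) : f x != po.
  apply/eqP => fx; have [_ [a a0 Ea]] := fP x.
  have := @rnc_prop K d hd (1, x) (0, 1) (c / a) (E x) E'.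
  rewrite /= /lam /= mulr1 mulr0 subr0 => h; have /eqP := oner_neq0 K; apply; apply: h.
  by apply: (@par_inj _ _ _ _ _ l); rewrite parZ Ea Ec fx scalerA divfK.
exists (po :: [seq f x | x <- S]); split; first by rewrite /= size_map.
  rewrite /= map_inj_uniq // uS andbT; apply/mapP => -[x _ e].
  by have := fo x; rewrite e eqxx.
by move=> p; rewrite inE => /orP[/eqP ->//|/mapP[x _ ->]]; case: (fP x).
Qed.

(** Tangent directions at [p], up to scalars. *)
Definition dir p l u : Prop := [/\ on l p, u != 0 & tg l p (tv p u)].

Lemma tg_subspace l p : is_subspace (tg l p).
Proof.
split=> [|a _ _ [v Tv ->] [w Tw ->]].
  by exists 0; rewrite ?par0 //; apply: sub0 (@lspan_subspace _ _ _).
by exists (a *: v + w); rewrite ?par_lin //; apply: subZD (@lspan_subspace _ _ _) _ _.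
Qed.

Lemma tg_par l p v : tg l p v -> exists w, v = par l w.
Proof. by case=> w _ ->; exists w. Qed.

Lemma tg_vr l p : on l p -> tg l p (vr p).
Proof.
move=> lp; have [z0 [c c0 E]] := crdP lp.
apply: (subZK (tg_subspace l p) c0); rewrite -E.
by eexists; last reflexivity; apply/rnc_tangentP; exists 1, 0, 0; rewrite /drnc !scale0r scale1r !addr0.
Qed.

(** The tangent is a line through [p]. *)
Lemma tg_basis l p : on l p -> exists2 D, tg l p D &
  [/\ forall v, tg l p v -> exists a b, v = a *: vr p + b *: D,
      forall a b, a *: vr p + b *: D = 0 -> a = 0 /\ b = 0
    & forall q (a c : K), on l q -> c != 0 -> c *: vr q = a *: vr p + D -> q = p].
Proof.
move=> lp; have [z0 [c c0 E]] := crdP lp; have [[e f] /= ef] := lam_dir z0.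
exists (par l (drnc d (crd l p).1 (crd l p).2 e f)).
  by eexists; last reflexivity; apply/rnc_tangentP; exists 0, e, f; rewrite scale0r add0r.
split=> [_ [w /(tangent_span z0 ef)[a [b ->]] ->]|a b|q a b lq b0].
- by exists (a * c), b; rewrite parD !parZ E scalerA.
- have -> : a *: vr p = par l ((a / c) *: rnc_vec d (crd l p).1 (crd l p).2).
    by rewrite parZ E scalerA divfK.
  rewrite -parZ -parD -(par0 l) => /(@par_inj _ _ _ _ _ l)/(tangent_indep hd z0 ef)[ac0 ->].
  by split=> //; move/eqP: ac0; rewrite mulf_eq0 invr_eq0 (negbTE c0) orbF => /eqP.
- have [q0 [g g0 Eq]] := crdP lq => F; apply/eqP; apply: contraT => qp.
  have := crd_neq lp lq; rewrite eq_sym => /(_ qp)/eqP[].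
  apply: (@tangent_meet _ _ hd _ _ e f (b / g) (a / c)) => //; first by rewrite mulf_neq0 ?invr_neq0.
  by apply: (@par_inj _ _ _ _ _ l); rewrite parD !parZ E Eq !scalerA !divfK.
Qed.

Lemma dir_exists l p : on l p -> exists u, dir p l u.
Proof.
move=> lp; have [D TD [_ ind _]] := tg_basis lp.
have [c [u E]] := tgl_tv lp TD; exists u; split=> //.
  apply/eqP => u0; have [] := ind c (-1); last by move=> _ /eqP; rewrite oppr_eq0 oner_eq0.
  by rewrite E u0 tv0 addr0 scaleN1r subrr.
have -> : tv p u = D - c *: vr p by rewrite E addrC addKr.
by apply: subB (tg_subspace l p) TD _; apply: subZ (tg_subspace l p) _; apply: tg_vr.
Qed.

Lemma dirZ p l u a : a != 0 -> dir p l u -> dir p l (a *: u).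
Proof.
move=> a0 [lp u0 Tu]; split; rewrite ?scaler_eq0 ?negb_or ?a0 //.
by rewrite tvZ; apply: subZ (tg_subspace l p) Tu.
Qed.

Lemma dir_decomp p l u D : on l p -> u != 0 -> (exists a b, tv p u = a *: vr p + b *: D) ->
  exists a b : K, b != 0 /\ tv p u = a *: vr p + b *: D.
Proof.
move=> lp u0 [a [b E]]; exists a, b; split=> //; apply: contra u0 => /eqP b0.
apply/eqP/(@tv_indep _ _ _ _ _ p (- a)); rewrite E b0 scale0r addr0.
by rewrite -scalerDl addNr scale0r.
Qed.

Lemma dir_uniq p l u u' : dir p l u -> dir p l u' -> exists2 a : K, a != 0 & u' = a *: u.
Proof.
move=> [lp u0 Tu] [_ u'0 Tu']; have [D TD [sp _ _]] := tg_basis lp.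
have [a [b [b0 E]]] := dir_decomp lp u0 (sp _ Tu).
have [a' [b' [b'0 E']]] := dir_decomp lp u'0 (sp _ Tu').
exists (b' / b); first by rewrite mulf_neq0 ?invr_neq0.
apply/eqP; rewrite -subr_eq0; apply/eqP.
apply: (@tv_indep _ _ _ _ _ p (b' / b * a - a')).
have -> : tv p (u' - b' / b *: u) = tv p u' - b' / b *: tv p u.
  by rewrite -scaleNr addrC tv_lin scaleNr addrC.
rewrite E E' scalerDr !scalerA divfK // scalerBl opprD [X in _ + X]addrACA subrr addr0.
by rewrite addrA subrK subrr.
Qed.

Lemma dir_line p l l' u : dir p l u -> dir p l' u -> l = l'.
Proof.
move=> [lp u0 Tu] [lp' _ Tu']; apply/eqP; apply: contraT => ll'.
have [D TD [sp ind tq]] := tg_basis lp.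
have [a [b [b0 E]]] := dir_decomp lp u0 (sp _ Tu).
have [w E1] := tg_par Tu; have [w' E1'] := tg_par Tu'.
have [v0 Ev0] := tg_par (tg_vr lp); have [v0' Ev0'] := tg_par (tg_vr lp').
(* a tangent vector that is not a point of the curve *)
have eE : par l (b^-1 *: w - (a / b) *: v0) = D.
  rewrite parD parZ -E1 E -scaleNr parZ -Ev0 scalerDr !scalerA mulVf // scale1r.
  by rewrite addrAC -scalerDl [b^-1 * a]mulrC subrr scale0r add0r.
have eE' : par l' (b^-1 *: w' - (a / b) *: v0') = D.
  rewrite parD parZ -E1' E -scaleNr parZ -Ev0' scalerDr !scalerA mulVf // scale1r.
  by rewrite addrAC -scalerDl [b^-1 * a]mulrC subrr scale0r add0r.
have nz : b^-1 *: w - (a / b) *: v0 != 0.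
  apply/eqP => z; have D0 : D = 0 by rewrite -eE z par0.
  by have [] := ind 0 1; rewrite ?D0 ?scaler0 ?scale0r ?addr0 // => _ /eqP; rewrite oner_eq0.
have [q [c [c0 Ec]]] := lines_meet ll' (etrans eE (esym eE')) nz.
have lq : on l q.
  apply/onP; exists (c^-1 *: (b^-1 *: w - (a / b) *: v0)).
  by rewrite parZ Ec scalerA mulVf // scale1r.
have qp : q = p by apply: (tq q 0 c) => //; rewrite scale0r add0r -Ec eE.
move: Ec; rewrite eE qp => Dq.
have [] := ind (- c) 1; first by rewrite Dq scale1r scaleNr addNr.
by move=> _ /eqP; rewrite oner_eq0.
Qed.

Lemma dir_onto p (u : 'rV[K]_n) : u != 0 -> exists l, dir p l u.
Proof. by move=> u0; have [l lp Tu] := tv_tgl p u; exists l. Qed.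

(** The lines joining [p] to the points of [l] are those whose direction lies
    in a plane pencil. *)
Lemma pencil p l : ~~ on l p -> exists2 B : 'M[K]_(2, n), row_free B &
  forall m u, dir p m u -> ((u <= B)%MS <-> exists2 q, on l q & on m q).
Proof.
move=> lp; have [B fB BP] := plane_axiom lp; exists B => // m u [mp u0 Tu]; split.
  case/BP => q lq Tq; exists q => //.
  have pq : p != q by apply: contra lp => /eqP ->.
  have [jp jq] := joinP pq.
  by have <- : join p q = m by apply: (@dir_line p _ _ u).
move=> [q lq mq]; apply/BP; exists q => //.
have pq : p != q by apply: contra lp => /eqP ->.
by rewrite (join_on pq mp mq).
Qed.

Lemma pair_free (u1 u2 : 'rV[K]_n) : u1 != 0 -> (forall a, u2 <> a *: u1) ->
  row_free (col_mx u1 u2).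
Proof.
move=> u10 ne; rewrite /row_free.
apply: contraT => rk.
have : kermx (col_mx u1 u2) != 0.
  rewrite -mxrank_eq0 mxrank_ker subn_eq0 -ltnNge ltn_neqAle rk.
  exact: rank_leq_row.
case/rowV0Pn => x /sub_kermxP; rewrite -[x](hsubmxK (n1 := 1) (n2 := 1)) mul_row_col.
rewrite [lsubmx x]mx11_scalar [rsubmx x]mx11_scalar !mul_scalar_mx => xE x0.
set a := lsubmx x 0 0 in xE; set b := rsubmx x 0 0 in xE.
have b0 : b != 0.
  apply: contra x0 => /eqP b0; move: xE; rewrite b0 scale0r addr0 => /eqP.
  rewrite scaler_eq0 (negbTE u10) orbF => /eqP a0; rewrite -/a -/b a0 b0.
  by apply/eqP/rowP => j; rewrite !mxE; case: splitP => k _; rewrite !mxE mul0rn.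
case: (ne (- (a / b))); apply: (scalerI b0); rewrite scalerA mulrN mulrCA divff // mulr1.
by move/eqP: xE; rewrite addrC addr_eq0 scaleNr => /eqP.
Qed.

Lemma pair_span (u1 u2 u : 'rV[K]_n) :
  (u <= col_mx u1 u2)%MS <-> exists a b, u = a *: u1 + b *: u2.
Proof.
split=> [/submxP[x ->]|[a [b ->]]].
  rewrite -[x](hsubmxK (n1 := 1) (n2 := 1)) mul_row_col.
  rewrite [lsubmx x]mx11_scalar [rsubmx x]mx11_scalar !mul_scalar_mx.
  by eexists; eexists.
have : (col_mx u1 u2 <= col_mx u1 u2)%MS by [].
by rewrite {1}col_mx_sub => /andP[s1 s2]; rewrite addmx_sub ?scalemx_sub.
Qed.

Lemma pencil_dim (B : 'M[K]_(2, n)) (u1 u2 : 'rV[K]_n) : row_free B ->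
  (u1 <= B)%MS -> (u2 <= B)%MS -> u1 != 0 -> (forall a, u2 <> a *: u1) ->
  forall u, (u <= B)%MS <-> exists a b, u = a *: u1 + b *: u2.
Proof.
move=> fB u1B u2B u10 ne u.
have /eqP rk := pair_free u10 ne.
have E : (col_mx u1 u2 :=: B)%MS.
  apply/eqmxP; rewrite -(eq_leqif (mxrank_leqif_eq _)) ?rk ?(eqP fB) //.
  by rewrite col_mx_sub u1B.
by rewrite -E; apply: pair_span.
Qed.

End Geometry.

(** * The projective geometry of a cap *)

Section Subspaces.
Variables (K : fieldType) (V : lmodType K) (d n : nat) (C : cap V d n).
Hypothesis hd : (2 <= d)%N.
Notation pt := (@pt _ _ _ _ C).
Notation ln := (@ln _ _ _ _ C).
Notation on := (@onl _ _ _ _ C).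
Notation vr := (@vr _ _ _ _ C).
Notation tg := (@tgl _ _ _ _ C).
Notation tv := (@tv _ _ _ _ C).
Notation join := (@join _ _ _ _ C).
Notation rw := 'rV[K]_n.
Implicit Types (p q x y z w : pt) (l m : ln) (E : set rw).

Lemma line_two l : exists a b : pt, [/\ a != b, on l a & on l b].
Proof.
have [|ps [sz ups psl]] := points_of_line hd l (S := [:: 0]); first by [].
case: ps sz ups psl => [|a [|b ps]] //= _ /andP[ab _] psl.
exists a, b; split; [|exact: psl (mem_head _ _)|by apply: psl; rewrite !inE eqxx orbT].
by move: ab; rewrite inE negb_or => /andP[].
Qed.

Lemma line_other l w : exists2 a : pt, on l a & a != w.
Proof.
have [a [b [ab la lb]]] := line_two l.
case: (eqVneq a w) => [aw|]; last by exists a.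
by exists b => //; rewrite eq_sym -aw.
Qed.

Lemma on_join1 p q : p != q -> on (join p q) p. Proof. by case/joinP. Qed.
Lemma on_join2 p q : p != q -> on (join p q) q. Proof. by case/joinP. Qed.

Lemma dir_join p q : p != q -> exists u, dir p (join p q) u.
Proof. by move=> pq; apply/dir_exists => //; apply: on_join1. Qed.

Lemma tg_dir p l u v : dir p l u -> tg l p v -> exists a b, v = a *: vr p + b *: tv p u.
Proof.
move=> [lp u0 Tu] Tv; have [D TD [sp _ _]] := tg_basis hd lp.
have [a [b [b0 E]]] := dir_decomp lp u0 (sp _ Tu).
have [a' [b' ->]] := sp _ Tv.
exists (a' - b' / b * a), (b' / b); rewrite E scalerDr !scalerA divfK // addrA -scalerDl.
by rewrite subrK.
Qed.

(** The union of the lines through [p] with direction in [E]. *)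
Definition xe p E : set pt := [set z | p = z \/ exists2 u, dir p (join p z) u & E u].
Definition inside l (Pi : set pt) : Prop := forall w, on l w -> Pi w.

Lemma xe_dir p E z u : is_subspace E -> xe p E z -> p != z -> dir p (join p z) u -> E u.
Proof.
move=> sE [->|[u' D' Eu']]; first by rewrite eqxx.
by move=> pz Du; have [c _ ->] := dir_uniq hd D' Du; apply: subZ.
Qed.

Lemma xe_line p E l u z : dir p l u -> E u -> on l z -> xe p E z.
Proof.
move=> D Eu lz; case: (eqVneq p z) => [->|pz]; first by left.
have lp : on l p by case: D.
by right; exists u => //; rewrite (join_on pz lp lz).
Qed.

Lemma dir_indep p y z u v : p != y -> p != z -> y != z -> ~~ on (join y z) p ->
  dir p (join p y) u -> dir p (join p z) v -> forall c, v <> c *: u.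
Proof.
move=> py pz yz np Dy Dz c vc; case/negP: np.
have c0 : c != 0.
  by apply/eqP => c0; case: Dz => _ /eqP + _; rewrite vc c0 scale0r.
have Dz' := dirZ c0 Dy; rewrite -vc in Dz'.
have jE := dir_line hd Dz Dz'.
have -> : join y z = join p y.
  by apply: join_on => //; [apply: on_join2 | rewrite -jE; apply: on_join2].
exact: on_join1.
Qed.

(** A plane pencil is determined by two of its members. *)
Lemma pencil_span p y z : p != y -> p != z -> y != z -> ~~ on (join y z) p ->
  exists u v (B : 'M[K]_(2, n)), [/\ row_free B, dir p (join p y) u, dir p (join p z) v,
    forall t, (t <= B)%MS <-> exists a b, t = a *: u + b *: v &
    forall m t, dir p m t -> ((t <= B)%MS <-> exists2 q, on (join y z) q & on m q)].
Proof.
move=> py pz yz np; have [u Du] := dir_join py; have [v Dv] := dir_join pz.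
have [B fB BP] := pencil hd np; exists u, v, B; split=> //.
apply: pencil_dim => //.
- by apply/(BP _ _ Du); exists y; apply: on_join1 || apply: on_join2.
- by apply/(BP _ _ Dv); exists z; apply: on_join2.
- by case: Du.
- exact: (dir_indep py pz yz np Du Dv).
Qed.

Lemma xe_closed p E y z w : is_subspace E -> xe p E y -> xe p E z -> y != z ->
  on (join y z) w -> xe p E w.
Proof.
move=> sE Ey Ez yz lw; case: (boolP (on (join y z) p)) => [lp|np].
  have [u Du] := dir_exists hd lp; apply: (xe_line Du _ lw).
  have [q [lq pq Eq]] : exists q, [/\ on (join y z) q, p != q & xe p E q].
    case: (eqVneq p y) => [py|py]; last by exists y; split=> //; apply: on_join1.
    by exists z; split=> //; [apply: on_join2 | rewrite py].
  by apply: (xe_dir sE Eq pq); rewrite (join_on pq lp lq).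
have py : p != y by apply: contra np => /eqP ->; apply: on_join1.
have pz : p != z by apply: contra np => /eqP ->; apply: on_join2.
have [u [v [B [fB Du Dv BE BP]]]] := pencil_span py pz yz np.
have pw : p != w by apply: contra np => /eqP ->.
have [t Dt] := dir_join pw; right; exists t => //.
have /BE[c [e ->]] : (t <= B)%MS by apply/(BP _ _ Dt); exists w => //; apply: on_join2.
by apply: subZD => //; [apply: (xe_dir sE Ey) | apply: subZ (xe_dir sE Ez _ Dv)].
Qed.

Lemma xe_inside p E y z : is_subspace E -> xe p E y -> xe p E z -> y != z ->
  inside (join y z) (xe p E).
Proof. by move=> sE Ey Ez yz w; apply: xe_closed. Qed.

(** A line in the span of [p] and a hyperplane of directions meets the latter. *)
Lemma hyper_meet p E (E' : set rw) m : is_subspace E ->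
  (forall u v, E u -> E v -> E' u \/ exists c, E' (c *: u + v)) ->
  inside m (xe p E) -> exists2 q, on m q & xe p E' q.
Proof.
move=> sE hE mE; case: (boolP (on m p)) => [mp|np]; first by exists p => //; left.
have [y [z [yz my mz]]] := line_two m; have mJ := join_on yz my mz.
rewrite -mJ in np mE *.
have py : p != y by apply: contra np => /eqP ->; apply: on_join1.
have pz : p != z by apply: contra np => /eqP ->; apply: on_join2.
have [u [v [B [fB Du Dv BE BP]]]] := pencil_span py pz yz np.
have Eu : E u by apply: (xe_dir sE (mE _ (on_join1 yz)) py).
have Ev : E v by apply: (xe_dir sE (mE _ (on_join2 yz)) pz).
have [E'u|[c E't]] := hE u v Eu Ev.
  by exists y; [apply: on_join1 | right; exists u].
have t0 : c *: u + v != 0.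
  apply/eqP => t0; have ne := dir_indep py pz yz np Du Dv; apply: (ne (- c)).
  by move/eqP: t0; rewrite addrC addr_eq0 scaleNr => /eqP.
have [m' Dm'] := dir_onto p t0.
have [|q lq mq] := (BP _ _ Dm').1; first by apply/BE; exists c, 1; rewrite scale1r.
by exists q => //; apply: (xe_line Dm' _ mq).
Qed.

(** Tangents at [w] to three lines of a plane through [w]. *)
Lemma tangent_plane w (a b : pt) y l : ~~ on l w -> on l a -> on l b -> on l y -> a != b ->
  forall v, tg (join w y) w v -> lspan (tg (join w a) w `|` tg (join w b) w) v.
Proof.
move=> nw la lb ly ab v Tv; have lJ := join_on ab la lb; rewrite -lJ in nw ly.
have wa : w != a by apply: contra nw => /eqP ->; apply: on_join1.
have wb : w != b by apply: contra nw => /eqP ->; apply: on_join2.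
have wy : w != y by apply: contra nw => /eqP ->.
have [u1 [u2 [B [fB D1 D2 BE BP]]]] := pencil_span wa wb ab nw.
have [u Du] := dir_join wy.
have /BE[c [e E]] : (u <= B)%MS by apply/(BP _ _ Du); exists y => //; apply: on_join2.
have [f [g ->]] := tg_dir Du Tv; rewrite E tv_lin tvZ.
apply: lspanD; apply: lspanZ; first by apply: in_lspan; left; apply: tg_vr => //; apply: on_join1.
apply: lspanD; apply: lspanZ; apply: in_lspan; [by left; case: D1 | by right; case: D2].
Qed.

Definition plane (Pi : set pt) : Prop :=
  exists p (B : 'M[K]_(2, n)), row_free B /\ Pi = xe p [set u | (u <= B)%MS].

Lemma row_subspace k (B : 'M[K]_(k, n)) : is_subspace [set u : rw | (u <= B)%MS].
Proof. by split=> [|c u v /= uB vB]; rewrite /= ?sub0mx // addmx_sub ?scalemx_sub. Qed.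

Lemma plane_closed Pi y z : plane Pi -> Pi y -> Pi z -> y != z -> inside (join y z) Pi.
Proof. by move=> [p [B [_ ->]]] Py Pz yz; apply: xe_inside => //; apply: row_subspace. Qed.

Lemma plane_inside Pi l y z : plane Pi -> on l y -> on l z -> y != z -> Pi y -> Pi z -> inside l Pi.
Proof. by move=> hP ly lz yz Py Pz; rewrite -(join_on yz ly lz); apply: plane_closed. Qed.

Lemma xe_pencil p (B : 'M[K]_(2, n)) l m u : row_free B -> ~~ on l p ->
  inside l (xe p [set u | (u <= B)%MS]) -> dir p m u -> (u <= B)%MS -> exists2 q, on l q & on m q.
Proof.
move=> fB np lP Du uB; have [y [z [yz ly lz]]] := line_two l.
rewrite -(join_on yz ly lz) in np lP *.
have py : p != y by apply: contra np => /eqP ->; apply: on_join1.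
have pz : p != z by apply: contra np => /eqP ->; apply: on_join2.
have [v1 [v2 [B' [fB' D1 D2 BE' BP]]]] := pencil_span py pz yz np.
have v1B := xe_dir (row_subspace B) (lP _ (on_join1 yz)) py D1.
have v2B := xe_dir (row_subspace B) (lP _ (on_join2 yz)) pz D2.
have BE := pencil_dim fB v1B v2B _ (dir_indep py pz yz np D1 D2).
by apply/(BP _ _ Du)/BE'/BE => //; case: D1.
Qed.

(** Veblen's axiom. *)
Lemma plane_meet Pi l m : plane Pi -> inside l Pi -> inside m Pi -> exists2 q, on l q & on m q.
Proof.
move=> [p [B [fB ->]]] lP mP.
have thr l' m' : inside l' (xe p [set u | (u <= B)%MS]) -> inside m' (xe p [set u | (u <= B)%MS]) ->
    on m' p -> exists2 q, on l' q & on m' q.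
  move=> l'P m'P m'p; case: (boolP (on l' p)) => [|np]; first by exists p.
  have [u Du] := dir_exists hd m'p; apply: (xe_pencil fB np l'P Du).
  have [a m'a ap] := line_other m' p; rewrite eq_sym in ap.
  by apply: (xe_dir (row_subspace B) (m'P _ m'a) ap); rewrite (join_on ap m'p m'a).
case: (boolP (on m p)) => [mp|mp]; first exact: thr.
case: (boolP (on l p)) => [lp|lp]; first by have [q] := thr m l mP lP lp; exists q.
(* both lines avoid [p]: use the pencil at a point [y] of [m] *)
have [y [y' [yy' my my']]] := line_two m.
case: (boolP (on l y)) => [ly|nly]; first by exists y.
have mJ := join_on yy' my my'.
have py : p != y by apply: contra mp => /eqP ->.
have py' : p != y' by apply: contra mp => /eqP ->.
have jP (a : pt) : inside (join p a) (xe p [set u | (u <= B)%MS]) \/ ~ xe p [set u | (u <= B)%MS] a \/ p = a.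
  case: (eqVneq p a) => [->|pa]; first by right; right.
  case: (pselect (xe p [set u | (u <= B)%MS] a)) => Ha; last by right; left.
  by left; apply: xe_inside => //; [apply: row_subspace | left].
have [z lz jz] : exists2 z, on l z & on (join p y) z.
  apply: thr => //; last exact: on_join1.
  by case: (jP y) => // -[//|/eqP]; [case; apply: mP | rewrite (negbTE py)].
have [z' lz' jz'] : exists2 z', on l z' & on (join p y') z'.
  apply: thr => //; last exact: on_join1.
  by case: (jP y') => // -[//|/eqP]; [case; apply: mP | rewrite (negbTE py')].
have pz : p != z by apply: contra lp => /eqP ->.
have pz' : p != z' by apply: contra lp => /eqP ->.
have jj : join p y != join p y'.
  apply: contra mp => /eqP jE; rewrite -mJ.
  have -> : join y y' = join p y by apply: join_on => //; [exact: on_join2 | rewrite jE; apply: on_join2].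
  exact: on_join1.
have zz' : z != z'.
  apply: contra jj => /eqP zE; rewrite -zE in jz'.
  by rewrite -(join_on pz (on_join1 py) jz) -(join_on pz (on_join1 py') jz').
have yz : y != z by apply: contra nly => /eqP ->.
have yz' : y != z' by apply: contra nly => /eqP ->.
have lJ := join_on zz' lz lz'; rewrite -lJ in nly.
have [u [v [B1 [fB1 Du Dv BE1 BP1]]]] := pencil_span yz yz' zz' nly.
have ny : ~~ on (join p y') y.
  apply: contra jj => ny; apply/eqP.
  exact: (two_points py (on_join1 py) (on_join2 py) (on_join1 py') ny).
have nB : ~~ on (join p z') y by rewrite (join_on pz' (on_join1 py') jz').
have yp : y != p by rewrite eq_sym.
have [u' [v' [B2 [fB2 Du' Dv' BE2 BP2]]]] := pencil_span yp yz' pz' nB.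
have jyz : join y p = join y z.
  apply/esym; apply: join_on => //; [exact: on_join1|].
  by rewrite joinC //.
have [t Dt] := dir_exists hd my.
have /BE2[c [e tE]] : (t <= B2)%MS.
  by apply/(BP2 _ _ Dt); exists y' => //; rewrite (join_on pz' (on_join1 py') jz'); apply: on_join2.
rewrite -jyz in Du; have [c1 _ u'E] := dir_uniq hd Du Du'; have [c2 _ v'E] := dir_uniq hd Dv Dv'.
have /(BP1 _ _ Dt)[q] : (t <= B1)%MS.
  by apply/BE1; exists (c * c1), (e * c2); rewrite tE u'E v'E !scalerA.
by rewrite lJ => lq mq; exists q.
Qed.

Lemma row_pair (B : 'M[K]_(2, n)) : row_free B -> exists u v : rw,
  [/\ (u <= B)%MS, (v <= B)%MS, u != 0 & forall c, v <> c *: u].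
Proof.
move=> fB; exists (row ord0 B), (row ord_max B).
have inj (x y : 'rV[K]_2) : x *m B = y *m B -> x = y by apply: row_free_inj.
have ne c : row ord_max B <> c *: row ord0 B.
  rewrite !rowE scalemxAl => /inj/rowP/(_ ord_max); rewrite !mxE !eqxx /= mulr0.
  by move/eqP; rewrite oner_eq0.
split=> //; try exact: row_sub.
apply/eqP; rewrite rowE -(mul0mx _ B) => /inj/rowP/(_ ord0); rewrite !mxE !eqxx /=.
by move/eqP; rewrite oner_eq0.
Qed.

Lemma plane_offline Pi w : plane Pi -> Pi w -> exists2 l, inside l Pi & ~~ on l w.
Proof.
move=> hP Pw; have [p [B [fB PE]]] := hP.
have [u [v [uB vB u0 ne]]] := row_pair fB.
have v0 : v != 0 by apply/eqP => v0; apply: (ne 0); rewrite v0 scale0r.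
have [l1 D1] := dir_onto p u0; have [l2 D2] := dir_onto p v0.
have l12 : l1 != l2.
  by apply/eqP => e; rewrite e in D1; have [c _] := dir_uniq hd D1 D2; apply: ne.
have [lp1 _ _] := D1; have [lp2 _ _] := D2.
have in1 : inside l1 Pi by move=> z lz; rewrite PE; apply: (xe_line D1).
have in2 : inside l2 Pi by move=> z lz; rewrite PE; apply: (xe_line D2).
case: (eqVneq p w) => [pw|pw].
  have [a la ap] := line_other l1 p; have [b lb bp] := line_other l2 p.
  have ab : a != b by apply: contra ap => /eqP ab; rewrite -ab in lb; rewrite (one_point l12 la lp1 lb lp2).
  exists (join a b); first by apply: plane_closed => //; [apply: in1 | apply: in2].
  rewrite -pw; apply: contra l12 => jp.
  have e1 : join a b = l1 by apply: (two_points ap) => //; apply: on_join1.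
  by apply/eqP; rewrite -e1; apply: (two_points bp) => //; apply: on_join2.
case: (boolP (on l1 w)) => [l1w|]; last by exists l1.
exists l2 => //; apply: contra l12 => l2w; apply/eqP.
by apply: (two_points pw).
Qed.

Lemma plane_tangent Pi w l1 l2 l3 : plane Pi -> inside l1 Pi -> inside l2 Pi -> inside l3 Pi ->
  l1 != l2 -> on l1 w -> on l2 w -> on l3 w ->
  forall v, tg l3 w v -> lspan (tg l1 w `|` tg l2 w) v.
Proof.
move=> hP i1 i2 i3 l12 w1 w2 w3 v Tv.
have [a la aw] := line_other l1 w; have [b lb bw] := line_other l2 w.
have ab : a != b by apply: contra aw => /eqP ab; rewrite -ab in lb; rewrite (one_point l12 la w1 lb w2).
have jw : ~~ on (join a b) w.
  apply: contra l12 => jp.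
  have e1 : join a b = l1 by apply: (two_points aw) => //; apply: on_join1.
  by apply/eqP; rewrite -e1; apply: (two_points bw) => //; apply: on_join2.
have inj : inside (join a b) Pi by apply: plane_closed => //; [apply: i1 | apply: i2].
have [y jy l3y] := plane_meet hP inj i3.
have wy : w != y by apply: contra jw => /eqP ->.
have := @tangent_plane w a b y _ jw (on_join1 ab) (on_join2 ab) jy ab v.
rewrite (join_on wy w3 l3y); rewrite eq_sym in aw; rewrite eq_sym in bw.
by rewrite (join_on aw w1 la) (join_on bw w2 lb); apply.
Qed.

End Subspaces.

(** * Lines of a plane in general position *)

Section Counting.

Lemma count_sum_le (T T' : eqType) (P : T -> T' -> bool) (cs : seq T) (ts : seq T') :
  (forall t, t \in ts -> count (P^~ t) cs <= 1)%N ->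
  (\sum_(c <- cs) count (P c) ts <= size ts)%N.
Proof.
move=> h; have -> : (\sum_(c <- cs) count (P c) ts = \sum_(t <- ts) count (P^~ t) cs)%N.
  under eq_bigr => c _ do rewrite -sum1_count big_mkcond.
  rewrite exchange_big /=; apply: eq_bigr => t _.
  by rewrite -sum1_count [RHS]big_mkcond.
rewrite -sum1_size big_seq [X in (_ <= X)%N]big_seq.
by apply: leq_sum => t /h.
Qed.

Lemma count_has_le (T T' : eqType) (P : T -> T' -> bool) (cs : seq T) (ts : seq T') :
  (count (fun c => has (P c) ts) cs <= \sum_(c <- cs) count (P c) ts)%N.
Proof.
rewrite -sum1_count big_mkcond; apply: leq_sum => c _.
by rewrite has_count; case: (count _ _).
Qed.

Lemma pigeon_min (T : eqType) (f : T -> nat) (cs : seq T) D :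
  (0 < size cs)%N -> (\sum_(c <- cs) f c <= D)%N ->
  exists2 c, c \in cs & (size cs * f c <= D)%N.
Proof.
move=> s0 hD; apply: contrapT => h.
suff : (D.+1 * size cs <= \sum_(c <- cs) size cs * f c)%N.
  by rewrite -big_distrr /= mulnC leq_pmul2l // ltnNge hD.
rewrite -sum1_size big_distrr /= big_seq [X in (_ <= X)%N]big_seq.
apply: leq_sum => c cc; rewrite muln1 ltnNge; apply/negP => le; apply: h.
by exists c => //; rewrite -sum1_size.
Qed.

Lemma filter_lower (T T' : eqType) (P : T -> T' -> bool) (cs : seq T) (ts : seq T') :
  (forall t, t \in ts -> count (P^~ t) cs <= 1)%N ->
  (size cs <= size [seq c <- cs | ~~ has (P c) ts] + size ts)%N.
Proof.
move=> h; rewrite size_filter -(count_predC (fun c => has (P c) ts) cs) addnC leq_add2l.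
exact: leq_trans (count_has_le _ _ _) (count_sum_le h).
Qed.

(** Twice the number of double points, and thrice the field size times the
    number of triple points, that the greedy choice of [j] lines allows. *)
Definition dbl (L j : nat) : nat := (j * (2 * L) + j * j.-1)%N.
Fixpoint trp (L j : nat) : nat := if j is j'.+1 then (trp L j' + 3 * dbl L j')%N else 0%N.

Lemma trp_closed L j : (trp L j + 2 * (j * j.-1) = j * j.-1 * (3 * L + j))%N.
Proof.
elim: j => [//|j IH] /=; rewrite /dbl; case: j IH => [|j] /= IH; first by rewrite !mul0n.
by nia.
Qed.

Lemma trp_mono L j j' : (j <= j')%N -> (trp L j <= trp L j')%N.
Proof.
move=> /subnK <-; elim: (j' - j)%N => [//|k IH]; rewrite addSn /=.
exact: leq_trans IH (leq_addr _ _).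
Qed.

Lemma arith_triple (s t T : nat) : (2 <= s -> 3 * (s * t) <= T -> 2 * T <= 3 * (s * (s - 2)) ->
  2 * t <= s - 2)%N.
Proof.
move=> s2 h1 h2; have : (s * (2 * t) <= s * (s - 2))%N by lia.
by rewrite leq_pmul2l //; lia.
Qed.

Lemma arith_fresh (s a b c e : nat) : (a + b <= s -> s.+1 <= c + b -> c <= e + a -> 0 < e)%N.
Proof. lia. Qed.

Lemma arith_good (s g t f : nat) : (2 <= s -> s <= g + (t + f) -> 2 * t <= s - 2 -> f <= 1 ->
  0 < g /\ s <= 2 * g)%N.
Proof. lia. Qed.

Lemma arith_dbl (L k D c : nat) : (2 * D <= dbl L k -> c <= L + k -> 2 * (D + c) <= dbl L k.+1)%N.
Proof. by rewrite /dbl; case: k => [|k] /=; nia. Qed.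

Lemma arith_tri (s g t c D d2 T : nat) : (s <= 2 * g -> g * c <= D -> 2 * D <= d2 ->
  3 * (s * t) <= T -> 3 * (s * (t + c)) <= T + 3 * d2)%N.
Proof.
move=> h1 h2 h3 h4; have h : (s * c <= 2 * D)%N by nia.
by rewrite mulnDr mulnDr; lia.
Qed.

End Counting.

Section Greedy.
Variables (K : fieldType) (V : lmodType K) (d n : nat) (C : cap V d n).
Hypothesis hd : (2 <= d)%N.
Notation pt := (@pt _ _ _ _ C).
Notation ln := (@ln _ _ _ _ C).
Notation on := (@onl _ _ _ _ C).
Notation join := (@join _ _ _ _ C).
Implicit Types (p q x y z w : pt) (l m : ln).

Definition mult (ls : seq ln) y : nat := count (fun l => on l y) ls.

Lemma mult_gt0 ls y : (0 < mult ls y)%N -> exists2 l, l \in ls & on l y.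
Proof. by rewrite -has_count => /hasP. Qed.

Lemma mult_cat ls ls' y : mult (ls ++ ls') y = (mult ls y + mult ls' y)%N.
Proof. exact: count_cat. Qed.

Variables (Pi : set pt) (m0 : ln) (inits : seq ln) (X0 F : seq pt) (x0 : pt) (g : ln).
Variables (S : seq K).
Hypothesis uS : uniq S.
Hypothesis hPi : plane Pi.
Hypothesis hin : forall l, l \in m0 :: inits -> inside l Pi.
Hypothesis uin : uniq (m0 :: inits).
Hypothesis m0x0 : on m0 x0.
Hypothesis gx0 : on g x0.
Hypothesis gm0 : g != m0.
Hypothesis gin : inside g Pi.
Hypothesis x0X : x0 \in X0.
Hypothesis XP : forall l y, l \in inits -> on l y -> on m0 y -> y \in X0.
Hypothesis Foff : forall y, y \in F -> ~~ on m0 y.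
Hypothesis szF : (size F <= 1)%N.
Hypothesis multi : forall y, ~~ on m0 y -> y \notin F -> (mult inits y <= 1)%N.

Let s := size S.
Let L0 := size inits.

(** A set of lines extending [m0 :: inits], in which at most three lines pass
    through any point off [m0]; [tp] and [dp] list the triple and double points. *)
Record greedy (etas : seq ln) (tp dp : seq pt) : Prop := Greedy {
  gr_in : forall l, l \in etas -> inside l Pi;
  gr_uniq : uniq (m0 :: inits ++ etas);
  gr_base : forall l y, l \in etas -> on l y -> on m0 y -> y \notin X0 /\
    (mult (inits ++ etas) y <= 1)%N;
  gr_F : forall l y, l \in etas -> y \in F -> ~~ on l y;
  gr_le3 : forall y, ~~ on m0 y -> y \notin F -> (mult (inits ++ etas) y <= 3)%N;
  gr_tp : forall y, ~~ on m0 y -> y \notin F -> (2 < mult (inits ++ etas) y)%N -> y \in tp;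
  gr_dp : forall y, ~~ on m0 y -> y \notin F -> (1 < mult (inits ++ etas) y)%N -> y \in dp;
  gr_off : forall y, y \in tp ++ dp -> ~~ on m0 y;
  gr_szd : (2 * size dp <= dbl L0 (size etas))%N;
  gr_szt : (3 * (s * size tp) <= trp L0 (size etas))%N }.

Lemma greedy0 : greedy [::] [::] [::].
Proof.
split=> //=; rewrite ?cats0 ?muln0 //.
- by move=> y ny nF; apply: leq_trans (multi ny nF) _.
- by move=> y ny nF; rewrite ltnNge (leq_trans (multi ny nF)).
- by move=> y ny nF; rewrite ltnNge (multi ny nF).
Qed.

(** A new line is chosen through a fresh point [p] of [m0]. At least half of the
    lines through [p] avoid the triple points, and one of them passes through at
    most the average number of double points, which become triple. *)
Lemma greedy_step etas tp dp : greedy etas tp dp ->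
  (size X0 + size etas <= s)%N -> (2 * trp L0 (size etas) <= 3 * (s * (s - 2)))%N -> (2 <= s)%N ->
  exists eta tp' dp', greedy (eta :: etas) tp' dp'.
Proof.
move=> [gin' gun gbase gF gle3 gtp gdp goff gszd gszt] hs hT hs2.
set ls := inits ++ etas in gun gbase gle3 gtp gdp.
have lsin l : l \in ls -> inside l Pi.
  by rewrite mem_cat => /orP[li|/gin' //]; apply: hin; rewrite inE li orbT.
have lsm0 l : l \in ls -> l != m0.
  by move=> ll; move: gun => /= /andP[nm _]; apply: contra nm => /eqP <-.
have m0in : inside m0 Pi by apply: hin; rewrite mem_head.
(* a fresh point of [m0] *)
have [p [m0p pX pls]] : exists p, [/\ on m0 p, p \notin X0 & forall l, l \in ls -> ~~ on l p].
  have [ps [szps ups psl]] := points_of_line hd m0 uS.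
  have h t : t \in etas -> (count (fun y => on t y) ps <= 1)%N.
    move=> te; have tm : t != m0 by apply: lsm0; rewrite mem_cat te orbT.
    rewrite -size_filter; case E: [seq _ <- _ | _] => [//|a [//|b r]].
    have ab : a != b.
      by have := filter_uniq (fun y => on t y) ups; rewrite E /= inE negb_or => /andP[/andP[]].
    have [ta pa] : on t a /\ a \in ps.
      by have := mem_head a (b :: r); rewrite -E mem_filter => /andP[].
    have [tb pb] : on t b /\ b \in ps.
      have : b \in a :: b :: r by rewrite !inE eqxx orbT.
    by rewrite -E mem_filter => /andP[].
    by case/eqP: ab; apply: (one_point tm) => //; apply: psl.
  have h1 := filter_lower (P := fun y l => on l y) h.
  have h2 := @filter_lower _ _ (fun y x => y == x) [seq c <- ps | ~~ has (fun l => on l c) etas] X0 _.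
  have {}h2 := h2 ltac:(by move=> t _; rewrite (count_uniq_mem t (filter_uniq _ ups)); case: (_ \in _)).
  set r := [seq c <- [seq c <- ps | _] | _] in h2.
  have : (0 < size r)%N by apply: arith_fresh hs _ h2; move: h1; rewrite szps.
  case E: r => [//|p r'] _; have : p \in r by rewrite E mem_head.
  rewrite !mem_filter => /andP[nX /andP[ne pps]].
  exists p; split; first exact: psl.
    by apply: contra nX => pX; apply/hasP; exists p.
  move=> l; rewrite mem_cat => /orP[li|le].
    apply: contra nX => lp; apply/hasP; exists p => //.
    by apply: XP li lp _; apply: psl.
  by apply: contra ne => lp; apply/hasP; exists l.
have px0 : p != x0 by apply: contra pX => /eqP ->.
have ngp : ~~ on g p by apply: contra gm0 => gp; apply/eqP; apply: (two_points px0).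
(* the lines joining [p] to the other points of [g] *)
have [cs [szcs ucs csP]] : exists cs : seq ln, [/\ (s <= size cs)%N, uniq cs &
    forall l, l \in cs -> [/\ on l p, l != m0 & inside l Pi]].
  have [ps [szps ups psl]] := points_of_line hd g uS.
  pose qs := [seq y <- ps | y != x0].
  have qP y : y \in qs -> [/\ on g y, y != x0 & p != y].
    rewrite mem_filter => /andP[yx yp]; split=> //; first exact: psl.
    by apply: contra ngp => /eqP ->; apply: psl.
  exists [seq join p y | y <- qs]; split.
  - rewrite size_map size_filter; have := count_predC (pred1 x0) ps.
    have -> : count (fun y => y != x0) ps = count (predC (pred1 x0)) ps by [].
    rewrite (count_uniq_mem x0 ups) szps; case: (x0 \in ps); last by rewrite add0n => ->.
    by rewrite add1n => -[->].
  - rewrite map_inj_in_uniq ?filter_uniq // => y y' yq yq' e.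
    have [gy _ py] := qP _ yq; have [gy' _ py'] := qP _ yq'.
    apply/eqP; apply: contraNT ngp => ne.
    have -> : g = join p y.
      by apply: (two_points ne) => //; [apply: on_join2 | rewrite e; apply: on_join2].
    exact: on_join1.
  - move=> _ /mapP[y yq ->]; have [gy yx py] := qP _ yq; split; first exact: on_join1.
      apply: contra gm0 => /eqP e; apply/eqP; apply: (two_points yx) => //.
      by rewrite -e; apply: on_join2.
    by apply: plane_closed => //; [apply: m0in | apply: gin].
have one t : ~~ on m0 t -> (count (fun l => on l t) cs <= 1)%N.
  move=> nt; rewrite -size_filter; case E: [seq _ <- _ | _] => [//|a [//|b r]].
  have ab : a != b.
    by have := filter_uniq (fun l => on l t) ucs; rewrite E /= inE negb_or => /andP[/andP[]].
  have [ta pa] : on a t /\ a \in cs.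
    by have := mem_head a (b :: r); rewrite -E mem_filter => /andP[].
  have [tb pb] : on b t /\ b \in cs.
    have : b \in a :: b :: r by rewrite !inE eqxx orbT.
    by rewrite -E mem_filter => /andP[].
  have [ap _ _] := csP _ pa; have [bp _ _] := csP _ pb.
  by case/negP: nt; rewrite (one_point ab ta ap tb bp).
pose good := [seq c <- cs | ~~ has (on c) (tp ++ F)].
have szg : (s <= size good + (size tp + size F))%N.
  rewrite -size_cat; apply: leq_trans szcs _; apply: (filter_lower (P := fun l y => on l y)) => t.
  rewrite mem_cat => /orP[ht|/Foff /one //]; apply: one; apply: goff.
  by rewrite mem_cat ht.
have [g0 sg] := arith_good hs2 szg (arith_triple hs2 gszt hT) szF.
have avg : (\sum_(c <- good) count (on c) dp <= size dp)%N.
  apply: (count_sum_le (P := fun l y => on l y)) => t td.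
  apply: leq_trans (one t _); last by apply: goff; rewrite mem_cat td orbT.
  by rewrite /good count_filter; apply: sub_count => l /= /andP[].
have [eta etag hmin] := pigeon_min g0 avg.
have [etaok etac] : ~~ has (on eta) (tp ++ F) /\ eta \in cs.
  by move: etag; rewrite mem_filter => /andP[].
have [etap etam0 etain] := csP _ etac.
have etanew : eta \notin ls by apply/negP => /pls; rewrite etap.
have /choice[mt mtP] : forall l, exists q, l \in ls -> on l q /\ on eta q.
  move=> l; case: (boolP (l \in ls)) => [ll|_]; last by exists p.
  by have [q lq eq] := plane_meet hd hPi (lsin l ll) etain; exists q.
pose tp' := tp ++ [seq y <- dp | on eta y].
pose dp' := dp ++ [seq y <- [seq mt l | l <- ls] | ~~ on m0 y].
have multE y : mult (inits ++ eta :: etas) y = (on eta y + mult ls y)%N.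
  by rewrite /ls !mult_cat /= addnCA.
have etatp y : on eta y -> y \notin tp ++ F.
  by move=> ey; apply: contra etaok => yt; apply/hasP; exists y.
exists eta, tp', dp'; split.
- by move=> l; rewrite inE => /orP[/eqP ->|/gin'].
- have pe : perm_eq (m0 :: inits ++ eta :: etas) (eta :: m0 :: ls).
    by rewrite (perm_catCA (m0 :: inits) [:: eta] etas).
  by rewrite (perm_uniq pe) cons_uniq inE negb_or etam0 etanew.
- move=> l y; rewrite inE multE => /orP[/eqP ->|le] ly m0y.
    have yp : y = p by apply: (one_point etam0).
    rewrite yp etap; split=> //; rewrite leqNgt ltnS; apply/negP => /mult_gt0[l' l'l].
    by apply/negP; apply: pls.
  have [yX hm] := gbase _ _ le ly m0y; split=> //.
  case ey: (on eta y) => //; have yp : y = p by apply: (one_point etam0).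
  by have := pls l; rewrite mem_cat le orbT -yp ly => /(_ isT).
- move=> l y; rewrite inE => /orP[/eqP ->|le] yF; last exact: gF le yF.
  by apply/negP => /etatp; rewrite mem_cat yF orbT.
- move=> y ny nF; rewrite multE; case ey: (on eta y); last exact: gle3.
  rewrite ltnS leqNgt; apply/negP => /(gtp _ ny nF) yt.
  by have := etatp _ ey; rewrite mem_cat yt.
- move=> y ny nF; rewrite multE mem_cat mem_filter; case ey: (on eta y) => /=.
    by rewrite ltnS => /(gdp _ ny nF) ->; rewrite orbT.
  by move/(gtp _ ny nF) ->.
- move=> y ny nF; rewrite multE mem_cat mem_filter; case ey: (on eta y) => /=.
    rewrite ltnS => /mult_gt0[l ll ly]; rewrite ny /=; apply/orP; right.
    apply/mapP; exists l => //; have [lq eq] := mtP l ll.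
    have le : l != eta by apply: contra etanew => /eqP <-.
    exact: (one_point le).
  by move/(gdp _ ny nF) ->.
- move=> y; rewrite !mem_cat !mem_filter => /orP[/orP[yt|/andP[_ yd]]|/orP[yd|/andP[]//]];
    by apply: goff; rewrite mem_cat ?yt ?yd ?orbT.
- rewrite size_cat size_filter /=; apply: arith_dbl gszd _.
  by apply: leq_trans (count_size _ _) _; rewrite size_map size_cat.
- by rewrite size_cat size_filter /=; apply: arith_tri sg hmin gszd gszt.
Qed.

Lemma greedy_exists N : (2 <= s)%N -> (size X0 + N <= s.+1)%N ->
  (2 * trp L0 N.-1 <= 3 * (s * (s - 2)))%N ->
  exists etas tp dp, size etas = N /\ greedy etas tp dp.
Proof.
move=> s2; elim: N => [|N IH] hs hT; first by exists [::], [::], [::]; split=> //; apply: greedy0.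
have [||etas [tp [dp [szN gr]]]] := IH; first by lia.
  apply: leq_trans hT; rewrite leq_mul2l /=; apply: trp_mono; exact: leq_pred.
have [|||eta [tp' [dp' gr']]] := greedy_step gr; rewrite ?szN //; first by lia.
by exists (eta :: etas), tp', dp'; rewrite /= szN.
Qed.

End Greedy.

(** * The span of lines of a plane *)

Section Chains.
Variables (K : fieldType) (V : lmodType K) (d n : nat) (C : cap V d n).
Hypothesis hd : (2 <= d)%N.
Notation pt := (@pt _ _ _ _ C).
Notation ln := (@ln _ _ _ _ C).
Notation on := (@onl _ _ _ _ C).
Notation vr := (@vr _ _ _ _ C).
Notation par := (@par _ _ _ _ C).
Notation tg := (@tgl _ _ _ _ C).
Notation join := (@join _ _ _ _ C).
Notation crd := (@crd _ _ _ _ C).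
Notation mult := (@mult _ _ _ _ C).
Implicit Types (p q x y z w : pt) (l m : ln) (ls etas : seq ln) (U : set V).

Variable S : seq K.
Hypothesis uS : uniq S.
Hypothesis hS : (d ^ 3 <= size S ^ 2)%N.
Let s := size S.

Lemma size_S : (d < s)%N.
Proof.
rewrite ltnNge; apply/negP => le; have : (s ^ 2 <= d ^ 2)%N by rewrite leq_exp2r.
have h : (d ^ 2 < d ^ 3)%N by rewrite ltn_exp2l.
by move=> h2; have := leq_trans hS h2; rewrite leqNgt h.
Qed.

Definition lvec ls : set V := [set v | exists2 l, l \in ls & exists t, v = par l t].
Definition pvec (Pi : set pt) : set V := [set v | exists2 p, Pi p & v = vr p].

Lemma lvec_pt ls l y : l \in ls -> on l y -> lvec ls (vr y).
Proof. by move=> ll /onP[v E]; exists l => //; exists v. Qed.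

Lemma lvec_tg ls l y v : l \in ls -> tg l y v -> lvec ls v.
Proof. by move=> ll [w _ ->]; exists l => //; exists w. Qed.

(** [d.+1] points of a line, counted with multiplicity, span its space. *)
Lemma line_full U l (ys : seq pt) : is_subspace U -> (d < size ys)%N ->
  (forall y, y \in ys -> on l y) -> (forall y, (count_mem y ys <= 2)%N) ->
  (forall y, y \in ys -> U (vr y)) ->
  (forall y v, (1 < count_mem y ys)%N -> tg l y v -> U v) ->
  forall t, U (par l t).
Proof.
move=> sU sz yl yc Uy Ut; pose z (y : pt) := crd l y.
have sU' : is_subspace [set t | U (par l t)].
  split=> [|a u v Uu Uv] /=; first by rewrite par0; apply: sub0.
  by rewrite par_lin; apply: subZD.
apply: (@rnc_full K d pt z ys [set t | U (par l t)]) => //.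
  split=> // [y yy|y y' yy yy' ne]; first by apply: crd0; apply: yl.
  by apply: crd_neq => //; apply: yl.
move=> y yy; have [_ [c c0 E]] := crdP (yl y yy); split=> [|cy a b] /=.
  by rewrite E; apply: subZ => //; apply: Uy.
apply: (Ut y) => //; exists (drnc d (z y).1 (z y).2 a b) => //.
by apply/rnc_tangentP; exists 0, a, b; rewrite scale0r add0r.
Qed.

(** Each point, counted with multiplicity, whose vector or tangent is already
    available lowers by one the dimension that a line can add. *)
Lemma line_dim (B : set V) l (ys : seq pt) :
  (forall y, y \in ys -> on l y) -> (forall y, (count_mem y ys <= 2)%N) ->
  (forall y, y \in ys -> lspan B (vr y)) ->
  (forall y v, (1 < count_mem y ys)%N -> tg l y v -> lspan B v) ->
  dimle B [set v | exists t, v = par l t] (d.+1 - size ys).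
Proof.
move=> yl yc By Bt; have [ps [szps ups psl]] := points_of_line hd l uS.
pose qs := take (d.+1 - size ys) [seq p <- ps | p \notin ys].
have uq : uniq qs by rewrite take_uniq ?filter_uniq.
have szq : size qs = (d.+1 - size ys)%N.
  rewrite size_takel // size_filter.
  have := count_predC (mem ys) ps; rewrite szps -/s => h.
  have h2 : (count (mem ys) ps <= size ys)%N.
    rewrite -size_filter; apply: uniq_leq_size; first exact: filter_uniq.
    by move=> y; rewrite mem_filter => /andP[].
  have -> : count (fun p => p \notin ys) ps = count (predC (mem ys)) ps by [].
  by have := size_S; move: h h2; rewrite -/s; lia.
have qP y : y \in qs -> on l y /\ y \notin ys.
  by move/mem_take; rewrite mem_filter => /andP[ny /psl].
exists [seq vr q | q <- qs]; split; first by rewrite size_map szq.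
move=> _ [t ->]; set W := lspan _.
have BW v : lspan B v -> W v by apply: lspan_mono => w; left.
have sW : is_subspace W by apply: lspan_subspace.
have ct y : count_mem y (ys ++ qs) = (count_mem y ys + (y \in qs))%N.
  by rewrite count_cat (count_uniq_mem y uq).
apply: (@line_full W l (ys ++ qs)) => //.
- by rewrite size_cat szq; lia.
- by move=> y; rewrite mem_cat => /orP[/yl|/qP[]].
- move=> y; rewrite ct; case: (boolP (y \in qs)) => [/qP[_ ny]|_]; last by rewrite addn0.
  by rewrite (count_memPn ny).
- move=> y; rewrite mem_cat => /orP[/By /BW //|yq].
  by apply: in_lspan; right; apply: map_f.
- move=> y v; rewrite ct; case: (boolP (y \in qs)) => [/qP[_ ny]|_]; last by rewrite addn0 => h /(Bt _ _ h) /BW.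
  by rewrite (count_memPn ny).
Qed.

Section InPlane.
Variable Pi : set pt.
Hypothesis hPi : plane Pi.

(** The points where [l] meets the lines of [ls], with the tangents at multiple
    points, already lie in the span of [ls]. *)
Lemma meet_points ls l : uniq ls -> (forall m, m \in l :: ls -> inside m Pi) -> l \notin ls ->
  exists ys : seq pt, [/\ size ys = size ls, forall y, y \in ys -> on l y,
    forall y, on l y -> count_mem y ys = mult ls y,
    forall y, y \in ys -> lvec ls (vr y)
    & forall y v, (1 < count_mem y ys)%N -> tg l y v -> lspan (lvec ls) v].
Proof.
move=> uls lin lls.
have /choice[mt mtP] : forall m, exists q, m \in ls -> on m q /\ on l q.
  move=> m; case: (boolP (m \in ls)) => [ml|_]; last first.
    by have [a _] := line_two hd l; exists a.
  have mi : inside m Pi by apply: lin; rewrite inE ml orbT.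
  by have [q mq lq] := plane_meet hd hPi mi (lin l (mem_head _ _)); exists q.
have ne m : m \in ls -> m != l by move=> ml; apply: contra lls => /eqP <-.
have yP y : y \in [seq mt m | m <- ls] -> on l y.
  by case/mapP => m ml ->; case: (mtP m ml).
have ct y : on l y -> count_mem y [seq mt m | m <- ls] = mult ls y.
  move=> ly; rewrite count_map; apply: eq_in_count => m ml /=; have [mq lq] := mtP m ml.
  apply/eqP/idP => [<- //|my]; exact: (one_point (ne _ ml)).
exists [seq mt m | m <- ls]; split=> //; first by rewrite size_map.
- by move=> _ /mapP[m ml ->]; have [mq _] := mtP m ml; apply: lvec_pt mq.
- move=> y v cy Tv; have yy : y \in [seq mt m | m <- ls] by rewrite -has_pred1 has_count ltnW.
  have ly := yP y yy; move: cy; rewrite ct // /mult -size_filter.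
  case E: [seq _ <- _ | _] => [//|a [//|b r]] _.
  have ab : a != b.
    by have := filter_uniq (fun m => on m y) uls; rewrite E /= inE negb_or => /andP[/andP[]].
  have [ta pa] : on a y /\ a \in ls.
    by have := mem_head a (b :: r); rewrite -E mem_filter => /andP[].
  have [tb pb] : on b y /\ b \in ls.
    have : b \in a :: b :: r by rewrite !inE eqxx orbT.
    by rewrite -E mem_filter => /andP[].
  have h : lspan (tg a y `|` tg b y) v.
    by apply: (plane_tangent hd hPi _ _ _ ab ta tb ly Tv); apply: lin; rewrite inE ?pa ?pb ?eqxx ?orbT.
  apply: lspan_mono h => x [Tx|Tx]; [exact: lvec_tg pa Tx | exact: lvec_tg pb Tx].
Qed.

(** A line adds one dimension less for each line that it meets, as long as at
    most two of these concur on it. *)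
Lemma chain_step ls l : uniq ls -> (forall m, m \in l :: ls -> inside m Pi) -> l \notin ls ->
  (forall y, on l y -> (mult ls y <= 2)%N) ->
  dimle (lvec ls) (lvec (l :: ls)) (d.+1 - size ls).
Proof.
move=> uls lin lls m2; have [ys [szy yl yc yB yT]] := meet_points uls lin lls.
rewrite -szy; have : dimle (lvec ls) [set v | exists t, v = par l t] (d.+1 - size ys).
  apply: line_dim => // [y|y yy]; last by apply: in_lspan; apply: yB.
  case: (boolP (y \in ys)) => [yy|ny]; last by rewrite (count_memPn ny).
  by rewrite yc ?yl //; apply: m2; apply: yl.
move=> /(@dimleU _ _ _ _ (lvec ls)) h; apply: dimle_mono (h _) => // v Lv; last exact: in_lspan.
  exact: in_lspan.
case: Lv => m; rewrite inE => /orP[/eqP ->|ml] vE; apply: in_lspan; first by left.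
by right; exists m.
Qed.

(** A line with [d.+1] zeros, counted with multiplicity, is in the span. *)
Lemma chain_line ls l : uniq ls -> (forall m, m \in l :: ls -> inside m Pi) ->
  (d < size ls)%N -> (forall y, on l y -> (mult ls y <= 2)%N) -> forall t, lspan (lvec ls) (par l t).
Proof.
move=> uls lin szls m2 t; case: (boolP (l \in ls)) => [ll|lls].
  by apply: in_lspan; exists l => //; exists t.
have [bs [szb bsP]] := chain_step uls lin lls m2.
have b0 : bs = [::] by apply/size0nil; move: szb szls; lia.
have : lspan (lvec ls `|` [set` bs]) (par l t) by apply: bsP; exists l; rewrite ?mem_head //; exists t.
by rewrite b0; apply: lspan_mono => v [//|].
Qed.

(** The lines through [p] are more numerous than the points to avoid. *)
Lemma lines_through p (T : seq pt) : Pi p -> (size T <= s)%N -> exists l,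
  [/\ inside l Pi, on l p & forall y, y \in T -> y != p -> ~~ on l y].
Proof.
move=> Pp szT; have [g gin gp] := plane_offline hd hPi Pp.
have [ps [szps ups psl]] := points_of_line hd g uS.
have pP y : y \in ps -> [/\ on g y & p != y].
  by move=> yp; split; [exact: psl | apply: contra gp => /eqP ->; apply: psl].
pose cs := [seq join p y | y <- ps].
have ucs : uniq cs.
  rewrite map_inj_in_uniq // => y y' yq yq' e; have [gy py] := pP _ yq; have [gy' py'] := pP _ yq'.
  apply/eqP; apply: contraNT gp => ne.
  have -> : g = join p y.
    by apply: (two_points ne) => //; [apply: on_join2 | rewrite e; apply: on_join2].
  exact: on_join1.
have csP l : l \in cs -> on l p /\ inside l Pi.
  move=> /mapP[y yp ->]; have [gy py] := pP _ yp; split; first exact: on_join1.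
  by apply: plane_closed => //; apply: gin.
have := @filter_lower _ _ (fun l y => on l y) cs [seq y <- T | y != p] _.
have h : forall t, t \in [seq y <- T | y != p] -> (count (fun l => on l t) cs <= 1)%N.
  move=> t; rewrite mem_filter => /andP[tp _]; rewrite -size_filter.
  case E: [seq _ <- _ | _] => [//|a [//|b r]].
  have ab : a != b.
    by have := filter_uniq (fun l => on l t) ucs; rewrite E /= inE negb_or => /andP[/andP[]].
  have [ta pa] : on a t /\ a \in cs.
    by have := mem_head a (b :: r); rewrite -E mem_filter => /andP[].
  have [tb pb] : on b t /\ b \in cs.
    have : b \in a :: b :: r by rewrite !inE eqxx orbT.
    by rewrite -E mem_filter => /andP[].
  have [ap _] := csP _ pa; have [bp _] := csP _ pb.
  by case/eqP: tp; apply: (one_point ab).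
move=> /(_ h) {h}; set good := [seq c <- cs | _]; rewrite size_map szps => hs.
have : (0 < size good)%N.
  rewrite lt0n; apply/eqP => e; move: hs; rewrite e add0n size_filter => hs.
  by have := leq_trans hs (leq_trans (count_size _ _) szT); rewrite ltnn.
rewrite /good; case E: [seq c <- cs | _] => [//|l r] _; have : l \in l :: r by rewrite mem_head.
rewrite -E mem_filter => /andP[nl /csP[lp lin]]; exists l; split=> // y yT yp.
by apply: contra nl => ly; apply/hasP; exists y; rewrite // mem_filter yp.
Qed.

(** [d.+1] lines span the plane: a point off them lies on a line that avoids the
    few points [T] on more than two of them. *)
Lemma chain_full ls (T : seq pt) : uniq ls -> (forall m, m \in ls -> inside m Pi) ->
  (d < size ls)%N -> (size T <= s)%N -> (forall y, (2 < mult ls y)%N -> y \in T) ->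
  forall p, Pi p -> lspan (lvec ls) (vr p).
Proof.
move=> uls lin szls szT TP p Pp; case: (posnP (mult ls p)) => [m0|]; last first.
  by case/mult_gt0 => l ll lp; apply: in_lspan; apply: lvec_pt lp.
have [l [lin' lp lT]] := lines_through Pp szT.
have /onP[t <-] := lp; apply: chain_line => // [m|y ly].
  by rewrite inE => /orP[/eqP -> //|/lin].
rewrite leqNgt; apply/negP => h; have yT := TP _ h.
have yp : y != p by apply/eqP => yp; rewrite yp m0 in h.
by have := lT _ yT yp; rewrite ly.
Qed.

(** The dimension that [m] lines add to [k] lines of a plane. *)
Fixpoint tri (k m : nat) : nat := if m is m'.+1 then (d.+1 - k + tri k.+1 m')%N else 0%N.

Lemma chain_dim ls etas : uniq (ls ++ etas) -> (forall m, m \in ls ++ etas -> inside m Pi) ->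
  (forall eta y, eta \in etas -> on eta y -> (mult (ls ++ etas) y <= 3)%N) ->
  dimle (lvec ls) (lvec (ls ++ etas)) (tri (size ls) (size etas)).
Proof.
elim: etas ls => [|eta etas IH] ls un lin m3.
  by rewrite cats0; apply: dimle_sub => v; apply: in_lspan.
have pe : perm_eq (ls ++ eta :: etas) ((eta :: ls) ++ etas) by rewrite (perm_catCA ls [:: eta] etas).
have multE y : mult (ls ++ eta :: etas) y = mult ((eta :: ls) ++ etas) y by apply/permP.
have : dimle (lvec (eta :: ls)) (lvec ((eta :: ls) ++ etas)) (tri (size (eta :: ls)) (size etas)).
  apply: IH; first by rewrite -(perm_uniq pe).
    by move=> m; rewrite -(perm_mem pe); apply: lin.
  by move=> e y ee ey; rewrite -multE; apply: (m3 e) => //; rewrite inE ee orbT.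
have : dimle (lvec ls) (lvec (eta :: ls)) (d.+1 - size ls).
  move: un; rewrite (perm_uniq pe) /= cat_uniq mem_cat negb_or => /andP[/andP[nl _] /andP[uls _]].
  apply: chain_step => // [m|y ey].
    by rewrite inE => /orP[/eqP ->|ml]; apply: lin; rewrite mem_cat ?ml // mem_head orbT.
  have := m3 eta y (mem_head _ _) ey; rewrite multE /= mult_cat /= ey; lia.
move=> h1 /(dimle_trans h1); apply: dimle_mono => v; first exact: in_lspan.
by case=> m; rewrite (perm_mem pe) => ml vE; apply: in_lspan; exists m.
Qed.

End InPlane.
End Chains.

(** * Lines in general position to a triangle or to a pencil *)

Section Numerics.
Variables d s : nat.
Hypothesis hd : (2 <= d)%N.
Hypothesis hs : (d ^ 3 <= s ^ 2)%N.

Lemma num_s3 : (3 <= s)%N.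
Proof.
rewrite leqNgt; apply/negP => h.
by move: hs hd; rewrite !expnS !expn0; case: s h => [|[|[|//]]] _; nia.
Qed.

Lemma num_case : d = 2 \/ (3 <= d /\ 6 <= s)%N.
Proof.
case: (ltnP d 3) => h; [left; lia | right; split=> //].
rewrite leqNgt; apply/negP => h6; have : (s ^ 2 <= 5 ^ 2)%N by rewrite leq_exp2r.
have : (3 ^ 3 <= d ^ 3)%N by rewrite leq_exp2r.
by move=> h1 h2; have := leq_trans h1 (leq_trans hs h2).
Qed.

Lemma num_big : (3 <= d)%N -> (2 * d ^ 3 <= 3 * (s * (s - 2)))%N.
Proof.
move=> h; case: num_case => [|[_ h6]]; first by move=> e; rewrite e in h.
apply: leq_trans (_ : 2 * s ^ 2 <= _)%N; first by rewrite leq_mul2l hs.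
by rewrite expnS expn1; nia.
Qed.

Lemma trp_le L j : (trp L j <= j * j * (3 * L + j))%N.
Proof. by have := trp_closed L j; case: j => [|j] /=; nia. Qed.

(** The greedy choice goes on until there are [d] lines. *)
Lemma num_triangle : (2 * trp 2 d.-1 <= 3 * (s * (s - 2)))%N.
Proof.
case: num_case => [d2|[d3 h6]]; first by rewrite d2.
apply: leq_trans (num_big d3); rewrite leq_mul2l /=.
have := trp_closed 2 d.-1; have [k ->] : exists k, d = k.+3 by exists (d - 3)%N; lia.
by rewrite /= !expnS expn0; nia.
Qed.

Lemma num_pencil L N : (L + N = d)%N -> (2 * trp L N.-1 <= 3 * (s * (s - 2)))%N.
Proof.
move=> LN; case: num_case => [d2|[d3 h6]].
  by case: N LN => [|[|[|N]]] LN //=; rewrite /dbl /= ?muln0 //; lia.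
apply: leq_trans (num_big d3); rewrite leq_mul2l /=.
apply: leq_trans (trp_le _ _) _; rewrite -LN !expnS expn0.
by case: N LN => [|N] /= LN; nia.
Qed.

Lemma num_pencil_end L N T : (L + N = d)%N -> (3 * (s * T) <= trp L N -> T < s)%N.
Proof.
move=> LN h; have s3 := num_s3; rewrite ltnNge; apply/negP => sT.
have h1 : (trp L N <= d ^ 3)%N.
  by apply: leq_trans (trp_le _ _) _; rewrite -LN !expnS expn0; nia.
have := leq_trans h (leq_trans h1 hs); rewrite expnS expn1.
have : (s * s <= s * T)%N by rewrite leq_mul2l sT orbT.
by nia.
Qed.

End Numerics.

Lemma tri_bin d k m : (k + m = d.+1)%N -> tri d k m = 'C(m.+1, 2).
Proof.
elim: m k => [|m IH] k km; first by rewrite bin_small.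
by rewrite /= IH ?addSnnS // [in RHS]binS bin1 addnC; congr (_ + _)%N; lia.
Qed.

Section Systems.
Variables (K : fieldType) (V : lmodType K) (d n : nat) (C : cap V d n).
Hypothesis hd : (2 <= d)%N.
Notation pt := (@pt _ _ _ _ C).
Notation ln := (@ln _ _ _ _ C).
Notation on := (@onl _ _ _ _ C).
Notation join := (@join _ _ _ _ C).
Notation mult := (@mult _ _ _ _ C).
Notation lvec := (@lvec _ _ _ _ C).
Notation pvec := (@pvec _ _ _ _ C).
Implicit Types (p q x y z w : pt) (l m : ln) (ls etas : seq ln) (U : set V).
Variable S : seq K.
Hypothesis uS : uniq S.
Hypothesis hS : (d ^ 3 <= size S ^ 2)%N.
Variable Pi : set pt.
Hypothesis hPi : plane Pi.
Let s := size S.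

Lemma join_ne (a b c : pt) : a != b -> a != c -> ~~ on (join b c) a -> b != c -> join a b != join a c.
Proof.
move=> ab ac na bc; apply: contra na => /eqP e.
have -> : join b c = join a b by apply: join_on => //; [apply: on_join2 | rewrite e; apply: on_join2].
exact: on_join1.
Qed.

(** [N] lines in general position, up to few triple points, with respect to the
    triangle [a b c]. *)
Lemma triangle_system N (a b c : pt) : Pi a -> Pi b -> Pi c -> b != c -> ~~ on (join b c) a ->
  (N <= d)%N -> exists (etas : seq ln) (tp : seq pt),
  let ls := [:: join b c, join a b, join a c & etas] in
  [/\ size etas = N, uniq ls, forall l, l \in ls -> inside l Pi,
      forall eta, eta \in etas -> [/\ ~~ on eta a, ~~ on eta b & ~~ on eta c] &
   [/\ forall y, (mult ls y <= 3)%N,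
      forall y, (2 < mult ls y)%N -> y \in tp,
      forall y, on (join b c) y -> (mult ls y <= 2)%N
    & (3 * (s * size tp) <= trp 2 N)%N]].
Proof.
move=> Pa Pb Pc bc na hN.
have ab : a != b by apply: contra na => /eqP ->; apply: on_join1.
have ac : a != c by apply: contra na => /eqP ->; apply: on_join2.
have jj := join_ne ab ac na bc.
have bcab : join b c != join a b by apply: contra na => /eqP ->; apply: on_join1.
have bcac : join b c != join a c by apply: contra na => /eqP ->; apply: on_join1.
have [ba ca] : b != a /\ c != a by rewrite ![_ == a]eq_sym.
have nac : ~~ on (join a c) b.
  by apply: contra bcac => h; rewrite (join_on bc h (on_join2 ac)).
have nab : ~~ on (join a b) c.
  by apply: contra bcab => h; rewrite (join_on bc (on_join2 ab) h).
pose inits := [:: join a b; join a c].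
have hin l : l \in join b c :: inits -> inside l Pi.
  by rewrite !inE => /or3P[] /eqP ->; apply: plane_closed.
have multi y : ~~ on (join b c) y -> y \notin [:: a] -> (mult inits y <= 1)%N.
  move=> _; rewrite inE => ya; rewrite /mult /=.
  case h1: (on (join a b) y); case h2: (on (join a c) y) => //.
  by case/eqP: ya; apply: (one_point jj) => //; apply: on_join1.
have XP l y : l \in inits -> on l y -> on (join b c) y -> y \in [:: b; c].
  move=> h ly my; move: h; rewrite !inE => /orP[] /eqP lE; rewrite lE in ly.
    by rewrite (one_point bcab my (on_join1 bc) ly (on_join2 ab)) eqxx.
  by rewrite (one_point bcac my (on_join2 bc) ly (on_join2 ac)) eqxx orbT.
have s3 := num_s3 hd hS; have sd := size_S hd hS.
have nT : (2 * trp 2 N.-1 <= 3 * (s * (s - 2)))%N.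
  by apply: leq_trans (num_triangle hd hS); rewrite leq_mul2l /=; apply: trp_mono; rewrite -!subn1 leq_sub2r.
have [||||||||||etas [tp [dp [szN [gin gun gbase gF gle3 gtp _ goff _ gszt]]]]] :=
  @greedy_exists K V d n C hd Pi (join b c) inits [:: b; c] [:: a] b (join a b) S uS hPi hin _ _ _ _ _ _ XP _ _ multi N _ _ nT.
- by rewrite /= !inE negb_or bcab bcac jj.
- exact: on_join1.
- exact: on_join2.
- by rewrite eq_sym.
- by apply: hin; rewrite !inE eqxx orbT.
- by rewrite inE eqxx.
- by move=> y; rewrite inE => /eqP ->.
- by [].
- exact: ltnW s3.
- by rewrite /= add2n ltnS (leq_ltn_trans hN sd).
exists etas, tp => ls.
have multE y : mult ls y = (on (join b c) y + mult (inits ++ etas) y)%N by [].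
have nv eta : eta \in etas -> [/\ ~~ on eta a, ~~ on eta b & ~~ on eta c].
  move=> ee; split; first by apply: (gF _ _ ee); rewrite inE.
    by apply/negP => eb; have [] := gbase _ _ ee eb (on_join1 bc); rewrite inE eqxx.
  by apply/negP => ec; have [] := gbase _ _ ee ec (on_join2 bc); rewrite !inE eqxx orbT.
have m0 v : (forall eta, eta \in etas -> ~~ on eta v) -> mult etas v = 0%N.
  by move=> h; apply/eqP; rewrite eqn0Ngt; apply/negP => /mult_gt0[e /h /negP].
have m2 y : on (join b c) y -> (mult ls y <= 2)%N.
  move=> my; rewrite multE my add1n ltnS; case: (posnP (mult etas y)) => [e0|/mult_gt0[e ee ey]]; last first.
    by case: (gbase _ _ ee ey my).
  rewrite mult_cat e0 addn0 /mult /=.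
  case h1: (on (join a b) y); case h2: (on (join a c) y) => //.
  by case/negP: na; rewrite -(one_point jj h1 (on_join1 ab) h2 (on_join1 ac)).
have ma : mult ls a = 2.
  rewrite multE (negbTE na) mult_cat m0 /mult /= ?(on_join1 ab) ?(on_join1 ac) //.
  by move=> e /nv[].
split=> //.
  by move=> l; rewrite -[ls]/((join b c :: inits) ++ etas) mem_cat => /orP[/hin|/gin].
split=> //.
- move=> y; case: (boolP (on (join b c) y)) => [/m2 h|my]; first exact: leq_trans h _.
  case: (eqVneq y a) => [->|ya]; first by rewrite ma.
  by rewrite multE (negbTE my); apply: gle3 => //; rewrite inE.
- move=> y hy; have my : ~~ on (join b c) y by apply: contraL hy => /m2; rewrite -leqNgt.
  have ya : y != a by apply: contraTneq hy => ->; rewrite ma.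
  by move: hy; rewrite multE (negbTE my); apply: gtp => //; rewrite inE.
- by rewrite szN in gszt.
Qed.

(** Complete [k] concurrent lines of a plane to [d.+1] lines by the greedy choice:
    the new lines add the dimensions counted by [tri], and all of them together
    span the plane. *)
Lemma concurrent_dim x (ls0 : seq ln) : uniq ls0 -> (0 < size ls0 <= d.+1)%N ->
  (forall l, l \in ls0 -> inside l Pi /\ on l x) ->
  dimle (lvec ls0) (pvec Pi) 'C(d.+2 - size ls0, 2).
Proof.
case: ls0 => [//|m0 inits] u0 /andP[_ szk] l0.
have [m0in m0x] := l0 m0 (mem_head _ _).
have Px : Pi x by apply: m0in.
have [a ma ax] := line_other hd m0 x.
have Pa : Pi a by apply: m0in.
have [g0 g0in g0a] := plane_offline hd hPi Px.
(* some line through [x] other than [m0] *)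
have [g [gin gx gm0]] : exists g, [/\ inside g Pi, on g x & g != m0].
  have [e [f [ef g0e g0f]]] := line_two hd g0.
  have Pe : Pi e by apply: g0in.
  have Pf : Pi f by apply: g0in.
  have xe : x != e by apply: contra g0a => /eqP ->.
  have xf : x != f by apply: contra g0a => /eqP ->.
  case: (eqVneq (join x e) m0) => [je|]; last first.
    by move=> ne; exists (join x e); split=> //; [apply: plane_closed | apply: on_join1].
  exists (join x f); split; [exact: plane_closed | exact: on_join1 |].
  rewrite -je eq_sym; apply: join_ne => //; by rewrite (join_on ef g0e g0f).
have multi y : ~~ on m0 y -> y \notin [::] -> (mult inits y <= 1)%N.
  move=> ny _; rewrite /mult -size_filter; case E: [seq _ <- _ | _] => [//|e [//|f r]].
  have ef : e != f.
    have := filter_uniq (fun l => on l y) (subseq_uniq (subseq_cons inits m0) u0).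
    by rewrite E /= inE negb_or => /andP[/andP[]].
  have [ey ei] : on e y /\ e \in inits.
    by have := mem_head e (f :: r); rewrite -E mem_filter => /andP[].
  have [fy fi] : on f y /\ f \in inits.
    have : f \in e :: f :: r by rewrite !inE eqxx orbT.
    by rewrite -E mem_filter => /andP[].
  have [_ ex] := l0 e (mem_behead (s := m0 :: inits) ei).
  have [_ fx] := l0 f (mem_behead (s := m0 :: inits) fi).
  by case/negP: ny; rewrite (one_point ef ey ex fy fx).
have XP l y : l \in inits -> on l y -> on m0 y -> y \in [:: x].
  move=> li ly my; have [_ lx] := l0 l (mem_behead (s := m0 :: inits) li).
  rewrite inE; apply/eqP; apply: (one_point (l := l) (m := m0)) => //.
  by move: u0 => /= /andP[nm _]; apply: contra nm => /eqP <-.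
have s3 := num_s3 hd hS; have sd := size_S hd hS.
pose N := (d - size inits)%N.
have LN : (size inits + N = d)%N by rewrite /N subnKC.
have nT := num_pencil hd hS LN.
have [||||||etas [tp [dp [szN [gin' gun gbase gF gle3 gtp _ goff _ gszt]]]]] :=
  @greedy_exists K V d n C hd Pi m0 inits [:: x] [::] x g S uS hPi _ u0 m0x gx gm0 gin _ XP _ _ multi N _ _ nT.
- by move=> l /l0[].
- by rewrite inE.
- by [].
- by [].
- exact: ltnW s3.
- by rewrite /= add1n ltnS (leq_trans (leq_subr _ _) (ltnW sd)).
have multE y : mult ((m0 :: inits) ++ etas) y = (on m0 y + mult (inits ++ etas) y)%N by [].
have xe eta : eta \in etas -> ~~ on eta x.
  by move=> ee; apply/negP => ex; have [] := gbase _ _ ee ex m0x; rewrite inE eqxx.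
have allin m : m \in (m0 :: inits) ++ etas -> inside m Pi.
  by rewrite mem_cat => /orP[/l0[]|/gin'].
have dT : (size (x :: tp) <= s)%N.
  by rewrite /=; apply: (num_pencil_end hd hS LN); rewrite -szN.
have m2 y : on m0 y -> y != x -> (mult ((m0 :: inits) ++ etas) y <= 2)%N.
  move=> my yx; rewrite multE my add1n ltnS; case: (posnP (mult etas y)) => [e0|/mult_gt0[e ee ey]]; last first.
    by case: (gbase _ _ ee ey my).
  rewrite mult_cat e0 addn0; apply: leq_trans (_ : 0 <= _)%N => //.
  rewrite leqn0 eqn0Ngt; apply/negP => /mult_gt0[l li ly].
  by have := XP l y li ly my; rewrite inE (negbTE yx).
have full := chain_full hd uS hS hPi (T := x :: tp) (ls := (m0 :: inits) ++ etas) gun allin _ dT _.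
have h1 := @chain_dim K V d n C hd S uS hS Pi hPi (m0 :: inits) etas gun allin _.
have {}h1 := h1 _; rewrite -[(d.+2 - _)%N]/(d.+1 - size inits)%N.
have -> : 'C(d.+1 - size inits, 2) = tri d (size (m0 :: inits)) (size etas).
  by rewrite szN (tri_bin (d := d)) /= ?addSn ?LN //; congr 'C(_, _); rewrite /N subSn.
have le3 : forall eta y, eta \in etas -> on eta y -> (mult ((m0 :: inits) ++ etas) y <= 3)%N.
  move=> eta y ee ey; case: (boolP (on m0 y)) => [my|ny].
    by apply: (leq_trans (m2 y my _)) => //; apply: contraTneq ey => ->; apply: xe.
  by rewrite multE (negbTE ny); apply: gle3.
apply: dimle_mono (h1 le3) => [v|_ [p Pp ->]]; first exact: in_lspan.
apply: full => // [|y]; first by rewrite size_cat szN /= addSn LN.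
move=> hy; rewrite inE; case: (eqVneq y x) => [//|yx] /=; case: (boolP (on m0 y)) => [my|ny].
  by move: hy; rewrite ltnNge m2.
by move: hy; rewrite multE (negbTE ny); apply: gtp.
Qed.

End Systems.

(** * Hyperplanes of directions in general position *)

Section NoThree.
Variables (K : fieldType) (d : nat) (S : seq K).
Hypothesis hd : (2 <= d)%N.
Hypothesis uS : uniq S.
Hypothesis hS : (d ^ 3 <= size S ^ 2)%N.

Lemma three_roots (h : {poly K}) x y z : (size h <= 3)%N -> uniq [:: x; y; z] ->
  h.[x] = 0 -> h.[y] = 0 -> h.[z] = 0 -> h = 0.
Proof.
move=> szh u hx hy hz; apply: contraTeq szh => h0; rewrite -ltnNge.
by apply: (max_poly_roots (rs := [:: x; y; z])) => //=; rewrite /root hx hy hz !eqxx.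
Qed.

(** Among the quadratics [1 + a X + b X^2] with [a, b] in [S], one has no three
    equal ratios to [f] on [J]: each triple of [J] excludes at most one of them. *)
Lemma no_three (J : seq K) (f : {poly K}) : uniq J -> size J = d.+1 ->
  (forall c, c \in J -> f.[c] != 0) ->
  exists2 g : {poly K}, (size g <= 3)%N &
    forall r, (count (fun c => (g.[c] == r * f.[c])%R) J <= 2)%N.
Proof.
move=> uJ szJ fJ; apply: contrapT => none.
pose g (ab : 'I_(size S) * 'I_(size S)) : {poly K} := 1 + S`_ab.1 *: 'X + S`_ab.2 *: 'X^2.
have szg ab : (size (g ab) <= 3)%N.
  apply/leq_sizeP => j h; rewrite !coefD !coefZ coefX coefXn coef1.
  by case: j h => [|[|[|j]]] //= _; rewrite !mulr0 !addr0.
have ge ab i : (i < 3)%N -> (g ab)`_i = [:: 1; S`_ab.1; S`_ab.2]`_i.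
  rewrite !coefD !coefZ coefX coefXn coef1.
  by case: i => [|[|[|i]]] //= _; rewrite ?mulr0 ?mulr1 ?addr0 ?add0r.
have E ab : exists A : {set 'I_d.+1}, #|A| = 3 /\
    exists r, forall i, i \in A -> (g ab).[J`_i] = r * f.[J`_i].
  apply: contrapT => nA; apply: none; exists (g ab) => // r; rewrite leqNgt; apply/negP => h.
  pose A := [set i : 'I_d.+1 | (g ab).[J`_i] == r * f.[J`_i]]%SET.
  have cA : (2 < #|A|)%N.
    apply: leq_trans h _; rewrite -size_filter -(size_map (fun c => inord (index c J) : 'I_d.+1)).
    rewrite cardE; apply: uniq_leq_size.
      rewrite map_inj_in_uniq ?filter_uniq // => x y; rewrite !mem_filter => /andP[_ xJ] /andP[_ yJ].
      move/(congr1 (@nat_of_ord d.+1)); rewrite !inordK -?szJ ?index_mem // => e.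
      by rewrite -(nth_index 0 xJ) e nth_index.
    move=> _ /mapP[x + ->]; rewrite mem_filter => /andP[hx xJ].
    by rewrite mem_enum inE inordK -?szJ ?index_mem // nth_index.
  have [x [y [z [[xA yA zA] [xy yz zx]]]]] := card_gt2P cA.
  apply: nA; exists [set x; y; z]%SET; split.
    by rewrite -finset.setUA cardsU1 !inE negb_or xy (eq_sym x z) zx cards2 yz.
  exists r => i; rewrite !inE => /orP[/orP[]|] /eqP ->; apply/eqP.
  - by move: xA; rewrite inE.
  - by move: yA; rewrite inE.
  - by move: zA; rewrite inE.
case: (choice E) => A AP.
have Ainj : injective A.
  move=> ab ab' eA; have [cA [r rP]] := AP ab; have [_ [r' rP']] := AP ab'.
  have cA3 : (2 < #|A ab|)%N by rewrite cA.
  have [x [y [z [[xA yA zA] [xy yz zx]]]]] := card_gt2P cA3.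
  have Jn i j : i != j :> 'I_d.+1 -> J`_i != J`_j by rewrite nth_uniq ?szJ.
  have u3 : uniq [:: J`_x; J`_y; J`_z].
    by rewrite /= !inE negb_or !Jn // eq_sym.
  have h0 : r' *: g ab - r *: g ab' = 0.
    apply: (three_roots _ u3).
      rewrite (leq_trans (size_polyD _ _)) // geq_max size_polyN.
      by rewrite !(leq_trans (size_scale_leq _ _)).
    - by rewrite hornerD hornerN !hornerZ rP // rP' -?eA //; ring.
    - by rewrite hornerD hornerN !hornerZ rP // rP' -?eA //; ring.
    - by rewrite hornerD hornerN !hornerZ rP // rP' -?eA //; ring.
  have coefE i : (i < 3)%N -> r' * (g ab)`_i = r * (g ab')`_i.
    move=> i3; have := congr1 (fun p : {poly K} => p`_i) h0.
    by rewrite coefB !coefZ coef0 => /eqP; rewrite subr_eq0 => /eqP.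
  have rr : r' = r by have := coefE 0 isT; rewrite !ge //= !mulr1.
  have r0 : r != 0.
    apply/eqP => r0; have g0 : g ab = 0.
      by apply: (three_roots _ u3) => //; rewrite rP // r0 mul0r.
    by have := ge ab 0 isT; rewrite g0 coef0 /= => /eqP; rewrite eq_sym oner_eq0.
  have e1 : S`_ab.1 = S`_ab'.1.
    by have := coefE 1 isT; rewrite !ge //= rr => /(mulfI r0).
  have e2 : S`_ab.2 = S`_ab'.2.
    by have := coefE 2 isT; rewrite !ge //= rr => /(mulfI r0).
  move: e1 e2; clear -uS; case: ab ab' => a b [a' b'] /= e1 e2.
  have inj (k k' : 'I_(size S)) : S`_k = S`_k' -> k = k'.
    by move=> h; apply/val_inj/eqP; rewrite -(nth_uniq 0 (ltn_ord k) (ltn_ord k') uS) h.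
  by rewrite (inj _ _ e1) (inj _ _ e2).
have : (#|{: 'I_(size S) * 'I_(size S)}| <= #|[set B : {set 'I_d.+1} | #|B| == 3]%SET|)%N.
  rewrite -(card_codom Ainj); apply: subset_leq_card; apply/fintype.subsetP => B /codomP[ab ->].
  by rewrite inE; case: (AP ab) => ->.
rewrite card_prod card_ord card_draws card_ord => h.
have := bin_ffact d.+1 3; rewrite !ffactnS ffactn0 /= => hb.
move: hS h hb; rewrite !expnS !expn0 !muln1; move: hd; case: (d) => [|[|k]] // _ /=.
by rewrite /factorial /=; move: ('C(_, 3)) (size S) => c s; nia.
Qed.

End NoThree.

Section Moment.
Variables (K : fieldType) (V : lmodType K) (d n : nat) (C : cap V d n).
Hypothesis hd : (2 <= d)%N.
Notation pt := (@pt _ _ _ _ C).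
Notation ln := (@ln _ _ _ _ C).
Notation on := (@onl _ _ _ _ C).
Notation vr := (@vr _ _ _ _ C).
Notation par := (@par _ _ _ _ C).
Notation join := (@join _ _ _ _ C).
Notation rw := 'rV[K]_n.
Notation pvec := (@pvec _ _ _ _ C).
Notation dir := (@dir _ _ _ _ C).
Notation xe := (@xe _ _ _ _ C).
Implicit Types (p q x y z w : pt) (l : ln) (ls etas : seq ln) (U : set V) (f g : {poly K}).
Variable S : seq K.
Hypothesis uS : uniq S.
Hypothesis hS : (d ^ 3 <= size S ^ 2)%N.
Variable x : pt.

Lemma line_span U l : is_subspace U -> (forall y, on l y -> U (vr y)) -> forall t, U (par l t).
Proof.
move=> sU Uy; have [ps [szps ups psl]] := points_of_line hd l uS.
have sd := size_S hd hS.
have c1 y : (count_mem y ps <= 1)%N by rewrite count_uniq_mem //; case: (_ \in _).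
apply: (@line_full _ _ _ _ C U l ps) => //; first by rewrite szps ltnW.
- by move=> y; apply: leq_trans (c1 y) _.
- by move=> y /psl; apply: Uy.
- by move=> y v; rewrite ltnNge c1.
Qed.

(** A linear embedding of the polynomials of size at most [m] in the directions
    at [x]. The polynomials with root [c] form a hyperplane, again embedded by
    [sub psi c], and these hyperplanes are in general position. *)
Definition pset (psi : {poly K} -> rw) (m : nat) : set rw :=
  [set u | exists2 f : {poly K}, (size f <= m)%N & u = psi f].
Definition emb (psi : {poly K} -> rw) (m : nat) : Prop :=
  (forall a (f g : {poly K}), psi (a *: f + g) = a *: psi f + psi g) /\
  (forall f : {poly K}, (size f <= m)%N -> psi f = 0 -> f = 0).
Definition sub (psi : {poly K} -> rw) (c : K) (f : {poly K}) : rw := psi (('X - c%:P) * f).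

Lemma emb0 psi m : emb psi m -> psi 0 = 0.
Proof. by case=> lp _; have := lp (-1) 0 0; rewrite scaler0 addr0 => {1}->; rewrite scaleN1r addNr. Qed.

Lemma embZ psi m a f : emb psi m -> psi (a *: f) = a *: psi f.
Proof. by move=> e; case: (e) => lp _; have := lp a f 0; rewrite (emb0 e) !addr0. Qed.

Lemma emb_inj psi m f g : emb psi m -> (size f <= m)%N -> (size g <= m)%N -> psi f = psi g -> f = g.
Proof.
move=> [lp ip] szf szg e; apply/eqP; rewrite -subr_eq0; apply/eqP; apply: ip.
  by rewrite (leq_trans (size_polyD _ _)) // geq_max szf size_polyN szg.
by rewrite -scaleN1r addrC lp e scaleN1r addNr.
Qed.

Lemma size_XcM (c : K) f m : (size f <= m)%N -> (size (('X - c%:P) * f)%R <= m.+1)%N.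
Proof.
move=> szf; apply: leq_trans (size_polyMleq _ _) _; rewrite size_XsubC; exact: szf.
Qed.

Lemma emb_sub psi m c : emb psi m.+1 -> emb (sub psi c) m.
Proof.
move=> [lp ip]; split=> [a f g|f szf h].
  by rewrite /sub mulrDr -scalerAr lp.
have /eqP := ip _ (size_XcM c szf) h; rewrite mulf_eq0 polyXsubC_eq0 /=.
by move/eqP.
Qed.

Lemma pset_subspace psi m : emb psi m -> is_subspace (pset psi m).
Proof.
move=> e; have [lp _] := e; split=> [|a _ _ [f szf ->] [g szg ->]].
  by exists 0; rewrite ?size_poly0 ?(emb0 e).
exists (a *: f + g); rewrite ?lp // (leq_trans (size_polyD _ _)) // geq_max szg andbT.
exact: leq_trans (size_scale_leq _ _) szf.
Qed.

Lemma pset_sub psi m c f : emb psi m.+1 -> (size f <= m.+1)%N ->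
  pset (sub psi c) m (psi f) <-> f.[c] = 0.
Proof.
move=> e szf; split=> [[g szg /(emb_inj e szf (size_XcM c szg)) ->]|].
  by rewrite hornerM !hornerE subrr mul0r.
move/eqP/factor_theorem => [g gE]; exists g; last by rewrite /sub gE mulrC.
case: (eqVneq g 0) => [->|g0]; first by rewrite size_poly0.
by move: szf; rewrite gE size_Mmonic ?monicXsubC // size_XsubC addn2.
Qed.

Lemma pset_sub_incl psi m c : pset (sub psi c) m `<=` pset psi m.+1.
Proof. by move=> _ [f szf ->]; exists (('X - c%:P) * f) => //; apply: size_XcM. Qed.

Lemma xe_mono E E' : E `<=` E' -> xe x E `<=` xe x E'.
Proof. by move=> EE y [->|[u Du Eu]]; [left | right; exists u => //; apply: EE]. Qed.

Definition hset psi m (J : seq K) : set V :=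
  [set v | exists2 c, c \in J & pvec (xe x (pset (sub psi c) m)) v].

(** [d.+1] hyperplanes of directions, given by the roots in [J], span the space.
    A point [p] outside them is joined to another point by a line that meets them
    in [d.+1] points; [no_three] provides a line on which no three of these
    coincide, and at a point on two hyperplanes the tangents of both are
    available. *)
Lemma hset_spans psi m J : emb psi m.+1 -> (3 <= m.+1)%N -> uniq J -> size J = d.+1 ->
  pvec (xe x (pset psi m.+1)) `<=` lspan (hset psi m J).
Proof.
move=> e m3 uJ szJ _ [p Ep ->]; have [lp ip] := e.
have sU := @lspan_subspace K V (hset psi m J); set U := lspan _ in sU *.
have Uc c y : c \in J -> xe x (pset (sub psi c) m) y -> U (vr y).
  by move=> cJ Ey; apply: in_lspan; exists c => //; exists y.
have [c0 c0J] : exists c, c \in J by case: (J) szJ => // c ? _; exists c; rewrite mem_head.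
case: (eqVneq x p) => [xp|xp]; first by apply: (Uc c0) => //; left.
have [u Du] := dir_join hd xp; have sE := pset_subspace e.
have [f szf uE] := xe_dir hd sE Ep xp Du.
case: (pselect (exists2 c, c \in J & f.[c] = 0)) => [[c cJ fc]|nf].
  by apply: (Uc c) => //; right; exists u => //; rewrite uE; apply/pset_sub.
have fJ c : c \in J -> f.[c] != 0 by move=> cJ; apply/eqP => fc; apply: nf; exists c.
have [g szg g2] := no_three hd uS hS uJ szJ fJ.
have szg' : (size g <= m.+1)%N by apply: leq_trans szg m3.
have ngf a : g <> a *: f.
  move=> gE; have := g2 a; suff -> : count (fun c => g.[c] == a * f.[c]) J = size J by rewrite szJ; lia.
  by apply/eqP; rewrite -all_count; apply/allP => c _; rewrite gE hornerZ.
have t0 : psi g != 0.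
  by apply/eqP => /(ip _ szg') g0; apply: (ngf 0); rewrite g0 scale0r.
have [l Dl] := dir_onto x t0; have [lx _ _] := Dl.
have [y ly] := line_other hd l x; rewrite eq_sym => xy.
have ut a : psi g <> a *: u.
  rewrite uE -(embZ _ _ e) => /(emb_inj e szg') h; apply: (ngf a); apply: h.
  exact: leq_trans (size_scale_leq _ _) szf.
have Dy : dir x (join x y) (psi g) by rewrite (join_on xy lx ly).
have py : p != y.
  apply/eqP => py; rewrite -py in Dy.
  by have [a _] := dir_uniq hd Du Dy; apply: ut.
have nx : ~~ on (join p y) x.
  apply/negP => h; have e1 : join x p = join p y by apply: join_on => //; apply: on_join1.
  have e2 : join x y = join p y by apply: join_on => //; apply: on_join2.
  rewrite e1 in Du; rewrite e2 in Dy.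
  by have [a _] := dir_uniq hd Du Dy; apply: ut.
have [u' [t' [B [fB Du' Dt' BE BP]]]] := pencil_span hd xp xy py nx.
have [a1 a10 u'E] := dir_uniq hd Du Du'; have [a2 a20 t'E] := dir_uniq hd Dy Dt'.
have {}BE t : (t <= B)%MS <-> exists a b, t = a *: u + b *: psi g.
  rewrite BE; split=> [[a [b ->]]|[a [b ->]]].
    by exists (a * a1), (b * a2); rewrite u'E t'E !scalerA.
  by exists (a / a1), (b / a2); rewrite u'E t'E !scalerA !divfK.
(* the point of the line [p y] on the hyperplane of the root [c] *)
pose r c := g.[c] / f.[c].
have E c : exists q, c \in J -> on (join p y) q /\ x != q /\ dir x (join x q) (psi (g - r c *: f)).
  case: (boolP (c \in J)) => cJ; last by exists p.
  have h0 : psi (g - r c *: f) != 0.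
    apply/eqP => /(ip _ _) h; apply: (ngf (r c)); apply/eqP; rewrite -subr_eq0; apply/eqP/h.
    rewrite (leq_trans (size_polyD _ _)) // geq_max szg' size_polyN.
    exact: leq_trans (size_scale_leq _ _) szf.
  have [m' Dm'] := dir_onto x h0.
  have [|q lq mq] := (BP _ _ Dm').1.
    apply/BE; exists (- r c), 1; rewrite scale1r uE -(embZ _ _ e).
    by have := lp 1 ((- r c) *: f) g; rewrite !scale1r => <-; rewrite scaleNr addrC.
  have xq : x != q by apply: contra nx => /eqP ->.
  by exists q => _; split=> //; split=> //; rewrite (join_on (l := m') xq) //; case: Dm'.
case: (choice E) => mt mtP.
have szh c : (size (g - r c *: f)%R <= m.+1)%N.
  rewrite (leq_trans (size_polyD _ _)) // geq_max szg' size_polyN.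
  exact: leq_trans (size_scale_leq _ _) szf.
have mtc c : c \in J -> xe x (pset (sub psi c) m) (mt c).
  move=> cJ; have [lq [xq Dq]] := mtP c cJ; right; exists (psi (g - r c *: f)) => //.
  by apply/pset_sub => //; rewrite !hornerE divfK ?fJ // subrr.
have mt_inj c c' : c \in J -> c' \in J -> mt c = mt c' -> r c = r c'.
  move=> cJ cJ' eq; have [_ [_ Dc]] := mtP c cJ; have [_ [_ Dc']] := mtP c' cJ'.
  rewrite -eq in Dc'; have [a a0] := dir_uniq hd Dc Dc'.
  rewrite -(embZ _ _ e) => h1.
  have h := emb_inj e (szh c') (leq_trans (size_scale_leq _ _) (szh c)) h1.
  have h3 : g = r c' *: f + a *: (g - r c *: f) by rewrite -h addrC subrK.
  have : (1 - a) *: g = (r c' - a * r c) *: f.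
    by rewrite !scalerBl scale1r {1}h3 scalerBr !scalerA addrA addrAC addrK.
  case: (eqVneq a 1) => [->|a1n].
    rewrite subrr scale0r mul1r => /esym/eqP; rewrite scaler_eq0 subr_eq0 => /orP[/eqP //|/eqP f0].
    by have := fJ c cJ; rewrite f0 horner0 eqxx.
  have a1' : 1 - a != 0 by rewrite subr_eq0 eq_sym.
  move=> h2; case: (ngf ((1 - a)^-1 * (r c' - a * r c))).
  by rewrite -scalerA -h2 scalerA mulVf // scale1r.
pose ys := [seq mt c | c <- J].
have cy w : (count_mem w ys <= 2)%N.
  rewrite count_map; case: (posnP (count (preim mt (pred1 w)) J)) => [->//|].
  rewrite -has_count => /hasP[c cJ /= /eqP cw]; apply: leq_trans (g2 (r c)).
  rewrite -!size_filter; apply: uniq_leq_size; first exact: filter_uniq.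
  move=> c' ; rewrite !mem_filter /= => /andP[/eqP c'w cJ']; rewrite cJ' andbT.
  by rewrite (mt_inj c c') ?cw // divfK ?fJ.
have /onP[v <-] := on_join1 py.
apply: (@line_full _ _ _ _ C U (join p y) ys) => //.
- by rewrite size_map szJ.
- by move=> w /mapP[c cJ ->]; case: (mtP c cJ).
- by move=> w /mapP[c cJ ->]; apply: (Uc c) => //; apply: mtc.
move=> w v' ; rewrite count_map -size_filter; case Ef: [seq _ <- _ | _] => [//|c [//|c' rr]] _.
have cc' : c != c'.
  by have := filter_uniq (preim mt (pred1 w)) uJ; rewrite Ef /= inE negb_or => /andP[/andP[]].
have [wc cJ] : mt c = w /\ c \in J.
  by have := mem_head c (c' :: rr); rewrite -Ef mem_filter => /andP[/eqP].
have [wc' cJ'] : mt c' = w /\ c' \in J.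
  have : c' \in c :: c' :: rr by rewrite !inE eqxx orbT.
  by rewrite -Ef mem_filter => /andP[/eqP].
(* the hyperplanes of [c] and [c'] have different tangent spaces at [w] *)
have sEc k : is_subspace (pset (sub psi k) m) by apply: pset_subspace; apply: emb_sub.
have Xw : xe x (pset (sub psi c) m) w by rewrite -wc; apply: mtc.
have Xw' : xe x (pset (sub psi c') m) w by rewrite -wc'; apply: mtc.
have np k : k \in J -> ~ xe x (pset (sub psi k) m) p.
  move=> kJ Xp; have := xe_dir hd (sEc k) Xp xp Du; rewrite uE => /(pset_sub _ e szf) fk.
  by have := fJ k kJ; rewrite fk eqxx.
have szX (k : K) : (size ('X - k%:P)%R <= m.+1)%N by rewrite size_XsubC; apply: leq_trans m3.
have X0 : psi ('X - c%:P) != 0.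
  by apply/eqP => /(ip _ (szX c)) /eqP; rewrite polyXsubC_eq0.
have [la Da] := dir_onto x X0; have [lax _ _] := Da.
have [a laa] := line_other hd la x; rewrite eq_sym => xa.
have Xa : xe x (pset (sub psi c) m) a.
  by apply: (xe_line Da) => //; apply/pset_sub => //; rewrite !hornerE subrr.
have nXa : ~ xe x (pset (sub psi c') m) a.
  move=> h; have Da' : dir x (join x a) (psi ('X - c%:P)) by rewrite (join_on xa lax laa).
  have := xe_dir hd (sEc c') h xa Da' => /(pset_sub _ e (szX c)).
  by rewrite !hornerE => /eqP; rewrite subr_eq0 eq_sym (negbTE cc').
have pa : p != a by apply/eqP => pa; apply: (np c cJ); rewrite pa.
have jin : inside (join p a) (xe x (pset psi m.+1)).
  by apply: xe_inside => //; apply: xe_mono Xa; apply: pset_sub_incl.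
have [b jb Xb] : exists2 b, on (join p a) b & xe x (pset (sub psi c') m) b.
  apply: (hyper_meet hd sE _ jin) => _ _ [f1 szf1 ->] [f2 szf2 ->].
  case: (eqVneq f1.[c'] 0) => [h|h]; first by left; apply/pset_sub.
  right; exists (- (f2.[c'] / f1.[c'])); rewrite -lp; apply/pset_sub => //.
    by rewrite (leq_trans (size_polyD _ _)) // geq_max szf2 andbT (leq_trans (size_scale_leq _ _)).
  by rewrite !hornerE mulNr divfK // addNr.
have ab : a != b by apply/eqP => ab; apply: nXa; rewrite ab.
have wa : w != a by apply/eqP => wa; apply: nXa; rewrite -wa.
have wp : w != p by apply/eqP => wp; apply: (np c cJ); rewrite -wp.
have nw : ~~ on (join p a) w.
  apply/negP => jw; apply: (np c cJ); apply: (xe_closed hd (sEc c) Xw Xa wa).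
  by rewrite (join_on wa jw (on_join2 pa)); apply: on_join1.
have wb : w != b by apply: contra nw => /eqP ->.
have lw : on (join p y) w by rewrite -wc; case: (mtP c cJ).
move=> Tv; have := @tangent_plane _ _ _ _ C hd w a b p _ nw (on_join2 pa) jb (on_join1 pa) ab v'.
rewrite (join_on wp lw (on_join1 py)) => /(_ Tv).
apply: lspan_elim => // t [Tt|Tt]; have [t1 ->] := tg_par Tt; apply: line_span => // q jq.
- by apply: (Uc c) => //; apply: (xe_closed hd (sEc c) Xw Xa wa).
- by apply: (Uc c') => //; apply: (xe_closed hd (sEc c') Xw' Xb wb).
Qed.

End Moment.

(** * The dimension of a cap *)

Section Dimension.
Variables (K : fieldType) (V : lmodType K) (d n : nat) (C : cap V d n).
Hypothesis hd : (2 <= d)%N.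
Notation pt := (@pt _ _ _ _ C).
Notation ln := (@ln _ _ _ _ C).
Notation on := (@onl _ _ _ _ C).
Notation rw := 'rV[K]_n.
Notation lvec := (@lvec _ _ _ _ C).
Notation pvec := (@pvec _ _ _ _ C).
Notation dir := (@dir _ _ _ _ C).
Notation xe := (@xe _ _ _ _ C).
Notation plane := (@plane _ _ _ _ C).
Implicit Types (p q x y z w : pt) (l : ln) (ls etas : seq ln) (U : set V) (f g : {poly K}).
Variable S : seq K.
Hypothesis uS : uniq S.
Hypothesis hS : (d ^ 3 <= size S ^ 2)%N.

Section AtPoint.
Variable x : pt.
Notation hset := (@hset _ _ _ _ C x).

Lemma emb_plane (psi : {poly K} -> rw) : emb psi 2 -> exists2 B : 'M[K]_(2, n), row_free B &
  pset psi 2 = [set u | (u <= B)%MS].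
Proof.
move=> e; have [lp ip] := e.
have ne a : psi 'X <> a *: psi 1.
  rewrite -(embZ _ _ e) => /(emb_inj e); rewrite size_polyX => /(_ isT) h.
  have : (size (a *: 1 : {poly K}) <= 2)%N by rewrite (leq_trans (size_scale_leq _ _)) // size_poly1.
  move/h/(congr1 (fun p : {poly K} => p`_1)); rewrite coefX coefZ coef1 mulr0 => /eqP.
  by rewrite oner_eq0.
have p1 : psi 1 != 0.
  by apply/eqP => /ip; rewrite size_poly1 => /(_ isT)/eqP; rewrite oner_eq0.
exists (col_mx (psi 1) (psi 'X)); first exact: pair_free.
have split2 f : (size f <= 2)%N -> psi f = f`_0 *: psi 1 + f`_1 *: psi 'X.
  move=> szf; have {1}-> : f = f`_0 *: 1 + f`_1 *: 'X.
    apply/polyP => i; rewrite coefD !coefZ coef1 coefX.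
    by case: i => [|[|i]] /=; rewrite ?mulr1 ?mulr0 ?addr0 ?add0r //; apply: (leq_sizeP _ _ szf).
  by rewrite lp (embZ _ _ e).
apply/seteqP; split=> u /=.
  by move=> [f szf ->]; apply/pair_span; exists f`_0, f`_1; apply: split2.
move=> /pair_span[a [b ->]]; exists (a *: 1 + b *: 'X); last by rewrite lp (embZ _ _ e).
rewrite (leq_trans (size_polyD _ _)) // geq_max !(leq_trans (size_scale_leq _ _)) //.
  by rewrite size_polyX.
by rewrite size_poly1.
Qed.

(** Hyperplanes are added one after another: by induction on the dimension the
    next hyperplane adds a binomial number of dimensions to those it already
    shares with the hyperplanes in [J], and [d.+1] of them span the space. *)
Lemma moment_dim m (psi : {poly K} -> rw) (J : seq K) : emb psi m.+2 -> uniq J ->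
  {subset J <= S} -> (0 < size J <= d.+1)%N ->
  dimle (hset psi m.+1 J) (pvec (xe x (pset psi m.+2))) 'C(m.+2 + d - size J, m.+2).
Proof.
elim: m psi J => [|m IHm] psi J e uJ JS /andP[J0 Jd].
  have [B fB BE] := emb_plane e; have [lp ip] := e.
  have hPi : plane (xe x (pset psi 2)) by exists x, B; rewrite BE.
  have szX (c : K) : (size ('X - c%:P)%R <= 2)%N by rewrite size_XsubC.
  have X0 (c : K) : psi ('X - c%:P) != 0.
    by apply/eqP => /(ip _ (szX c)) /eqP; rewrite polyXsubC_eq0.
  have /choice[L LP] : forall c : K, exists l, dir x l (psi ('X - c%:P)).
    by move=> c; apply: dir_onto.
  have inL c : inside (L c) (xe x (pset (sub psi c) 1)).
    move=> y ly; apply: (xe_line (LP c)) => //.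
    by apply/pset_sub => //; rewrite !hornerE subrr.
  have -> : (2 + d - size J = d.+2 - size J)%N by rewrite add2n.
  have := @concurrent_dim _ _ _ _ C hd S uS hS _ hPi x [seq L c | c <- J].
  rewrite size_map => /(_ _ _ _) h; apply: dimle_mono (h _ _ _) => [v|v|||].
  - case=> l /mapP[c cJ ->] [t ->]; apply: (line_span hd uS hS); first exact: lspan_subspace.
    by move=> y ly; apply: in_lspan; exists c => //; exists y => //; apply: inL.
  - exact: in_lspan.
  - rewrite map_inj_in_uniq // => c c' cJ cJ' eL; have := LP c'; rewrite -eL => D'.
    have [a a0] := dir_uniq hd (LP c) D'; rewrite -(embZ _ _ e) => /(emb_inj e (szX c')) E.
    have := E (leq_trans (size_scale_leq _ _) (szX c)) => /(congr1 (fun p : {poly K} => p.[c])).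
    by rewrite !hornerE subrr mulr0 => /eqP; rewrite subr_eq0 => /eqP.
  - by rewrite J0.
  - move=> l /mapP[c cJ ->]; split; last by case: (LP c).
    by move=> y /inL; apply: xe_mono; apply: pset_sub_incl.
have [k kE] : exists k, k = (d.+1 - size J)%N by exists (d.+1 - size J)%N.
elim: k J kE uJ JS J0 Jd => [|k IHk] J kE uJ JS J0 Jd.
  have szJ : size J = d.+1 by apply/eqP; rewrite eqn_leq Jd -subn_eq0 -kE.
  apply: (dimle_le (leq0n _)); apply: dimle_sub.
  exact: (hset_spans hd uS hS).
have Jd' : (size J <= d)%N by rewrite -ltnS -subn_gt0 -kE.
have [c cS cJ] : exists2 c, c \in S & c \notin J.
  apply: contrapT => nc; have := size_S hd hS; rewrite ltnNge => /negP; apply.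
  apply: leq_trans Jd'; apply: uniq_leq_size => // c cS; apply: contraT => cJ.
  by case: nc; exists c.
have e' := emb_sub c e.
have h1 := IHm (sub psi c) J e' uJ JS; rewrite J0 Jd in h1.
have h2 : dimle (hset psi m.+2 (c :: J)) (pvec (xe x (pset psi m.+3))) 'C(m.+3 + d - (size J).+1, m.+3).
  apply: IHk => //=; first by rewrite subSS; move: kE; rewrite subSn // => -[].
    by rewrite cJ.
  by move=> c'; rewrite inE => /orP[/eqP ->|/JS].
have sub1 : hset (sub psi c) m.+1 J `<=` lspan (hset psi m.+2 J).
  move=> v [c' c'J [y Xy ->]]; apply: in_lspan; exists c' => //; exists y => //.
  apply: xe_mono Xy => _ [f szf ->]; exists (('X - c%:P) * f); first exact: size_XcM.
  by rewrite /sub mulrCA.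
have h3 : dimle (hset psi m.+2 J) (hset psi m.+2 (c :: J)) 'C(m.+2 + d - size J, m.+2).
  have := dimle_mono sub1 (@sub_lspan _ _ _) (h1 isT).
  move=> /(@dimleU _ _ _ _ (hset psi m.+2 J)) h; apply: dimle_mono (h _) => //; try exact: sub_lspan.
  move=> v [c']; rewrite inE => /orP[/eqP ->|c'J] Xv; apply: in_lspan; first by left.
  by right; exists c'.
have -> : 'C(m.+3 + d - size J, m.+3) =
    ('C(m.+2 + d - size J, m.+2) + 'C(m.+3 + d - (size J).+1, m.+3))%N.
  have -> : (m.+3 + d - size J = (m.+2 + d - size J).+1)%N.
    by rewrite addSn subSn // (leq_trans Jd') // leq_addl.
  by rewrite binS addSn subSS addnC.
exact: dimle_trans h3 h2.
Qed.

(** The dimensions added along a flag from a plane to the whole space. *)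
Lemma flag_dim m (psi : {poly K} -> rw) (c : K) : c \in S -> emb psi m.+2 ->
  exists2 k, (k + 'C(d.+2, 2) = 'C(m.+2 + d, m.+2))%N &
  dimle (pvec (xe x (pset (iter m (fun ps => sub ps c) psi) 2))) (pvec (xe x (pset psi m.+2))) k.
Proof.
move=> cS; elim: m psi => [|m IH] psi e.
  by exists 0%N; [rewrite add2n | apply: dimle_sub; apply: sub_lspan].
have [k kE hk] := IH _ (emb_sub c e).
exists (k + 'C(m.+3 + d - 1, m.+3))%N.
  rewrite addnAC kE [in RHS]addSn binS addnC; congr (_ + _)%N; by rewrite addSn subSS subn0.
rewrite iterSr; apply: dimle_trans hk _.
have JS : {subset [:: c] <= S} by move=> c'; rewrite inE => /eqP ->.
have h := @moment_dim m.+1 psi [:: c] e isT JS isT.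
apply: dimle_mono h; last exact: sub_lspan.
by move=> v [c' /[1!inE]/eqP -> Xv]; apply: in_lspan.
Qed.

End AtPoint.

(** The plane spans a space of the largest possible dimension, see [plane_dim]. *)
Definition full (Pi : set pt) : Prop := ~ dimle set0 (pvec Pi) 'C(d.+2, 2).-1.

Lemma plane_dim Pi : plane Pi -> dimle set0 (pvec Pi) 'C(d.+2, 2).
Proof.
move=> hPi; have [x [B [fB PE]]] := hPi.
have Px : Pi x by rewrite PE; left.
have [l lin _] := plane_offline hd hPi Px.
have [y [_ [_ ly _]]] := line_two hd l.
have h1 : dimle set0 (lvec [:: l]) d.+1.
  have h := @line_dim _ _ _ _ C hd S uS hS set0 l [::].
  rewrite subn0 in h; apply: dimle_mono (h _ _ _ _) => //.
  by move=> v [m]; rewrite inE => /eqP -> E; apply: in_lspan.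
have h2 : dimle (lvec [:: l]) (pvec Pi) 'C(d.+2 - 1, 2).
  apply: (concurrent_dim hd uS hS hPi (x := y)) => //.
  by move=> m; rewrite inE => /eqP ->.
have -> : 'C(d.+2, 2) = (d.+1 + 'C(d.+2 - 1, 2))%N by rewrite subn1 /= binS bin1 addnC.
exact: dimle_trans h1 h2.
Qed.

Lemma pvec_all : lspan (pvec [set: pt]) = [set: V].
Proof.
apply/seteqP; split=> // v _; apply: (@vr_span _ _ _ _ C) => [|p]; first exact: lspan_subspace.
by apply: in_lspan; exists p.
Qed.

Lemma xe_all x E : (forall u, E u) -> xe x E = [set: pt].
Proof.
move=> Eall; apply/seteqP; split=> // y _; case: (eqVneq x y) => [|xy]; first by left.
by have [u Du] := dir_join hd xy; right; exists u.
Qed.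

End Dimension.

Section Flags.
Variable K : fieldType.

Lemma iter_sub0 n m (psi : {poly K} -> 'rV[K]_n) (f : {poly K}) :
  iter m (fun ps => sub ps 0) psi f = psi ('X^m * f).
Proof.
elim: m f => [|m IH] f; first by rewrite expr0 mul1r.
by rewrite iterS /sub IH polyC0 subr0 mulrA -exprSr.
Qed.

(** Every plane of directions is the last term of a flag as in [flag_dim]. *)
Lemma flag_emb m (B : 'M[K]_(2, m.+2)) : row_free B ->
  exists psi : {poly K} -> 'rV[K]_m.+2, [/\ emb psi m.+2, forall u, pset psi m.+2 u &
    pset (iter m (fun ps => sub ps 0) psi) 2 = [set u | (u <= B)%MS]].
Proof.
move=> fB; have rB : \rank B = 2 by apply/eqP.
pose E := row_ebase B; have uE : E \in unitmx by apply: row_ebase_unit.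
pose D := col_ebase B; have uD : D \in unitmx by apply: col_ebase_unit.
have BE : B = D *m pid_mx 2 *m E by have := mulmx_ebase B; rewrite rB => {1}<-.
pose co (f : {poly K}) : 'rV[K]_m.+2 := \row_j f`_(m.+1 - j).
pose psi f := co f *m E.
exists psi; split.
- split=> [a f g|f szf h].
    rewrite /psi scalemxAl -mulmxDl; congr (_ *m _); apply/rowP => j.
    by rewrite !mxE coefD coefZ.
  have h0 : co f = 0 by rewrite -[co f](mulmxK uE) -/(psi f) h mul0mx.
  apply/polyP => i; rewrite coef0; case: (ltnP i m.+2) => im; last exact: (leq_sizeP _ _ szf).
  have lt : (m.+1 - i < m.+2)%N by rewrite ltnS leq_subr.
  have := congr1 (fun M : 'rV_m.+2 => M 0 (Ordinal lt)) h0.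
  by rewrite !mxE /= subKn.
- move=> u; pose w := u *m invmx E.
  exists (\poly_(i < m.+2) w 0 (inord (m.+1 - i))); first exact: size_poly.
  rewrite /psi -[u](mulmxKV uE); congr (_ *m _); apply/rowP => j; rewrite !mxE coef_poly.
  rewrite ltnS leq_subr subKn ?inord_val //; last by rewrite -ltnS.
  by rewrite /w mxE.
have coX (f : {poly K}) : (size f <= 2)%N -> co ('X^m * f) = (\row_(j < 2) f`_(1 - j)) *m pid_mx 2.
  move=> szf; apply/rowP => j; rewrite !mxE !big_ord_recl big_ord0 !mxE /= addr0 /bump /= !add1n !andbT.
  rewrite coefXnM; case: j => [[|[|j]] jm] /=.
  - by rewrite subn0 ltnNge leqnSn /= subSn // subnn mulr1 mulr0 addr0.
  - by rewrite subSS subn0 ltnn subnn mulr0 add0r mulr1.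
  - have m0 : (0 < m)%N by move: jm; rewrite !ltnS => jm; apply: leq_ltn_trans jm.
    by rewrite !mulr0 addr0 subSS ltn_subrL m0.
apply/seteqP; split=> u /=.
  move=> [f szf ->]; rewrite iter_sub0 /psi coX // BE.
  apply/submxP; exists ((\row_(j < 2) f`_(1 - j)) *m invmx D).
  by rewrite !mulmxA mulmxKV.
move=> /submxP[v ->]; pose w := v *m D.
exists (\poly_(i < 2) w 0 (inord (1 - i))); first exact: size_poly.
rewrite iter_sub0 /psi coX ?size_poly // BE !mulmxA -/w; congr (_ *m _ *m _).
apply/rowP => j; rewrite [RHS]mxE coef_poly ltnS leq_subr subKn ?inord_val //.
by rewrite -ltnS.
Qed.

(** The roots used by [flag_dim] can be translated, so that [0] is one of them. *)
Lemma shift_zero d (S : seq K) : (2 <= d)%N -> uniq S -> (d ^ 3 <= size S ^ 2)%N ->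
  exists S' : seq K, [/\ uniq S', (d ^ 3 <= size S' ^ 2)%N & 0 \in S'].
Proof.
move=> hd uS hS; have := num_s3 hd hS; case: S uS hS => [//|c S] uS hS _.
exists [seq x - c | x <- c :: S]; split; last by rewrite /= subrr mem_head.
  by rewrite map_inj_uniq // => x y /addIr.
by rewrite size_map.
Qed.

End Flags.

Section Fullness.
Variables (K : fieldType) (V : lmodType K) (d n : nat) (C : cap V d n) (S : seq K).
Hypothesis hd : (2 <= d)%N.
Hypothesis uS : uniq S.
Hypothesis hS : (d ^ 3 <= size S ^ 2)%N.
Hypothesis hn : (2 <= n)%N.

Lemma dim_over_plane (Pi : set (pt C)) : plane Pi ->
  exists2 k, (k + 'C(d.+2, 2) = 'C(n + d, d))%N & dimle (pvec Pi) [set: V] k.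
Proof.
case: n C hn Pi => [|[|m]] // C' _ Pi [x [B [fB PE]]].
have [psi [e all eB]] := flag_emb fB.
have [S' [uS' hS' S0]] := shift_zero hd uS hS.
have [k kE hk] := flag_dim hd uS' hS' x S0 e.
exists k; first by rewrite kE -bin_sub ?leq_addr // addKn.
by move: hk; rewrite eB -PE; apply: dimle_mono => //; [exact: sub_lspan | rewrite xe_all // pvec_all].
Qed.

(** A plane, and then a flag above it, bound the dimension of [V]. *)
Lemma finite_dim (p : pt C) : dimle set0 [set: V] 'C(n + d, d).
Proof.
have [B fB] : exists B : 'M[K]_(2, n), row_free B.
  exists (pid_mx 2); by rewrite /row_free rank_pid_mx.
have hPi : plane (xe p [set u | (u <= B)%MS]) by exists p, B.
have [k <- hk] := dim_over_plane hPi; rewrite addnC.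
exact: dimle_trans (plane_dim hd uS hS hPi) hk.
Qed.

(** Since [V] is large enough, no plane spans less than expected. *)
Lemma plane_full (Pi : set (pt C)) : dim_ge V 'C(n + d, d) -> plane Pi -> full Pi.
Proof.
move=> [b ib] hPi hf; have [k kE hk] := dim_over_plane hPi.
have := dimle_indep (dimle_trans hf hk) ib.
have : (0 < 'C(d.+2, 2))%N by rewrite bin_gt0.
by rewrite -kE; case: ('C(d.+2, 2)) => // c _ /=; rewrite addnS [(c + k)%N]addnC ltnn.
Qed.

End Fullness.

(** * Perspectivities *)

Section Perspectivity.
Variables (K : fieldType) (V : lmodType K) (d n : nat) (C : cap V d n).
Hypothesis hd : (2 <= d)%N.
Notation pt := (@pt _ _ _ _ C).
Notation ln := (@ln _ _ _ _ C).
Notation on := (@onl _ _ _ _ C).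
Notation vr := (@vr _ _ _ _ C).
Notation par := (@par _ _ _ _ C).
Notation tg := (@tgl _ _ _ _ C).
Notation tv := (@tv _ _ _ _ C).
Notation join := (@join _ _ _ _ C).
Notation rw := 'rV[K]_n.
Notation crd := (@crd _ _ _ _ C).
Notation mult := (@mult _ _ _ _ C).
Notation lvec := (@lvec _ _ _ _ C).
Notation pvec := (@pvec _ _ _ _ C).
Notation dir := (@dir _ _ _ _ C).
Notation xe := (@xe _ _ _ _ C).
Notation plane := (@plane _ _ _ _ C).
Implicit Types (p q x y z w : pt) (l m : ln) (ls etas : seq ln) (U : set V).
Variable S : seq K.
Hypothesis uS : uniq S.
Hypothesis hS : (d ^ 3 <= size S ^ 2)%N.
Variable M : nat.
Hypothesis hfin : dimle set0 [set: V] M.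
Hypothesis hfull : forall Pi, plane Pi -> full Pi.
Let s := size S.

Lemma tri_cat k a b : tri d k (a + b) = (tri d k a + tri d (k + a) b)%N.
Proof.
elim: a k => [|a IH] k; first by rewrite addn0.
by rewrite addSn /= IH addSnnS addnA.
Qed.

Lemma tri_three : 'C(d.+2, 2) = (tri d 0 d.-1 + 3)%N.
Proof.
rewrite -(tri_bin (k := 0) (add0n d.+1)).
have -> : d.+1 = (d.-1 + 2)%N by rewrite addn2 prednK // ltnW.
have e : d = d.-1.+1 by rewrite prednK // ltnW.
rewrite tri_cat add0n /= addn0; congr (_ + _)%N.
by rewrite [X in (X.+1 - _)%N]e [X in (X.+1 - _.+1)%N]e subSS !subSn // subnn.
Qed.

(** The coordinate of [y] on [l] relative to [y0]. *)
Definition lm l y0 y : K := lam (crd l y0) (crd l y).1 (crd l y).2.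

Lemma lm_self l y : lm l y y = 0. Proof. exact: lam_self. Qed.

Lemma lm_neq0 l y0 y : on l y0 -> on l y -> y0 != y -> lm l y0 y != 0.
Proof. exact: crd_neq. Qed.

(** A functional that vanishes on [etas] and at [es] with multiplicity vanishes
    on a line with [d.+1] zeros. *)
Lemma kill_line (Pi : set pt) (f : V -> K) etas m (es : seq pt) : plane Pi -> functional f ->
  (forall v, lvec etas v -> f v = 0) -> uniq etas -> (forall l, l \in m :: etas -> inside l Pi) ->
  m \notin etas -> (d < size etas + size es)%N ->
  (forall y, on m y -> (mult etas y + count_mem y es <= 2)%N) ->
  (forall y, y \in es -> on m y /\ f (vr y) = 0) ->
  (forall y v, y \in es -> (1 < mult etas y + count_mem y es)%N -> tg m y v -> f v = 0) ->
  forall t, f (par m t) = 0.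
Proof.
move=> hPi lf fe ue ein me sz c2 esP est.
have sk := functional_ker lf; have [ys [szy yl yc yB yT]] := meet_points hd hPi ue ein me.
have fL v : lspan (lvec etas) v -> f v = 0 by apply: lspan_elim sk _.
have ct y : y \in ys -> count_mem y (ys ++ es) = (mult etas y + count_mem y es)%N.
  by move=> yy; rewrite count_cat yc // yl.
apply: (@line_full _ _ _ _ C [set v | f v = 0] m (ys ++ es)) => //.
- by rewrite size_cat szy.
- by move=> y; rewrite mem_cat => /orP[/yl|/esP[]].
- move=> y; case: (boolP (y \in ys)) => [yy|ny]; first by rewrite ct //; apply: c2; apply: yl.
  rewrite count_cat (count_memPn ny); case: (boolP (y \in es)) => [yes|nes]; last first.
    by rewrite (count_memPn nes).
  by have [my _] := esP y yes; apply: leq_trans (c2 y my); rewrite leq_add2r.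
- by move=> y; rewrite mem_cat => /orP[/yB /fe|/esP[]].
- move=> y v; case: (boolP (y \in es)) => [yes|nes]; last first.
    by rewrite count_cat (count_memPn nes) addn0 => /yT h /h /fL.
  case: (boolP (y \in ys)) => [yy|ny]; first by rewrite ct // => h; apply: (est y).
  rewrite count_cat (count_memPn ny) add0n => h; apply: (est y) => //.
  by apply: leq_trans h _; apply: leq_addl.
Qed.

Lemma mult_notin etas y : (forall eta, eta \in etas -> ~~ on eta y) -> mult etas y = 0%N.
Proof.
by move=> h; apply/eqP; rewrite eqn0Ngt; apply/negP => /mult_gt0[e /h /negP].
Qed.

Lemma pull_functional (f : V -> K) l : functional f -> functional (f \o par l).
Proof. by move=> lf a u v; rewrite /= par_lin lf. Qed.

Lemma pull_vr (f : V -> K) l y : functional f -> on l y ->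
  (hev d (polyf (f \o par l)) (crd l y).1 (crd l y).2 == 0) = (f (vr y) == 0).
Proof.
move=> lf ly; have [_ [c c0 E]] := crdP ly.
rewrite polyf_rnc; last exact: pull_functional.
by rewrite /= E funZ // mulf_eq0 (negbTE c0).
Qed.

Section OneSystem.
Variables (x y1 y2 : pt) (l : ln).
Hypothesis y12 : y1 != y2.
Hypothesis ly1 : on l y1.
Hypothesis ly2 : on l y2.
Hypothesis nlx : ~~ on l x.
Variables (u1 u2 : rw).
Hypothesis D1 : dir x (join x y1) u1.
Hypothesis D2 : dir x (join x y2) u2.

(** The idea of all the linear forms below: [d.-1] lines [etas] in general position
    and the vertices [x], [y1], [y2] impose independent conditions, because the
    plane is full. Let [p1] and [p2] vanish on [etas], at [x], and at [y2] and
    [y1]. On [l] both are products of known linear factors, up to scalars, hence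
    a combination that vanishes at [y] is explicit. It vanishes on [x y], on
    account of [d.+1] zeros; its value at a tangent vector of [x y] then gives the
    direction of this line in terms of [u1] and [u2]. The points [y] for which
    [x y] passes through a triple point are excluded. *)
Lemma one_system : exists (al be : K) (tp : seq pt), [/\ al != 0, be != 0, (2 * size tp <= s - 2)%N &
  forall y, on l y -> (forall t, t \in tp -> t != x -> ~~ on (join x y) t) ->
    dir x (join x y) ((al * lm l y2 y) *: u1 + (be * lm l y1 y) *: u2)].
Proof.
have lJ := join_on y12 ly1 ly2.
have xne y : on l y -> x != y by move=> ly; apply: contra nlx => /eqP ->.
have xy1 := xne _ ly1; have xy2 := xne _ ly2.
have [B fB BP] := pencil hd nlx; pose Pi := xe x [set u | (u <= B)%MS].
have hPi : plane Pi by exists x, B.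
have sB := row_subspace B.
have dB m u q : dir x m u -> on l q -> on m q -> (u <= B)%MS by move=> Dm lq mq; apply/(BP _ _ Dm); exists q.
have lin : inside l Pi.
  move=> y ly; have [u Du] := dir_join hd (xne _ ly); right; exists u => //=.
  by apply: (dB _ _ _ Du ly); apply: on_join2; apply: xne.
have Px : Pi x by left.
have [P1 P2] : Pi y1 /\ Pi y2 by split; apply: lin.
have nx : ~~ on (join y1 y2) x by rewrite lJ.
have dd : (d.-1 <= d)%N by apply: leq_pred.
have [etas [tp]] := triangle_system hd uS hS hPi Px P1 P2 y12 nx dd.
cbv zeta => -[szN un lsin nv [m3 mtp m2 szt]].
rewrite lJ in un lsin m3 mtp m2; set ls := [:: l, _, _ & etas] in un lsin m3 mtp m2.
have multE y : mult ls y = (on l y + (on (join x y1) y + (on (join x y2) y + mult etas y)))%N by [].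
have ein m : m \in etas -> inside m Pi by move=> me; apply: lsin; rewrite !inE me !orbT.
have jin y : on l y -> inside (join x y) Pi.
  by move=> ly; apply: plane_closed => //; [apply: lin | apply: xne].
move: (un) => /= /and4P[nl n1 n2 ue]; rewrite !inE !negb_or in nl n1.
have [/andP[lab /andP[lac lne]] /andP[abac ane]] := (nl, n1).
have e0 v : (forall eta, eta \in etas -> ~~ on eta v) -> mult etas v = 0%N by apply: mult_notin.
have ex : mult etas x = 0%N by apply: e0 => e /nv[].
have ey1 : mult etas y1 = 0%N by apply: e0 => e /nv[].
have ey2 : mult etas y2 = 0%N by apply: e0 => e /nv[].
have el y : on l y -> (mult etas y <= 1)%N.
  by move=> ly; have := m2 y ly; rewrite multE ly add1n ltnS; apply: leq_trans; rewrite !addnA leq_addl.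
have e1 y : on (join x y1) y -> (mult etas y <= 2)%N.
  by move=> h; have := m3 y; rewrite multE h addnCA add1n ltnS; apply: leq_trans; rewrite !addnA leq_addl.
have e2 y : on (join x y2) y -> (mult etas y <= 2)%N.
  move=> h; have := m3 y; rewrite multE h (addnCA (on (join x y1) y)) addnCA add1n ltnS.
  by apply: leq_trans; rewrite !addnA leq_addl.
have dS : d = d.-1.+1 by rewrite prednK //; apply: ltnW.
pose R : set V := lvec etas.
have dimR : dimle set0 R (tri d 0 d.-1).
  have h := @chain_dim _ _ _ _ C hd S uS hS Pi hPi [::] etas ue ein.
  rewrite -szN; apply: dimle_mono (h _) => [v [m]|v|eta y ee ey] //; first exact: in_lspan.
  by apply: leq_trans (m3 y); rewrite multE /= !addnA leq_addl.
have triE : 'C(d.+2, 2) = (tri d 0 d.-1 + 3)%N by apply: tri_three.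
have szt2 : (2 * size tp <= s - 2)%N.
  apply: (arith_triple _ szt); last exact: num_triangle.
  by apply: ltnW; apply: (num_s3 hd hS).
have szts : (size tp <= s)%N.
  by apply: leq_trans (leq_trans szt2 (leq_subr _ _)); rewrite mul2n -addnn leq_addl.
(* adjoining the three vertices to [etas] gives the span of the plane *)
have spans v1 v2 v3 : [:: v1; v2; v3] =i [:: y1; y2; x] ->
    forall p, Pi p -> lspan (R `|` [set vr v1; vr v2; vr v3]) (vr p).
  move=> vE p Pp; set W := lspan _; have sW : is_subspace W by apply: lspan_subspace.
  have Wv v : v \in [:: y1; y2; x] -> W (vr v).
    rewrite -vE !inE => /or3P[] /eqP ->; apply: in_lspan; right; by [left; left|left; right|right].
  have WR v : R v -> W v by move=> Rv; apply: in_lspan; left.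
  have WRs v : lspan R v -> W v by apply: lspan_elim.
  have lineW m v v' : v != v' -> m \notin etas -> inside m Pi -> on m v -> on m v' ->
      W (vr v) -> W (vr v') -> mult etas v = 0%N -> mult etas v' = 0%N ->
      (forall y, on m y -> (mult etas y <= 2)%N) -> forall t, W (par m t).
    move=> vv me min mv mv' Wv1 Wv1' e e' mm.
    have [|ys [szy yl yc yB yT]] := meet_points hd hPi ue _ me (l := m).
      by move=> k; rewrite inE => /orP[/eqP ->|/ein].
    have nys k : mult etas k = 0%N -> k \notin ys.
      by move=> k0; apply/negP => kys; move: (kys); rewrite -has_pred1 has_count yc ?yl // k0.
    have ct y : count_mem y (ys ++ [:: v; v']) = (count_mem y ys + ((v == y) + (v' == y)))%N.
      by rewrite count_cat /= addn0.
    apply: (@line_full _ _ _ _ C W m (ys ++ [:: v; v'])) => //.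
    - by rewrite size_cat szy szN addn2 -dS.
    - by move=> y; rewrite mem_cat mem_seq2 => /orP[/yl //|/orP[] /eqP ->].
    - move=> y; rewrite ct; case: (boolP (y \in ys)) => [yy|ny]; last first.
        by rewrite (count_memPn ny); case: (v == y); case: (v' == y).
      have [k1 k2] : v != y /\ v' != y.
        by split; apply: contraTneq yy => <-; apply: nys.
      by rewrite (negbTE k1) (negbTE k2) yc ?yl // addn0; apply: mm; apply: yl.
    - by move=> y; rewrite mem_cat mem_seq2 => /orP[/yB /WR //|/orP[] /eqP ->].
    - move=> y w; rewrite ct; case: (boolP (y \in ys)) => [yy|ny].
        have [k1 k2] : v != y /\ v' != y by split; apply: contraTneq yy => <-; apply: nys.
        by rewrite (negbTE k1) (negbTE k2) addn0 => /yT h /h /WRs.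
      rewrite (count_memPn ny); case: (eqVneq v y) => [q1|_]; case: (eqVneq v' y) => [q2|_] //.
      by move: vv; rewrite q1 q2 eqxx.
  have Wl := lineW l y1 y2 y12 lne lin ly1 ly2 (Wv y1 _) (Wv y2 _) ey1 ey2 _.
  have {}Wl := Wl _ _ (fun y ly => leq_trans (el y ly) (leqnSn 1)).
  have W1 := lineW (join x y1) x y1 xy1 ane (jin _ ly1) (on_join1 xy1) (on_join2 xy1) (Wv x _) (Wv y1 _) ex ey1 _.
  have {}W1 := W1 _ _ e1.
  have in1 : y1 \in [:: y1; y2; x] by rewrite !inE eqxx.
  have in2 : y2 \in [:: y1; y2; x] by rewrite !inE eqxx orbT.
  have in3 : x \in [:: y1; y2; x] by rewrite !inE eqxx !orbT.
  have h := @chain_full _ _ _ _ C hd S uS hS Pi hPi [:: l, join x y1 & etas] tp _ _ _ szts _ p Pp.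
  have : lspan (lvec [:: l, join x y1 & etas]) (vr p).
    apply: h => [|m|/=|y hy].
    - by rewrite /= !inE negb_or lab lne ane ue.
    - rewrite !inE => /or3P[/eqP ->|/eqP ->|/ein] //; exact: jin.
    - by rewrite szN -dS.
    - apply: mtp; apply: leq_trans hy _.
      by rewrite multE /= leq_add2l leq_add2l leq_addl.
  apply: lspan_elim => // v [m]; rewrite !inE => /or3P[/eqP ->|/eqP ->|me] [t ->].
  - exact: Wl.
  - exact: W1.
  - by apply: WR; exists m => //; exists t.
have indep v1 v2 v3 : [:: v1; v2; v3] =i [:: y1; y2; x] ->
    ~ lspan (R `|` [set vr v2; vr v3]) (vr v1).
  move=> vE h; apply: (hfull hPi); rewrite triE addn3 /=.
  have h2 : dimle R (pvec Pi) 2.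
    exists [:: vr v2; vr v3]; split=> // _ [p Pp ->].
    have sW := @lspan_subspace K V (R `|` [set` [:: vr v2; vr v3]]).
    have e : lspan (R `|` [set vr v2; vr v3]) `<=` lspan (R `|` [set` [:: vr v2; vr v3]]).
      apply: lspan_mono => v [Rv|[->|->]]; [by left | |]; right; by rewrite /= !inE eqxx ?orbT.
    apply: lspan_elim (spans v1 v2 v3 vE p Pp) => // v [Rv|[[->|->]|->]].
    + by apply: in_lspan; left.
    + exact: e.
    + by apply: in_lspan; right; rewrite /= !inE eqxx.
    + by apply: in_lspan; right; rewrite /= !inE eqxx orbT.
  by have := dimle_trans dimR h2; rewrite addn2.

(* functionals vanishing on [etas], at [x] and at one of [y1], [y2] *)
have sep v1 v2 v3 : [:: v1; v2; v3] =i [:: y1; y2; x] ->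
    exists f, [/\ functional f, forall v, R v -> f v = 0, f (vr v2) = 0, f (vr v3) = 0 & f (vr v1) != 0].
  move=> vE; have [f [lf fU fv]] := functional_sep hfin (@lspan_subspace _ _ _) (indep _ _ _ vE).
  exists f; split=> //; last by rewrite fv oner_neq0.
  - by move=> v Rv; apply: fU; apply: in_lspan; left.
  - by apply: fU; apply: in_lspan; right; left.
  - by apply: fU; apply: in_lspan; right; right.
have [p1 [lp1 p1R p12 p1x p11]] := sep y1 y2 x (fun _ => erefl _).
have [p2 [lp2 p2R p21 p2x p22]] := sep y2 y1 x ltac:(by move=> v; rewrite !inE orbCA).
have lein m : m \in l :: etas -> inside m Pi by rewrite in_cons => /orP[/eqP ->|/ein].
have [ys [szy yl yc yB yT]] := meet_points hd hPi ue lein lne.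
have c1 y : (count_mem y ys <= 1)%N.
  case: (boolP (y \in ys)) => [yy|ny]; last by rewrite (count_memPn ny).
  by rewrite yc ?yl // el // yl.
pose z := crd l; pose Q := \prod_(y <- ys) lamp (z y).
have szQ : (size Q <= d)%N by apply: leq_trans (size_prod_lamp _ _) _; rewrite szy szN -dS.
(* the restriction to [l] of a functional vanishing on [etas] and at [v] *)
have fac v (f : V -> K) : on l v -> mult etas v = 0%N -> functional f -> (forall w : V, R w -> f w = 0) ->
    f (vr v) = 0 -> exists k, polyf (f \o par l) = k *: (lamp (z v) * Q).
  move=> lv ev lf fR fv.
  have nv' : v \notin ys by apply/negP => vy; move: (vy); rewrite -has_pred1 has_count yc // ev.
  have cv y : (count_mem y (v :: ys) <= 1)%N.
    rewrite /=; case: (eqVneq v y) => [<-|_]; last by rewrite add0n.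
    by rewrite (count_memPn nv').
  have inl y : y \in v :: ys -> on l y by rewrite in_cons => /orP[/eqP ->|/yl].
  have zz : zpts z (v :: ys).
    split=> [y /inl|y y' /inl h /inl|y]; [exact: crd0 | exact: crd_neq | exact: leq_trans (cv y) _].
  have ze : zero_at d (polyf (f \o par l)) z (v :: ys).
    move=> y yy; split; last by rewrite ltnNge cv.
    apply/eqP; rewrite pull_vr ?inl //; move: yy; rewrite in_cons => /orP[/eqP ->|/yB /fR ->] //.
    by rewrite fv.
  have szl : (size (v :: ys) <= d)%N by rewrite /= szy szN -dS.
  have [q szq qE] := form_factor zz szl (size_polyf _) ze.
  exists q`_0; rewrite qE big_cons -/Q mulrC -mul_polyC; congr (_ * _).
  by apply: size1_polyC; move: szq; rewrite /= szy szN -dS subnn.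
have [k1 P1E] := fac y2 p1 ly2 ey2 lp1 p1R p12.
have [k2 P2E] := fac y1 p2 ly1 ey1 lp2 p2R p21.
have k10 : k1 != 0.
  apply: contraNneq p11 => k0; rewrite -(pull_vr lp1 ly1) P1E k0 scale0r.
  by rewrite /hev big1 // => j _; rewrite coef0 mul0r.
have k20 : k2 != 0.
  apply: contraNneq p22 => k0; rewrite -(pull_vr lp2 ly2) P2E k0 scale0r.
  by rewrite /hev big1 // => j _; rewrite coef0 mul0r.
have key y : on l y -> (forall t, on (join x y) t -> (mult etas t <= 2)%N) ->
    forall u, dir x (join x y) u -> k2 * lm l y1 y * p1 (tv x u) = k1 * lm l y2 y * p2 (tv x u).
  move=> ly gm u Du; have xy := xne _ ly; have jmx := on_join1 xy; have jmy := on_join2 xy.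
  pose f v := (k2 * lm l y1 y) * p1 v - (k1 * lm l y2 y) * p2 v.
  have lf : functional f by move=> a v w; rewrite /f lp1 lp2; ring.
  have fR v : R v -> f v = 0 by move=> Rv; rewrite /f p1R // p2R // !mulr0 subr0.
  have pfE : polyf (f \o par l) =
      (k1 * k2) *: ((lm l y1 y *: lamp (z y2) - lm l y2 y *: lamp (z y1)) * Q).
    transitivity ((k2 * lm l y1 y) *: polyf (p1 \o par l) - (k1 * lm l y2 y) *: polyf (p2 \o par l)).
      apply/polyP => i; rewrite coefB !coefZ !coef_poly; case: ltnP => _ //.
      by rewrite !mulr0 subr0.
    by rewrite P1E P2E -!mul_polyC !polyCM; ring.
  have L0 : hev 1 (lm l y1 y *: lamp (z y2) - lm l y2 y *: lamp (z y1)) (z y).1 (z y).2 = 0.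
    rewrite -scaleN1r hevD !hevZ !hev_lamp1 /lm /z; ring.
  have szL : (size (lm l y1 y *: lamp (z y2) - lm l y2 y *: lamp (z y1))%R <= 2)%N.
    apply: leq_trans (size_polyD _ _) _; rewrite geq_max size_polyN.
    by apply/andP; split; apply: leq_trans (size_scale_leq _ _) (size_lamp _).
  have [r szr rE] := hev_factor szL (crd0 ly) L0.
  have pfE2 : polyf (f \o par l) = lamp (z y) * ((k1 * k2) *: (r * Q)).
    by rewrite pfE rE -!mul_polyC; ring.
  have szrQ : (size ((k1 * k2) *: (r * Q))%R <= d)%N.
    rewrite (leq_trans (size_scale_leq _ _)) // (size1_polyC szr) mul_polyC.
    exact: leq_trans (size_scale_leq _ _) szQ.
  have fy : f (vr y) = 0.
    apply/eqP; rewrite -(pull_vr lf ly) pfE2 {1}dS hev_lam -?dS //.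
    by rewrite lam_self mul0r.
  have ftl : y \in ys -> forall v, tg l y v -> f v = 0.
    move=> yy _ [w /rnc_tangentP[c [a [b ->]]] ->].
    have lfl := pull_functional l lf.
    rewrite parD parZ funD // funZ //.
    have -> : f (par l (rnc_vec d (crd l y).1 (crd l y).2)) = 0.
      by have [_ [e e0' ->]] := crdP ly; rewrite funZ // fy mulr0.
    rewrite mulr0 add0r -[f _]/((f \o par l) _) -polyf_drnc // pfE2.
    have QE : Q = lamp (z y) * \prod_(i <- rem y ys) lamp (z i) by rewrite /Q (big_rem y).
    have d2 : d = d.-2.+2 by case: (d) hd => [|[|]].
    have szQ' : (size ((k1 * k2) *: (r * \prod_(i <- rem y ys) lamp (z i)))%R <= d.-2.+1)%N.
      rewrite (leq_trans (size_scale_leq _ _)) // (size1_polyC szr) mul_polyC.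
      apply: leq_trans (size_scale_leq _ _) _; apply: leq_trans (size_prod_lamp _ _) _.
      by rewrite size_rem // szy szN.
    have -> : (k1 * k2) *: (r * Q) = lamp (z y) * ((k1 * k2) *: (r * \prod_(i <- rem y ys) lamp (z i))).
      by rewrite QE -!mul_polyC; ring.
    have szQ2 := @size_lampM K (z y) _ _ szQ'.
    rewrite [in dhev d]d2 dhev_lam // hev_lam // !lam_self; ring.
  have fx : f (vr x) = 0 by rewrite /f p1x p2x !mulr0 subr0.
  have jin' := jin y ly.
  have jne : join x y \notin etas by apply/negP => /nv[]; rewrite jmx.
  have min m : m \in join x y :: etas -> inside m Pi by rewrite in_cons => /orP[/eqP ->|/ein].
  have f0 : forall t, f (par (join x y) t) = 0.
    apply: (kill_line (es := [:: x; y]) hPi lf fR ue min jne).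
    - by rewrite szN addn2 -dS.
    - move=> t jt /=; rewrite addn0; case: (eqVneq x t) => [<-|xt].
        by rewrite ex eq_sym (negbTE xy).
      case: (eqVneq y t) => [<-|_]; last by rewrite addn0; apply: gm.
      by rewrite add0n addn1 ltnS el.
    - by move=> t; rewrite mem_seq2 => /orP[] /eqP ->.
    - move=> t v; rewrite mem_seq2 => /orP[] /eqP -> /=.
        by rewrite ex eqxx eq_sym (negbTE xy).
      rewrite (negbTE xy) eqxx addn0 add0n addn1 ltnS => my; case: (mult_gt0 my) => e ee ey Tv.
      have yy : y \in ys by rewrite -has_pred1 has_count yc.
      have le : l != e by apply: contraNneq lne => ->.
      have h := plane_tangent hd hPi lin (ein _ ee) jin' le ly ey jmy Tv.
      apply: (lspan_elim (functional_ker lf) _ h).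
      by move=> w [Tw|Tw]; [exact: ftl | apply: fR; apply: lvec_tg ee Tw].
  have [w E] : exists w : 'rV[K]_d.+1, tv x u = par (join x y) w by case: Du => _ _ /tg_par.
  by have := f0 w; rewrite -E /f => /eqP; rewrite subr_eq0 => /eqP.
have P21 : p2 (tv x u1) = 0.
  have := key y1 ly1 e1 u1 D1; rewrite lm_self mulr0 mul0r => /esym/eqP.
  by rewrite !mulf_eq0 (negbTE k10) (negbTE (lm_neq0 ly2 ly1 _)) ?(eq_sym y2) //= => /eqP.
have P12 : p1 (tv x u2) = 0.
  have := key y2 ly2 e2 u2 D2; rewrite lm_self mulr0 mul0r => /eqP.
  by rewrite !mulf_eq0 (negbTE k20) (negbTE (lm_neq0 ly1 ly2 _)) //= => /eqP.
(* a functional that also vanishes on the tangent at [x] vanishes on the line *)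
have nz (f : V -> K) y u : on l y -> (forall t, on (join x y) t -> (mult etas t <= 2)%N) ->
    functional f -> (forall v : V, R v -> f v = 0) -> f (vr x) = 0 -> dir x (join x y) u ->
    f (tv x u) = 0 -> f (vr y) = 0.
  move=> ly gm lf fR fx Du fu; have xy := xne _ ly.
  have jne : join x y \notin etas by apply/negP => /nv[]; rewrite (on_join1 xy).
  have min m : m \in join x y :: etas -> inside m Pi.
    by rewrite in_cons => /orP[/eqP ->|/ein] //; apply: jin.
  have /onP[t <-] := on_join2 xy.
  apply: (kill_line (es := [:: x; x]) hPi lf fR ue min jne).
  - by rewrite szN addn2 -dS.
  - move=> t' jt /=; case: (eqVneq x t') => [<-|_]; first by rewrite ex.
    by rewrite !addn0; apply: gm.
  - by move=> t'; rewrite mem_seq2 orbb => /eqP ->; split=> //; apply: on_join1.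
  - move=> t' v; rewrite mem_seq2 orbb => /eqP -> _ /(tg_dir hd Du)[a [b ->]].
    by rewrite lf fx mulr0 add0r funZ // fu mulr0.
have P11 : p1 (tv x u1) != 0.
  by apply: contraNneq p11 => h; apply/eqP; apply: (nz p1 y1 u1).
have P22 : p2 (tv x u2) != 0.
  by apply: contraNneq p22 => h; apply/eqP; apply: (nz p2 y2 u2).
exists (k1 * p2 (tv x u2)), (k2 * p1 (tv x u1)), tp; split; rewrite ?mulf_neq0 //.
move=> y ly good; have xy := xne _ ly.
have gm t : on (join x y) t -> (mult etas t <= 2)%N.
  move=> jt; case: (eqVneq t x) => [->|tx]; first by rewrite ex.
  rewrite leqNgt; apply/negP => h.
  have tt : t \in tp by apply: mtp; apply: leq_trans h _; rewrite multE !addnA leq_addl.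
  by have := good t tt tx; rewrite jt.
have [u Du] := dir_join hd xy.
have u1B := dB _ _ _ D1 ly1 (on_join2 xy1); have u2B := dB _ _ _ D2 ly2 (on_join2 xy2).
have [_ u10 _] := D1.
have ne12 := dir_indep hd xy1 xy2 y12 nx D1 D2.
have /(pencil_dim fB u1B u2B u10 ne12)[a [b uE]] := dB _ _ _ Du ly (on_join2 xy).
have HK := key y ly gm u Du.
rewrite uE !tv_lin !tvZ lp1 lp2 (funZ b _ lp1) (funZ b _ lp2) P12 P21 !mulr0 addr0 add0r in HK.
set al := k1 * p2 (tv x u2); set be := k2 * p1 (tv x u1).
have {}HK : be * lm l y1 y * a = al * lm l y2 y * b.
  transitivity (k2 * lm l y1 y * (a * p1 (tv x u1))); first by rewrite /be; ring.
  by rewrite HK /al; ring.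
have al0 : al != 0 by rewrite mulf_neq0.
have be0 : be != 0 by rewrite mulf_neq0.
clearbody al be.
have [mu mu0 [Ea Eb]] : exists2 mu, mu != 0 & a = mu * (al * lm l y2 y) /\ b = mu * (be * lm l y1 y).
  have ab0 : (a != 0) || (b != 0).
    rewrite -negb_and; apply/negP => /andP[/eqP a0 /eqP b0]; case: Du => _ /eqP + _; apply.
    by rewrite uE a0 b0 !scale0r addr0.
  case: (eqVneq y y2) => [yy|yy2].
    have l1 : lm l y1 y != 0 by rewrite yy lm_neq0.
    move: HK; rewrite yy lm_self mulr0 mul0r -yy => /eqP.
    rewrite !mulf_eq0 (negbTE be0) (negbTE l1) /= => /eqP a0.
    rewrite a0 eqxx /= in ab0; exists (b / (be * lm l y1 y)).
      by rewrite mulf_neq0 ?invr_neq0 ?mulf_neq0.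
    by rewrite a0 divfK ?mulf_neq0 // mulr0.
  have l2 : lm l y2 y != 0 by rewrite lm_neq0 // eq_sym.
  have a0 : a != 0.
    apply: contraTneq ab0 => a0; rewrite a0 eqxx /= negbK; move: HK; rewrite a0 mulr0 => /esym/eqP.
    by rewrite !mulf_eq0 (negbTE al0) (negbTE l2) /= => /eqP ->.
  exists (a / (al * lm l y2 y)); first by rewrite mulf_neq0 ?invr_neq0 ?mulf_neq0.
  split; first by rewrite divfK ?mulf_neq0.
  apply: (mulfI (mulf_neq0 al0 l2)); rewrite -HK; field.
  by rewrite ?al0 ?l2.
have -> : (al * lm l y2 y) *: u1 + (be * lm l y1 y) *: u2 = mu^-1 *: u.
  by rewrite uE Ea Eb scalerDr !scalerA !mulKf.
by apply: dirZ => //; rewrite invr_neq0.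
Qed.

End OneSystem.

(** Perspectivities are projective: the direction of [x y] depends linearly on
    the parameter of [y] on [l]. A point that is bad for the system of [y1] and
    [y2] is a base point of another system; the two descriptions agree at two
    common good points, which determines the constants. *)
Lemma perspectivity x l : ~~ on l x -> exists w1 w2 : rw,
  [/\ w1 != 0, forall c, w2 <> c *: w1 &
   forall y, on l y -> dir x (join x y) ((crd l y).1 *: w1 + (crd l y).2 *: w2)].
Proof.
move=> nlx; have [y1 [y2 [y12 ly1 ly2]]] := line_two hd l.
have lJ := join_on y12 ly1 ly2.
have xne y : on l y -> x != y by move=> ly; apply: contra nlx => /eqP ->.
have [xy1 xy2] : x != y1 /\ x != y2 by split; apply: xne.
have [u1 D1] := dir_join hd xy1; have [u2 D2] := dir_join hd xy2.
have nx : ~~ on (join y1 y2) x by rewrite lJ.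
have ne12 := dir_indep hd xy1 xy2 y12 nx D1 D2.
have [_ u10 _] := D1; have [_ u20 _] := D2.
have [al [be [tp [al0 be0 szt good]]]] := one_system y12 ly1 ly2 nlx D1 D2.
have all y : on l y -> dir x (join x y) ((al * lm l y2 y) *: u1 + (be * lm l y1 y) *: u2).
  move=> ly; case: (eqVneq y1 y) => [<-|y1y].
    by rewrite lm_self mulr0 scale0r addr0; apply: dirZ => //; rewrite mulf_neq0 // lm_neq0 // eq_sym.
  case: (eqVneq y2 y) => [<-|y2y].
    by rewrite lm_self mulr0 scale0r add0r; apply: dirZ => //; rewrite mulf_neq0 // lm_neq0.
  have xy := xne _ ly; have [u3 D3] := dir_join hd xy.
  have [al' [be' [tp' [al'0 be'0 szt' good']]]] := one_system y1y ly1 ly nlx D1 D3.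
  have [B fB BP] := pencil hd nlx.
  have dB m u q : dir x m u -> on l q -> on m q -> (u <= B)%MS by move=> Dm lq mq; apply/(BP _ _ Dm); exists q.
  have /(pencil_dim fB (dB _ _ _ D1 ly1 (on_join2 xy1)) (dB _ _ _ D2 ly2 (on_join2 xy2)) u10 ne12)
    [a [b uE]] := dB _ _ _ D3 ly (on_join2 xy).
  (* two points of [l], other than [y1], that are good for both systems *)
  have [z1 [z2 [z12 gz1]]] : exists z1 z2 : pt, z1 != z2 /\
      (forall z, z \in [:: z1; z2] -> [/\ on l z, y1 != z,
        forall t, t \in tp -> t != x -> ~~ on (join x z) t &
        forall t, t \in tp' -> t != x -> ~~ on (join x z) t]).
    have [ps [szps ups psl]] := points_of_line hd l uS.
    pose ts := [seq t <- tp ++ tp' | t != x].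
    have h1 t : t \in ts -> (count (fun z => on (join x z) t) ps <= 1)%N.
      rewrite mem_filter => /andP[tx _]; rewrite eq_sym in tx.
      rewrite -size_filter; case E: [seq _ <- _ | _] => [//|c [//|e r]].
      have ce : c != e.
        by have := filter_uniq (fun z => on (join x z) t) ups; rewrite E /= inE negb_or => /andP[/andP[]].
      have [tc pc] : on (join x c) t /\ c \in ps.
        by have := mem_head c (e :: r); rewrite -E mem_filter => /andP[].
      have [te pe] : on (join x e) t /\ e \in ps.
        have : e \in c :: e :: r by rewrite !inE eqxx orbT.
        by rewrite -E mem_filter => /andP[].
      have [lc le] := (psl _ pc, psl _ pe); have [xc xe'] := (xne _ lc, xne _ le).
      case/negP: nlx; have -> : l = join x c.
        apply: (two_points ce) => //; first exact: on_join2.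
        have -> : join x c = join x e by apply: (two_points tx) => //; apply: on_join1.
        exact: on_join2.
      exact: on_join1.
    have h := filter_lower (P := fun z t => on (join x z) t) h1.
    set gs := [seq c <- ps | _] in h.
    have szts : (size ts <= s - 2)%N.
      rewrite size_filter (leq_trans (count_size _ _)) // size_cat.
      by rewrite -(leq_pmul2l (m := 2)) // mulnDr [leqRHS]mul2n -addnn leq_add.
    have s3 : (3 <= s)%N := num_s3 hd hS.
    have szg : (3 <= size gs)%N.
      rewrite -(leq_add2r (size ts)); apply: leq_trans h; rewrite szps -/s.
      by apply: leq_trans (leq_add (leqnn 3) szts) _; rewrite addnBA ?(ltnW s3) // addnC -addnBA.
    have ugs : uniq gs by apply: filter_uniq.
    have : (2 <= size [seq z <- gs | z != y1])%N.
      rewrite size_filter; have := count_predC (pred1 y1) gs.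
      rewrite (count_uniq_mem y1 ugs) => e; rewrite -(leq_add2l (y1 \in gs)).
      have -> : count (fun z => z != y1) gs = count (predC (pred1 y1)) gs by [].
      by rewrite e; apply: leq_trans szg; case: (_ \in _).
    case E: [seq z <- gs | _] => [//|z1 [//|z2 r]] _.
    have z12 : z1 != z2.
      by have := filter_uniq (fun z => z != y1) ugs; rewrite E /= inE negb_or => /andP[/andP[]].
    have zP z : z \in [:: z1, z2 & r] -> [/\ on l z, y1 != z,
        forall t, t \in tp -> t != x -> ~~ on (join x z) t &
        forall t, t \in tp' -> t != x -> ~~ on (join x z) t].
      rewrite -E mem_filter => /andP[zy]; rewrite mem_filter => /andP[nh zp].
      have nt t : t \in tp ++ tp' -> t != x -> ~~ on (join x z) t.
        by move=> tt tx; apply: contra nh => h'; apply/hasP; exists t => //; rewrite mem_filter tx.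
      split; [exact: psl | by rewrite eq_sym | |] => t tt tx; apply: nt => //;
        by rewrite mem_cat tt ?orbT.
    exists z1, z2; split=> // z; rewrite mem_seq2 => /orP[] /eqP ->; apply: zP.
      by rewrite mem_head.
    by rewrite in_cons mem_head orbT.
  (* at a good point the two descriptions of the direction agree *)
  have eqz z : z \in [:: z1; z2] -> al * be' * b * lm l y2 z = be * al' * lm l y z + be * be' * a * lm l y1 z.
    move=> /gz1[lz y1z g1 g2]; have E1 := good z lz g1; have E2 := good' z lz g2.
    have [c c0] := dir_uniq hd E1 E2; rewrite uE => E.
    have l1 := lm_neq0 ly1 lz y1z.
    have : (al' * lm l y z + be' * lm l y1 z * a - c * (al * lm l y2 z)) *: u1 =
           (c * (be * lm l y1 z) - be' * lm l y1 z * b) *: u2.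
      apply/eqP; rewrite -subr_eq0; move/eqP: E; rewrite -subr_eq0 => /eqP <-.
      by apply/eqP/rowP => j; rewrite !mxE; ring.
    set A := (X in X *: u1 = _); set A' := (X in _ = X *: u2) => EA.
    have A'0 : A' = 0.
      apply/eqP; apply: contraT => A'0; case: (ne12 (A / A')); apply: (scalerI A'0).
      by rewrite scalerA mulrCA divff // mulr1.
    have A0 : A = 0.
      move/eqP: EA; rewrite A'0 scale0r scaler_eq0 (negbTE u10) orbF => /eqP //.
    have cE : c * be = be' * b.
      by apply: (mulIf l1); apply/eqP; rewrite -subr_eq0; apply/eqP; rewrite -A'0 /A'; ring.
    transitivity (al * lm l y2 z * (be' * b)); first ring.
    rewrite -cE; transitivity (be * (c * (al * lm l y2 z))); first ring.
    have -> : c * (al * lm l y2 z) = al' * lm l y z + be' * lm l y1 z * a.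
      by apply/esym/eqP; rewrite -subr_eq0; apply/eqP; rewrite -[RHS]A0.
    ring.
  have zlin (f1 f2 f3 : K) : (forall z, z \in [:: z1; z2] -> f1 * lm l y2 z = f2 * lm l y z + f3 * lm l y1 z) ->
      forall w, on l w -> f1 * lm l y2 w = f2 * lm l y w + f3 * lm l y1 w.
    move=> hz w lw; have [lz1 _ _ _] := gz1 z1 (mem_head _ _).
    have [lz2 _ _ _] := gz1 z2 ltac:(by rewrite !inE eqxx orbT).
    have [e [f [wE _]]] := @lam_comb K (crd l z1) (crd l z2) (crd l w) (crd_neq lz1 lz2 z12).
    have := hz z1 (mem_head _ _); have := hz z2 ltac:(by rewrite !inE eqxx orbT).
    rewrite /lm wE /lam /= => h2 h1.
    transitivity (e * (f1 * ((crd l y2).1 * (crd l z1).2 - (crd l y2).2 * (crd l z1).1)) +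
      f * (f1 * ((crd l y2).1 * (crd l z2).2 - (crd l y2).2 * (crd l z2).1))); first ring.
    by rewrite h1 h2; ring.
  have := zlin _ _ _ eqz y ly; rewrite lm_self mulr0 add0r => e.
  have {}e : al * lm l y2 y * b = be * lm l y1 y * a.
    by apply: (mulfI be'0); transitivity (al * be' * b * lm l y2 y); [ring | rewrite e; ring].
  have l1 := lm_neq0 ly1 ly y1y; have l2 := lm_neq0 ly2 ly y2y.
  have a0 : a != 0.
    apply/eqP => a0; move: e; rewrite a0 mulr0 => /eqP; rewrite !mulf_eq0 (negbTE al0) (negbTE l2) /=.
    by move=> /eqP b0; case: D3 => _ /eqP + _; apply; rewrite uE a0 b0 !scale0r addr0.
  have -> : (al * lm l y2 y) *: u1 + (be * lm l y1 y) *: u2 = (al * lm l y2 y / a) *: u3.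
    rewrite uE scalerDr !scalerA divfK //; congr (_ + _ *: _).
    by rewrite [RHS]mulrAC e mulfK.
  by apply: dirZ => //; rewrite !mulf_neq0 // invr_neq0.
set c1 := crd l y1; set c2 := crd l y2.
have D : lam c1 c2.1 c2.2 != 0 by apply: crd_neq.
exists (- (al * c2.2) *: u1 + (- (be * c1.2)) *: u2), ((al * c2.1) *: u1 + (be * c1.1) *: u2).
have E (e f e' f' c : K) : e' *: u1 + f' *: u2 = c *: (e *: u1 + f *: u2) -> e' = c * e /\ f' = c * f.
  move=> h; have h2 : (f' - c * f) *: u2 = (c * e - e') *: u1.
    apply/eqP; rewrite -subr_eq0; move/eqP: h; rewrite -subr_eq0 => /eqP <-.
    by apply/eqP/rowP => j; rewrite !mxE; ring.
  have f0 : f' - c * f = 0.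
    apply/eqP; apply: contraT => f0; case: (ne12 ((c * e - e') / (f' - c * f))).
    by apply: (scalerI f0); rewrite h2 scalerA mulrCA divff // mulr1.
  move/eqP: h2; rewrite f0 scale0r eq_sym scaler_eq0 (negbTE u10) orbF subr_eq0 => /eqP ->.
  by split=> //; apply/eqP; rewrite -subr_eq0 f0.
have u12 (e f : K) : e *: u1 + f *: u2 = 0 -> e = 0 /\ f = 0.
  by move=> h; have := E 0 0 e f 0; rewrite h scale0r mul0r => /(_ erefl).
split.
- apply/eqP => /u12[h1 h2]; case/eqP: D; rewrite /lam.
  have -> : c2.2 = 0 by apply: (mulfI al0); rewrite mulr0 -[LHS]opprK h1 oppr0.
  have -> : c1.2 = 0 by apply: (mulfI be0); rewrite mulr0 -[LHS]opprK h2 oppr0.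
  by rewrite mulr0 mul0r subrr.
- move=> c /E[h1 h2]; case/eqP: D; rewrite /lam.
  have -> : c2.1 = - c * c2.2 by apply: (mulfI al0); rewrite h1; ring.
  have -> : c1.1 = - c * c1.2 by apply: (mulfI be0); rewrite h2; ring.
  ring.
- move=> y ly; have := all y ly; congr (dir _ _ _).
  by apply/rowP => j; rewrite !mxE /lm /lam; ring.
Qed.

End Perspectivity.

(** * Hyperplanes *)

Section Charts.
Variables (K : fieldType) (V : lmodType K) (d n : nat) (C : cap V d n).
Hypothesis hd : (2 <= d)%N.
Notation pt := (@pt _ _ _ _ C).
Notation ln := (@ln _ _ _ _ C).
Notation on := (@onl _ _ _ _ C).
Notation join := (@join _ _ _ _ C).
Notation rw := 'rV[K]_n.
Notation crd := (@crd _ _ _ _ C).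
Notation dir := (@dir _ _ _ _ C).
Notation xe := (@xe _ _ _ _ C).
Notation plane := (@plane _ _ _ _ C).
Implicit Types (p q x y : pt) (l m : ln) (ls etas : seq ln) (U : set V).
Variable S : seq K.
Hypothesis uS : uniq S.
Hypothesis hS : (d ^ 3 <= size S ^ 2)%N.
Variable M : nat.
Hypothesis hfin : dimle set0 [set: V] M.
Hypothesis hfull : forall Pi, plane Pi -> full Pi.

(** [p] is the point of [l] with parameter [z]. *)
Definition atp l (z : K * K) p : Prop := on l p /\ lam (crd l p) z.1 z.2 = 0.
Definition cmb (e f : K * K) (s t : K) : K * K := (s * e.1 + t * f.1, s * e.2 + t * f.2).

Lemma cmb_neq0 e f s t : lam e f.1 f.2 != 0 -> (s, t) != (0, 0) -> cmb e f s t != (0, 0).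
Proof.
move=> ef st; apply: contra st => /eqP[h1 h2].
have s0 : s * lam e f.1 f.2 = 0.
  transitivity ((s * e.1 + t * f.1) * f.2 - (s * e.2 + t * f.2) * f.1); first by rewrite /lam; ring.
  by rewrite h1 h2; ring.
have t0 : t * lam e f.1 f.2 = 0.
  transitivity (e.1 * (s * e.2 + t * f.2) - e.2 * (s * e.1 + t * f.1)); first by rewrite /lam; ring.
  by rewrite h1 h2; ring.
move/eqP: s0; move/eqP: t0; rewrite !mulf_eq0 (negbTE ef) !orbF => /eqP -> /eqP ->.
by rewrite eqxx.
Qed.

Lemma atp_exists l (z : K * K) : z != (0, 0) -> exists p, atp l z p.
Proof.
move=> z0; have [p lp [c c0 E]] := pt_exists l z0; exists p; split=> //.
exact: (crd_uniq hd z0 c0 E).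
Qed.

Lemma atp_scale l (z : K * K) p : z != (0, 0) -> atp l z p -> exists2 a : K, a != 0 & z = (a * (crd l p).1, a * (crd l p).2).
Proof. by move=> z0 [lp h]; apply: lam_prop => //; apply: crd0. Qed.

Lemma atp_uniq l (z : K * K) p q : z != (0, 0) -> atp l z p -> atp l z q -> p = q.
Proof.
move=> z0 ap aq; have [lp _] := ap; have [lq _] := aq.
have [a a0 E] := atp_scale z0 ap; have [b b0 E'] := atp_scale z0 aq.
apply/eqP; apply: contraT => pq; move/eqP: (crd_neq lp lq pq); case.
apply: (mulfI (mulf_neq0 a0 b0)); rewrite mulr0.
have [e1 e2] : a * (crd l p).1 = b * (crd l q).1 /\ a * (crd l p).2 = b * (crd l q).2.
  by move: E'; rewrite E => -[].
rewrite /lam; transitivity ((a * (crd l p).1) * (b * (crd l q).2) - (a * (crd l p).2) * (b * (crd l q).1)).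
  by ring.
by rewrite e1 e2; ring.
Qed.

Lemma atp_crd l p : on l p -> atp l (crd l p) p.
Proof. by move=> lp; split=> //; apply: lam_self. Qed.

Lemma atpZ l (z : K * K) p a : atp l z p -> atp l (a * z.1, a * z.2) p.
Proof. by move=> [lp h]; split=> //=; move: h; rewrite /lam /= => h; rewrite mulrCA [_ * (a * _)]mulrCA -mulrBr h mulr0. Qed.

Lemma cmb_span l p q (z : K * K) : on l p -> on l q -> p != q -> exists s t, z = cmb (crd l p) (crd l q) s t.
Proof.
by move=> lp lq pq; have [a [b [E _]]] := @lam_comb K (crd l p) (crd l q) z (crd_neq lp lq pq); exists a, b.
Qed.

Lemma comb_indep (u1 u2 : rw) (e f : K) : u1 != 0 -> (forall c, u2 <> c *: u1) ->
  e *: u1 + f *: u2 = 0 -> e = 0 /\ f = 0.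
Proof.
move=> u10 ne h; have f0 : f = 0.
  apply/eqP; apply: contraT => f0; case: (ne (- e / f)); apply: (scalerI f0).
  by rewrite scalerA mulrCA divff // mulr1 scaleNr; apply/eqP; rewrite -addr_eq0 addrC h.
split=> //; move/eqP: h; rewrite f0 scale0r addr0 scaler_eq0 (negbTE u10) orbF.
by move/eqP.
Qed.

Lemma atp_cmb l e f s t y : lam e f.1 f.2 != 0 -> (s, t) != (0, 0) -> atp l (cmb e f s t) y ->
  exists2 a : K, a != 0 & crd l y = cmb e f (a * s) (a * t).
Proof.
move=> ef st hy; have [a a0 E] := atp_scale (cmb_neq0 ef st) hy.
exists a^-1; first by rewrite invr_neq0.
move: E; rewrite /cmb => -[E1 E2]; rewrite [LHS]surjective_pairing.
by congr (_, _); rewrite -!mulrA -mulrDr ?E1 ?E2 mulKf.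
Qed.

(** Two independent directions at [p] are those of two points, whose line meets
    exactly the lines of the pencil. *)
Lemma dir_pencil p (u v : rw) : u != 0 -> (forall c, v <> c *: u) ->
  exists y z : pt, [/\ p != y, p != z, y != z, ~~ on (join y z) p &
    [/\ dir p (join p y) u, dir p (join p z) v &
      forall m (t : rw), dir p m t ->
        ((exists a b, t = a *: u + b *: v) <-> exists2 q, on (join y z) q & on m q)]].
Proof.
move=> u0 ne; have v0 : v != 0 by apply/eqP => v0; apply: (ne 0); rewrite v0 scale0r.
have [l Dl] := dir_onto p u0; have [m Dm] := dir_onto p v0.
have lm : l != m.
  by apply/eqP => e; rewrite e in Dl; have [c _] := dir_uniq hd Dl Dm; apply: ne.
have [lp _ _] := Dl; have [mp _ _] := Dm.
have [y ly yp] := line_other hd l p; have [z mz zp] := line_other hd m p.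
rewrite eq_sym in yp; rewrite eq_sym in zp.
have yz : y != z.
  apply: contra yp => /eqP yz; rewrite -yz in mz.
  by apply/eqP; apply: (one_point lm).
have lJ := join_on yp lp ly; have mJ := join_on zp mp mz.
have np : ~~ on (join y z) p.
  apply: contra lm => jp; have -> : l = join y z.
    by apply: (two_points yp) => //; apply: on_join1.
  by apply/eqP; apply: (two_points zp) => //; apply: on_join2.
rewrite -lJ in Dl; rewrite -mJ in Dm.
have [u' [v' [B [fB Du Dv BE BP]]]] := pencil_span hd yp zp yz np.
have [c1 c10 E1] := dir_uniq hd Dl Du; have [c2 c20 E2] := dir_uniq hd Dm Dv.
exists y, z; split=> //; split=> // k t Dt; rewrite -(BP _ _ Dt) BE E1 E2; split=> -[a [b ->]].
  by exists (a / c1), (b / c2); rewrite !scalerA !divfK.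
by exists (a * c1), (b * c2); rewrite !scalerA.
Qed.

(** Hyperplanes are defined by incidence; that their directions at a point form a
    linear hyperplane is [H_form]. *)
Definition hyperplane (H : set pt) := [/\ forall y z : pt, H y -> H z -> y != z -> inside (join y z) H,
  forall l, exists2 q, on l q & H q & exists o, ~ H o].

Lemma hyperplane_exists (p : pt) : (0 < n)%N -> exists2 H, hyperplane H & H p.
Proof.
move=> n0; pose j0 := Ordinal n0; pose E := [set u : rw | u 0 j0 = 0].
have sE : is_subspace E.
  by split=> [|a u v]; rewrite /E /= !mxE // => -> ->; rewrite mulr0 addr0.
exists (xe p E); last by left.
split=> [y z Hy Hz yz|l|]; first exact: xe_inside.
  apply: (@hyper_meet _ _ _ _ C hd p [set: rw] E l); first by split.
    move=> u v _ _; case: (eqVneq (u 0 j0) 0) => [|u0]; first by left.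
    by right; exists (- (v 0 j0 / u 0 j0)); rewrite /E /= !mxE mulNr divfK // addNr.
  move=> y ly; case: (eqVneq p y) => [|py]; first by left.
  by have [u Du] := dir_join hd py; right; exists u.
have e0 : delta_mx 0 j0 != 0 :> rw.
  by apply/eqP => /rowP/(_ j0)/eqP; rewrite !mxE !eqxx oner_eq0.
have [l Dl] := dir_onto p e0; have [lp _ _] := Dl.
have [o lo op] := line_other hd l p; exists o => Ho; rewrite eq_sym in op.
have := xe_dir hd sE Ho op; rewrite (join_on op lp lo) => /(_ _ Dl).
by rewrite /E /= !mxE !eqxx => /eqP; rewrite oner_eq0.
Qed.

Section Hyperplane.
Variable H : set pt.
Hypothesis hH : hyperplane H.

Lemma H_inside l y (z : pt) : on l y -> on l z -> y != z -> H y -> H z -> inside l H.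
Proof. by case: hH => h _ _ ly lz yz Hy Hz; rewrite -(join_on yz ly lz); apply: h. Qed.

Lemma H_one l y (z : pt) o : on l y -> on l z -> on l o -> H y -> H z -> ~ H o -> y = z.
Proof.
move=> ly lz lo Hy Hz no; apply/eqP; apply: contraT => yz; case: no.
exact: (H_inside ly lz yz).
Qed.

(** At a point of a hyperplane the directions in the hyperplane are the kernel
    of a linear form. *)
Lemma H_form p : H p -> exists phi : rw -> K, [/\ functional phi, exists v, phi v = 1 &
  forall l u, dir p l u -> (phi u = 0 <-> inside l H)].
Proof.
move=> Hp; have [cl mt [o no]] := hH.
pose E := [set u : rw | u = 0 \/ exists2 l, dir p l u & inside l H].
have EP l u : dir p l u -> (E u <-> inside l H).
  move=> D; split=> [[u0|[m D' inm]]|]; last by right; exists l.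
    by case: D => _ /eqP; rewrite u0.
  by rewrite (dir_line hd D D').
(* on the plane of two directions, [E] contains the line to the point of [H] *)
have mk (u v : rw) : u != 0 -> (forall c, v <> c *: u) -> exists a b : K, (a, b) != (0, 0) /\ E (a *: u + b *: v).
  move=> u0 ne; have [y [z [py pz yz np [Du Dv P]]]] := dir_pencil p u0 ne.
  have [q jq Hq] := mt (join y z); have pq : p != q by apply: contra np => /eqP ->.
  have [t Dt] := dir_join hd pq.
  have [a [b tE]] : exists a b, t = a *: u + b *: v.
    by apply/(P _ _ Dt); exists q => //; apply: on_join2.
  exists a, b; rewrite -tE; split; last by apply/(EP _ _ Dt); apply: cl.
  by apply/eqP => -[a0 b0]; case: Dt => _ /eqP []; rewrite tE a0 b0 !scale0r addr0.
have EZ a u : E u -> E (a *: u).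
  case: (eqVneq a 0) => [->|a0]; first by rewrite scale0r; left.
  by case=> [->|[l D inl]]; [left; rewrite scaler0 | right; exists l => //; apply: dirZ].
have EDi (u v : rw) : E u -> E v -> E (u + v).
  move=> Eu Ev; case: (eqVneq u 0) => [->|u0]; first by rewrite add0r.
  case: (pselect (exists c, v = c *: u)) => [[c ->]|ne].
    by rewrite -{1}[u]scale1r -scalerDl; apply: EZ.
  have {}ne c : v <> c *: u by move=> e; apply: ne; exists c.
  have [y [z [py pz yz np [Du Dv P]]]] := dir_pencil p u0 ne.
  have Hy : H y by apply: ((EP _ _ Du).1 Eu); apply: on_join2.
  have Hz : H z by apply: ((EP _ _ Dv).1 Ev); apply: on_join2.
  have uv0 : u + v != 0.
    by apply/eqP => /eqP; rewrite addrC addr_eq0 => /eqP e; apply: (ne (-1)); rewrite scaleN1r.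
  have [m Dm] := dir_onto p uv0.
  have [q jq mq] : exists2 q, on (join y z) q & on m q.
    by apply/(P _ _ Dm); exists 1, 1; rewrite !scale1r.
  have pq : p != q by apply: contra np => /eqP ->.
  apply/(EP _ _ Dm); have [mp _ _] := Dm.
  by apply: (H_inside mp mq) => //; apply: (cl y z).
have po : p != o by apply: contra_notN no => /eqP <-.
have [v0 D0] := dir_join hd po.
have nE : ~ E v0 by move/(EP _ _ D0) => h; apply: no; apply: h; apply: on_join2.
have v00 : v0 != 0 by case: D0.
have ex (u : rw) : exists c : K, E (u - c *: v0).
  case: (pselect (exists c, u = c *: v0)) => [[c ->]|ne].
    by exists c; rewrite subrr; left.
  have {}ne c : u <> c *: v0 by move=> e; apply: ne; exists c.
  have [a [b [ab Eab]]] := mk _ _ v00 ne.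
  have b0 : b != 0.
    apply/eqP => b0; rewrite b0 scale0r addr0 in Eab.
    have a0 : a != 0 by apply: contra ab => /eqP ->; rewrite b0.
    by apply: nE; have := EZ a^-1 _ Eab; rewrite scalerA mulVf // scale1r.
  exists (- (a / b)); have := EZ b^-1 _ Eab.
  by rewrite scalerDr !scalerA mulVf // scale1r addrC [b^-1 * a]mulrC scaleNr opprK.
have uq (u : rw) c c' : E (u - c *: v0) -> E (u - c' *: v0) -> c = c'.
  move=> h h'; apply/eqP; apply: contraT => cc; case: nE.
  have := EDi _ _ h' (EZ (-1) _ h); rewrite scaleN1r opprB addrC addrA subrK.
  by rewrite -scalerBl => /(EZ (c - c')^-1); rewrite scalerA mulVf ?subr_eq0 // scale1r.
have [phi phiP] := choice ex; exists phi; split.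
- move=> a u v; apply: (uq (a *: u + v)) => //.
  have -> : a *: u + v - (a * phi u + phi v) *: v0 = a *: (u - phi u *: v0) + (v - phi v *: v0).
    by rewrite scalerDl -scalerA scalerBr opprD addrACA.
  by apply: EDi => //; apply: EZ.
- by exists v0; apply: (uq v0) => //; rewrite scale1r subrr; left.
- move=> l u D; rewrite -(EP _ _ D); split=> [e|Eu]; first by have := phiP u; rewrite e scale0r subr0.
  by apply: (uq u) => //; rewrite scale0r subr0.
Qed.

(** Away from [H] the normalized direction from [p] is an affine function on each line. *)
Lemma H_coord p : H p -> exists (phi : rw -> K) (al : pt -> rw),
  [/\ functional phi, exists v, phi v = 1,
      forall z : pt, ~ H z -> phi (al z) = 1 /\ dir p (join p z) (al z) &
      forall l r z0, on l r -> on l z0 -> H r -> ~ H z0 -> exists rho : rw,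
        [/\ phi rho = 0, p != r -> dir p (join p r) rho, p = r -> rho = 0 &
          forall s t y, s != 0 -> atp l (cmb (crd l z0) (crd l r) s t) y ->
            al y = al z0 + (t / s) *: rho]].
Proof.
move=> Hp; have [phi [lphi one phiP]] := H_form Hp.
have pz (z : pt) : ~ H z -> p != z by move=> nz; apply: contra_notN nz => /eqP <-.
have ex (z : pt) : exists u : rw, ~ H z -> phi u = 1 /\ dir p (join p z) u.
  case: (pselect (H z)) => [Hz|nz]; first by exists 0.
  have [u D] := dir_join hd (pz _ nz).
  have u0 : phi u != 0.
    apply/eqP => /(phiP _ _ D) h; apply: (nz); apply: h; apply: on_join2; exact: pz.
  by exists ((phi u)^-1 *: u) => _; rewrite funZ // mulVf //; split=> //; apply: dirZ; rewrite ?invr_neq0.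
have [al alP] := choice ex; exists phi, al; split=> // l r z0 lr lz Hr nz.
have ef : lam (crd l z0) (crd l r).1 (crd l r).2 != 0.
  by apply: crd_neq => //; apply: contra_notN nz => /eqP ->.
have st0 (s t : K) : s != 0 -> (s, t) != (0, 0) by move=> s0; apply: contra s0 => /eqP[->].
have off s t y : s != 0 -> atp l (cmb (crd l z0) (crd l r) s t) y -> ~ H y.
  move=> s0 hy Hy; have [ly _] := hy; have yr := H_one ly lr lz Hy Hr nz.
  have [a a0 E] := atp_cmb ef (st0 _ t s0) hy.
  have := lam_self (crd l r); rewrite -{2 3}yr {1 2}E /cmb /lam /= => h.
  move/eqP: ef; apply; apply: (mulfI (mulf_neq0 a0 s0)); rewrite mulr0 -[RHS]oppr0 -h /lam; ring.
have [D1 Dz] := alP _ nz.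
case: (eqVneq p r) => [pr|pr].
  exists 0; split=> //; first exact: fun0.
  move=> s t y s0 hy; have ny := off _ _ _ s0 hy; have [D1' Dy] := alP _ ny; have [ly _] := hy.
  have lp : on l p by rewrite pr.
  rewrite (join_on (pz _ nz) lp lz) in Dz; rewrite (join_on (pz _ ny) lp ly) in Dy.
  have [a _ E] := dir_uniq hd Dz Dy; move: D1'; rewrite E funZ // D1 mulr1 => ->.
  by rewrite scale1r scaler0 addr0.
have lp : ~~ on l p by apply: contra pr => lp; apply/eqP; apply: (H_one lp lr lz).
have [w1 [w2 [_ _ W]]] := perspectivity hd uS hS hfin hfull lp.
have Wz := W _ lz; have Wr := W _ lr.
set wz := _ + _ in Wz; set wr := _ + _ in Wr.
have [c c0 Ec] := dir_uniq hd Wz Dz.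
have pwr : phi wr = 0.
  by apply/(phiP _ _ Wr); apply: (H_inside (on_join1 pr) (on_join2 pr)).
have pwz : phi wz = c^-1.
  by apply: (mulfI c0); rewrite -funZ // -Ec D1 divff.
exists (c *: wr); split=> //; first by rewrite funZ // pwr mulr0.
- by move=> _; apply: dirZ.
- by move=> e; rewrite e eqxx in pr.
move=> s t y s0 hy; have ny := off _ _ _ s0 hy; have [D1' Dy] := alP _ ny; have [ly _] := hy.
have [a a0 E] := atp_cmb ef (st0 _ t s0) hy.
have := W _ ly; have -> : (crd l y).1 *: w1 + (crd l y).2 *: w2 = (a * s) *: wz + (a * t) *: wr.
  by rewrite E /cmb /= /wz /wr; apply/rowP => j; rewrite !mxE; ring.
move=> Wy; have [b b0 Eb] := dir_uniq hd Wy Dy.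
move: D1'; rewrite Eb funZ // funD // !funZ // pwr pwz mulr0 addr0 => h.
have -> : b = c / (a * s) by apply: (mulIf (mulf_neq0 (mulf_neq0 a0 s0) (invr_neq0 c0))); rewrite h; field; rewrite a0 s0 c0.
by rewrite Ec scalerDr !scalerA; congr (_ *: _ + _ *: _); field; rewrite ?a0 ?s0.
Qed.

End Hyperplane.
End Charts.

(** * Affine coordinates *)

Section Affine.
Variables (K : fieldType) (V : lmodType K) (d n : nat) (C : cap V d n).
Hypothesis hd : (2 <= d)%N.
Notation pt := (@pt _ _ _ _ C).
Notation ln := (@ln _ _ _ _ C).
Notation on := (@onl _ _ _ _ C).
Notation join := (@join _ _ _ _ C).
Notation rw := 'rV[K]_n.
Notation crd := (@crd _ _ _ _ C).
Notation xe := (@xe _ _ _ _ C).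
Notation plane := (@plane _ _ _ _ C).
Implicit Types (p q x y : pt) (l m : ln) (ls etas : seq ln) (U : set V).
Variable S : seq K.
Hypothesis uS : uniq S.
Hypothesis hS : (d ^ 3 <= size S ^ 2)%N.
Variable M : nat.
Hypothesis hfin : dimle set0 [set: V] M.
Hypothesis hfull : forall Pi, plane Pi -> full Pi.
Notation atp := (@atp _ _ _ _ C).
Notation hyperplane := (@hyperplane _ _ _ _ C).

Lemma plane_through l (o : pt) : ~~ on l o -> exists Pi, [/\ plane Pi, inside l Pi & Pi o].
Proof.
move=> no; have [y [z [yz ly lz]]] := line_two hd l.
have lJ := join_on yz ly lz; rewrite -lJ in no *.
have oy : o != y by apply: contra no => /eqP ->; apply: on_join1.
have oz : o != z by apply: contra no => /eqP ->; apply: on_join2.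
have [u [v [B [fB Du Dv BE BP]]]] := pencil_span hd oy oz yz no.
have hP : plane (xe o [set u : rw | (u <= B)%MS]) by exists o, B.
exists (xe o [set u : rw | (u <= B)%MS]); split=> //; last by left.
apply: plane_closed => //.
  by right; exists u => //=; apply/(BP _ _ Du); exists y; [apply: on_join1 | apply: on_join2].
by right; exists v => //=; apply/(BP _ _ Dv); exists z; apply: on_join2.
Qed.

Lemma pair_l (s t : K) : s != 0 -> (s, t) != (0, 0).
Proof. by move=> s0; apply: contra s0 => /eqP[->]. Qed.
Lemma pair_r (s t : K) : t != 0 -> (s, t) != (0, 0).
Proof. by move=> s0; apply: contra s0 => /eqP[_ ->]. Qed.

Section Hyperplane.
Variable H : set pt.
Hypothesis hH : hyperplane H.
Variables p1 p2 : pt.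
Hypothesis Hp1 : H p1.
Hypothesis Hp2 : H p2.
Hypothesis p12 : p1 != p2.

(** The directions from [p1], together with one coordinate of those from [p2],
    make the complement of [H] an affine space, in which the affine parameter of
    a line is projectively related to the parameter of the curve. *)
Lemma chart : exists Phi : pt -> rw,
  [/\ forall l r (z0 : pt), on l r -> on l z0 -> H r -> ~ H z0 -> exists2 Q : rw, Q != 0 &
        forall s t y, s != 0 -> atp l (cmb (crd l z0) (crd l r) s t) y ->
            Phi y = Phi z0 + (t / s) *: Q,
      forall y z, ~ H y -> ~ H z -> Phi y = Phi z -> y = z &
      forall P, exists2 z, ~ H z & Phi z = P].
Proof.
have [ph1 [al1 [lph1 [v0 v01] alP1 L1]]] := H_coord hd uS hS hfin hfull hH Hp1.
have [ph2 [al2 [lph2 _ alP2 L2]]] := H_coord hd uS hS hfin hfull hH Hp2.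
have p21 : p2 != p1 by rewrite eq_sym.
have [de Dde] := dir_join hd p21.
have [j dej] : exists j, de 0 j != 0.
  by apply/rV0Pn; case: Dde.
pose Phi y := al1 y + (al2 y 0 j - 1) *: v0; exists Phi.
have ph1P y : ~ H y -> ph1 (Phi y) = al2 y 0 j.
  by move=> ny; have [e _] := alP1 _ ny; rewrite funD // funZ // v01 e mulr1 addrCA subrr addr0.
have line l r (z0 : pt) : on l r -> on l z0 -> H r -> ~ H z0 -> exists2 Q : rw, Q != 0 &
        forall s t y, s != 0 -> atp l (cmb (crd l z0) (crd l r) s t) y ->
            Phi y = Phi z0 + (t / s) *: Q.
  move=> lr lz Hr nz; have [r1 [f1 d1 e1 E1]] := L1 l r z0 lr lz Hr nz.
  have [r2 [f2 d2 e2 E2]] := L2 l r z0 lr lz Hr nz.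
  exists (r1 + r2 0 j *: v0); last first.
    move=> s t y s0 hy; rewrite /Phi (E1 _ _ _ s0 hy) (E2 _ _ _ s0 hy) !mxE.
    rewrite scalerDr scalerA addrACA -scalerDl; congr (_ + _ *: _); ring.
  apply/eqP => Q0; have r2j : r2 0 j = 0.
    by have := congr1 ph1 Q0; rewrite fun0 // funD // funZ // f1 v01 add0r mulr1.
  have r10 : r1 = 0 by move: Q0; rewrite r2j scale0r addr0.
  case: (eqVneq p1 r) => [pr|/d1[_ /eqP[]//]].
  have [|a a0 E] := dir_uniq hd Dde _ (u' := r2); first by rewrite pr; apply: d2; rewrite -pr.
  by move/eqP: r2j; rewrite E mxE mulf_eq0 (negbTE a0) (negbTE dej).
have [_ mt _] := hH.
split=> // [y z ny nz E|P].
  apply/eqP; apply: contraT => yz; have [r jr Hr] := mt (join y z).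
  have jy := on_join1 yz; have jz := on_join2 yz.
  have yr : y != r by apply: contra_notN ny => /eqP ->.
  have [Q Q0 LQ] := line _ _ _ jr jy Hr ny.
  have [s [t st]] := cmb_span (crd (join y z) z) jy jr yr.
  have az : atp (join y z) (cmb (crd (join y z) y) (crd (join y z) r) s t) z.
    by rewrite -st; apply: atp_crd.
  have ne := crd_neq jy jr yr.
  have s0 : s != 0.
    apply/eqP => s0; case: nz; have -> // : z = r.
    apply: (atp_uniq (crd0 jz) (atp_crd jz)).
    by rewrite st s0 /cmb !mul0r !add0r; apply/atpZ/atp_crd.
  have t0 : t != 0.
    apply/eqP => t0; move/eqP: yz; apply.
    apply: (atp_uniq (crd0 jz) _ (atp_crd jz)).
    by rewrite st t0 /cmb !mul0r !addr0; apply/atpZ/atp_crd.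
  have := LQ _ _ _ s0 az; rewrite -E -{1}[Phi y]addr0 => /addrI/esym/eqP.
  by rewrite scaler_eq0 (negbTE Q0) mulf_eq0 invr_eq0 (negbTE t0) (negbTE s0).
pose a1 := P - (ph1 P - 1) *: v0.
have fa1 : ph1 a1 = 1 by rewrite /a1 -scaleNr addrC lph1 v01 mulr1 opprB subrK.
have a10 : a1 != 0 by apply/eqP => e; move/eqP: fa1; rewrite e fun0 // eq_sym oner_eq0.
have [m Dm] := dir_onto p1 a10; have [mp1 _ _] := Dm.
have al1E y : on m y -> ~ H y -> al1 y = a1.
  move=> my ny; have [e Dy] := alP1 _ ny.
  have py : p1 != y by apply: contra_notN ny => /eqP <-.
  rewrite (join_on py mp1 my) in Dy; have [a a0 E] := dir_uniq hd Dy Dm.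
  by move: fa1; rewrite E funZ // e mulr1 => ->; rewrite scale1r.
have [z0 mz0 nz0] : exists2 z0, on m z0 & ~ H z0.
  apply: contrapT => h.
  (* the linear form of [L1] is nonzero at the direction of [m], so [m] is not in [H] *)
  have inm : inside m H by move=> y my; apply: contrapT => ny; apply: h; exists y.
  have [_ _ [o no]] := hH.
  have po : p1 != o by apply: contra_notN no => /eqP <-.
  have [q mq qp] := line_other hd m p1.
  have oq : o != q by apply: contra_notN no => /eqP ->; apply: inm.
  have [r' [g1 k1 h1 E1]] := L1 (join o q) q o (on_join2 oq) (on_join1 oq) (inm _ mq) no.
  have pq : p1 != q by rewrite eq_sym.
  have := k1 pq; rewrite (join_on pq mp1 mq) => D'; have [a a0 E] := dir_uniq hd Dm D'.
  by move/eqP: g1; rewrite E funZ // fa1 mulr1 (negbTE a0).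
have [Q Q0 LQ] := line m p1 z0 mp1 mz0 Hp1 nz0.
have z0p : z0 != p1 by apply: contra_notN nz0 => /eqP ->.
have ne := crd_neq mz0 mp1 z0p.
have off s t y : s != 0 -> atp m (cmb (crd m z0) (crd m p1) s t) y -> ~ H y.
  move=> s0 hy Hy; have [my _] := hy; have yr := H_one hH my mp1 mz0 Hy Hp1 nz0.
  have [a a0 E] := atp_cmb ne (pair_l t s0) hy.
  have := lam_self (crd m p1); rewrite -{2 3}yr {1 2}E /cmb /lam /= => h.
  move/eqP: ne; apply; apply: (mulfI (mulf_neq0 a0 s0)); rewrite mulr0 -[RHS]oppr0 -h /lam; ring.
have pick t : exists2 y, atp m (cmb (crd m z0) (crd m p1) 1 t) y & Phi y = Phi z0 + t *: Q.
  have [y hy] := atp_exists hd m (cmb_neq0 ne (pair_l t (oner_neq0 K))).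
  by exists y => //; rewrite (LQ _ _ _ (oner_neq0 _) hy) divr1.
have PhE y : on m y -> ~ H y -> Phi y = a1 + (al2 y 0 j - 1) *: v0.
  by move=> my ny; rewrite /Phi al1E.
have [y1 h1 E1] := pick 1; have [my1 _] := h1; have ny1 := off _ _ _ (oner_neq0 _) h1.
pose ka := al2 y1 0 j - al2 z0 0 j.
have QE : Q = ka *: v0.
  have e : (al2 y1 0 j - 1) *: v0 = (al2 z0 0 j - 1) *: v0 + Q.
    by apply: (addrI a1); rewrite addrA -!PhE // E1 scale1r.
  rewrite /ka; apply: (addrI ((al2 z0 0 j - 1) *: v0)); rewrite -e -scalerDl; congr (_ *: _); ring.
have ka0 : ka != 0 by apply/eqP => k0; move/eqP: Q0; rewrite QE k0 scale0r.
have [y hy Ey] := pick ((ph1 P - al2 z0 0 j) / ka); exists y; first exact: (off _ _ _ (oner_neq0 _) hy).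
rewrite Ey QE scalerA divfK // PhE // /a1 -addrA -scalerDl -addrA -scaleNr -scalerDl.
by rewrite [X in X *: _](_ : _ = 0) ?scale0r ?addr0 //; ring.
Qed.

End Hyperplane.
End Affine.

(** * Points at infinity *)

Section Coordinates.
Variables (K : fieldType) (V : lmodType K) (d n : nat) (C : cap V d n).
Hypothesis hd : (2 <= d)%N.
Notation pt := (@pt _ _ _ _ C).
Notation ln := (@ln _ _ _ _ C).
Notation on := (@onl _ _ _ _ C).
Notation join := (@join _ _ _ _ C).
Notation rw := 'rV[K]_n.
Notation crd := (@crd _ _ _ _ C).
Notation dir := (@dir _ _ _ _ C).
Notation plane := (@plane _ _ _ _ C).
Implicit Types (p q x y : pt) (l m : ln) (ls etas : seq ln) (U : set V).
Variable S : seq K.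
Hypothesis uS : uniq S.
Hypothesis hS : (d ^ 3 <= size S ^ 2)%N.
Variable M : nat.
Hypothesis hfin : dimle set0 [set: V] M.
Hypothesis hfull : forall Pi, plane Pi -> full Pi.
Notation atp := (@atp _ _ _ _ C).
Notation hyperplane := (@hyperplane _ _ _ _ C).

Lemma size_S3 : (3 <= size S)%N.
Proof. by have := size_S hd hS; lia. Qed.

Section Chart.
Variable H : set pt.
Hypothesis hH : hyperplane H.
Variable Z : rw -> pt.
Hypothesis Zn : forall P : rw, ~ H (Z P).
Hypothesis Zi : injective Z.
Hypothesis Zs : forall y, ~ H y -> exists P : rw, y = Z P.
(** The affine line through [P] with direction [Q] is a curve with point [r] at infinity. *)
Definition infp (P Q : rw) (r : pt) := exists l (e f : K * K), [/\ lam e f.1 f.2 != 0,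
  forall s t, s != 0 -> atp l (cmb e f s t) (Z (P + (t / s) *: Q)), atp l f r & H r].
Hypothesis Zl : forall P Q : rw, Q != 0 -> exists r, infp P Q r.

Lemma infp_on (P Q : rw) l (e f : K * K) : (forall s t, s != 0 -> atp l (cmb e f s t) (Z (P + (t / s) *: Q))) ->
  forall c, on l (Z (P + c *: Q)).
Proof. by move=> h c; have [] := h 1 c (oner_neq0 _); rewrite divr1. Qed.

Lemma Zneq (P Q : rw) c c' : Q != 0 -> c != c' -> Z (P + c *: Q) != Z (P + c' *: Q).
Proof.
move=> Q0; apply: contra => /eqP/Zi/addrI/eqP; rewrite -subr_eq0 -scalerBl scaler_eq0 (negbTE Q0).
by rewrite orbF subr_eq0.
Qed.

Lemma Zline (A B : rw) c : A != B -> on (join (Z A) (Z B)) (Z (A + c *: (B - A))).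
Proof.
move=> AB; have Q0 : B - A != 0 by rewrite subr_eq0 eq_sym.
have [r [l [e [f [ef L _ _]]]]] := Zl A Q0; have h := infp_on L.
have ZAB : Z A != Z B by apply: contra AB => /eqP/Zi ->.
have -> // : join (Z A) (Z B) = l.
apply: join_on => //; first by have := h 0; rewrite scale0r addr0.
by have := h 1; rewrite scale1r addrC subrK.
Qed.

(** Parallel affine lines have the same point at infinity. They are coplanar: a
    point [P2 + Q] of the second lies on a line through [P1] that meets a line
    joining [P2] to a point of the first; here the parameter [si] must avoid [0]
    and [1]. Two coplanar lines of the cap meet, and parallel affine lines can
    only meet in [H]. *)
Lemma infp_uniq (P1 P2 Q : rw) r1 r2 : Q != 0 -> infp P1 Q r1 -> infp P2 Q r2 -> r1 = r2.
Proof.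
move=> Q0 [l1 [e1 [f1 [ef1 L1 [lr1 R1] H1]]]] [l2 [e2 [f2 [ef2 L2 [lr2 R2] H2]]]].
have h1 := infp_on L1; have h2 := infp_on L2.
have on0 := h2 0; rewrite scale0r addr0 in on0.
have on1 := h1 0; rewrite scale0r addr0 in on1.
have one : 0 != 1 :> K by rewrite eq_sym oner_neq0.
case: (eqVneq l1 l2) => [l12|l12].
  by rewrite -l12 in lr2; apply: (H_one hH lr1 lr2 on1).
have ne c : P2 <> P1 + c *: Q.
  move=> e; case/negP: l12; apply/eqP; apply: (two_points (Zneq P2 Q0 one)) => //.
    by rewrite e -addrA -scalerDl.
  by rewrite e -addrA -scalerDl.
have nl1 : ~~ on l1 (Z P2).
  apply/negP => l1P.
  have [s [t E]] : exists s t, crd l1 (Z P2) = cmb e1 f1 s t.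
    by have [a [b [E _]]] := lam_comb (crd l1 (Z P2)) ef1; exists a, b.
  have s0 : s != 0.
    apply/eqP => s0; apply: (@Zn P2); have -> // : Z P2 = r1.
    apply: (atp_uniq (crd0 l1P) (atp_crd l1P)); rewrite E s0 /cmb !mul0r !add0r; exact: atpZ.
  have := L1 s t s0; rewrite -E => /(atp_uniq (crd0 l1P) (atp_crd l1P))/Zi; exact: ne.
have [Pi [hPi in1 Pi2]] := plane_through hd nl1.
have [si [si0 si1]] : exists si : K, si != 0 /\ si != 1.
  have := size_S3; case: S uS => [|x [|x' [|x'' T]]] //= /and3P[/norP[xx' /norP[xx'' _]] /norP[x'x'' _] _] _.
  case: (eqVneq x 0) => [x0|x0]; last case: (eqVneq x 1) => [x1|x1]; last by exists x.
    case: (eqVneq x' 1) => [x1|x1]; last by exists x'; rewrite x1 eq_sym -x0.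
    by exists x''; rewrite eq_sym -{1}x0 xx'' eq_sym -x1.
  case: (eqVneq x' 0) => [x'0|x'0]; last by exists x'; rewrite x'0 eq_sym -x1.
  by exists x''; rewrite eq_sym -{1}x'0 x'x'' eq_sym -x1.
pose A := P1 + (si / (1 - si)) *: Q; pose D := P2 + 1 *: Q.
have s10 : 1 - si != 0 by rewrite subr_eq0 eq_sym.
have AP2 : A != P2 by apply/eqP => e; apply: (ne (si / (1 - si))).
have PiA : Pi (Z A) by apply: in1; apply: h1.
have ZA2 : Z A != Z P2 by apply: contra AP2 => /eqP/Zi ->.
pose Y := A + si *: (P2 - A).
have PiY : Pi (Z Y) by apply: (plane_closed hd hPi PiA Pi2 ZA2); apply: Zline.
have YE : Y = P1 + si *: (D - P1).
  by rewrite /Y /A /D; apply/rowP => j; rewrite !mxE; field.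
have P1Y : P1 != Y.
  apply/eqP => e; apply: (ne (-1)); have /eqP : si *: (D - P1) = 0.
    by apply: (addrI P1); rewrite -YE addr0.
  rewrite scaler_eq0 (negbTE si0) subr_eq0 => /eqP <-; rewrite /D -addrA -scalerDl subrr scale0r.
  by rewrite addr0.
have DE : D = P1 + si^-1 *: (Y - P1).
  by rewrite YE; apply/rowP => j; rewrite !mxE; field.
have ZP1Y : Z P1 != Z Y by apply: contra P1Y => /eqP/Zi ->.
have PiD : Pi (Z D) by apply: (plane_closed hd hPi (in1 _ on1) PiY ZP1Y); rewrite DE; apply: Zline.
have in2 : inside l2 Pi.
  have ZD : Z P2 != Z D by rewrite -{1}[P2]addr0 -(scale0r Q); apply: Zneq.
  by apply: (plane_inside hd hPi on0 _ ZD) => //; apply: h2.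
have [q lq1 lq2] := plane_meet hd hPi in1 in2.
suff Hq : H q by rewrite (H_one hH lr1 lq1 on1) // (H_one hH lr2 lq2 on0).
apply: contrapT => nq.
have aff l (e f : K * K) P r : lam e f.1 f.2 != 0 -> on l q -> H r -> atp l f r ->
    (forall s t, s != 0 -> atp l (cmb e f s t) (Z (P + (t / s) *: Q))) -> exists c, q = Z (P + c *: Q).
  move=> ef lq Hr R L; have [s [t [E _]]] := lam_comb (crd l q) ef.
  have s0 : s != 0.
    apply/eqP => s0; apply: nq; have -> // : q = r.
    by apply: (atp_uniq (crd0 lq) (atp_crd lq)); rewrite E s0 /= !mul0r !add0r; apply: atpZ.
  by exists (t / s); apply: (atp_uniq (crd0 lq) (atp_crd lq)); rewrite E; apply: L.
have [c E] := aff _ _ _ P1 r1 ef1 lq1 H1 (conj lr1 R1) L1.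
have [c' E'] := aff _ _ _ P2 r2 ef2 lq2 H2 (conj lr2 R2) L2.
apply: (ne (c - c')); apply: (addIr (c' *: Q)); rewrite -addrA -scalerDl subrK.
by apply: Zi; rewrite -E -E'.
Qed.

Lemma dir_at_infinity : exists h : rw -> pt, forall Q : rw, Q != 0 -> forall P : rw, infp P Q (h Q).
Proof.
have /choice[h hP] : forall Q : rw, exists r, Q != 0 -> infp 0 Q r.
  move=> Q; case: (eqVneq Q 0) => [->|Q0]; first by exists (Z 0).
  by have [r R] := Zl 0 Q0; exists r.
exists h => Q Q0 P; have [r R] := Zl P Q0.
by rewrite (infp_uniq Q0 (hP _ Q0) R).
Qed.

Variable h : rw -> pt.
Hypothesis hP : forall Q : rw, Q != 0 -> forall P : rw, infp P Q (h Q).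

Lemma infp_H (P Q : rw) r : infp P Q r -> H r. Proof. by move=> [l [e [f []]]]. Qed.

Lemma infp_join (P Q : rw) : Q != 0 -> join (Z P) (h Q) = join (Z P) (Z (P + Q)).
Proof.
move=> Q0; have [l [e [f [ef L [lr _] Hr]]]] := hP Q0 P; have ho := infp_on L.
have l0 := ho 0; have l1 := ho 1; rewrite scale0r addr0 in l0; rewrite scale1r in l1.
have one : 0 != 1 :> K by rewrite eq_sym oner_neq0.
rewrite (join_on _ l0 l1); last by have := Zneq P Q0 one; rewrite scale0r addr0 scale1r.
by apply: join_on => //; apply: contra_notN (@Zn P) => /eqP ->.
Qed.

Lemma h_onto r : H r -> exists2 Q : rw, Q != 0 & r = h Q.
Proof.
move=> Hr; have n0 := @Zn 0; have zr : Z 0 != r by apply: contra_notN n0 => /eqP ->.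
have jz := on_join1 zr; have jr := on_join2 zr.
move gE : (join (Z 0) r) jz jr => g jz jr.
have ne := crd_neq jz jr zr.
have [y hy] := atp_exists hd g (cmb_neq0 ne (pair_l 1 (oner_neq0 K))).
have [jy _] := hy; have [a a0 E] := atp_cmb ne (pair_l 1 (oner_neq0 K)) hy.
have ny : ~ H y.
  move=> Hy; have yr := H_one hH jy jr jz Hy Hr n0.
  have := lam_self (crd g r); rewrite -{2 3}yr {1 2}E /cmb /lam /= => h0.
  by move/eqP: ne; apply; apply: (mulfI a0); rewrite mulr0 -[RHS]oppr0 -h0 /lam; ring.
have [Q yE] := Zs ny; have Q0 : Q != 0.
  apply/eqP => e; rewrite e in yE.
  have := lam_self (crd g (Z 0)); rewrite -{2 3}yE {1 2}E /cmb /lam /= => h0.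
  by move/eqP: ne; apply; apply: (mulfI a0); rewrite mulr0 -h0 /lam; ring.
exists Q => //; have zy : Z 0 != Z Q by apply: contra Q0 => /eqP/Zi <-.
have Hh := infp_H (hP Q0 0).
have zh : Z 0 != h Q by apply: contra_notN n0 => /eqP ->.
apply: (H_one hH jr _ jz Hr Hh n0).
have -> : g = join (Z 0) (h Q).
  by rewrite infp_join // add0r; apply: (two_points zy) => //; [rewrite -yE | apply: on_join1 | apply: on_join2].
exact: on_join2.
Qed.

Lemma hZ c (Q : rw) : c != 0 -> Q != 0 -> h (c *: Q) = h Q.
Proof.
move=> c0 Q0; have cQ0 : c *: Q != 0 by rewrite scaler_eq0 negb_or c0.
apply: (@infp_uniq 0 0 _ _ _ cQ0 (hP cQ0 0)); have [l [e [f [ef L R Hr]]]] := hP Q0 0.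
exists l, e, (c * f.1, c * f.2); split=> //=.
- have -> : lam e (c * f.1) (c * f.2) = c * lam e f.1 f.2 by rewrite /lam; ring.
  by rewrite mulf_neq0.
- move=> s t s0; have := L s (t * c) s0.
  by rewrite /cmb /= !scalerA !mulrA [t * c / s]mulrAC.
- exact: atpZ.
Qed.

(** Seen from [Z 0], the points at infinity in a pencil have projective directions. *)
Lemma h_dir (u v : rw) : u != 0 -> (forall c, v <> c *: u) -> exists o1 o2 : rw,
  forall s t, (s, t) != (0, 0) -> dir (Z 0) (join (Z 0) (h (s *: u + t *: v))) (s *: o1 + t *: o2).
Proof.
move=> u0 ne; have v0 : v != 0 by apply/eqP => v0; apply: (ne 0); rewrite v0 scale0r.
have [l [e [f [ef L R Hr]]]] := hP v0 u; have ho := infp_on L.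
have uv c : u + c *: v != 0.
  apply/eqP => E; have c0 : c != 0.
    by apply/eqP => c0; move/eqP: u0; rewrite -E c0 scale0r addr0.
  apply: (ne (- c^-1)); apply: (scalerI c0); rewrite scalerA mulrN divff // scaleN1r.
  by apply/eqP; rewrite -addr_eq0 addrC E.
have no : ~~ on l (Z 0).
  apply/negP => lo; have [s [t [E _]]] := lam_comb (crd l (Z 0)) ef.
  have s0 : s != 0.
    apply/eqP => s0; apply: (@Zn 0); have -> // : Z 0 = h v.
    by apply: (atp_uniq (crd0 lo) (atp_crd lo)); rewrite E s0 /= !mul0r !add0r; apply: atpZ.
  have := L s t s0; rewrite /cmb -E => /(atp_uniq (crd0 lo) (atp_crd lo))/Zi/eqP.
  by rewrite eq_sym (negbTE (uv _)).
have [w1 [w2 [_ _ W]]] := perspectivity hd uS hS hfin hfull no.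
exists (e.1 *: w1 + e.2 *: w2), (f.1 *: w1 + f.2 *: w2) => s t st.
have W' y : atp l (cmb e f s t) y -> dir (Z 0) (join (Z 0) y)
   (s *: (e.1 *: w1 + e.2 *: w2) + t *: (f.1 *: w1 + f.2 *: w2)).
  move=> hy; have [ly _] := hy; have [a a0 E] := atp_cmb ef st hy.
  have := W _ ly; rewrite E => /(dirZ (invr_neq0 a0)); congr dir.
  by rewrite /cmb /=; apply/rowP => j; rewrite !mxE; field.
case: (eqVneq s 0) => [s0|s0].
  have t0 : t != 0 by apply: contra st => /eqP ->; rewrite s0.
  rewrite {1}s0 scale0r add0r hZ //; apply: W'; rewrite s0 /cmb !mul0r !add0r; exact: atpZ.
have -> : s *: u + t *: v = s *: (u + (t / s) *: v).
  by rewrite scalerDr scalerA mulrCA divff // mulr1.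
rewrite hZ // infp_join // add0r; apply: W'; exact: L.
Qed.

(** A line of [H] is seen from [Z 0] under the directions found in [h_dir], and a
    perspectivity compares them with the parameter of that line. *)
Lemma h_line (u v : rw) : u != 0 -> (forall c, v <> c *: u) -> exists g (e f : K * K),
  lam e f.1 f.2 != 0 /\ forall s t, (s, t) != (0, 0) -> atp g (cmb e f s t) (h (s *: u + t *: v)).
Proof.
move=> u0 ne; have v0 : v != 0 by apply/eqP => v0; apply: (ne 0); rewrite v0 scale0r.
have [o1 [o2 D]] := h_dir u0 ne.
have H1 := infp_H (hP u0 0); have H2 := infp_H (hP v0 0).
have zh r : H r -> Z 0 != r by move=> Hr; apply: contra_notN (@Zn 0) => /eqP ->.
have D1 := D 1 0 (pair_l 0 (oner_neq0 K)); have D2 := D 0 1 (pair_r 0 (oner_neq0 K)).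
rewrite !scale1r !scale0r !addr0 in D1; rewrite !scale1r !scale0r !add0r in D2.
have uv0 s t : (s, t) != (0, 0) -> s *: u + t *: v != 0.
  by move=> st; apply: contra st => /eqP /(comb_indep u0 ne)[-> ->].
have o0 s t : (s, t) != (0, 0) -> s *: o1 + t *: o2 != 0 by move=> st; have [] := D _ _ st.
have hh : h u != h v.
  apply/eqP => E; rewrite -E in D2; have [c _ e] := dir_uniq hd D1 D2.
  by have := o0 (- c) 1 (pair_r _ (oner_neq0 K)); rewrite scale1r e scaleNr addNr eqxx.
have [cl _ _] := hH; have inH : inside (join (h u) (h v)) H by apply: cl.
have no : ~~ on (join (h u) (h v)) (Z 0) by apply/negP => /inH; apply: Zn.
have ju := on_join1 hh; have jv := on_join2 hh.
have [w1 [w2 [_ _ W]]] := perspectivity hd uS hS hfin hfull no.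
have [a a0 E1] := dir_uniq hd (W _ ju) D1; have [b b0 E2] := dir_uniq hd (W _ jv) D2.
set g := join (h u) (h v) in W ju jv inH E1 E2 *.
pose e := (a * (crd g (h u)).1, a * (crd g (h u)).2); pose f := (b * (crd g (h v)).1, b * (crd g (h v)).2).
exists g, e, f; have ef : lam e f.1 f.2 != 0.
  have -> : lam e f.1 f.2 = a * b * lam (crd g (h u)) (crd g (h v)).1 (crd g (h v)).2.
    by rewrite /lam /e /f /=; ring.
  by rewrite !mulf_neq0 // crd_neq.
split=> // s t st; have [y hy] := atp_exists hd g (cmb_neq0 ef st).
have [gy _] := hy; have [c c0 E] := atp_cmb ef st hy.
have := W _ gy; have -> : (crd g y).1 *: w1 + (crd g y).2 *: w2 = c *: (s *: o1 + t *: o2).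
  by rewrite E E1 E2 /cmb /e /f /=; apply/rowP => j; rewrite !mxE; ring.
move=> Dy; have Hh := infp_H (hP (uv0 _ _ st) 0).
have jj := dir_line hd Dy (dirZ c0 (D _ _ st)).
have -> // : h (s *: u + t *: v) = y.
apply: (H_one hH (on_join2 (zh _ Hh)) _ (on_join1 (zh _ Hh)) Hh (inH _ gy) (@Zn 0)).
by rewrite -jj; apply: on_join2; apply: zh; apply: inH.
Qed.

End Chart.
End Coordinates.

(** * Homogeneous coordinates *)

Section Frame.
Variables (K : fieldType) (V : lmodType K) (d n : nat) (C : cap V d n).
Hypothesis hd : (2 <= d)%N.
Notation pt := (@pt _ _ _ _ C).
Notation ln := (@ln _ _ _ _ C).
Notation join := (@join _ _ _ _ C).
Notation rw := 'rV[K]_n.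
Notation crd := (@crd _ _ _ _ C).
Notation plane := (@plane _ _ _ _ C).
Implicit Types (p q x y : pt) (l m : ln) (ls etas : seq ln) (U : set V).
Variable S : seq K.
Hypothesis uS : uniq S.
Hypothesis hS : (d ^ 3 <= size S ^ 2)%N.
Variable M : nat.
Hypothesis hfin : dimle set0 [set: V] M.
Hypothesis hfull : forall Pi, plane Pi -> full Pi.
Notation atp := (@atp _ _ _ _ C).
Notation hyperplane := (@hyperplane _ _ _ _ C).
Notation row1 := 'rV[K]_n.+1.

(** [Psi A] is the point with homogeneous coordinates [A]: every pencil of
    coordinate vectors parametrizes a curve, projectively. *)
Definition framed (Psi : row1 -> pt) := forall A B : row1, A != 0 -> (forall c, B <> c *: A) ->
  exists l (e f : K * K), lam e f.1 f.2 != 0 /\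
    forall s t, (s, t) != (0, 0) -> atp l (cmb e f s t) (Psi (s *: A + t *: B)).

Definition hd0 (A : row1) : K := A 0 0.
Definition tl (A : row1) : rw := rsubmx (A : 'rV_(1 + n)).

Lemma tl_lin a (A B : row1) : tl (a *: A + B) = a *: tl A + tl B.
Proof. by apply/rowP => j; rewrite !mxE. Qed.
Lemma hd0_lin a (A B : row1) : hd0 (a *: A + B) = a * hd0 A + hd0 B.
Proof. by rewrite /hd0 !mxE. Qed.

Lemma hd_tl (a : K) (u : rw) : exists A : row1, hd0 A = a /\ tl A = u.
Proof.
exists (row_mx (a%:M : 'rV_1) u); split.
  by rewrite /hd0 mxE; case: splitP => // j _; rewrite mxE ord1 eqxx.
by rewrite /tl row_mxKr.
Qed.

Lemma hd_tl_eq (A B : row1) : hd0 A = hd0 B -> tl A = tl B -> A = B.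
Proof.
move=> h t; apply/rowP => i; case: (@splitP 1 n i) => [j e|j e].
  by have -> : i = 0; [apply: val_inj; rewrite /= e ord1 | exact: h].
have := congr1 (fun u : rw => u 0 j) t; rewrite !mxE.
by have -> : i = rshift 1 j by apply: val_inj.
Qed.

Lemma tl0 A : tl A = 0 -> hd0 A = 0 -> A = 0.
Proof. by move=> t h; apply: hd_tl_eq; rewrite ?t ?h /hd0 /tl ?mxE //; apply/rowP => j; rewrite !mxE. Qed.

(** Affine coordinates off a hyperplane, completed by the directions of affine
    lines as points at infinity. *)
Lemma frame_exists (p : pt) : (2 <= n)%N ->
  exists2 Psi : row1 -> pt, framed Psi & forall y, exists2 A, A != 0 & Psi A = y.
Proof.
move=> n2; have [H hH Hp] := hyperplane_exists hd p (ltnW n2).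
have [p2 Hp2 pp2] : exists2 p2, H p2 & p != p2.
  pose j0 := Ordinal (ltnW n2); pose j1 := Ordinal n2.
  have e0 : delta_mx 0 j0 != 0 :> rw by apply/eqP => /rowP/(_ j0)/eqP; rewrite !mxE !eqxx oner_eq0.
  have ne (c : K) : delta_mx 0 j1 <> c *: delta_mx 0 j0 :> rw.
    by move=> /rowP/(_ j1)/eqP; rewrite !mxE !eqxx /= mulr0 oner_eq0.
  have [y [z [py pz yz np _]]] := dir_pencil hd p e0 ne.
  have [_ mt _] := hH; have [q jq Hq] := mt (join y z); exists q => //.
  by apply: contra np => /eqP ->.
have [Phi [L Pi Ps]] := chart hd uS hS hfin hfull hH Hp Hp2 pp2.
have /choice[Z ZP] : forall P : rw, exists y, ~ H y /\ Phi y = P.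
  by move=> P; have [y ny E] := Ps P; exists y.
have Zn P : ~ H (Z P) by case: (ZP P).
have ZK P : Phi (Z P) = P by case: (ZP P).
have Zi : injective Z by move=> P Q E; rewrite -(ZK P) E ZK.
have Zs y : ~ H y -> exists P, y = Z P by move=> ny; exists (Phi y); apply: Pi; rewrite ?ZK.
have Zl (P Q : rw) : Q != 0 -> exists r, infp H Z P Q r.
  move=> Q0; have zz : Z P != Z (P + Q).
    by apply: contra Q0 => /eqP/Zi/eqP; rewrite -{1}[P]addr0 (inj_eq (addrI P)) eq_sym.
  have [_ mt _] := hH; have [r jr Hr] := mt (join (Z P) (Z (P + Q))).
  have j0 := on_join1 zz; have j1 := on_join2 zz.
  have zr : Z P != r by apply: contra_notN (Zn P) => /eqP ->.
  have [Q' Q'0 LQ] := L _ _ _ jr j0 Hr (Zn P).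
  move gE : (join (Z P) (Z (P + Q))) jr j0 j1 LQ => g jr j0 j1 LQ.
  have ne := crd_neq j0 jr zr.
  have off s t y : s != 0 -> atp g (cmb (crd g (Z P)) (crd g r) s t) y -> ~ H y.
    move=> s0 hy Hy; have [my _] := hy; have yr := H_one hH my jr j0 Hy Hr (Zn P).
    have [a a0 E] := atp_cmb ne (pair_l t s0) hy.
    have := lam_self (crd g r); rewrite -{2 3}yr {1 2}E /cmb /lam /= => h.
    by move/eqP: ne; apply; apply: (mulfI (mulf_neq0 a0 s0)); rewrite mulr0 -[RHS]oppr0 -h /lam; ring.
  have [s1 [t1 E1]] := cmb_span (crd g (Z (P + Q))) j0 jr zr.
  have s10 : s1 != 0.
    apply/eqP => s0; apply: (Zn (P + Q)); have -> // : Z (P + Q) = r.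
    apply: (atp_uniq (crd0 j1) (atp_crd j1)); rewrite E1 s0 /cmb !mul0r !add0r; exact/atpZ/atp_crd.
  pose ka := t1 / s1.
  have QE : Q = ka *: Q'.
    have := LQ s1 t1 (Z (P + Q)) s10; rewrite -E1 => /(_ (atp_crd j1)).
    by rewrite !ZK => /addrI.
  have ka0 : ka != 0 by apply: contra Q0 => /eqP k0; rewrite QE k0 scale0r.
  exists r; exists g, (crd g (Z P)), (ka * (crd g r).1, ka * (crd g r).2); split=> //=.
  - have -> : lam (crd g (Z P)) (ka * (crd g r).1) (ka * (crd g r).2) = ka * lam (crd g (Z P)) (crd g r).1 (crd g r).2.
      by rewrite /lam; ring.
    by rewrite mulf_neq0.
  - move=> s t s0.
    have -> : cmb (crd g (Z P)) (ka * (crd g r).1, ka * (crd g r).2) s t = cmb (crd g (Z P)) (crd g r) s (t * ka).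
      by rewrite /cmb /= !mulrA.
    have [y hy] := atp_exists hd g (cmb_neq0 ne (pair_l (t * ka) s0)).
    have -> // : Z (P + (t / s) *: Q) = y.
    apply: Pi => //; first exact: (off _ _ _ s0 hy).
    by rewrite ZK (LQ _ _ _ s0 hy) ZK QE scalerA mulrAC.
  - by apply: atpZ; apply: atp_crd.
have [h hP] := dir_at_infinity hd uS hS hH Zn Zi Zl.
pose Psi (A : row1) := if hd0 A == 0 then h (tl A) else Z ((hd0 A)^-1 *: tl A).
exists Psi; last first.
  move=> y; case: (pselect (H y)) => [Hy|ny].
    have [Q Q0 ->] := h_onto hd hH Zn Zi Zs hP Hy.
    have [A [A0 AQ]] := hd_tl 0 Q; exists A; last by rewrite /Psi A0 eqxx AQ.
    by apply: contra Q0 => /eqP A00; rewrite -AQ A00; apply/eqP/rowP => j; rewrite !mxE.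
  have [P ->] := Zs y ny; have [A [A0 AP]] := hd_tl 1 P; exists A.
    by apply/eqP => A00; move/eqP: A0; rewrite A00 /hd0 mxE eq_sym oner_eq0.
  by rewrite /Psi A0 oner_eq0 AP invr1 scale1r.
have main (A B : row1) : hd0 A != 0 -> (forall c, B <> c *: A) -> exists l (e f : K * K), lam e f.1 f.2 != 0 /\
    forall s t, (s, t) != (0, 0) -> atp l (cmb e f s t) (Psi (s *: A + t *: B)).
  move=> A0 ne; pose ka := hd0 B / hd0 A; pose Q := tl B - ka *: tl A.
  have Q0 : Q != 0.
    apply/eqP => /eqP; rewrite subr_eq0 => /eqP E; apply: (ne ka); apply: hd_tl_eq.
      by rewrite -[ka *: A]addr0 hd0_lin /ka divfK // /hd0 mxE addr0.
    by rewrite -[ka *: A]addr0 tl_lin E; apply/rowP => j; rewrite !mxE addr0.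
  have Q0' : (hd0 A)^-1 *: Q != 0 by rewrite scaler_eq0 negb_or invr_eq0 A0.
  have [l [e [f [ef Le R Hr]]]] := hP _ Q0' ((hd0 A)^-1 *: tl A).
  exists l, e, (ka * e.1 + f.1, ka * e.2 + f.2); split=> /=.
    by move: ef; congr (_ != 0); rewrite /lam; ring.
  move=> s t st; have -> : cmb e (ka * e.1 + f.1, ka * e.2 + f.2) s t = cmb e f (s + t * ka) t.
    by rewrite /cmb /=; congr (_, _); ring.
  have hE : hd0 (s *: A + t *: B) = (s + t * ka) * hd0 A.
    by rewrite hd0_lin -[t *: B]addr0 hd0_lin /hd0 [X in _ + (_ + X)]mxE addr0 -/(hd0 _) -/(hd0 _) /ka; field.
  have tE : tl (s *: A + t *: B) = (s + t * ka) *: tl A + t *: Q.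
    rewrite tl_lin -[t *: B]addr0 tl_lin; apply/rowP => j; rewrite /Q; rewrite !mxE; ring.
  rewrite /Psi hE mulf_eq0 (negbTE A0) orbF tE; case: eqP => [s0|/eqP s0].
    rewrite s0 scale0r add0r; have t0 : t != 0.
      by apply: contra st => /eqP t0; move: s0; rewrite t0 mul0r addr0 => ->.
    have hZ' := hZ hd uS hS hH Zn Zi Zl hP.
    rewrite hZ' // -(hZ' (hd0 A)^-1) // ?invr_eq0 // /cmb !mul0r !add0r; exact: atpZ.
  have := Le _ t s0; congr (atp _ _ (Z _)).
  by move: (Q) => Q1; apply/rowP => j; rewrite !mxE; move: (hd0 A) A0 => a A0; field; rewrite ?s0 ?A0.
move=> A B A0 ne; case: (eqVneq (hd0 A) 0) => [hA|hA]; last exact: main.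
case: (eqVneq (hd0 B) 0) => [hB|hB].
  have tA0 : tl A != 0 by apply: contra A0 => /eqP tA; apply/eqP/tl0.
  have tne c : tl B <> c *: tl A.
    move=> e; apply: (ne c); apply: hd_tl_eq; first by rewrite -[c *: A]addr0 hd0_lin hA hB mulr0 /hd0 mxE addr0.
    by rewrite e; apply/rowP => j; rewrite !mxE.
  have [g [e [f [ef G]]]] := h_line hd uS hS hfin hfull hH Zn Zi Zl hP tA0 tne.
  exists g, e, f; split=> // s t st; rewrite /Psi hd0_lin -[t *: B]addr0 hd0_lin hA hB !mulr0 !add0r.
  by rewrite {1}/hd0 mxE eqxx addr0 tl_lin -[t *: B]addr0 tl_lin; have -> : tl 0 = 0 by [apply/rowP => j; rewrite !mxE]; rewrite addr0; apply: G.
have ne' c : A <> c *: B.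
  move=> E; case: (eqVneq c 0) => [c0|c0]; first by move/eqP: A0; rewrite E c0 scale0r.
  by apply: (ne c^-1); rewrite E scalerA mulVf // scale1r.
have [l [e [f [ef G]]]] := main B A hB ne'.
exists l, f, e; split=> [|s t st].
  by move: ef; rewrite lamC oppr_eq0.
rewrite addrC; have -> : cmb f e s t = cmb e f t s by rewrite /cmb; congr (_, _); rewrite addrC.
by apply: G; apply: contra st => /eqP[-> ->].
Qed.

End Frame.

(** * Parametrized curves in coordinates *)

Section Carnot.
Variables (K : fieldType) (V : lmodType K) (d n : nat) (C : cap V d n).
Hypothesis hd : (2 <= d)%N.
Notation pt := (@pt _ _ _ _ C).
Notation ln := (@ln _ _ _ _ C).
Notation on := (@onl _ _ _ _ C).
Notation vr := (@vr _ _ _ _ C).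
Notation par := (@par _ _ _ _ C).
Notation tg := (@tgl _ _ _ _ C).
Notation crd := (@crd _ _ _ _ C).
Notation plane := (@plane _ _ _ _ C).
Implicit Types (p q x y : pt) (l m : ln) (ls etas : seq ln) (U : set V).
Variable S : seq K.
Hypothesis uS : uniq S.
Hypothesis hS : (d ^ 3 <= size S ^ 2)%N.
Variable M : nat.
Hypothesis hfin : dimle set0 [set: V] M.
Hypothesis hfull : forall Pi, plane Pi -> full Pi.
Notation atp := (@atp _ _ _ _ C).
Notation row1 := 'rV[K]_n.+1.
Variable Psi : row1 -> pt.
Hypothesis hPsi : framed Psi.

Lemma framed_eq A B : A != 0 -> B != 0 -> Psi A = Psi B -> exists c, B = c *: A.
Proof.
move=> A0 B0 E; apply: contrapT => ne.
have {}ne c : B <> c *: A by move=> e; apply: ne; exists c.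
have [l [e [f [ef G]]]] := hPsi A0 ne.
have := G 1 0 (pair_l 0 (oner_neq0 K)); have := G 0 1 (pair_r 0 (oner_neq0 K)).
rewrite !scale1r !scale0r add0r addr0 E => h1 h2.
have e0 : cmb e f 1 0 != (0, 0) by apply: cmb_neq0 (pair_l _ (oner_neq0 K)).
have f0 : cmb e f 0 1 != (0, 0) by apply: cmb_neq0 (pair_r _ (oner_neq0 K)).
have [a a0 E1] := atp_scale e0 h2; have [b b0 E2] := atp_scale f0 h1.
have : b * a * lam e f.1 f.2 = b * a * lam (cmb e f 1 0) (cmb e f 0 1).1 (cmb e f 0 1).2.
  by rewrite /cmb /lam /=; ring.
rewrite E1 E2 [X in _ = _ * X](_ : _ = 0); last by rewrite /lam /=; ring.
by move/eqP; rewrite mulr0 !mulf_eq0 (negbTE a0) (negbTE b0) (negbTE ef).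
Qed.

Hypothesis hn : (0 < n)%N.

Lemma indep_exists (A : row1) : A != 0 -> exists B : row1, forall c, B <> c *: A.
Proof.
move=> /rV0Pn[j Aj]; have [j' jj] : exists j' : 'I_n.+1, j' != j.
  case: (eqVneq ord0 j) => [<-|]; last by exists ord0.
  by exists ord_max; rewrite -val_eqE /= -lt0n.
exists (delta_mx 0 j') => c E; have := congr1 (fun u : row1 => u 0 j) E.
rewrite !mxE eqxx /= eq_sym (negbTE jj) => /esym/eqP; rewrite mulf_eq0 (negbTE Aj) orbF => /eqP c0.
have := congr1 (fun u : row1 => u 0 j') E; rewrite c0 scale0r !mxE !eqxx => /eqP.
by rewrite oner_eq0.
Qed.

Lemma framedZ c (A : row1) : c != 0 -> A != 0 -> Psi (c *: A) = Psi A.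
Proof.
move=> c0 A0; have [B ne] := indep_exists A0.
have [l [e [f [ef G]]]] := hPsi A0 ne.
have h1 := G 1 0 (pair_l 0 (oner_neq0 K)); have h2 := G c 0 (pair_l 0 c0).
move: h1 h2; rewrite scale1r scale0r !addr0 => h1 h2.
apply: (atp_uniq (cmb_neq0 ef (pair_l _ c0)) h2).
by have := atpZ c h1; rewrite /cmb /= !mul0r !addr0 !mul1r.
Qed.

(** A parametrization of degree [d] of the image of a pencil. *)
Definition curve l (A B : row1) (w : K -> K -> V) := exists (e f : K * K) (k : K),
  [/\ lam e f.1 f.2 != 0, k != 0, forall s t, (s, t) != (0, 0) -> atp l (cmb e f s t) (Psi (s *: A + t *: B)) &
     forall s t, w s t = k *: par l (rnc_vec d (cmb e f s t).1 (cmb e f s t).2)].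

Lemma curve_vr l A B w s t : curve l A B w -> (s, t) != (0, 0) ->
  exists2 c : K, c != 0 & w s t = c *: vr (Psi (s *: A + t *: B)).
Proof.
move=> [e [f [k [ef k0 G ->]]]] st; have hy := G s t st; have [ly _] := hy.
have [a a0 ->] := atp_scale (cmb_neq0 ef st) hy; have [_ [c c0 E]] := crdP ly.
exists (k * (a ^+ d * c)); first by rewrite !mulf_neq0 // expf_neq0.
by rewrite /= rnc_scale parZ E !scalerA !mulrA.
Qed.

Lemma curve_scale l A B w k : k != 0 -> curve l A B w -> curve l A B (fun s t => k *: w s t).
Proof.
move=> k0 [e [f [k' [ef k'0 G W]]]]; exists e, f, (k * k'); split=> //; first by rewrite mulf_neq0.
by move=> s t; rewrite W scalerA.
Qed.

Lemma curve_exists A B c : c != 0 -> A != 0 -> (forall c, B <> c *: A) ->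
  exists l w, curve l A B w /\ w 1 0 = c *: vr (Psi A).
Proof.
move=> c0 A0 ne; have [l [e [f [ef G]]]] := hPsi A0 ne.
pose w s t := par l (rnc_vec d (cmb e f s t).1 (cmb e f s t).2).
have cw : curve l A B w by exists e, f, 1; split=> //; [apply: oner_neq0 | move=> s t; rewrite scale1r].
have [k k0] := curve_vr cw (pair_l 0 (oner_neq0 K)); rewrite scale1r scale0r addr0 => E.
exists l, (fun s t => (c / k) *: w s t); split.
  by apply: curve_scale; rewrite // mulf_neq0 // invr_neq0.
by rewrite E scalerA divfK.
Qed.

Lemma curve_change l A B w a b : curve l A B w -> b != 0 ->
  curve l A (a *: A + b *: B) (fun s t => w (s + t * a) (t * b)).
Proof.
move=> [e [f [k [ef k0 G W]]]] b0; exists e, (cmb e f a b), k.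
have cE s t : cmb e (cmb e f a b) s t = cmb e f (s + t * a) (t * b) by rewrite /cmb /=; congr (_, _); ring.
split=> //.
- have -> : lam e (cmb e f a b).1 (cmb e f a b).2 = b * lam e f.1 f.2 by rewrite /lam /cmb /=; ring.
  by rewrite mulf_neq0.
- move=> s t st; rewrite cE; have := G (s + t * a) (t * b).
  rewrite scalerDr !scalerA addrA -scalerDl; apply.
  apply: contra st => /eqP[h1 /eqP]; rewrite mulf_eq0 (negbTE b0) orbF => /eqP t0.
  by move: h1; rewrite t0 mul0r addr0 => ->.
- by move=> s t; rewrite W cE.
Qed.

Lemma curve_swap l A B w : curve l A B w -> curve l B A (fun s t => w t s).
Proof.
move=> [e [f [k [ef k0 G W]]]]; exists f, e, k.
have cE s t : cmb f e s t = cmb e f t s by rewrite /cmb; congr (_, _); rewrite addrC.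
split=> //; first by move: ef; rewrite lamC oppr_eq0.
- by move=> s t st; rewrite cE addrC; apply: G; apply: contra st => /eqP[-> ->].
- by move=> s t; rewrite W cE.
Qed.

Lemma curve_neq0 l A B w : curve l A B w -> w 1 0 != 0.
Proof.
by move=> cw; have [c c0 ->] := curve_vr cw (pair_l 0 (oner_neq0 K)); rewrite scaler_eq0 negb_or c0 vr_neq0.
Qed.

(** The parametrization of a pencil is unique up to a scalar: a projectivity of
    the projective line that fixes three points is the identity. *)
Lemma curve_uniq l l' A B w w' : curve l A B w -> curve l' A B w' -> w 1 0 = w' 1 0 ->
  l = l' /\ forall s t, w s t = w' s t.
Proof.
move=> [e [f [k [ef k0 G W]]]] [e' [f' [k' [ef' k'0 G' W']]]] E.
have o10 := pair_l 0 (oner_neq0 K); have o01 := pair_r 0 (oner_neq0 K).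
have o11 := pair_l 1 (oner_neq0 K).
have ab : Psi (1 *: A + 0 *: B) != Psi (0 *: A + 1 *: B).
  apply/eqP => EE; have h1 := G _ _ o10; have h2 := G _ _ o01; rewrite -EE in h2.
  have [a a0 E1] := atp_scale (cmb_neq0 ef o10) h1; have [b b0 E2] := atp_scale (cmb_neq0 ef o01) h2.
  move/eqP: ef; apply; have -> : lam e f.1 f.2 = lam (cmb e f 1 0) (cmb e f 0 1).1 (cmb e f 0 1).2.
    by rewrite /cmb /lam /=; ring.
  by rewrite E1 E2 /lam /=; ring.
have ll : l = l'.
  by apply: (two_points ab); [case: (G _ _ o10)|case: (G _ _ o01)|case: (G' _ _ o10)|case: (G' _ _ o01)].
split=> //; subst l'.
have pr s t : (s, t) != (0, 0) -> exists2 c : K, c != 0 & cmb e' f' s t = (c * (cmb e f s t).1, c * (cmb e f s t).2).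
  move=> st; have [a a0 E1] := atp_scale (cmb_neq0 ef st) (G _ _ st).
  have [b b0 E2] := atp_scale (cmb_neq0 ef' st) (G' _ _ st).
  by exists (b / a); rewrite ?mulf_neq0 ?invr_neq0 // E2 E1 /= !mulrA !divfK.
have [a a0] := pr _ _ o10; have [b b0] := pr _ _ o01; have [c c0] := pr _ _ o11.
rewrite /cmb /= !mul0r !mul1r !addr0 !add0r => -[h1 h2] [h3 h4] [h5 h6].
have ea : e' = (a * e.1, a * e.2) by rewrite [LHS]surjective_pairing h5 h6.
have fb : f' = (b * f.1, b * f.2) by rewrite [LHS]surjective_pairing h3 h4.
rewrite ea fb /= in h1 h2.
have ca : c = a.
  apply: (mulIf ef); transitivity ((c * (e.1 + f.1)) * f.2 - (c * (e.2 + f.2)) * f.1); first by rewrite /lam; ring.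
  by rewrite -h1 -h2 /lam; ring.
have cb : c = b.
  apply: (mulIf ef); transitivity (e.1 * (c * (e.2 + f.2)) - e.2 * (c * (e.1 + f.1))); first by rewrite /lam; ring.
  by rewrite -h1 -h2 /lam; ring.
have cE s t : rnc_vec d (cmb e' f' s t).1 (cmb e' f' s t).2 = a ^+ d *: rnc_vec d (cmb e f s t).1 (cmb e f s t).2.
  rewrite -rnc_scale ea fb -cb ca /cmb /=; congr (rnc_vec d _ _); ring.
have kk : k = k' * a ^+ d.
  have nz : par l (rnc_vec d (cmb e f 1 0).1 (cmb e f 1 0).2) != 0.
    have cw : curve l A B w by exists e, f, k; split.
    by have := curve_neq0 cw; rewrite W scaler_eq0 negb_or => /andP[].
  apply/eqP; rewrite -subr_eq0; move: E; rewrite W W' cE parZ scalerA => /eqP.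
  by rewrite -subr_eq0 -scalerBl scaler_eq0 (negbTE nz) orbF.
by move=> s t; rewrite W W' cE parZ scalerA kk.
Qed.

(** A linear form on a curve is the product of the linear factors of its zeros. *)
Lemma curve_factor l A B w (f : V -> K) (bs : seq (K * K)) : curve l A B w -> functional f ->
  size bs = d -> (forall b, b \in bs -> b != (0, 0) /\ f (vr (Psi (b.1 *: A + b.2 *: B))) = 0) ->
  (forall b b' : K * K, b \in bs -> b' \in bs -> b != b' -> lam b b'.1 b'.2 != 0) ->
  (forall b, (count_mem b bs <= 2)%N) ->
  (forall b v, (1 < count_mem b bs)%N -> tg l (Psi (b.1 *: A + b.2 *: B)) v -> f v = 0) ->
  exists c, forall s t, f (w s t) = c * \prod_(b <- bs) lam b s t.
Proof.
move=> [e [g [k [eg k0 G W]]]] lf szb b0 bn bc b2.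
pose y (b : K * K) := Psi (b.1 *: A + b.2 *: B); pose z (b : K * K) := crd l (y b).
have hy b : b \in bs -> atp l (cmb e g b.1 b.2) (y b).
  by move=> bb; apply: G; rewrite -surjective_pairing; case: (b0 _ bb).
have /choice[r rP] : forall b : K * K, exists r : K, b \in bs -> r != 0 /\ forall x : K * K, lam (z b) (cmb e g x.1 x.2).1 (cmb e g x.1 x.2).2 = r * lam b x.1 x.2.
  move=> b; case: (boolP (b \in bs)) => bb; last by exists 0.
  have bz : (b.1, b.2) != (0, 0) by rewrite -surjective_pairing; case: (b0 _ bb).
  have [a a0 E] := atp_cmb eg bz (hy _ bb); exists (a * lam e g.1 g.2) => _; split; first by rewrite mulf_neq0.
  by move=> x; rewrite /z E /cmb /lam /=; ring.
have lg := pull_functional l lf.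
have zz : zpts z bs.
  split=> // [b bb|b b' bb bb' ne]; first by apply: crd0; case: (hy _ bb).
  have bz : (b'.1, b'.2) != (0, 0) by rewrite -surjective_pairing; case: (b0 _ bb').
  have [a a0 E] := atp_cmb eg bz (hy _ bb'); have [r0 rE] := rP _ bb.
  have -> : lam (z b) (z b').1 (z b').2 = a * lam (z b) (cmb e g b'.1 b'.2).1 (cmb e g b'.1 b'.2).2.
    by rewrite [z b']E /cmb /lam /=; ring.
  by rewrite rE !mulf_neq0 // bn.
have zp : zero_at d (polyf (f \o par l)) z bs.
  move=> b bb; have [ly _] := hy _ bb; split=> [|c2 a a'].
    by apply/eqP; rewrite pull_vr //; case: (b0 _ bb) => _ ->.
  rewrite polyf_drnc //=; apply: (b2 b) => //.
  by eexists; last reflexivity; apply/rnc_tangentP; exists 0, a, a'; rewrite scale0r add0r.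
have [|q szq pE] := form_factor zz _ (size_polyf _) zp; first by rewrite szb.
rewrite szb subnn in szq; have qE := size1_polyC szq.
exists (k * (q`_0 * \prod_(b <- bs) r b)) => s t.
rewrite W funZ // -[f _]/((f \o par l) _) -polyf_rnc // pE -{1}szb -[size bs]addn0.
rewrite hev_prod // qE hev0 -mulrA; congr (_ * _); rewrite mulrC -mulrA; congr (_ * _);
first by rewrite coefC eqxx.
rewrite -big_split /= big_seq [RHS]big_seq; apply: eq_bigr => b bb.
by have [_ /(_ (s, t)) /= ->] := rP _ bb.
Qed.

End Carnot.

(** * The theorem of Carnot *)

Section Triangle.
Variables (K : fieldType) (V : lmodType K) (d n : nat) (C : cap V d n).
Hypothesis hd : (2 <= d)%N.
Notation pt := (@pt _ _ _ _ C).
Notation ln := (@ln _ _ _ _ C).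
Notation on := (@onl _ _ _ _ C).
Notation vr := (@vr _ _ _ _ C).
Notation par := (@par _ _ _ _ C).
Notation crd := (@crd _ _ _ _ C).
Notation mult := (@mult _ _ _ _ C).
Notation lvec := (@lvec _ _ _ _ C).
Notation plane := (@plane _ _ _ _ C).
Implicit Types (p q y : pt) (l m : ln) (ls etas : seq ln) (U : set V).
Variable S : seq K.
Hypothesis uS : uniq S.
Hypothesis hS : (d ^ 3 <= size S ^ 2)%N.
Variable M : nat.
Hypothesis hfin : dimle set0 [set: V] M.
Hypothesis hfull : forall Pi, plane Pi -> full Pi.
Notation row1 := 'rV[K]_n.+1.
Variable Psi : row1 -> pt.
Hypothesis hPsi : framed Psi.
Hypothesis hn : (0 < n)%N.
Notation curve := (@curve _ _ _ _ C Psi).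

Lemma curve_onto l A B w y : curve l A B w -> on l y ->
  exists s t, (s, t) != (0, 0) /\ y = Psi (s *: A + t *: B).
Proof.
move=> [e [f [k [ef k0 G W]]]] ly; have [s [t [E _]]] := lam_comb (crd l y) ef.
have st : (s, t) != (0, 0).
  apply/eqP => -[s0 t0]; have := crd0 ly; rewrite E s0 t0 !mul0r addr0 eqxx //.
exists s, t; split=> //; apply: (atp_uniq (crd0 ly) (atp_crd ly)); rewrite E; exact: G.
Qed.

Lemma curve_on l A B w s t : curve l A B w -> (s, t) != (0, 0) -> on l (Psi (s *: A + t *: B)).
Proof. by move=> [e [f [k [ef k0 G W]]]] st; case: (G s t st). Qed.

Lemma count_roots (cs bs : seq K) : Poly cs != 0 -> uniq bs ->
  (count (fun b => (Poly cs).[b] == 0)%R bs <= (size cs).-1)%N.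
Proof.
move=> p0 ub; rewrite -size_filter.
have h : all (root (Poly cs)) [seq b <- bs | (Poly cs).[b] == 0].
  by apply/allP => b; rewrite mem_filter => /andP[].
have := leq_trans (max_poly_roots p0 h (filter_uniq _ ub)) (size_Poly cs).
by case: (size cs).
Qed.

Variables P0 P1 P2 : row1.
Definition trv (x : K * K * K) : row1 := x.1.1 *: P0 + x.1.2 *: P1 + x.2 *: P2.
Hypothesis tri0 : forall x, trv x = 0 -> x = (0, 0, 0).
Definition conic (b : K) (x : K * K * K) : K := x.1.1 + b * x.1.2 + b ^+ 2 * x.2.

Lemma conicZ b c x : conic b (c * x.1.1, c * x.1.2, c * x.2) = c * conic b x.
Proof. by rewrite /conic /=; ring. Qed.

Lemma trv_neq0 x : x != (0, 0, 0) -> trv x != 0.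
Proof. by apply: contra => /eqP/tri0 ->. Qed.

Lemma trv_eq x x' : x != (0, 0, 0) -> x' != (0, 0, 0) -> Psi (trv x) = Psi (trv x') ->
  exists c, x' = (c * x.1.1, c * x.1.2, c * x.2).
Proof.
move=> x0 x'0 /(framed_eq hPsi (trv_neq0 x0) (trv_neq0 x'0))[c E]; exists c.
have /tri0[/eqP h1 /eqP h2 /eqP h3] : trv (x'.1.1 - c * x.1.1, x'.1.2 - c * x.1.2, x'.2 - c * x.2) = 0.
  have : trv x' - c *: trv x = 0 by rewrite E subrr.
  by move=> <-; rewrite /trv /=; apply/rowP => j; rewrite !mxE; ring.
rewrite !subr_eq0 in h1 h2 h3.
by rewrite [LHS]surjective_pairing [x'.1]surjective_pairing (eqP h1) (eqP h2) (eqP h3).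
Qed.

(** The lines [x0 + b x1 + b^2 x2 = 0] of a dual conic: no three of them concur. *)
Lemma dual_conic : exists eta : K -> ln, forall b, (forall x, x != (0, 0, 0) -> on (eta b) (Psi (trv x)) = (conic b x == 0)) /\
  forall y, on (eta b) y -> exists2 x, x != (0, 0, 0) & y = Psi (trv x).
Proof.
suff /choice[eta h] : forall b : K, exists eta : ln, (forall x, x != (0, 0, 0) -> on eta (Psi (trv x)) = (conic b x == 0)) /\
  forall y, on eta y -> exists2 x, x != (0, 0, 0) & y = Psi (trv x) by exists eta.
move=> b; pose A := trv (b, -1, 0); pose B := trv (0, b, -1).
have cE s t : s *: A + t *: B = trv (s * b, t * b - s, - t).
  by rewrite /A /B /trv /=; apply/rowP => j; rewrite !mxE; ring.
have A0 : A != 0 by apply: trv_neq0; apply/eqP => -[_ /eqP]; rewrite oppr_eq0 oner_eq0.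
have ne c : B <> c *: A.
  move=> E; have : (- c) *: A + 1 *: B = 0 by rewrite scale1r scaleNr E addNr.
  by rewrite cE => /tri0[_ _ /eqP]; rewrite oppr_eq0 oner_eq0.
have [l [w [cw _]]] := curve_exists hPsi (oner_neq0 K) A0 ne.
have nz s t : (s, t) != (0, 0) -> (s * b, t * b - s, - t) != (0, 0, 0).
  apply: contra => /eqP[_ h /eqP]; rewrite oppr_eq0 => /eqP t0; move/eqP: h.
  by rewrite t0 mul0r sub0r oppr_eq0 => /eqP ->.
have onl y : on l y -> exists s t, (s, t) != (0, 0) /\ y = Psi (trv (s * b, t * b - s, - t)).
  by move=> /(curve_onto cw)[s [t [st ->]]]; exists s, t; rewrite cE.
exists l; split=> [x x0|y /onl[s [t [st ->]]]]; last by exists (s * b, t * b - s, - t); rewrite ?nz.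
apply/idP/eqP => [/onl[s [t [st E]]]|h].
  have [c ->] := trv_eq (nz _ _ st) x0 (esym E).
  by rewrite conicZ /conic /=; ring.
have E : trv x = (- x.1.2 - b * x.2) *: A + (- x.2) *: B.
  rewrite cE; congr trv; rewrite [LHS]surjective_pairing [x.1]surjective_pairing; congr (_, _, _).
  - by apply/eqP; rewrite -subr_eq0 -[X in _ == X]h /conic; apply/eqP; ring.
  - ring.
  - ring.
rewrite E; apply: (curve_on cw); apply: contra x0 => /eqP[h1 h2].
by apply/eqP/tri0; rewrite E h1 h2 !scale0r addr0.
Qed.

(** A multiplicative closing condition around a triangle, as in Carnot's theorem.
    Since the plane is full, a nonzero linear form vanishes on [d] lines of the dual
    conic; it is nonzero at the vertices, as otherwise it would vanish on a side
    that belongs to the dual conic as well, hence on [d.+1] such lines and on the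
    plane. On each side it is the product of the traces of the [d] lines, up to a
    scalar; evaluating at the vertices shows that the three scalars agree. *)
Lemma carnot l01 l02 l12 w01 w02 w12 : curve l01 P0 P1 w01 -> curve l02 P0 P2 w02 ->
  curve l12 P1 P2 w12 -> w01 1 0 = w02 1 0 -> w01 0 1 = w12 1 0 -> w12 0 1 = w02 0 1.
Proof.
move=> c01 c02 c12 e0 e1.
have o10 := pair_l 0 (oner_neq0 K); have o01 := pair_r 0 (oner_neq0 K).
have [eta etaP] := dual_conic.
have etaE b x : x != (0, 0, 0) -> on (eta b) (Psi (trv x)) = (conic b x == 0) by case: (etaP b) => h _; apply: h.
have etaO b y : on (eta b) y -> exists2 x, x != (0, 0, 0) & y = Psi (trv x) by case: (etaP b) => _; apply.
(* [d] nonzero elements of [K] *)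
have [bs [ub szb b0]] : exists bs : seq K, [/\ uniq bs, size bs = d & forall b, b \in bs -> b != 0].
  have szr : (d <= size (rem 0%R S))%N.
    have := size_S hd hS; case: (boolP (0 \in S)) => h; last by rewrite rem_id // => /ltnW.
    by rewrite size_rem //; case: (size S).
  exists (take d (rem 0 S)); split; first by rewrite take_uniq // rem_uniq.
    by rewrite size_take; case: ltngtP szr.
  by move=> b /mem_take; rewrite mem_rem_uniq // inE => /andP[].
have cnt x : x != (0, 0, 0) -> (count (fun b => conic b x == 0)%R bs <= 2)%N.
  move=> x0; have p0 : Poly [:: x.1.1; x.1.2; x.2] != 0.
    apply: contra x0 => /eqP E; apply/eqP; rewrite [LHS]surjective_pairing [x.1]surjective_pairing.
    have cf i : [:: x.1.1; x.1.2; x.2]`_i = 0 by rewrite -coef_Poly E coef0.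
    by have /= -> := cf 0%N; have /= -> := cf 1%N; have /= -> := cf 2%N.
  apply: leq_trans (count_roots p0 ub); apply: eq_leq; apply: eq_count => b; cbv beta.
  by rewrite horner_Poly /conic /=; congr (_ == _); ring.
have multE x : x != (0, 0, 0) -> mult (map eta bs) (Psi (trv x)) = count (fun b => conic b x == 0) bs.
  by move=> x0; rewrite /mult count_map; apply: eq_count => b /=; rewrite etaE.
have mult2 y : (mult (map eta bs) y <= 2)%N.
  case: (posnP (mult (map eta bs) y)) => [->//|/mult_gt0[m /mapP[b _ ->]]].
  by move=> /etaO[x x0 ->]; rewrite multE //; apply: cnt.
have p100 : (1, 0, 0) != (0, 0, 0) :> K * K * K by apply/eqP => -[/eqP]; rewrite oner_eq0.
have eta_inj : injective eta.
  move=> b b' E; have z0 : (b, -1, 0) != (0, 0, 0) :> K * K * K.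
    by apply/eqP => -[_ /eqP]; rewrite oppr_eq0 oner_eq0.
  have : on (eta b) (Psi (trv (b, -1, 0))) by rewrite etaE // /conic /=; apply/eqP; ring.
  rewrite E etaE // /conic /= => /eqP h; apply/eqP; rewrite -subr_eq0 -h; apply/eqP; ring.
have ue : uniq (map eta bs) by rewrite map_inj_uniq.
have onE l A B w x s t : curve l A B w -> (s, t) != (0, 0) -> s *: A + t *: B = trv x -> on l (Psi (trv x)).
  by move=> cw st <-; apply: curve_on cw st.
have t1 s t : s *: P0 + t *: P1 = trv (s, t, 0) by rewrite /trv /= scale0r addr0.
have t2 s t : s *: P0 + t *: P2 = trv (s, 0, t) by rewrite /trv /= scale0r addr0.
have t3 s t : s *: P1 + t *: P2 = trv (0, s, t) by rewrite /trv /= scale0r add0r.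
have a0 : (1, 0, 0) != (0, 0, 0) :> K * K * K by [].
have a1 : (0, 1, 0) != (0, 0, 0) :> K * K * K by apply/eqP => -[/eqP]; rewrite oner_eq0.
have a2 : (0, 0, 1) != (0, 0, 0) :> K * K * K by apply/eqP => -[/eqP]; rewrite oner_eq0.
(* the plane of the triangle *)
have n2 : ~~ on l01 (Psi (trv (0, 0, 1))).
  apply/negP => /(curve_onto c01)[s [t [st]]]; rewrite t1 => E.
  have st0 : (s, t, 0) != (0, 0, 0) :> K * K * K by apply: contra st => /eqP[-> ->].
  have [c [_ _ /eqP]] := trv_eq st0 a2 (esym E); by rewrite /= mulr0 oner_eq0.
have [Pi [hPi in01 Pi2]] := plane_through hd n2.
have neP x x' : x != (0, 0, 0) -> x' != (0, 0, 0) -> (forall c, x' <> (c * x.1.1, c * x.1.2, c * x.2)) -> Psi (trv x) != Psi (trv x').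
  by move=> x0 x'0 ne; apply/eqP => /(trv_eq x0 x'0)[c]; apply: ne.
have Pi0 : Pi (Psi (trv (1, 0, 0))) by apply: in01; apply: (onE _ _ _ _ _ 1 0 c01); rewrite ?t1.
have Pi1 : Pi (Psi (trv (0, 1, 0))) by apply: in01; apply: (onE _ _ _ _ _ 0 1 c01); rewrite ?t1.
have in12 : inside l12 Pi.
  apply: (plane_inside hd hPi (y := Psi (trv (0, 1, 0))) (z := Psi (trv (0, 0, 1)))) => //.
  - by apply: (onE _ _ _ _ _ 1 0 c12); rewrite ?t3.
  - by apply: (onE _ _ _ _ _ 0 1 c12); rewrite ?t3.
  - by apply: neP => // c [_ _ /eqP]; rewrite /= mulr0 oner_eq0.
have in02 : inside l02 Pi.
  apply: (plane_inside hd hPi (y := Psi (trv (1, 0, 0))) (z := Psi (trv (0, 0, 1)))) => //.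
  - by apply: (onE _ _ _ _ _ 1 0 c02); rewrite ?t2.
  - by apply: (onE _ _ _ _ _ 0 1 c02); rewrite ?t2.
  - by apply: neP => // c [_ _ /eqP]; rewrite /= mulr0 oner_eq0.
have ine b : inside (eta b) Pi.
  have q1 : (b, -1, 0) != (0, 0, 0) :> K * K * K by apply/eqP => -[_ /eqP]; rewrite oppr_eq0 oner_eq0.
  have q2 : (0, b, -1) != (0, 0, 0) :> K * K * K by apply/eqP => -[_ /eqP]; rewrite oppr_eq0 oner_eq0.
  apply: (plane_inside hd hPi (y := Psi (trv (b, -1, 0))) (z := Psi (trv (0, b, -1)))) => //.
  - by rewrite etaE // /conic /=; apply/eqP; ring.
  - by rewrite etaE // /conic /=; apply/eqP; ring.
  - by apply: neP => // c [_ _ /eqP]; rewrite /= mulr0 oppr_eq0 oner_eq0.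
  - apply: in01; apply: (onE _ _ _ _ _ b (-1) c01); rewrite ?t1 //.
    by apply/pair_r; rewrite oppr_eq0 oner_eq0.
  - apply: in12; apply: (onE _ _ _ _ _ b (-1) c12); rewrite ?t3 //.
    by apply/pair_r; rewrite oppr_eq0 oner_eq0.
have ins m : m \in map eta bs -> inside m Pi by case/mapP => b _ ->.
(* a linear form that vanishes on the [d] lines *)
have [y0 Py0 ny0] : exists2 y, Pi y & ~ lspan (lvec (map eta bs)) (vr y).
  apply: contrapT => h; apply: (hfull hPi).
  have dm := @chain_dim _ _ _ _ C hd S uS hS Pi hPi [::] (map eta bs) ue ins (fun _ y _ _ => leqW (mult2 y)).
  rewrite size_map szb /= in dm.
  have -> : 'C(d.+2, 2).-1 = tri d 0 d.
    by rewrite -(tri_bin (k := 0) (add0n d.+1)) -addn1 tri_cat /= subSnn addn0 addn1.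
  apply: dimle_mono dm => v; first by case.
  move=> [y Py ->]; apply: contrapT => ny; apply: h; exists y => //.
have [f [lf fk f1]] := functional_sep hfin (@lspan_subspace _ _ (lvec (map eta bs))) ny0.
have {}fk v : lvec (map eta bs) v -> f v = 0 by move=> h; apply: fk; apply: in_lspan.
have nonv m x : inside m Pi -> m \notin map eta bs -> (forall y, on m y -> (mult (map eta bs) y <= 1)%N) ->
    on m x -> mult (map eta bs) x = 0%N -> f (vr x) != 0.
  move=> inm nm m1 mx mx0; apply/eqP => fx.
  have fm := @kill_line _ _ _ _ C hd Pi f (map eta bs) m [:: x] hPi lf fk ue _ nm.
  have {}fm : forall t, f (par m t) = 0.
    apply: fm => [l|||y|y v].
    - by rewrite inE => /orP[/eqP ->|/ins].
    - by rewrite size_map szb addn1.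
    - by move=> y my; have := m1 y my; rewrite /= addn0; case: (x == y) => /=; case: (mult _ y) => [|[]].
    - by rewrite inE => /eqP ->.
    - by rewrite inE => /eqP ->; rewrite mx0 /= eqxx.
  have := @chain_full _ _ _ _ C hd S uS hS Pi hPi (m :: map eta bs) [::] _ _ _ _ _ y0 Py0.
  rewrite /= nm ue size_map szb => /(_ isT) h.
  have : lspan (lvec (m :: map eta bs)) (vr y0).
    apply: h => // [l|y]; first by rewrite inE => /orP[/eqP ->|/ins].
    rewrite ltnNge => /negP []; case: (boolP (on m y)) => my /=; last exact: mult2.
    exact: (m1 y my).
  move/(@lspan_elim _ _ _ [set v | f v = 0]); rewrite /= f1 => h'.
  have /eqP : 1 = 0 :> K; last by rewrite oner_eq0.
  apply: h'; first exact: functional_ker.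
  move=> v [l + [t ->]]; rewrite inE => /orP[/eqP ->|ll]; first exact: fm.
  by apply: fk; exists l => //; exists t.
have cnt1 a c : (a, c) != (0, 0) -> (count (fun b => a + b * c == 0)%R bs <= 1)%N.
  move=> ac; have p0 : Poly [:: a; c] != 0.
    apply: contra ac => /eqP E; have cf i : [:: a; c]`_i = 0 by rewrite -coef_Poly E coef0.
    by have /= -> := cf 0%N; have /= -> := cf 1%N.
  apply: leq_trans (count_roots p0 ub); apply: eq_leq; apply: eq_count => b; cbv beta.
  by rewrite horner_Poly /=; congr (_ == _); ring.
have m01 y : on l01 y -> (mult (map eta bs) y <= 1)%N.
  move=> /(curve_onto c01)[s [t [st ->]]]; rewrite t1 multE; last by apply: contra st => /eqP[-> ->].
  by apply: leq_trans (cnt1 _ _ st); apply: eq_leq; apply: eq_count => b /=; rewrite /conic /= mulr0 addr0.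
have m12 y : on l12 y -> (mult (map eta bs) y <= 1)%N.
  move=> /(curve_onto c12)[s [t [st ->]]]; rewrite t3 multE; last by apply: contra st => /eqP[-> ->].
  apply: leq_trans (cnt1 _ _ st); apply: eq_leq; apply: eq_in_count => b bb /=; rewrite /conic /= add0r.
  rewrite expr2 -mulrA -mulrDr mulf_eq0 (negbTE (b0 _ bb)) //.
have mz x : x != (0, 0, 0) -> (forall b, b \in bs -> conic b x != 0) -> mult (map eta bs) (Psi (trv x)) = 0%N.
  move=> x0 h; rewrite multE //; apply/eqP; rewrite eqn0Ngt -has_count; apply/hasPn => b bb; exact: h.
have mv0 : mult (map eta bs) (Psi (trv (1, 0, 0))) = 0%N.
  by apply: mz => // b bb; rewrite /conic /= !mulr0 !addr0 oner_neq0.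
have mv1 : mult (map eta bs) (Psi (trv (0, 1, 0))) = 0%N.
  by apply: mz => // b bb; rewrite /conic /= mulr1 mulr0 addr0 add0r b0.
have mv2 : mult (map eta bs) (Psi (trv (0, 0, 1))) = 0%N.
  by apply: mz => // b bb; rewrite /conic /= mulr1 mulr0 !add0r expf_neq0 ?b0.
have nin m x : on m x -> mult (map eta bs) x = 0%N -> m \notin map eta bs.
  move=> mx h; apply/negP => me; have : (0 < mult (map eta bs) x)%N by rewrite /mult -has_count; apply/hasP; exists m.
  by rewrite h.
have v0on : on l01 (Psi (trv (1, 0, 0))) by apply: (onE _ _ _ _ _ 1 0 c01); rewrite ?t1.
have v1on : on l01 (Psi (trv (0, 1, 0))) by apply: (onE _ _ _ _ _ 0 1 c01); rewrite ?t1.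
have v2on : on l12 (Psi (trv (0, 0, 1))) by apply: (onE _ _ _ _ _ 0 1 c12); rewrite ?t3.
have f2n : f (vr (Psi (trv (0, 0, 1)))) != 0 by apply: (nonv l12); rewrite ?(nin _ _ v2on).
have f1n : f (vr (Psi (trv (0, 1, 0)))) != 0 by apply: (nonv l01); rewrite ?(nin _ _ v1on).
have f0n : f (vr (Psi (trv (1, 0, 0)))) != 0 by apply: (nonv l01); rewrite ?(nin _ _ v0on).
(* the restriction of [f] to a side *)
have side l A B w (io : K -> K -> K * K * K) (ai aj : K -> K) : curve l A B w -> inside l Pi ->
    (forall s t, s *: A + t *: B = trv (io s t)) -> (forall b s t, conic b (io s t) = ai b * s + aj b * t) ->
    (forall b, b \in bs -> ai b != 0) ->
    (forall b b', b \in bs -> b' \in bs -> ai b * aj b' = ai b' * aj b -> (ai b, aj b) = (ai b', aj b')) ->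
    (forall s t, io s t = (0, 0, 0) -> (s, t) = (0, 0)) ->
    exists c, forall s t, f (w s t) = c * \prod_(b <- bs) (- (ai b * s + aj b * t)).
  move=> cw inl E cE a0' ap io0.
  have nz (z : K * K) : z != (0, 0) -> io z.1 z.2 != (0, 0, 0).
    by apply: contra => /eqP/io0 zE; rewrite [z]surjective_pairing zE.
  pose pr b := (- aj b, ai b).
  have pr0 b : b \in bs -> pr b != (0, 0) by move=> bb; apply/pair_r/a0'.
  have onb b : b \in bs -> on (eta b) (Psi ((pr b).1 *: A + (pr b).2 *: B)).
    by move=> bb; rewrite E etaE ?nz ?pr0 // cE /pr /=; apply/eqP; ring.
  have cnt' z : z \in map pr bs -> (count_mem z (map pr bs) <= count (fun b => on (eta b) (Psi (z.1 *: A + z.2 *: B)))%R bs)%N.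
    move=> zb; rewrite count_map -!size_filter; apply: uniq_leq_size; first exact: filter_uniq.
    by move=> b; rewrite !mem_filter /= => /andP[/eqP <- bb]; rewrite bb onb.
  have [|||||c cP] := curve_factor cw lf (bs := map pr bs).
  - by rewrite size_map.
  - by move=> _ /mapP[b bb ->]; split; [apply: pr0 | apply: fk; apply: lvec_pt (onb _ bb); apply: map_f].
  - move=> _ _ /mapP[b bb ->] /mapP[b' bb' ->]; apply: contra => /eqP h; apply/eqP.
    have e : ai b * aj b' = ai b' * aj b.
      by apply/eqP; rewrite -subr_eq0 -h /lam /pr /=; apply/eqP; ring.
    by have [g1 g2] := ap b b' bb bb' e; rewrite /pr g1 g2.
  - move=> z; case: (boolP (z \in map pr bs)) => zb; last by rewrite (count_memPn zb).
    apply: leq_trans (cnt' z zb) _; have z0 : z != (0, 0) by case/mapP: zb => b bb ->; apply: pr0.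
    rewrite E; have := cnt _ (nz _ z0); congr (_ <= _)%N; apply: eq_count => b /=.
    by rewrite etaE // nz.
  - move=> z v c2 Tv; have zb : z \in map pr bs.
      by rewrite -has_pred1 has_count; apply: leq_trans c2.
    have := leq_trans c2 (cnt' z zb); rewrite -size_filter.
    have := filter_uniq (fun b => on (eta b) (Psi (z.1 *: A + z.2 *: B))) ub.
    have := @mem_filter _ (fun b => on (eta b) (Psi (z.1 *: A + z.2 *: B))) ^~ bs.
    case: [seq _ <- _ | _] => [|b [|b' T]] //= mf /andP[bT _] _.
    have := mf b; rewrite mem_head => /esym/andP[ob bb].
    have := mf b'; rewrite !in_cons eqxx orbT => /esym/andP[ob' bb'].
    have bb'n : eta b != eta b'.
      by apply: contra bT => /eqP/eta_inj ->; rewrite mem_head.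
    have z0 : (z.1, z.2) != (0, 0) by rewrite -surjective_pairing; case/mapP: zb => c bc ->; apply: pr0.
    have ly := curve_on cw z0.
    have := plane_tangent hd hPi (ine b) (ine b') inl bb'n ob ob' ly Tv.
    move/(@lspan_elim _ _ _ [set v | f v = 0]); apply; first exact: functional_ker.
    by move=> u [Tu|Tu]; apply: fk; [apply: (@lvec_tg _ _ _ _ C _ (eta b)) Tu | apply: (@lvec_tg _ _ _ _ C _ (eta b')) Tu]; apply: map_f.
  exists c => s t; rewrite cP big_map; congr (_ * _); apply: eq_bigr => b _.
  by rewrite /pr /lam /=; ring.
have [k1 F1] := side _ _ _ _ (fun s t => (s, t, 0)) (fun=> 1) id c01 in01 t1
  (fun b s t => ltac:(rewrite /conic /=; ring)) (fun b _ => oner_neq0 K)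
  (fun b b' _ _ h => ltac:(congr (_, _); move: h; rewrite !mul1r => ->; done)) (fun s t h => ltac:(by case: h => -> ->)).
have [k2 F2] := side _ _ _ _ (fun s t => (s, 0, t)) (fun=> 1) (fun b => b ^+ 2) c02 in02 t2
  (fun b s t => ltac:(rewrite /conic /=; ring)) (fun b _ => oner_neq0 K)
  (fun b b' _ _ h => ltac:(congr (_, _); move: h; rewrite !mul1r => ->; done)) (fun s t h => ltac:(by case: h => -> ->)).
have inj3 b b' : b \in bs -> b' \in bs -> b * b' ^+ 2 = b' * b ^+ 2 -> (b, b ^+ 2) = (b', b' ^+ 2).
  move=> bb bb' h; suff -> : b = b' by [].
  apply: (mulfI (mulf_neq0 (b0 b bb) (b0 b' bb'))); transitivity (b' * b ^+ 2); first ring.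
  by rewrite -h; ring.
have [k3 F3] := side _ _ _ _ (fun s t => (0, s, t)) id (fun b => b ^+ 2) c12 in12 t3
  (fun b s t => ltac:(rewrite /conic /=; ring)) b0 inj3 (fun s t h => ltac:(by case: h => -> ->)).
pose pr (g : K -> K) := \prod_(b <- bs) - g b.
have prn g : (forall b, b \in bs -> g b != 0) -> pr g != 0.
  by move=> g0; rewrite /pr prodf_seq_neq0; apply/allP => b bb /=; rewrite oppr_eq0 g0.
have G10 : f (w01 1 0) = k1 * pr (fun=> 1) by rewrite F1; congr (_ * _); apply: eq_bigr => b _; ring.
have G11 : f (w01 0 1) = k1 * pr id by rewrite F1; congr (_ * _); apply: eq_bigr => b _ /=; ring.
have G20 : f (w02 1 0) = k2 * pr (fun=> 1) by rewrite F2; congr (_ * _); apply: eq_bigr => b _; ring.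
have G22 : f (w02 0 1) = k2 * pr (fun b => b ^+ 2) by rewrite F2; congr (_ * _); apply: eq_bigr => b _ /=; ring.
have G31 : f (w12 1 0) = k3 * pr id by rewrite F3; congr (_ * _); apply: eq_bigr => b _ /=; ring.
have G32 : f (w12 0 1) = k3 * pr (fun b => b ^+ 2) by rewrite F3; congr (_ * _); apply: eq_bigr => b _ /=; ring.
have k12 : k1 = k2.
  by apply: (mulIf (prn (fun=> 1) (fun b _ => oner_neq0 K))); rewrite -G10 -G20 e0.
have k13 : k1 = k3 by apply: (mulIf (prn id b0)); rewrite -G11 -G31 e1.
have [c c0 E] := curve_vr c12 o01; have [c' c'0 E'] := curve_vr c02 o01.
rewrite E E' t2 t3; congr (_ *: _); apply: (mulIf f2n).
by rewrite -!funZ // -{1}t3 -E -t2 -E' G32 G22 -k13 k12.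
Qed.

End Triangle.

(** * Functions that are forms on every pencil *)

Section Forms.
Variables (K : fieldType) (V : lmodType K).

Definition isform k (g : K -> K -> V) := exists c : nat -> V,
  forall s t, g s t = \sum_(i < k.+1) (s ^+ (k - i) * t ^+ i) *: c i.

Lemma isform_ext k g g' : (forall s t, g s t = g' s t) -> isform k g' -> isform k g.
Proof. by move=> E [c cP]; exists c => s t; rewrite E. Qed.

Lemma isformD k g g' : isform k g -> isform k g' -> isform k (fun s t => g s t + g' s t).
Proof.
move=> [c cP] [c' cP']; exists (fun i => c i + c' i) => s t.
by rewrite cP cP' -big_split; apply: eq_bigr => i _; rewrite scalerDr.
Qed.

Lemma isformZ k a g : isform k g -> isform k (fun s t => a *: g s t).
Proof.
move=> [c cP]; exists (fun i => a *: c i) => s t.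
by rewrite cP scaler_sumr; apply: eq_bigr => i _; rewrite !scalerA mulrC.
Qed.

Lemma isform0 k : isform k (fun _ _ => 0).
Proof. by exists (fun=> 0) => s t; rewrite big1 // => i _; rewrite scaler0. Qed.

Lemma isform_sum k (I : Type) (r : seq I) (g : I -> K -> K -> V) : (forall i, isform k (g i)) ->
  isform k (fun s t => \sum_(i <- r) g i s t).
Proof.
move=> h; elim: r => [|i r IH].
  by apply: isform_ext (isform0 k) => s t; rewrite big_nil.
by apply: isform_ext (isformD (h i) IH) => s t; rewrite big_cons.
Qed.

Lemma isform_const c : isform 0 (fun _ _ => c).
Proof. by exists (fun=> c) => s t; rewrite big_ord1 !expr0 mulr1 scale1r. Qed.

Lemma isform_swap k g : isform k g -> isform k (fun s t => g t s).
Proof.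
move=> [c cP]; exists (fun i => c (k - i)%N) => s t; rewrite cP (reindex_inj rev_ord_inj) /=.
apply: eq_bigr => i _; have ik : (i <= k)%N by rewrite -ltnS.
by rewrite subSS subKn // mulrC.
Qed.

Lemma isform_mull k g : isform k g -> isform k.+1 (fun s t => s *: g s t).
Proof.
move=> [c cP]; exists (fun i => if (i < k.+1)%N then c i else 0) => s t.
rewrite big_ord_recr /= ltnn scaler0 addr0 cP scaler_sumr; apply: eq_bigr => i _.
by rewrite ltn_ord scalerA mulrA -exprS subSn // -ltnS.
Qed.

Lemma isform_mul k a b g : isform k g -> isform k.+1 (fun s t => (s * a + t * b) *: g s t).
Proof.
move=> fg; have fs := isform_swap (isform_mull (isform_swap fg)).
apply: isform_ext (isformD (isformZ a (isform_mull fg)) (isformZ b fs)) => s t.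
by rewrite scalerDl !scalerA [s * a]mulrC [t * b]mulrC.
Qed.

Lemma isform_pow m p (a b a' b' : K) c :
  isform (m + p) (fun s t => ((s * a + t * b) ^+ m * (s * a' + t * b') ^+ p) *: c).
Proof.
elim: m => [|m IH].
  elim: p => [|p IH]; first by apply: isform_ext (isform_const c) => s t; rewrite !expr0 mulr1 scale1r.
  by apply: isform_ext (isform_mul a' b' IH) => s t; rewrite scalerA !expr0 !mul1r exprS.
by apply: isform_ext (isform_mul a b IH) => s t; rewrite scalerA exprS mulrA.
Qed.

End Forms.

Section Polynomials.
Variables (K : fieldType) (V : lmodType K) (M : nat).
Hypothesis hfin : dimle set0 [set: V] M.

Lemma vec_eq (u v : V) : (forall f : V -> K, functional f -> f u = f v) -> u = v.
Proof.
move=> h; apply/eqP; rewrite -subr_eq0; apply/eqP; apply: contrapT => ne.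
have s0 : is_subspace [set 0 : V] by split=> // a _ _ -> ->; rewrite scaler0 addr0.
have [f [lf _ /eqP]] := functional_sep hfin s0 ne.
by rewrite funD // -scaleN1r funZ // mulN1r (h f lf) subrr eq_sym oner_eq0.
Qed.

Variable S : seq K.
Hypothesis uS : uniq S.

Lemma vpoly_eq m (c c' : nat -> V) : (m <= size S)%N ->
  (forall t, \sum_(i < m) t ^+ i *: c i = \sum_(i < m) t ^+ i *: c' i) -> forall i, (i < m)%N -> c i = c' i.
Proof.
move=> szS E i im; apply: vec_eq => f lf; pose p := \poly_(i < m) (f (c i) - f (c' i)).
have ev g t : functional f -> f (\sum_(i < m) t ^+ i *: g i) = \sum_(i < m) f (g i) * t ^+ i.
  by move=> _; rewrite fun_sum //; apply: eq_bigr => j _; rewrite funZ // mulrC.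
have pt t : p.[t] = 0.
  transitivity (f (\sum_(i < m) t ^+ i *: c i) - f (\sum_(i < m) t ^+ i *: c' i)); last by rewrite E subrr.
  rewrite /p horner_poly !ev // -sumrB.
  by apply: eq_bigr => j _; rewrite mulrBl.
have p0 : p = 0.
  apply: contraTeq szS => pn; rewrite -ltnNge; apply: leq_trans (size_poly m _).
  by apply: (max_poly_roots pn _ uS); apply/allP => x _; rewrite /root pt.
have := congr1 (fun q : {poly K} => q`_i) p0; rewrite /= coef_poly im coef0 => /eqP.
by rewrite subr_eq0 => /eqP.
Qed.

(** Interpolation: the coefficients of a polynomial are linear in its values. *)
Lemma interpolation m : (m <= size S)%N -> exists la : nat -> K, exists mu : nat -> nat -> K,
  forall (c : nat -> V) j, (j < m)%N -> c j = \sum_(k < m) mu j k *: \sum_(i < m) la k ^+ i *: c i.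
Proof.
move=> szS; pose A : 'M[K]_m := Vandermonde m (\row_(k < m) S`_k).
have uA : A \in unitmx.
  rewrite unitmxE det_Vandermonde unitfE; apply/prodf_neq0 => i _; apply/prodf_neq0 => j ij.
  rewrite !mxE subr_eq0 nth_uniq //.
  - by rewrite neq_ltn ij orbT.
  - exact: leq_trans (ltn_ord _) szS.
  - exact: leq_trans (ltn_ord _) szS.
exists (fun k => S`_k), (fun j k => if insub j is Some j' then if insub k is Some k' then invmx A k' j' else 0 else 0).
move=> c j jm; rewrite insubT /=.
have -> : c j = \sum_(i < m) \sum_(k < m) (A i k * invmx A k (Ordinal jm)) *: c i.
  transitivity (\sum_(i < m) (A *m invmx A) i (Ordinal jm) *: c i); last first.
    by apply: eq_bigr => i _; rewrite mxE scaler_suml.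
  rewrite mulmxV // (bigD1 (Ordinal jm)) //= mxE eqxx scale1r big1 ?addr0 // => i ne.
  by rewrite mxE (negbTE ne) scale0r.
rewrite exchange_big /=; apply: eq_bigr => k _.
rewrite valK.
rewrite scaler_sumr; apply: eq_bigr => i _; rewrite !mxE scalerA mulrC //.
Qed.

(** Monomials may be repeated in the list, so that sums are concatenations. *)
Definition hpoly N k (g : 'rV[K]_N -> V) := exists L : seq ((nat -> nat) * V),
  (forall x, List.In x L -> (\sum_(i < N) x.1 i)%N = k) /\
  forall x : 'rV[K]_N, g x = \sum_(m <- L) (\prod_(i < N) x 0 i ^+ m.1 i) *: m.2.

Lemma hpoly_ext N k (g g' : 'rV[K]_N -> V) : (forall x, g x = g' x) -> hpoly k g' -> hpoly k g.
Proof. by move=> E [L [L1 L2]]; exists L; split=> // x; rewrite E. Qed.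

Lemma hpoly_sum N k m (g : nat -> 'rV[K]_N -> V) : (forall j, (j < m)%N -> hpoly k (g j)) ->
  hpoly k (fun x => \sum_(j < m) g j x).
Proof.
elim: m => [|m IH] h.
  by exists [::]; split=> // x; rewrite big_ord0 big_nil.
have [L [L1 L2]] := IH (fun j jm => h j (ltnW jm)); have [L' [L1' L2']] := h m (ltnSn m).
exists (L ++ L'); split=> [x /List.in_app_iff[/L1|/L1'] //|x].
by rewrite big_ord_recr big_cat /= L2 L2'.
Qed.

Definition cns N (a : K) (b : 'rV[K]_N) : 'rV[K]_N.+1 :=
  \row_i (if unlift ord0 i is Some j then b 0 j else a).
Definition tln N (x : 'rV[K]_N.+1) : 'rV[K]_N := \row_j x 0 (lift ord0 j).

Lemma cnsK N (x : 'rV[K]_N.+1) : cns (x 0 0) (tln x) = x.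
Proof. by apply/rowP => i; rewrite mxE; case: unliftP => [j ->|->] //; rewrite mxE. Qed.

Lemma cns_lin N s t a a' (b b' : 'rV[K]_N) :
  s *: cns a b + t *: cns a' b' = cns (s * a + t * a') (s *: b + t *: b').
Proof. by apply/rowP => i; rewrite !mxE; case: unlift => [j|] //; rewrite !mxE. Qed.

Lemma hpoly_cns N k j (g : 'rV[K]_N -> V) : (j <= k)%N -> hpoly j g ->
  hpoly k (fun x : 'rV[K]_N.+1 => x 0 0 ^+ (k - j) *: g (tln x)).
Proof.
move=> jk [L [L1 L2]].
exists [seq ((fun i => if i is i'.+1 then m.1 i' else k - j)%N, m.2) | m <- L]; split.
  by move=> x /List.in_map_iff[m [<- /L1 mj]]; rewrite big_ord_recl /= mj subnK.
move=> x; rewrite L2 big_map scaler_sumr; apply: eq_bigr => m _.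
rewrite big_ord_recl /= scalerA; congr (_ * _ *: _).
by apply: eq_bigr => i _; rewrite mxE.
Qed.

Definition pencilwise N k (g : 'rV[K]_N -> V) :=
  forall A B : 'rV[K]_N, isform k (fun s t => g (s *: A + t *: B)).

(** The two forms of degree [k] are [s ^ (k - j)] and [t ^ (k - j)] times [ga], so
    that cross-multiplying gives an equality of forms of degree [2 k - j]; with
    enough scalars it holds for the coefficients, and [s ^ (k - j)] can be
    cancelled. *)
Lemma coef_form k j (ga : K -> K -> V) : (2 * k <= (size S).+1)%N -> (0 < j < k)%N ->
  (forall a s t, ga (a * s) (a * t) = a ^+ j *: ga s t) ->
  isform k (fun s t => s ^+ (k - j) *: ga s t) ->
  isform k (fun s t => t ^+ (k - j) *: ga s t) -> isform j ga.
Proof.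
move=> szS /andP[j0 jk] hom [f fP] [g gP].
have kj : (0 < k - j)%N by rewrite subn_gt0.
have fk : f k = 0.
  have := fP 0 1; rewrite expr0n (gtn_eqF kj) scale0r big_ord_recr /= subnn expr0 expr1n mul1r scale1r.
  rewrite big1 ?add0r // => i _; rewrite expr0n gtn_eqF ?mul0r ?scale0r // subn_gt0; exact: ltn_ord.
have gk : ga 0 1 = g k.
  have := gP 0 1; rewrite expr1n scale1r big_ord_recr /= subnn expr0 expr1n mul1r scale1r => ->.
  rewrite big1 ?add0r // => i _; rewrite expr0n gtn_eqF ?mul0r ?scale0r // subn_gt0; exact: ltn_ord.
have f1 t : ga 1 t = \sum_(i < k.+1) t ^+ i *: f i.
  by have := fP 1 t; rewrite expr1n scale1r => ->; apply: eq_bigr => i _; rewrite expr1n mul1r.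
have g1 t : t ^+ (k - j) *: ga 1 t = \sum_(i < k.+1) t ^+ i *: g i.
  by have := gP 1 t => ->; apply: eq_bigr => i _; rewrite expr1n mul1r.
(* compare the polynomials [t^(k-j) ga(1,t)] of degree less than [2k-j] *)
have cmp phi : functional phi -> (forall i, (j < i <= k)%N -> phi (f i) = 0) /\ phi (f j) = phi (g k).
  move=> lp; pose F := \poly_(i < k) phi (f i); pose G := \poly_(i < k.+1) phi (g i).
  have ev m (c : nat -> V) t : phi (\sum_(i < m) t ^+ i *: c i) = (\poly_(i < m) phi (c i)).[t].
    by rewrite fun_sum // horner_poly; apply: eq_bigr => i _; rewrite funZ // mulrC.
  have FG t : ('X^(k - j) * F).[t] = G.[t].
    have Gt : G.[t] = phi (t ^+ (k - j) *: ga 1 t) by rewrite /G -ev g1.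
    have Ft : F.[t] = phi (ga 1 t) by rewrite /F -ev f1 big_ord_recr /= fk scaler0 addr0.
    by rewrite hornerM hornerXn Gt Ft funZ.
  have E : 'X^(k - j) * F = G.
    apply/eqP; rewrite -subr_eq0; apply: contraT => pn.
    have := max_poly_roots pn _ uS; rewrite (_ : all _ _); last first.
      by apply/allP => x _; rewrite /root hornerD hornerN FG subrr.
    move/(_ isT) => lt; have : (size ('X^(k - j) * F - G)%R <= (2 * k).-1)%N.
      apply: leq_trans (size_polyD _ _) _; rewrite size_polyN geq_max; apply/andP; split.
        apply: leq_trans (size_polyMleq _ _) _; rewrite size_polyXn.
        have := size_poly k (fun i => phi (f i)); rewrite -/F; move: (size F) => a; lia.
      by apply: leq_trans (size_poly _ _) _; lia.
    move: lt szS; move: (size _) (size S) => a b; lia.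
  have cE i : (i < k)%N -> phi (f i) = G`_(i + (k - j)).
    by move=> ik; rewrite -E coefXnM ltnNge leq_addl /= addnK coef_poly ik.
  split=> [i /andP[ji ik]|]; last first.
    by rewrite cE // subnKC // ?coef_poly ?ltnSn // ltnW.
  case: (ltnP i k) => ik'; last by rewrite (_ : i = k) ?fk ?fun0 //; apply/eqP; rewrite eqn_leq ik.
  rewrite cE // coef_poly; case: ltnP => // h; exfalso; move: h; lia.
have f0 i : (j < i <= k)%N -> f i = 0 by move=> h; apply: vec_eq => phi lp; rewrite (cmp phi lp).1 // fun0.
have fj : f j = g k by apply: vec_eq => phi lp; rewrite (cmp phi lp).2.
have f1' t : ga 1 t = \sum_(i < j.+1) t ^+ i *: f i.
  rewrite f1 (big_ord_widen _ (fun i => t ^+ i *: f i) (ltnW jk : (j.+1 <= k.+1)%N)).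
  rewrite [LHS](bigID (fun i : 'I_k.+1 => (i < j.+1)%N)) /= [X in _ + X]big1 ?addr0 // => i.
  by rewrite -leqNgt => ji; rewrite f0 ?scaler0 // ji -ltnS ltn_ord.
exists f => s t; case: (eqVneq s 0) => [->|s0].
  have := hom t 0 1; rewrite mulr0 mulr1 => ->; rewrite gk -fj big_ord_recr /= subnn expr0 mul1r.
  rewrite big1 ?add0r // => i _; rewrite expr0n gtn_eqF ?mul0r ?scale0r // subn_gt0; exact: ltn_ord.
have := hom s 1 (t / s); rewrite mulr1 mulrCA divff // mulr1 => ->; rewrite f1' scaler_sumr.
apply: eq_bigr => i _; rewrite scalerA expr_div_n; congr (_ *: _).
have -> : s ^+ j = s ^+ (j - i) * s ^+ i by rewrite -exprD subnK // -ltnS.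
by rewrite -mulrA [X in _ * X]mulrCA divff ?expf_neq0 // mulr1.
Qed.

(** Induction on the number of variables. The coefficient [c b j] of degree [j] in
    the remaining variables [b] is homogeneous of degree [j]; interpolation in the
    first variable shows that it becomes a form of degree [k] after multiplication
    by the powers in [coef_form], so it is a form of degree [j] on every pencil. *)
Lemma pencilwise_poly N k (g : 'rV[K]_N -> V) : (2 * k <= (size S).+1)%N -> (k < size S)%N ->
  pencilwise k g -> hpoly k g.
Proof.
elim: N k g => [|N IH] k g sz2 sz1 pg.
  have [c cP] := pg 0 0; have g0 x : g x = g 0 by congr g; apply/rowP => -[].
  case: k sz2 sz1 pg c cP => [|k] sz2 sz1 pg c cP.
    exists [:: ((fun=> 0%N), g 0)]; split=> [x [<-|[]]|x]; first by rewrite big_ord0.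
    by rewrite big_seq1 big_ord0 scale1r g0.
  exists [::]; split=> // x; rewrite big_nil g0.
  have := cP 0 0; rewrite !scale0r addr0 => ->; rewrite big1 // => i _.
  case: (posnP i) => [i0|i0]; first by rewrite i0 subn0 expr0n /= mul0r scale0r.
  by rewrite (expr0n _ i) (gtn_eqF i0) mulr0 scale0r.
have /choice[c cP] : forall b : 'rV[K]_N, exists c : nat -> V, forall t u,
    g (cns t (u *: b)) = \sum_(i < k.+1) (t ^+ (k - i) * u ^+ i) *: c i.
  move=> b; have [c cP] := pg (cns 1 0) (cns 0 b); exists c => t u; rewrite -cP cns_lin.
  by rewrite mulr1 mulr0 addr0 scaler0 add0r.
have gE t b : g (cns t b) = \sum_(i < k.+1) t ^+ (k - i) *: c b i.
  by rewrite -{1}[b]scale1r cP; apply: eq_bigr => i _; rewrite expr1n mulr1.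
have rev t (F : nat -> V) : \sum_(i < k.+1) t ^+ (k - i) *: F i = \sum_(i < k.+1) t ^+ i *: F (k - i)%N.
  rewrite (reindex_inj rev_ord_inj) /=; apply: eq_bigr => i _.
  by rewrite subSS subKn // -ltnS.
have hom j u b : (j <= k)%N -> c (u *: b) j = u ^+ j *: c b j.
  move=> jk; have h := @vpoly_eq k.+1 (fun i => c (u *: b) (k - i)%N) (fun i => u ^+ (k - i) *: c b (k - i)%N) sz1.
  rewrite -[j](subKn jk); apply: h; last by rewrite ltnS leq_subr.
  move=> t; rewrite -(rev t (fun i => c (u *: b) i)) -(rev t (fun i => u ^+ i *: c b i)) -gE cP.
  by apply: eq_bigr => i _; rewrite scalerA.
suff pc j : (j <= k)%N -> pencilwise j (fun b => c b j).
  apply: (@hpoly_ext _ _ _ (fun x => \sum_(j < k.+1) x 0 0 ^+ (k - j) *: c (tln x) j)).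
    by move=> x; rewrite -{1}[x]cnsK gE.
  apply: (@hpoly_sum _ k k.+1 (fun j x => x 0 0 ^+ (k - j) *: c (tln x) j)) => j jk.
  apply: (@hpoly_cns N k j (fun b => c b j)) => //.
  apply: IH => //; [move: sz2 jk | move: sz1 jk | exact: pc]; clear; lia.
move=> jk b b'; set ga := fun s t => _.
have gh a s t : ga (a * s) (a * t) = a ^+ j *: ga s t.
  by rewrite /ga -!scalerA -scalerDr hom.
have [j0|j0] := posnP j.
  have c0 b0 : c b0 j = c 0 j by have := hom j 0 b0 jk; rewrite j0 expr0 scale1r scale0r.
  by rewrite j0; apply: isform_ext (isform_const (c 0 0%N)) => s t; rewrite /ga c0 j0.
have form1 : isform k (fun s t => s ^+ (k - j) *: ga s t).
  have [la [mu muP]] := interpolation sz1.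
  apply: (@isform_ext _ _ _ _ (fun s t => \sum_(r < k.+1) mu (k - j)%N r *: g (s *: cns (la r) b + t *: cns 0 b'))).
    move=> s t; have := muP (fun i => s ^+ i *: c (s *: b + t *: b') (k - i)%N) (k - j)%N.
    rewrite ltnS leq_subr subKn // => /(_ isT) ->; apply: eq_bigr => r _; congr (_ *: _).
    rewrite cns_lin mulr0 addr0 gE rev; apply: eq_bigr => i _.
    by rewrite scalerA mulrC exprMn.
  by apply: isform_sum => r; apply: isformZ; apply: pg.
have form2 : isform k (fun s t => t ^+ (k - j) *: ga s t).
  have [la [mu muP]] := interpolation sz1.
  apply: (@isform_ext _ _ _ _ (fun s t => \sum_(r < k.+1) mu (k - j)%N r *: g (s *: cns 0 b + t *: cns (la r) b'))).
    move=> s t; have := muP (fun i => t ^+ i *: c (s *: b + t *: b') (k - i)%N) (k - j)%N.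
    rewrite ltnS leq_subr subKn // => /(_ isT) ->; apply: eq_bigr => r _; congr (_ *: _).
    rewrite cns_lin mulr0 add0r gE rev; apply: eq_bigr => i _.
    by rewrite scalerA mulrC exprMn.
  by apply: isform_sum => r; apply: isformZ; apply: pg.
case: (ltnP j k) => jk'; first by apply: (coef_form sz2 _ gh form1 form2); rewrite j0.
have jE : j = k by apply/eqP; rewrite eqn_leq jk.
by rewrite jE; apply: isform_ext form1 => s t; rewrite jE subnn expr0 scale1r.
Qed.

End Polynomials.

(** * Lifting the coordinates to vectors *)

Section Lift.
Variables (K : fieldType) (V : lmodType K) (d n : nat) (C : cap V d n).
Hypothesis hd : (2 <= d)%N.
Notation pt := (@pt _ _ _ _ C).
Notation ln := (@ln _ _ _ _ C).
Notation vr := (@vr _ _ _ _ C).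
Notation par := (@par _ _ _ _ C).
Notation plane := (@plane _ _ _ _ C).
Implicit Types (p q y : pt) (l m : ln) (ls etas : seq ln) (U : set V).
Variable S : seq K.
Hypothesis uS : uniq S.
Hypothesis hS : (d ^ 3 <= size S ^ 2)%N.
Variable M : nat.
Hypothesis hfin : dimle set0 [set: V] M.
Hypothesis hfull : forall Pi, plane Pi -> full Pi.
Notation row1 := 'rV[K]_n.+1.
Variable Psi : row1 -> pt.
Hypothesis hPsi : framed Psi.
Hypothesis hn : (0 < n)%N.
Notation curve := (@curve _ _ _ _ C Psi).

Lemma curve_hom l A B w a s t : curve l A B w -> w (a * s) (a * t) = a ^+ d *: w s t.
Proof.
move=> [e [f [k [ef k0 G W]]]]; rewrite !W.
have -> : cmb e f (a * s) (a * t) = (a * (cmb e f s t).1, a * (cmb e f s t).2).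
  by rewrite /cmb /=; congr (_, _); ring.
by rewrite /= rnc_scale parZ !scalerA mulrC.
Qed.

Lemma curve_form l A B w : curve l A B w -> isform d w.
Proof.
move=> [e [f [k [ef k0 G W]]]].
apply: (@isform_ext _ _ _ _ (fun s t => k *: \sum_(i < d.+1)
   ((s * e.1 + t * f.1) ^+ (d - i) * (s * e.2 + t * f.2) ^+ i) *: par l (delta_mx 0 i))).
  move=> s t; rewrite W; congr (_ *: _).
  have lp : forall (r : seq 'I_d.+1) (F : 'I_d.+1 -> 'rV[K]_d.+1), par l (\sum_(i <- r) F i) = \sum_(i <- r) par l (F i).
    by move=> r F; apply: (big_morph (par l)); [exact: parD | exact: par0].
  rewrite [rnc_vec _ _ _]row_sum_delta lp; apply: eq_bigr => i _.
  by rewrite parZ mxE.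
apply: isformZ; apply: isform_sum => i; have := @isform_pow K V (d - i) i e.1 f.1 e.2 f.2 (par l (delta_mx 0 i)).
by rewrite subnK // -ltnS.
Qed.

Lemma line_form (u : V) a b : isform d (fun s t => (s * a + t * b) ^+ d *: u).
Proof.
have := @isform_pow K V d 0 a b 0 0 u; rewrite addn0; apply: isform_ext => s t.
by rewrite expr0 mulr1.
Qed.

Definition proportional (A B : row1) := exists c, B = c *: A.

Lemma proportionalN (A B : row1) : ~ proportional A B -> forall c, B <> c *: A.
Proof. by move=> h c E; apply: h; exists c. Qed.

(** Vectors of the points, normalized along the curves through a point, match
    along every curve by Carnot's theorem. *)
Lemma lift_exists : exists v : row1 -> V,
  (forall A, A != 0 -> exists2 c : K, c != 0 & v A = c *: vr (Psi A)) /\ pencilwise d v.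
Proof.
have d0 : (0 < d)%N by apply: ltnW.
have o10 := pair_l 0 (oner_neq0 K); have o01 := pair_r 0 (oner_neq0 K).
pose A0 : row1 := delta_mx 0 0.
have A00 : A0 != 0 by apply/eqP => /rowP/(_ 0)/eqP; rewrite !mxE !eqxx oner_eq0.
have /choice[lw lwP] : forall D : row1, exists lw : ln * (K -> K -> V), ~ proportional A0 D ->
    curve lw.1 A0 D lw.2 /\ lw.2 1 0 = vr (Psi A0).
  move=> D; case: (pselect (proportional A0 D)) => pD; last first.
    have [l [w [cw E]]] := curve_exists hPsi (oner_neq0 K) A00 (proportionalN pD).
    by exists (l, w); split=> //; rewrite /= E scale1r.
  have [B ne] := indep_exists hn A00; have [l [w _]] := curve_exists hPsi (oner_neq0 K) A00 ne.
  by exists (l, w).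
have cw D : ~ proportional A0 D -> curve (lw D).1 A0 D (lw D).2 by case/lwP.
have w10 D : ~ proportional A0 D -> (lw D).2 1 0 = vr (Psi A0) by case/lwP.
have /choice[v vP] : forall D : row1, exists u : V, (forall c, D = c *: A0 -> u = c ^+ d *: vr (Psi A0)) /\
    (~ proportional A0 D -> u = (lw D).2 0 1).
  move=> D; case: (pselect (proportional A0 D)) => [[c cD]|pD]; last first.
    by exists ((lw D).2 0 1); split=> // c E; case: pD; exists c.
  exists (c ^+ d *: vr (Psi A0)); split=> [c'|[]]; last by exists c.
  rewrite cD => /eqP; rewrite -subr_eq0 -scalerBl scaler_eq0 (negbTE A00) orbF subr_eq0.
  by move/eqP ->.
have vA0 c : v (c *: A0) = c ^+ d *: vr (Psi A0) by case: (vP (c *: A0)) => h _; apply: h.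
have vw D : ~ proportional A0 D -> v D = (lw D).2 0 1 by case: (vP D).
have v1 D s t : ~ proportional A0 D -> v (s *: A0 + t *: D) = (lw D).2 s t.
  move=> pD; case: (eqVneq t 0) => [t0|t0].
    rewrite t0 scale0r addr0 vA0 -(w10 _ pD) -(curve_hom s 1 0 (cw _ pD)).
    by rewrite mulr1 mulr0.
  have pD' : ~ proportional A0 (s *: A0 + t *: D).
    move=> [c E]; apply: pD; exists ((c - s) / t); apply: (scalerI t0).
    by rewrite scalerA mulrC divfK // scalerBl -E addrC addKr.
  have cw' := curve_change s (cw _ pD) t0.
  have [|_ E] := curve_uniq (cw _ pD') cw'; first by rewrite !mul0r addr0 !w10.
  by rewrite vw // E add0r !mul1r.
have vZ c A : v (c *: A) = c ^+ d *: v A.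
  case: (pselect (proportional A0 A)) => [[a ->]|pA]; first by rewrite scalerA !vA0 exprMn scalerA.
  have := v1 A 0 c pA; rewrite scale0r add0r => ->.
  by rewrite (vw _ pA) -(curve_hom c 0 1 (cw _ pA)) mulr0 mulr1.
have vv A : A != 0 -> exists2 c : K, c != 0 & v A = c *: vr (Psi A).
  move=> An; case: (pselect (proportional A0 A)) => [[a E]|pA].
    have a0 : a != 0 by apply: contra An => /eqP a0; rewrite E a0 scale0r.
    by exists (a ^+ d); rewrite ?expf_neq0 // E vA0 (framedZ hPsi hn a0 A00).
  have [c c0 E] := curve_vr (cw _ pA) o01; exists c => //.
  by rewrite vw // E scale0r add0r scale1r.
exists v; split=> // A B.
case: (eqVneq A 0) => [->|An].
  apply: isform_ext (line_form (v B) 0 1) => s t; rewrite scaler0 add0r vZ mulr0 add0r mulr1 //.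
case: (pselect (proportional A B)) => [[c ->]|pAB].
  apply: isform_ext (line_form (v A) 1 c) => s t.
  by rewrite scalerA -scalerDl vZ mulr1.
have pN := proportionalN pAB.
case: (pselect (proportional A0 A)) => [[a E]|pA].
  have a0 : a != 0 by apply: contra An => /eqP a0; rewrite E a0 scale0r.
  have pB : ~ proportional A0 B by move=> [b Eb]; apply: pAB; exists (b / a); rewrite E scalerA divfK.
  have := curve_swap (curve_change 0 (curve_swap (cw _ pB)) a0).
  move/curve_form; apply: isform_ext => s t.
  by rewrite E scalerA v1 //; congr ((lw B).2 _ _); ring.
case: (pselect (exists a b, A0 = a *: A + b *: B)) => [[a [b E]]|tri].
  have b0 : b != 0.
    apply/eqP => b0; apply: pA; have a0 : a != 0.
      by apply: contra A00 => /eqP a0; rewrite E a0 b0 !scale0r addr0.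
    by exists a^-1; rewrite E b0 scale0r addr0 scalerA mulVf // scale1r.
  have BE : B = b^-1 *: A0 + (- a / b) *: A.
    rewrite E scalerDr !scalerA mulVf // scale1r addrAC -scalerDl.
    by rewrite [X in X *: _](_ : _ = 0) ?scale0r ?add0r //; field.
  have := curve_change (- a / b) (curve_swap (cw _ pA)) (invr_neq0 b0).
  move/curve_form; apply: isform_ext => s t.
  rewrite BE scalerDr !scalerA addrCA -scalerDl v1 //.
have indep (x y z : K) : x *: A0 + y *: A + z *: B = 0 -> [/\ x = 0, y = 0 & z = 0].
  move=> E; have x0 : x = 0.
    apply/eqP; apply: contraT => x0; case: tri; exists (- y / x), (- z / x).
    apply: (scalerI x0); rewrite scalerDr !scalerA ![x * (_ / _)]mulrC !divfK //.
    by rewrite !scaleNr -opprD; apply/eqP; rewrite -addr_eq0 addrA E.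
  move: E; rewrite x0 scale0r add0r => E.
  by have [y0 z0] := comb_indep An pN E.
have [c c0 E] := vv A An; have [l [w [cAB wE]]] := curve_exists hPsi c0 An pN.
apply: isform_ext (curve_form cAB) => s t.
case: (eqVneq t 0) => [t0|t0].
  rewrite t0 scale0r addr0 vZ E -wE -(curve_hom s 1 0 cAB) mulr1 mulr0 //.
pose D := s *: A + t *: B; have cAD := curve_change s cAB t0.
have pD : ~ proportional A0 D.
  move=> [e Ee]; have [] := indep (- e) s t; last by move=> _ _ /eqP; rewrite (negbTE t0).
  by rewrite -addrA -/D Ee scaleNr addNr.
have ind3 x : trv A0 A D x = 0 -> x = (0, 0, 0).
  rewrite /trv /D scalerDr !scalerA addrA -[X in X + _ = 0]addrA -scalerDl => /indep[x0 h1 /eqP].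
  rewrite mulf_eq0 (negbTE t0) orbF => /eqP h2; move: h1; rewrite h2 mul0r addr0 => h1.
  by rewrite [LHS]surjective_pairing [x.1]surjective_pairing x0 h1 h2.
have := carnot hd uS hS hfin hfull hPsi ind3 (cw _ pA) (cw _ pD) cAD.
rewrite (w10 _ pA) (w10 _ pD) -(vw _ pA) -(vw _ pD) mul0r addr0 mul0r => /(_ erefl).
by rewrite E wE => /(_ erefl); rewrite mul1r add0r mul1r => <-.
Qed.

End Lift.

(** * From subspaces to coordinates *)

Section Tangents.
Variables (K : fieldType) (V : lmodType K) (d : nat).
Hypothesis hd : (2 <= d)%N.
Variable S : seq K.
Hypothesis uS : uniq S.
Hypothesis hS : (d ^ 3 <= size S ^ 2)%N.
Notation rpt := (@rnc_point d K).
Notation rtg := (@rnc_tangent d K).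
Implicit Types (f : {linear 'rV[K]_d.+1 -> V}) (z : K * K) (U : set V).

Lemma image_span f f' (u v : 'rV[K]_d.+1) : f @` lspan [set u] = f' @` lspan [set v] ->
  exists c : K, f u = c *: f' v.
Proof.
move=> E; have : (f @` lspan [set u]) (f u) by exists u => //; apply: in_lspan.
by rewrite E => -[w /lspan1[c ->] <-]; exists c; rewrite linearZ.
Qed.

Lemma std_image f f' U (X : set (set V)) : proj_equiv_by f (@std_rnc d K) U X -> proj_equiv_by f' (@std_rnc d K) U X ->
  forall z, z != (0, 0) -> exists (y : K * K) (c : K), [/\ y != (0, 0), c != 0 &
    f (rnc_vec d z.1 z.2) = c *: f' (rnc_vec d y.1 y.2)].
Proof.
move=> [fi _ fX] [fi' _ fX'] z z0.
have : X (f @` rpt z.1 z.2) by rewrite fX; exists (rpt z.1 z.2) => //; exists z.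
rewrite fX' => -[_ [y y0 <-]] E; have [c cE] := image_span (esym E); exists y, c; split=> //.
by apply: contraNneq (rnc_neq0 d z0) => c0; apply/eqP/fi; rewrite cE c0 scale0r linear0.
Qed.

(** The tangent lines do not depend on the parametrization of the curve. *)
Lemma tangent_sub f f' U (X : set (set V)) z z' : proj_equiv_by f (@std_rnc d K) U X ->
  proj_equiv_by f' (@std_rnc d K) U X -> z != (0, 0) -> z' != (0, 0) ->
  f @` rpt z.1 z.2 = f' @` rpt z'.1 z'.2 ->
  f @` rtg z.1 z.2 `<=` f' @` rtg z'.1 z'.2.
Proof.
move=> hf hf' z0 z'0 E; have [fi fr _] := hf; have [fi' fr' _] := hf'.
have /choice[G GP] : forall u, exists w, f' w = f u.
  by move=> u; have : range f' (f u); [rewrite fr' -fr; exists u | case=> w _ <-; exists w].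
have Glin a u v : G (a *: u + v) = a *: G u + G v by apply: fi'; rewrite linearP !GP linearP.
have Ginj : injective G by move=> u v e; apply: fi; rewrite -!GP e.
have [c cE] := image_span E.
have c0 : c != 0 by apply: contraNneq (rnc_neq0 d z0) => c0; apply/eqP/fi; rewrite cE c0 scale0r linear0.
have /choice[sg sgP] : forall x : K * K, exists yc : (K * K) * K, x != (0, 0) ->
    [/\ yc.1 != (0, 0), yc.2 != 0, G (rnc_vec d x.1 x.2) = yc.2 *: rnc_vec d yc.1.1 yc.1.2 & x = z -> yc.1 = z'].
  move=> x; case: (eqVneq x z) => [->|xz].
    by exists (z', c) => _; split=> //=; apply: fi'; rewrite GP linearZ.
  case: (eqVneq x (0, 0)) => [_|x0]; first by exists (z', c).
  have [y [e [y0 e0 Ey]]] := std_image hf hf' x0.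
  by exists (y, e) => _; split=> //= [|h]; [apply: fi'; rewrite GP linearZ | rewrite h eqxx in xz].
have T a b : rtg z'.1 z'.2 (G (drnc d z.1 z.2 a b)).
  have [_ _ _ /(_ erefl) <-] := sgP z z0.
  apply: (@tangent_transport K d hd G (fun x => (sg x).1) (fun x => (sg x).2) Glin Ginj _ _ _ S) => // x x0;
    by have [] := sgP x x0.
move=> _ [v /rnc_tangentP[a [b [e ->]]] <-].
exists (G (a *: rnc_vec d z.1 z.2 + drnc d z.1 z.2 b e)) => //.
rewrite Glin; apply: (@subZD _ _ (rtg z'.1 z'.2)); [exact: (@lspan_subspace _ _ _) | | exact: T].
have -> : G (rnc_vec d z.1 z.2) = c *: rnc_vec d z'.1 z'.2 by apply: fi'; rewrite GP linearZ.
by apply: lspanZ; apply: in_lspan; left; left.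
Qed.

Lemma tangent_eq f f' U (X : set (set V)) z z' : proj_equiv_by f (@std_rnc d K) U X ->
  proj_equiv_by f' (@std_rnc d K) U X -> z != (0, 0) -> z' != (0, 0) ->
  f @` rpt z.1 z.2 = f' @` rpt z'.1 z'.2 ->
  f @` rtg z.1 z.2 = f' @` rtg z'.1 z'.2.
Proof. by move=> hf hf' z0 z'0 E; apply/seteqP; split; [exact: (tangent_sub hf hf' z0 z'0 E) | exact: (tangent_sub hf' hf z'0 z0 (esym E))]. Qed.

End Tangents.

Section Bridge.
Variables (K : fieldType) (d : nat).
Hypothesis hd : (2 <= d)%N.
Variable V : lmodType K.
Hypothesis hV : exists v : V, v != 0.
Variables X Xi : set (set V).
Hypothesis hcap : veronesean_cap d X Xi.
Variable n : nat.
Hypothesis hindex : cap_index d X Xi n.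
Variable S : seq K.
Hypothesis uS : uniq S.
Hypothesis hS : (d ^ 3 <= size S ^ 2)%N.

Notation rpt := (@rnc_point d K).
Notation rtg := (@rnc_tangent d K).

Lemma point_gen (x : set V) : is_point x -> exists2 v, v != 0 & x = lspan [set v].
Proof.
move=> [b [ib <-]]; exists (b ord0).
  apply/eqP => b0; have := ib (fun=> 1); rewrite big_ord1 b0 scaler0 => /(_ erefl ord0)/eqP.
  by rewrite oner_eq0.
congr lspan; apply/seteqP; split=> [_ [i _ <-]|_ ->]; [by rewrite (ord1 i) | by exists ord0].
Qed.

Lemma span_point (v : V) : v != 0 -> is_point (lspan [set v]).
Proof.
move=> v0; exists (fun=> v); split.
  by move=> c; rewrite big_ord1 => /eqP; rewrite scaler_eq0 (negbTE v0) orbF => /eqP c0 i; rewrite ord1.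
by congr lspan; apply/seteqP; split=> [_ [i _ <-]|_ ->] //; exists ord0.
Qed.

Lemma span_sub (U : set V) v : is_subspace U -> (lspan [set v] `<=` U) <-> U v.
Proof.
move=> sU; split=> [h|Uv w /lspan1[c ->]]; last exact: subZ.
by apply: h; apply: in_lspan.
Qed.

Lemma has_dim_subspace (U : set V) m : has_dim U m -> is_subspace U.
Proof. by move=> [b [_ <-]]; apply: lspan_subspace. Qed.

Lemma has_dim_neq0 (U : set V) m : has_dim U m.+1 -> exists2 v, U v & v != 0.
Proof.
move=> [b [ib <-]]; exists (b ord0); first by apply: in_lspan; exists ord0.
apply/eqP => b0; have z : \sum_(i < m.+1) (i == ord0)%:R *: b i = 0.
  by rewrite (bigD1 ord0) //= b0 scaler0 add0r big1 // => i /negbTE ->; rewrite scale0r.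
by have := ib _ z ord0; rewrite eqxx => /eqP; rewrite oner_eq0.
Qed.

(** Choose a vector on each point, a parametrization of each rational space, and
    a complement of each point in its tangent space. The tangents of the chosen
    parametrizations are those of the cap by [tangent_eq]. *)
Lemma cap_exists : exists C : cap V d n, [/\ inhabited (pt C),
  forall p : pt C, X (lspan [set vr p]) & forall x, X x -> exists p : pt C, x = lspan [set vr p]].
Proof.
have [Xpt Xspan Xidim Xrnc V1 V2 V3] := hcap.
pose T := {p | X p}; pose L := {l | Xi l}.
have /choice[vr vrP] : forall p : T, exists v, v != 0 /\ sval p = lspan [set v].
  by move=> [p Xp]; have [v v0 E] := point_gen (Xpt p Xp); exists v.
have /choice[par parP] : forall l : L, exists f : {linear 'rV[K]_d.+1 -> V},
    proj_equiv_by f (@std_rnc d K) (sval l) (points_on X (sval l)).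
  by move=> [l Xl]; apply: Xrnc.
have lsub (l : L) : is_subspace (sval l).
  by case: l => l Xl /=; apply: has_dim_subspace (Xidim l Xl).
have vr0 p : vr p != 0 by case: (vrP p).
have vrE p : sval p = lspan [set vr p] by case: (vrP p).
have sval_inj (p q : T) : sval p = sval q -> p = q.
  by case: p q => p Xp [q Xq] /= E; subst q; congr exist; apply: Prop_irrelevance.
have lval_inj (p q : L) : sval p = sval q -> p = q.
  by case: p q => p Xp [q Xq] /= E; subst q; congr exist; apply: Prop_irrelevance.
have onP (l : L) (p : T) : (exists v, par l v = vr p) <-> sval p `<=` sval l.
  rewrite vrE (span_sub _ (lsub l)); have [_ <- _] := parP l.
  by split=> [[v E]|[v _ E]]; exists v.
have ptE (l : L) (z : K * K) : z != (0, 0) -> exists (p : T) (c : K),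
    [/\ c != 0, par l (rnc_vec d z.1 z.2) = c *: vr p & sval p = par l @` rpt z.1 z.2].
  move=> z0; have [pi _ pX] := parP l.
  have [Xp pl] : points_on X (sval l) (par l @` rpt z.1 z.2).
    by rewrite pX; exists (rpt z.1 z.2) => //; exists z.
  pose p : T := exist _ _ Xp; have : sval p (par l (rnc_vec d z.1 z.2)).
    by exists (rnc_vec d z.1 z.2) => //; apply: in_lspan.
  rewrite vrE => /lspan1[c cE]; exists p, c; split=> //.
  by apply: contraNneq (rnc_neq0 d z0) => c0; apply/eqP/pi; rewrite cE c0 scale0r linear0.
have /choice[crd crdP] : forall lp : L * T, exists z : K * K, sval lp.2 `<=` sval lp.1 ->
    z != (0, 0) /\ sval lp.2 = par lp.1 @` rpt z.1 z.2.
  move=> [l p]; case: (pselect (sval p `<=` sval l)) => [pl|npl]; last by exists (0, 0).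
  have [pi _ pX] := parP l; have : points_on X (sval l) (sval p) by split=> //; case: (p).
  by rewrite pX => -[_ [z z0 <-]] E; exists z.
have /choice[join joinP] : forall pq : T * T, exists l : L, pq.1 <> pq.2 ->
    [/\ sval pq.1 `<=` sval l, sval pq.2 `<=` sval l &
     forall l' : L, sval pq.1 `<=` sval l' -> sval pq.2 `<=` sval l' -> l' = l].
  have [l0] : exists l0 : L, True.
    have [v v0] := hV; have : lspan (\bigcup_(p in X) p) v by rewrite Xspan.
    apply: contraPP => nl sv; case/eqP: v0; move: sv.
    apply: (@lspan_elim _ _ _ [set v | v = 0]).
      by split=> // a _ _ -> ->; rewrite scaler0 addr0.
    move=> w [x Xx xw]; have [u Tu u0] := has_dim_neq0 (hindex Xx).
    by case: Tu => l [Xl _] _; case: nl; exists (exist _ l Xl).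
  move=> _ [p q]; case: (pselect (p = q)) => [pq|pq]; first by exists l0.
  have [|l [[Xl pl ql] lu]] := V1 (sval p) (sval q) (svalP p) (svalP q).
    by move=> /sval_inj.
  by exists (exist _ l Xl) => _; split=> // l' pl' ql'; apply: lval_inj; rewrite /= (lu (sval l')) //; split=> //; case: (l').
pose tgl (l : L) (p : T) (v : V) := exists2 w, rtg (crd (l, p)).1 (crd (l, p)).2 w & v = par l w.
(* the tangent lines of the cap in coordinates *)
have tangE (l : L) (p : T) : sval p `<=` sval l -> forall v, cap_tangent d X (sval p) (sval l) v <-> tgl l p v.
  move=> pl; have [z0 pz] := crdP (l, p) pl; set z := crd (l, p) in z0 pz.
  have ex : exists T', is_tangent d (sval l) (points_on X (sval l)) (sval p) T'.
    by exists (par l @` rtg z.1 z.2); exists (par l); split=> //; exists z.1, z.2; rewrite -surjective_pairing.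
  rewrite /cap_tangent /tangent; have [T' hT'] := ex.
  have [f [hf [s [t [st pst ->]]]]] := getPex ex.
  have E := @tangent_eq K V d hd S uS hS f (par l) _ _ (s, t) z hf (parP l) st z0 (etrans (esym pst) pz).
  by move=> v; rewrite E; split=> [[w Tw <-]|[w Tw ->]]; exists w.
have tg_vr l p : sval p `<=` sval l -> tgl l p (vr p).
  move=> pl; have [z0 pz] := crdP (l, p) pl; rewrite /= in z0 pz.
  have : sval p (vr p) by rewrite vrE; apply: in_lspan.
  rewrite pz => -[w /lspan1[c ->] E]; exists (c *: rnc_vec d (crd (l, p)).1 (crd (l, p)).2) => //.
  by apply: lspanZ; apply: in_lspan; left; left.
pose TT (p : T) := \bigcup_(xi in [set xi | Xi xi /\ sval p `<=` xi]) cap_tangent d X (sval p) xi.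
have TTE p v : TT p v <-> exists2 l : L, sval p `<=` sval l & tgl l p v.
  split=> [[l [Xl pl] Tv]|[l pl Tv]].
    by exists (exist _ l Xl) => //; apply/tangE.
  by exists (sval l); [split=> //; case: (l) | apply/tangE].
have TTd (p : T) : has_dim (TT p) n.+1 by apply: hindex; case: (p).
have TTvr p : TT p (vr p).
  have [u Tu _] := has_dim_neq0 (TTd p); have /TTE[l pl _] := Tu.
  by apply/TTE; exists l => //; apply: tg_vr.
have TTs p := has_dim_subspace (TTd p).
have /choice[bb bbP] : forall p : T, exists b : 'I_n -> V, [/\ forall i, TT p (b i),
    forall a (c : 'rV[K]_n), a *: vr p + \sum_i c 0 i *: b i = 0 -> a = 0 /\ c = 0
    & forall w, TT p w -> exists a (c : 'rV[K]_n), w = a *: vr p + \sum_i c 0 i *: b i].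
  by move=> p; apply: basis_exchange (TTd p) (TTvr p) (vr0 p).
pose tv (p : T) (u : 'rV[K]_n) : V := \sum_i u 0 i *: bb p i.
have tv_lin p a u v : tv p (a *: u + v) = a *: tv p u + tv p v.
  by rewrite /tv scaler_sumr -big_split; apply: eq_bigr => i _; rewrite !mxE scalerDl scalerA.
have tvT p u : TT p (tv p u).
  by have [bT _ _] := bbP p; apply: sub_sum => // i _; apply: subZ.
have tv_indep p c u : c *: vr p + tv p u = 0 -> u = 0.
  by have [_ ind _] := bbP p => /ind[].
have tv_span p w : TT p w -> exists a u, w = a *: vr p + tv p u by have [_ _] := bbP p; apply.
have on_asbool (l : L) (p : T) : `[< exists v, par l v = vr p >] = `[< sval p `<=` sval l >].
  by apply: asbool_equiv_eq.
pose pt' : eqType := {classic T}; pose ln' : eqType := {classic L}.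
have axq (p : T) (l : L) : ~ sval p `<=` sval l -> exists2 B : 'M[K]_(2, n), row_free B &
    forall u, (u <= B)%MS <-> exists2 q : T, sval q `<=` sval l & tgl (join (p, q)) p (tv p u).
  move=> npl; have := V3 (sval p) (sval l) (svalP p) (svalP l) npl.
  set W := \bigcup_(y in _) _ => hW; have sW := has_dim_subspace hW.
  have WE v : W v <-> exists2 q : T, sval q `<=` sval l & tgl (join (p, q)) p v.
    have rs (q : T) : sval q `<=` sval l -> rational_space Xi (sval p) (sval q) = sval (join (p, q)) /\ sval p `<=` sval (join (p, q)).
      move=> ql; have pq : p <> q by move=> pq; apply: npl; rewrite pq.
      have [jp jq ju] := joinP (p, q) pq; split=> //.
      have ex : exists xi, [set xi | [/\ Xi xi, sval p `<=` xi & sval q `<=` xi]] xi.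
        by exists (sval (join (p, q))); split=> //; case: (join _).
      have [Xg pg qg] := getPex ex.
      by have := ju (exist _ _ Xg) pg qg => /(congr1 sval).
    split=> [[y [Xy yl] Tv]|[q ql Tv]].
      have [E pj] := rs (exist _ y Xy) yl; exists (exist _ y Xy) => //.
      by apply/tangE => //; rewrite -E.
    have [E pj] := rs q ql; exists (sval q); first by split=> //; case: (q).
    by rewrite E; apply/tangE.
  have WT v : W v -> TT p v.
    move=> /WE[q ql Tv]; apply/TTE; exists (join (p, q)) => //.
    by have pq : p <> q; [move=> pq; apply: npl; rewrite pq | have [] := joinP (p, q) pq].
  have Wvr : W (vr p).
    have [u /WE[q ql _] _] := has_dim_neq0 hW; apply/WE; exists q => //; apply: tg_vr.
    by have pq : p <> q; [move=> pq; apply: npl; rewrite pq | have [] := joinP (p, q) pq].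
  have [b [bW ind sp]] := basis_exchange hW Wvr (vr0 p).
  have /choice[au auP] : forall i : 'I_2, exists au : K * 'rV[K]_n, b i = au.1 *: vr p + tv p au.2.
    by move=> i; have [a [u E]] := tv_span p _ (WT _ (bW i)); exists (a, u).
  pose B := \matrix_(i < 2) (au i).2.
  have tvB (y : 'rV[K]_2) : \sum_i y 0 i *: b i = (\sum_i y 0 i * (au i).1) *: vr p + tv p (y *m B).
    have -> : y *m B = \sum_i y 0 i *: (au i).2.
      by rewrite mulmx_sum_row; apply: eq_bigr => i _; rewrite rowK.
    have -> : tv p (\sum_i y 0 i *: (au i).2) = \sum_i y 0 i *: tv p (au i).2.
      have t0 : tv p 0 = 0 by rewrite /tv big1 // => i _; rewrite mxE scale0r.
      have tD u v : tv p (u + v) = tv p u + tv p v by have := tv_lin p 1 u v; rewrite !scale1r.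
      rewrite (big_morph (tv p) tD t0); apply: eq_bigr => i _.
      by have := tv_lin p (y 0 i) (au i).2 0; rewrite t0 !addr0.
    rewrite scaler_suml -big_split; apply: eq_bigr => i _ /=.
    by rewrite auP scalerDr scalerA.
  exists B.
    rewrite -kermx_eq0; apply/rowV0P => y /sub_kermxP yB; have t0 : tv p 0 = 0 by rewrite /tv big1 // => i _; rewrite mxE scale0r.
    apply: (proj2 (ind (- \sum_i y 0 i * (au i).1) y _)).
    by rewrite tvB yB t0 addr0 scaleNr addNr.
  move=> u; rewrite -WE; split=> [/submxP[y ->]|Wu].
    have -> : tv p (y *m B) = (- \sum_i y 0 i * (au i).1) *: vr p + \sum_i y 0 i *: b i.
      by rewrite tvB addrA -scalerDl addNr scale0r add0r.
    by apply: subZD => //; apply: sub_sum => // i _; apply: subZ.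
  have [a [y E]] := sp _ Wu; apply/submxP; exists y.
  apply/eqP; rewrite -subr_eq0; apply/eqP.
  apply: (@tv_indep p (- (a + \sum_i y 0 i * (au i).1))).
  have -> : tv p (u - y *m B) = tv p u - tv p (y *m B).
    by have := tv_lin p (-1) (y *m B) u; rewrite !scaleN1r [- _ + u]addrC [- _ + tv p u]addrC.
  by rewrite E tvB [X in _ + (X - _)]addrA addrK -!scalerDl addNr scale0r.
have onb (l : L) (p : T) : `[< exists v, par l v = vr p >] -> sval p `<=` sval l.
  by move/asboolP; apply: (onP l p).1.
have bon (l : L) (p : T) : sval p `<=` sval l -> `[< exists v, par l v = vr p >].
  by move=> pl; apply/asboolP/(onP l p).2.
have vrp p : sval p (vr p) by rewrite vrE; apply: in_lspan.
have nonempty : inhabited T.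
  have [v v0] := hV; have : lspan (\bigcup_(p in X) p) v by rewrite Xspan.
  apply: contraPP => nT sv; case/eqP: v0; move: sv.
  apply: (@lspan_elim _ _ _ [set v | v = 0]).
    by split=> // a _ _ -> ->; rewrite scaler0 addr0.
  by move=> w [x Xx _]; case: nT; constructor; exists x.
unshelve refine (ex_intro _ (@Cap K V d n pt' ln' vr (fun l => par l) (fun l p => crd (l, p)) tv
  (fun p q => join (p, q)) _ _ _ _ _ _ _ _ _ _ _ _ _ _ _) _).
- exact: vr0.
- move=> a p q E; have a0 : a != 0 by apply: contraNneq (vr0 p) => a0; rewrite E a0 scale0r.
  apply: sval_inj; rewrite !vrE E; apply/seteqP; split=> w /lspan1[c ->]; apply/lspan1.
    by exists (c * a); rewrite scalerA.
  by exists (c / a); rewrite scalerA divfK.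
- move=> U sU Uv v; have : lspan (\bigcup_(p in X) p) v by rewrite Xspan.
  apply: lspan_elim => // w [x Xx xw].
  have : sval (exist _ x Xx : T) w by [].
  by rewrite vrE => /lspan1[c ->]; apply: subZ.
- by move=> l a u v; rewrite linearP.
- by move=> l; case: (parP l).
- by move=> l z z0; have [p [c [c0 E _]]] := ptE l z z0; exists p, c.
- move=> l p /onb pl; have [z0 pz] := crdP (l, p) pl; split=> //; rewrite /= in z0 pz.
  have : sval p (par l (rnc_vec d (crd (l, p)).1 (crd (l, p)).2)).
    by rewrite pz; exists (rnc_vec d (crd (l, p)).1 (crd (l, p)).2) => //; apply: in_lspan.
  rewrite vrE => /lspan1[c E]; exists c => //.
  by apply: contraNneq (rnc_neq0 d z0) => c0; have [pi _ _] := parP l; apply/eqP/pi; rewrite E c0 scale0r linear0.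
- move=> p q /eqP pq; have [jp jq _] := joinP (p, q) pq; split; exact: bon.
- by move=> p q l /eqP pq /onb lp /onb lq; have [_ _ ju] := joinP (p, q) pq; apply: ju.
- move=> l l' v v' /eqP ll E v0; have [pi pr _] := parP l; have [_ pr' _] := parP l'.
  have w0 : par l v != 0 by apply: contraNneq v0 => w0; apply/eqP/pi; rewrite w0 linear0.
  have Xp : X (lspan [set par l v]).
    apply: (V2 (sval l) (sval l')); [exact: svalP | exact: svalP | by move/lval_inj | exact: span_point | |].
      by apply/span_sub => //; rewrite -pr; exists v.
    by apply/span_sub => //; rewrite E -pr'; exists v'.
  pose p : T := exist _ _ Xp; have : sval p (par l v) by apply: in_lspan.
  rewrite vrE => /lspan1[c cE]; exists p, c; split=> //.
  by apply: contraNneq w0 => c0; rewrite cE c0 scale0r.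
- exact: tv_lin.
- exact: tv_indep.
- move=> l p v /onb pl Tv; have : TT p v by apply/TTE; exists l.
  by move/tv_span.
- by move=> p u; have /TTE[l pl Tu] := tvT p u; exists l => //; apply: bon.
- move=> p l /negP npl; have [|B fB BP] := axq p l; first by move=> pl; apply: npl; apply: bon.
  exists B => // u; rewrite BP; split=> -[q ql Tq]; exists q => //; [exact: bon | exact: onb].
split; first exact: nonempty.
  by move=> p; rewrite -vrE; case: (p).
by move=> x Xx; exists (exist _ x Xx : T); rewrite -vrE.
Qed.

End Bridge.

(** * The Veronese variety *)

Lemma form_size d (K : fieldType) (S : seq K) : (2 <= d)%N -> (d ^ 3 <= size S ^ 2)%N ->
  (2 * d <= (size S).+1)%N /\ (d < size S)%N.
Proof.
case: d => [|[|e]] // _; move: (size S) => s h; split; rewrite leqNgt; apply/negP => lt.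
  have : (s ^ 2 <= (2 * e + 2) ^ 2)%N by rewrite leq_exp2r; [move: lt; clear; lia | ].
  by move/(leq_trans h); rewrite !expnS !expn0 !muln1; clear; nia.
have : (s ^ 2 <= e.+2 ^ 2)%N by rewrite leq_exp2r; [move: lt; clear; lia | ].
by move/(leq_trans h); rewrite leq_exp2l.
Qed.

Section Linear.
Variables (K : fieldType) (V : lmodType K) (d n : nat).

Lemma monomial_coord (e : nat -> nat) : (\sum_(i < n.+1) e i)%N = d ->
  exists j : 'I_'C(n + d, d), forall x : 'rV[K]_n.+1, \prod_(i < n.+1) x 0 i ^+ e i = veronese_vec d x 0 j.
Proof.
move=> se; have le i : (e (i : 'I_n.+1) < d.+1)%N by rewrite ltnS -se (bigD1 i) //= leq_addr.
pose t : n.+1.-tuple 'I_d.+1 := [tuple Ordinal (le i) | i < n.+1].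
have tE : t \in exponents n d.
  rewrite inE big_tuple; apply/eqP; rewrite -[RHS]se; apply: eq_bigr => i _.
  by rewrite tnth_mktuple.
exists (cast_ord (card_exponents n d) (enum_rank_in tE t)) => x; rewrite mxE.
apply: eq_bigr => i _; rewrite /exponent cast_ordK enum_rankK_in // tnth_mktuple //.
Qed.

(** A homogeneous polynomial is linear in the monomials of its degree. *)
Lemma poly_linear (v : 'rV[K]_n.+1 -> V) : hpoly d v ->
  exists f : {linear 'rV[K]_'C(n + d, d) -> V}, forall x, v x = f (veronese_vec d x).
Proof.
move=> [L [L1 L2]].
have C0 : (0 < 'C(n + d, d))%N by rewrite bin_gt0 leq_addl.
have /choice[ix ixP] : forall e : nat -> nat, exists j : 'I_'C(n + d, d), (\sum_(i < n.+1) e i)%N = d ->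
    forall x : 'rV[K]_n.+1, \prod_(i < n.+1) x 0 i ^+ e i = veronese_vec d x 0 j.
  move=> e; case: (eqVneq (\sum_(i < n.+1) e i)%N d) => [/monomial_coord[j jP]|/eqP ne]; first by exists j.
  by exists (Ordinal C0) => h; case: ne.
pose g (y : 'rV[K]_'C(n + d, d)) : V := \sum_(m <- L) y 0 (ix m.1) *: m.2.
have lg : linear g.
  move=> a u w; rewrite /g scaler_sumr -big_split; apply: eq_bigr => m _.
  by rewrite !mxE scalerDl scalerA.
pose f : {linear 'rV[K]_'C(n + d, d) -> V} := HB.pack g (GRing.isLinear.Build K _ V *:%R g lg).
exists f => x; rewrite L2 /=; rewrite /g; elim: L L1 {L2 g lg f} => [|m L IH] L1; first by rewrite !big_nil.
rewrite !big_cons ixP ?IH // => [y hy|]; [by apply: L1; right | by apply: L1; left].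
Qed.

End Linear.

Section Surjective.
Variables (K : fieldType) (V : lmodType K) (m : nat) (f : {linear 'rV[K]_m -> V}).
Hypothesis fs : forall v, exists x, f x = v.
Hypothesis hdim : dim_ge V m.

Lemma surj_inj : injective f.
Proof.
have [b ib] := hdim; have /choice[u uP] : forall i, exists x, f x = b i by move=> i; apply: fs.
pose B := \matrix_(i < m) u i.
have fB y : f (y *m B) = \sum_i y 0 i *: b i.
  by rewrite mulmx_sum_row linear_sum; apply: eq_bigr => i _; rewrite linearZ rowK uP.
have fB0 : row_free B.
  rewrite -kermx_eq0; apply/rowV0P => y /sub_kermxP yB.
  have := fB y; rewrite yB linear0 => /esym/ib y0; apply/rowP => i; rewrite mxE; exact: y0.
have uB : B \in unitmx by rewrite -row_free_unit.
move=> x y E; apply/eqP; rewrite -subr_eq0; apply/eqP; have : f (x - y) = 0 by rewrite linearB E subrr.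
rewrite -{1}[x - y](mulmxKV uB) fB => /ib z.
have z0 : (x - y) *m invmx B = 0 by apply/rowP => i; rewrite z mxE.
by rewrite -[x - y](mulmxKV uB) z0 mul0mx.
Qed.

End Surjective.

Theorem mainTheorem1 (K : fieldType) (d : nat) (hd : (2 <= d)%N)
    (V : lmodType K) (hV : exists v : V, v != 0)
    (X Xi : set (set V)) (hcap : veronesean_cap d X Xi)
    (n : nat) (hn : (2 <= n)%N) (hindex : cap_index d X Xi n)
    (hdim : dim_ge V 'C(n + d, d)) (hK : card_ge_pow_3_2 K d) :
  has_dim [set: V] 'C(n + d, d) /\
  proj_equiv (veronese_variety n d K) [set: V] X.
Proof.
have [S [uS hS]] := hK.
have [C [[p] CX XC]] := cap_exists hd hV hcap hindex uS hS.
have hfin := finite_dim hd uS hS hn p.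
have hfull (Pi : set (pt C)) : plane Pi -> full Pi by apply: (plane_full hd uS hS hn hdim).
have [Psi hPsi onto] := frame_exists hd uS hS hfin hfull p hn.
have [v [vP pv]] := lift_exists hd uS hS hfin hfull hPsi (ltnW hn).
have [sz2 sz1] := form_size hd hS.
have [f fE] := poly_linear (pencilwise_poly hfin uS sz2 sz1 pv).
have fs u : exists x, f x = u.
  suff : range f u by case=> x _ <-; exists x.
  apply: (@vr_span _ _ _ _ C (range f)) => [|q].
    by split=> [|a _ _ [x _ <-] [y _ <-]]; [exists 0; rewrite ?linear0 | exists (a *: x + y); rewrite ?linearP].
  have [A A0 <-] := onto q; have [c c0 E] := vP A A0.
  by exists (c^-1 *: veronese_vec d A); rewrite // linearZ /= -fE E scalerA mulVf // scale1r.
split.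
  have [b ib] := hdim; exists b; split=> //; exact: indep_span hfin ib.
exists f; split; first exact: surj_inj fs hdim.
  by apply/seteqP; split=> // u _; have [x <-] := fs u; exists x.
have img A : A != 0 -> f @` lspan [set veronese_vec d A] = lspan [set vr (Psi A)].
  move=> A0; have [c c0 E] := vP A A0; apply/seteqP; split=> [_ [_ /lspan1[a ->] <-]|_ /lspan1[a ->]].
    by apply/lspan1; exists (a * c); rewrite linearZ /= -fE E scalerA.
  exists ((a / c) *: veronese_vec d A); first by apply/lspan1; exists (a / c).
  by rewrite linearZ /= -fE E scalerA divfK.
apply/seteqP; split=> [x Xx|_ [_ [A A0 <-] <-]]; last by rewrite img.
have [q ->] := XC x Xx; have [A A0 <-] := onto q.
by exists (lspan [set veronese_vec d A]); [exists A | rewrite img].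
Qed.
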